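(* Fix $\star\in\{0,\boldsymbol n,s\}$ and let $\beta\ge2$. Then the discrete variational inequality $$\text{find }\boldsymbol u_h\in K_h^\star:\qquad a^\star(\boldsymbol u_h,\boldsymbol v_h-\boldsymbol u_h)\ge F(\boldsymbol v_h-\boldsymbol u_h)\quad\text{for all }\boldsymbol v_h\in K_h^\star$$ admits a unique solution $\boldsymbol u_h\in K_h^\star$.
   Context: Domain and mesh. $\Omega\subset\mathbb R^d$ ($d\in\{2,3\}$) is a bounded simply connected Lipschitz domain with boundary $\Gamma=\partial\Omega$ and outer unit normal $\boldsymbol n=\boldsymbol n_\Omega$; $f\in L^2(\Omega)$. $(\cdot,\cdot)$ and $\|\cdot\|$ are the $L^2(\Omega)$ inner product and norm; $\langle\cdot,\cdot\rangle_{\partial\omega}$ is the (extended) $L^2(\partial\omega)$ duality. $\mathcal T$ is a finite conforming mesh of $\Omega$ of open simplices $T$, $\bigcup_{T\in\mathcal T}\overline T=\overline\Omega$; $\boldsymbol n_T$ is the outer unit normal on $\partial T$; $\mathcal S=\{\partial T: T\in\mathcal T\}$ is the skeleton. $\nabla_{\mathcal T}$, $\mathrm{div}_{\mathcal T}$ are the $\mathcal T$-piecewise gradient and divergence. Spaces. $H^1(\mathcal T)=\{w\in L^2(\Omega): w|_T\in H^1(T)\ \forall T\in\mathcal T\}$, $\boldsymbol H(\mathrm{div},\mathcal T)=\{\boldsymbol q\in L^2(\Omega)^d:\boldsymbol q|_T\in\boldsymbol H(\mathrm{div},T)\ \forall T\in\mathcal T\}$. $H^{1/2}(\mathcal S)$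 is the set of $\widehat u\in\prod_{T}H^{1/2}(\partial T)$ for which there is $w\in H^1(\Omega)$ with $\widehat u|_{\partial T}=w|_{\partial T}$ for all $T$; $H^{-1/2}(\mathcal S)$ is the set of $\widehat\sigma\in\prod_T H^{-1/2}(\partial T)$ for which there is $\boldsymbol q\in\boldsymbol H(\mathrm{div},\Omega)$ with $\widehat\sigma|_{\partial T}=(\boldsymbol q\cdot\boldsymbol n_T)|_{\partial T}$ for all $T$. Norms: $\|\widehat u\|_{1/2,\mathcal S}$ is the infimum of $(\|w\|^2+\|\nabla w\|^2)^{1/2}$ over all such $w$; $\|\widehat\sigma\|_{-1/2,\mathcal S}$ is the infimum of $(\|\boldsymbol q\|^2+\|\mathrm{div}\,\boldsymbol q\|^2)^{1/2}$ over all such $\boldsymbol q$. The restrictions to $\Gamma$ are $\widehat u|_\Gamma:=w|_\Gamma\in H^{1/2}(\Gamma)$ and $\widehat\sigma|_\Gamma:=(\boldsymbol q\cdot\boldsymbol n_\Omega)|_\Gamma\in H^{-1/2}(\Gamma)$ (independent of the chosen $w$, $\boldsymbol q$). Set $\langle\widehat u,\boldsymbol\tau\cdot\boldsymbol n\rangle_{\mathcal S}=\sum_T\langle\widehat u|_{\partial T},\boldsymbol\tau\cdot\boldsymbol n_T\rangle_{\partial T}$ and $\langle\widehat\sigma,v\rangle_{\mathcal S}=\sum_T\langle\widehat\sigma|_{\partial T},v\rangle_{\partial T}$. $U=L^2(\Omega)\times L^2(\Omega)^d\times H^{1/2}(\mathcal S)\times H^{-1/2}(\mathcal S)$ with $\|(u,\boldsymbol\sigma,\widehat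 u,\widehat\sigma)\|_U^2=\|u\|^2+\|\boldsymbol\sigma\|^2+\|\widehat u\|_{1/2,\mathcal S}^2+\|\widehat\sigma\|_{-1/2,\mathcal S}^2$; $V=H^1(\mathcal T)\times\boldsymbol H(\mathrm{div},\mathcal T)$ with $\|(v,\boldsymbol\tau)\|_V^2=\|v\|^2+\|\nabla_{\mathcal T}v\|^2+\|\boldsymbol\tau\|^2+\|\mathrm{div}_{\mathcal T}\boldsymbol\tau\|^2$ and the inner product $(\cdot,\cdot)_V$ inducing it. Forms. For $\boldsymbol u=(u,\boldsymbol\sigma,\widehat u,\widehat\sigma)\in U$, $\boldsymbol v=(v,\boldsymbol\tau)\in V$: $b(\boldsymbol u,\boldsymbol v)=(\boldsymbol\sigma,\nabla_{\mathcal T}v)+(u,v)-\langle\widehat\sigma,v\rangle_{\mathcal S}+(\boldsymbol\sigma,\boldsymbol\tau)+(u,\mathrm{div}_{\mathcal T}\boldsymbol\tau)-\langle\widehat u,\boldsymbol\tau\cdot\boldsymbol n\rangle_{\mathcal S}$, $L(\boldsymbol v)=(f,v)$. The operator $\Theta:U\to V$ is defined by $(\Theta\boldsymbol u,\boldsymbol v)_V=b(\boldsymbol u,\boldsymbol v)$ for all $\boldsymbol v\in V$, and $\Theta_\beta:=\beta\Theta$. Trace operators: $\gamma_0\boldsymbol u=\widehat u|_\Gamma$, $\gamma_{\boldsymbol n}\boldsymbol u=\widehat\sigma|_\Gamma$. For $\boldsymbol u,\boldsymbol v\in U$: $a^0(\boldsymbol u,\boldsymbol v)=b(\boldsymbol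 u,\Theta_\beta\boldsymbol v)+\langle\gamma_{\boldsymbol n}\boldsymbol u,\gamma_0\boldsymbol v\rangle_\Gamma$, $a^{\boldsymbol n}(\boldsymbol u,\boldsymbol v)=b(\boldsymbol u,\Theta_\beta\boldsymbol v)+\langle\gamma_{\boldsymbol n}\boldsymbol v,\gamma_0\boldsymbol u\rangle_\Gamma$, $a^s(\boldsymbol u,\boldsymbol v)=b(\boldsymbol u,\Theta_\beta\boldsymbol v)+\tfrac12(\langle\gamma_{\boldsymbol n}\boldsymbol u,\gamma_0\boldsymbol v\rangle_\Gamma+\langle\gamma_{\boldsymbol n}\boldsymbol v,\gamma_0\boldsymbol u\rangle_\Gamma)$, $F(\boldsymbol v)=L(\Theta_\beta\boldsymbol v)$. Orderings. $\widehat v\ge0$ in $H^{1/2}(\Gamma)$ means that $\widehat v$ is the weak $H^{1/2}(\Gamma)$-limit of a sequence of non-negative Lipschitz continuous functions on $\Gamma$. $\widehat\sigma\ge0$ in $H^{-1/2}(\Gamma)$ means $\langle\widehat\sigma,\widehat v\rangle_\Gamma\ge0$ for all $\widehat v\in H^{1/2}(\Gamma)$ with $\widehat v\ge0$. Discrete spaces. $U_h=P^0(\mathcal T)\times[P^0(\mathcal T)]^d\times S^1(\mathcal S)\times P^0(\mathcal S)\subset U$, where $P^0(\mathcal T)$ are the $\mathcal T$-element-wise constants, $P^0(\mathcal S)\subset H^{-1/2}(\mathcal S)$ consists of those elements that are constant on each facet of each $\partial T$, and $S^1(\mathcal S)\subset H^{1/2}(\mathcal S)$ consists of the globally continuous functions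 on the skeleton that are affine on each facet. $K_h^0=\{\boldsymbol v_h\in U_h:\gamma_0\boldsymbol v_h\ge0\}$, $K_h^{\boldsymbol n}=\{\boldsymbol v_h\in U_h:\gamma_{\boldsymbol n}\boldsymbol v_h\ge0\}$, $K_h^s=K_h^0\cap K_h^{\boldsymbol n}$. *)

(* Defs.v *)
From HB Require Import structures.
From mathcomp Require Import all_boot all_order all_algebra.
From mathcomp Require Import all_classical all_reals all_analysis.
Import Order.TTheory GRing.Theory Num.Theory.
Import numFieldNormedType.Exports.

Set Implicit Arguments.
Unset Strict Implicit.
Unset Printing Implicit Defensive.

Local Open Scope classical_set_scope.
Local Open Scope ring_scope.

Definition rV_display : measure_display. Proof. exact: default_measure_display. Qed.

(* The sigma-algebra on R^n generated by the coordinates, i.e. the Borel one. *)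
Section rV_measurable.
Context {R : realType} {n : nat}.
Let coord (i : 'I_n) (v : 'rV[R]_n) : measurableTypeR R := v ord0 i.
Let s0 : g_sigma_preimage coord set0. Proof. exact: sigma_algebra0. Qed.
Let sC A : g_sigma_preimage coord A -> g_sigma_preimage coord (~` A).
Proof. exact: sigma_algebraC. Qed.
Let sU (F : _^nat) : (forall i, g_sigma_preimage coord (F i)) ->
  g_sigma_preimage coord (\bigcup_i (F i)).
Proof. exact: sigma_algebra_bigcup. Qed.
HB.instance Definition _ :=
  @isMeasurable.Build rV_display 'rV[R]_n (g_sigma_preimage coord) s0 sC sU.

Lemma measurable_coord (i : 'I_n) :
  measurable_fun setT (fun v : 'rV[R]_n => v ord0 i : measurableTypeR R).
Proof.
move=> _ A mA; rewrite setTI; apply: sub_sigma_algebra.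
by rewrite -bigcup_seq /=; exists i; [rewrite /= mem_index_enum|exists A; rewrite ?setTI].
Qed.

Lemma measurable_fun_rV d (T : measurableType d) (f : T -> 'rV[R]_n) :
  (forall i, measurable_fun setT (fun x => f x ord0 i : measurableTypeR R)) ->
  measurable_fun setT f.
Proof.
move=> mf _ A mA; rewrite setTI.
suff : <<s \big[setU/set0]_(i < n) preimage_set_system setT (coord i) measurable >>
   `<=` [set A | measurable (f @^-1` A)] by exact.
apply: smallest_sub.
  split=> /=; first by rewrite preimage_set0.
    by move=> B mB; rewrite setTD preimage_setC; exact: measurableC.
  by move=> F mF; rewrite preimage_bigcup; exact: bigcupT_measurable.
move=> B; rewrite -bigcup_seq => -[i _ [C mC <-]] /=.
by have := mf i measurableT C mC; rewrite !setTI.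
Qed.
End rV_measurable.

Section lebesgue_rV_step.
Context {R : realType} {n : nat}.
Variable mu : {sigma_finite_measure set 'rV[R]_n -> \bar R}.

Definition rV_cons (p : measurableTypeR R * 'rV[R]_n) : 'rV[R]_n.+1 :=
  \row_i oapp (fun j => p.2 ord0 j) p.1 (unlift ord0 i).

Lemma measurable_rV_cons : measurable_fun setT rV_cons.
Proof.
apply: measurable_fun_rV => i; case: (unliftP ord0 i) => [j ->|->].
  rewrite (_ : (fun x => _) =
    (fun v : 'rV[R]_n => v ord0 j : measurableTypeR R) \o snd).
    exact: (measurableT_comp (measurable_coord j)).
  by apply/funext => p; rewrite mxE liftK.
rewrite (_ : (fun x => _) = fst) //.
by apply/funext => p; rewrite mxE unlift_none.
Qed.

Definition lebesgue_rV_step : set 'rV[R]_n.+1 -> \bar R :=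
  pushforward (@lebesgue_measure R \x mu)%E rV_cons.


Let mpre A : measurable A -> measurable (rV_cons @^-1` A).
Proof. by move=> mA; rewrite -[X in measurable X]setTI; exact: measurable_rV_cons. Qed.

Let step0 : lebesgue_rV_step set0 = 0%E.
Proof. by rewrite /lebesgue_rV_step /pushforward preimage_set0 measure0. Qed.

Let step_ge0 A : (0 <= lebesgue_rV_step A)%E.
Proof. exact: (measure_ge0 (@lebesgue_measure R \x mu)%E). Qed.

Let step_sigma_additive : semi_sigma_additive lebesgue_rV_step.
Proof.
move=> F mF tF mUF; rewrite /lebesgue_rV_step /pushforward preimage_bigcup.
apply: measure_semi_sigma_additive.
- by move=> k; exact: mpre.
- apply/trivIsetP => /= i j _ _ ij; rewrite -preimage_setI.
  by move/trivIsetP : tF => /(_ _ _ _ _ ij) ->//; rewrite preimage_set0.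
- by rewrite -preimage_bigcup; exact: mpre.
Qed.

HB.instance Definition _ := isMeasure.Build _ _ _ lebesgue_rV_step
  step0 step_ge0 step_sigma_additive.

Let uncons (v : 'rV[R]_n.+1) : measurableTypeR R * 'rV[R]_n :=
  (v ord0 ord0, \row_j v ord0 (lift ord0 j)).

Let rV_consK : cancel rV_cons uncons.
Proof.
move=> [a v]; congr pair; first by rewrite mxE unlift_none.
by apply/rowP => j; rewrite !mxE liftK.
Qed.

Let measurable_uncons : measurable_fun setT uncons.
Proof.
apply/measurable_fun_pairP; split; first exact: measurable_coord.
apply: measurable_fun_rV => j.
rewrite (_ : (fun x => _) =
  (fun v : 'rV[R]_n.+1 => v ord0 (lift ord0 j) : measurableTypeR R)).
  exact: measurable_coord.
by apply/funext => v /=; rewrite mxE.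
Qed.

Let step_sigma_finite : sigma_finite setT lebesgue_rV_step.
Proof.
have /sigma_finiteP[F [TF ndF Foo]] := sigma_finiteT (@lebesgue_measure R).
have /sigma_finiteP[G [TG ndG Goo]] := sigma_finiteT mu.
exists (fun k => uncons @^-1` (F k `*` G k)).
  rewrite -preimage_bigcup -[LHS](preimage_setT uncons); congr (_ @^-1` _).
  rewrite -setXTT TF TG predeqE => -[x y]; split.
    move=> [/= [k _ Fkx] [l _ Gly]]; exists (maxn k l) => //; split.
    - by move: x Fkx; exact/subsetPset/ndF/leq_maxl.
    - by move: y Gly; exact/subsetPset/ndG/leq_maxr.
  by move=> [k _ []/= ? ?]; split; exists k.
move=> k; have [mF Fk] := Foo k; have [mG Gk] := Goo k; split.
  by rewrite -[X in measurable X]setTI; apply: measurable_uncons => //; exact: measurableX.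
rewrite /lebesgue_rV_step /pushforward -comp_preimage.
rewrite (_ : uncons \o rV_cons = id); last by apply/funext => p /=; rewrite rV_consK.
by rewrite preimage_id product_measure1E// lte_mul_pinfty// ge0_fin_numE.
Qed.

HB.instance Definition _ := Measure_isSigmaFinite.Build _ _ _ lebesgue_rV_step
  step_sigma_finite.
End lebesgue_rV_step.

(* Lebesgue measure on R^n, as the n-fold product of the one on R. *)
Fixpoint lebesgue_rV {R : realType} (n : nat) :
    {sigma_finite_measure set 'rV[R]_n -> \bar R} :=
  match n with
  | 0 => @dirac _ _ (0 : 'rV[R]_0) R
  | m.+1 => lebesgue_rV_step (lebesgue_rV m)
  end.

Section geometry.
Context {R : realType}.

Definition dotp {d} (x y : 'rV[R]_d) : R := \sum_i x ord0 i * y ord0 i.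

Definition boundary {d} (w : set 'rV[R]_d) : set 'rV[R]_d :=
  closure w `\` interior w.

Definition simply_connected {d} (w : set 'rV[R]_d) : Prop :=
  let I := [set t : R | 0 <= t <= 1] in
  (forall x y, w x -> w y -> exists c : R -> 'rV[R]_d,
     [/\ {within I, continuous c}, forall t, I t -> w (c t), c 0 = x & c 1 = y])
  /\
  (forall c : R -> 'rV[R]_d,
     {within I, continuous c} -> (forall t, I t -> w (c t)) -> c 0 = c 1 ->
     exists h : R * R -> 'rV[R]_d,
       [/\ {within I `*` I, continuous h},
           forall s t, I s -> I t -> w (h (s, t)),
           forall t, I t -> h (0, t) = c t,
           forall t, I t -> h (1, t) = c 0 &
           forall s, I s -> h (s, 0) = c 0 /\ h (s, 1) = c 0]).

(* Near each boundary point, w is the strict epigraph of a Lipschitz function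
   g in a direction e: the function g is defined on the whole space but does
   not depend on the component along the unit vector e. *)
Definition lipschitz_boundary {d} (w : set 'rV[R]_d) : Prop :=
  forall p, boundary w p ->
  exists (r : R) (e : 'rV[R]_d) (g : 'rV[R]_d -> R),
    [/\ 0 < r, dotp e e = 1, [lipschitz g x | x in setT],
        forall x t, g (x + t *: e) = g x &
        forall x, ball p r x -> (w x <-> g x < dotp x e)].

Definition lipschitz_domain {d} (w : set 'rV[R]_d) : Prop :=
  [/\ w !=set0, open w, connected w, bounded_set w & lipschitz_boundary w].

(* A simplex in R^(n+1) is given by the matrix V whose n+2 rows are its
   vertices. *)
Definition affinely_independent {n} (V : 'M[R]_(n.+2, n.+1)) : Prop :=
  row_free (\matrix_(i < n.+1) (row (lift ord0 i) V - row ord0 V)).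

Definition simplex {n} (V : 'M[R]_(n.+2, n.+1)) : set 'rV[R]_n.+1 :=
  [set x | exists l : 'rV[R]_n.+2,
    [/\ forall i, 0 < l ord0 i, \sum_i l ord0 i = 1 & x = l *m V]].

Definition face {n} (V : 'M[R]_(n.+2, n.+1)) (I : {set 'I_n.+2}) :
    set 'rV[R]_n.+1 :=
  [set x | exists l : 'rV[R]_n.+2,
    [/\ forall i, 0 <= l ord0 i, forall i, i \notin I -> l ord0 i = 0,
        \sum_i l ord0 i = 1 & x = l *m V]].

Definition facet {n} (V : 'M[R]_(n.+2, n.+1)) (j : 'I_n.+2) := face V (~: [set j]).

Record conforming_mesh {n} (Om : set 'rV[R]_n.+1) {N}
    (T : 'I_N -> 'M[R]_(n.+2, n.+1)) : Prop := {
  mesh_nondegenerate : forall k, affinely_independent (T k);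
  mesh_sub : forall k, simplex (T k) `<=` Om;
  mesh_cover : \bigcup_k closure (simplex (T k)) = closure Om;
  mesh_disjoint : forall k l, k != l -> simplex (T k) `&` simplex (T l) = set0;
  mesh_conforming : forall k l, exists I J : {set 'I_n.+2},
    closure (simplex (T k)) `&` closure (simplex (T l)) = face (T k) I /\
    closure (simplex (T k)) `&` closure (simplex (T l)) = face (T l) J }.

(* The surface integral of phi over the facet opposite to vertex j: the facet
   is the image of the reference simplex of R^n under s |-> v + s *m D, where v
   is one of its vertices and the rows of D are the edges issued from v. *)
Definition facet_integral {n} (V : 'M[R]_(n.+2, n.+1)) (j : 'I_n.+2)
    (phi : 'rV[R]_n.+1 -> R) : R :=
  let v := row (lift j ord0) V in
  let D := \matrix_(m < n) (row (lift j (lift ord0 m)) V - v) in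
  Num.sqrt (\det (D *m D^T)) *
  \int[lebesgue_rV n]_(s in [set s : 'rV[R]_n |
      (forall i, 0 <= s ord0 i) /\ \sum_i s ord0 i <= 1]) phi (v + s *m D).

End geometry.

(* Elements of L^2(w) are represented by functions on the whole space, which are
   only relevant almost everywhere in w. *)
Section sobolev.
Context {R : realType} {d : nat}.
Local Notation E := 'rV[R]_d.
Local Notation leb := (@lebesgue_rV R d).
Implicit Types (w : set E) (f g u v : E -> R) (q r : E -> E).

Definition L2 w f : Prop :=
  measurable_fun w f /\ leb.-integrable w (EFin \o (fun x => f x ^+ 2)).

Definition L2v w q : Prop := forall i, L2 w (fun x => q x ord0 i).

Definition ip w f g : R := \int[leb]_(x in w) (f x * g x).

Definition ipv w q r : R := \int[leb]_(x in w) dotp (q x) (r x).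

Definition pderiv (i : 'I_d) f : E -> R := fun x => 'D_(delta_mx ord0 i) f x.

Definition grad f : E -> E := fun x => \row_i pderiv i f x.

Definition smooth f : Prop :=
  forall (s : seq 'I_d) (x : E), differentiable (foldr pderiv f s) x.

Definition test_function w (phi : E -> R) : Prop :=
  smooth phi /\
  exists K : set E, [/\ compact K, K `<=` w & forall x, ~ K x -> phi x = 0].

Definition is_wgrad w u q : Prop :=
  L2v w q /\ forall phi, test_function w phi ->
    forall i, ip w u (pderiv i phi) = - ip w (fun x => q x ord0 i) phi.

Definition is_wdiv w q g : Prop :=
  L2 w g /\ forall phi, test_function w phi -> ipv w q (grad phi) = - ip w g phi.

Definition H1space w u : Prop := L2 w u /\ exists q, is_wgrad w u q.

Definition Hdiv w q : Prop := L2v w q /\ exists g, is_wdiv w q g.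

(* The weak derivatives are determined almost everywhere in w. *)
Definition wgrad w u : E -> E := xget (0 : E -> E) [set q | is_wgrad w u q].

Definition wdiv w q : E -> R := xget (0 : E -> R) [set g | is_wdiv w q g].

Definition H1norm w u : R :=
  Num.sqrt (ip w u u + ipv w (wgrad w u) (wgrad w u)).

Definition H10space w u : Prop :=
  H1space w u /\ forall e : R, 0 < e ->
    exists phi, test_function w phi /\ H1norm w (u - phi) < e.

(* H^{1/2}(bd w) is the trace space H^1(w) / H^1_0(w) (the kernel of the trace
   operator is H^1_0(w)): its elements are represented by functions u with
   H1space w u, and equality in H^{1/2}(bd w) is the relation same_trace w. *)
Definition same_trace w u v : Prop :=
  [/\ H1space w u, H1space w v & H10space w (u - v)].

(* The trace of u on bd w is the Lipschitz function (restriction of) phi. *)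
Definition has_trace w u (phi : E -> R) : Prop :=
  exists g, [/\ [lipschitz g x | x in closure w],
    forall x, boundary w x -> g x = phi x & same_trace w u g].

(* H^{-1/2}(bd w) is the dual of H^{1/2}(bd w), whose norm is the quotient norm:
   its elements are functionals of the representatives u, and l u is
   the duality pairing <l, u>_{bd w}. Only the values of l on H^1(w) matter. *)
Definition Hmhalf w (l : (E -> R) -> R) : Prop :=
  [/\ forall a u v, H1space w u -> H1space w v -> l (a *: u + v) = a * l u + l v,
      forall u v, same_trace w u v -> l u = l v &
      exists C : R, forall u, H1space w u -> `|l u| <= C * H1norm w u].

(* The element (q . n)|_{bd w} of H^{-1/2}(bd w), for q in H(div, w). *)
Definition normal_trace w q : (E -> R) -> R :=
  fun u => ipv w q (wgrad w u) + ip w (wdiv w q) u.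

Definition half_nneg w u : Prop :=
  H1space w u /\ exists (phi un : nat -> E -> R),
    (forall m, [/\ [lipschitz phi m x | x in boundary w],
                   forall x, boundary w x -> 0 <= phi m x &
                   has_trace w (un m) (phi m)]) /\
    (* weak convergence in H^{1/2}(bd w) *)
    (forall l, Hmhalf w l -> (fun m => l (un m)) @ \oo --> l u).

Definition mhalf_nneg w (l : (E -> R) -> R) : Prop :=
  forall u, half_nneg w u -> 0 <= l u.

End sobolev.

Inductive variant := variant_0 | variant_n | variant_s.

Section dpg.
Context {R : realType} {n : nat}.
Local Notation E := 'rV[R]_n.+1.
Local Notation leb := (@lebesgue_rV R n.+1).
Variables (Om : set E) (N : nat) (V : 'I_N -> 'M[R]_(n.+2, n.+1)).
Local Notation T k := (simplex (V k)).

(* Equality in U of two representatives is eqU below.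
   Representatives (u, sigma, uhat, sigmahat): uhat k stands for uhat|_{bd T_k}
   in H^{1/2}(bd T_k), sigmahat k for sigmahat|_{bd T_k} in H^{-1/2}(bd T_k). *)
Definition trialT : Type :=
  ((E -> R) * (E -> E) * ('I_N -> E -> R) * ('I_N -> (E -> R) -> R))%type.
Definition fld (u : trialT) : E -> R := u.1.1.1.
Definition flux (u : trialT) : E -> E := u.1.1.2.
Definition uhat (u : trialT) : 'I_N -> E -> R := u.1.2.
Definition shat (u : trialT) : 'I_N -> (E -> R) -> R := u.2.

Definition lifts_half (uh : 'I_N -> E -> R) (w : E -> R) : Prop :=
  H1space Om w /\ forall k, same_trace (T k) (uh k) w.

Definition lifts_mhalf (sh : 'I_N -> (E -> R) -> R) (q : E -> E) : Prop :=
  Hdiv Om q /\ forall k v, H1space (T k) v -> sh k v = normal_trace (T k) q v.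

Definition Hhalf_skel (uh : 'I_N -> E -> R) : Prop :=
  (forall k, H1space (T k) (uh k)) /\ exists w, lifts_half uh w.

Definition Hmhalf_skel (sh : 'I_N -> (E -> R) -> R) : Prop :=
  (forall k, Hmhalf (T k) (sh k)) /\ exists q, lifts_mhalf sh q.

Definition inU (u : trialT) : Prop :=
  [/\ L2 Om (fld u), L2v Om (flux u), Hhalf_skel (uhat u) & Hmhalf_skel (shat u)].

Definition eqU (u v : trialT) : Prop :=
  [/\ ae_eq leb Om (fld u) (fld v), ae_eq leb Om (flux u) (flux v),
      forall k, same_trace (T k) (uhat u k) (uhat v k) &
      forall k w, H1space (T k) w -> shat u k w = shat v k w].

Definition testT : Type := ((E -> R) * (E -> E))%type.

Definition inV (v : testT) : Prop :=
  [/\ L2 Om v.1, forall k, H1space (T k) v.1, L2v Om v.2 & forall k, Hdiv (T k) v.2].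

Definition pw_grad (v : E -> R) : E -> E :=
  fun x => \sum_(k < N) (\1_(T k) x : R) *: wgrad (T k) v x.

Definition pw_div (t : E -> E) : E -> R :=
  fun x => \sum_(k < N) (\1_(T k) x : R) * wdiv (T k) t x.

Definition ipV (v w : testT) : R :=
  ip Om v.1 w.1 + ipv Om (pw_grad v.1) (pw_grad w.1) +
  ipv Om v.2 w.2 + ip Om (pw_div v.2) (pw_div w.2).

Definition pair_uhat (uh : 'I_N -> E -> R) (t : E -> E) : R :=
  \sum_(k < N) normal_trace (T k) t (uh k).

Definition pair_shat (sh : 'I_N -> (E -> R) -> R) (v : E -> R) : R :=
  \sum_(k < N) sh k v.

Definition bform (u : trialT) (v : testT) : R :=
  ipv Om (flux u) (pw_grad v.1) + ip Om (fld u) v.1 - pair_shat (shat u) v.1 +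
  ipv Om (flux u) v.2 + ip Om (fld u) (pw_div v.2) - pair_uhat (uhat u) v.2.

(* The Riesz representative of bform u in V, unique almost everywhere. *)
Definition Theta (u : trialT) : testT :=
  xget (0 : testT) [set z | inV z /\ forall v, inV v -> ipV z v = bform u v].

Definition Theta_beta (beta : R) (u : trialT) : testT := beta *: Theta u.

(* Well defined up to equality in H^{1/2}(bd Om). *)
Definition gamma0 (u : trialT) : E -> R :=
  xget (0 : E -> R) [set w | lifts_half (uhat u) w].

(* As a functional on (representatives in H^1(Om) of) H^{1/2}(bd Om), so that
   gamman u (gamma0 v) is the duality between the two traces on bd Om. *)
Definition gamman (u : trialT) : (E -> R) -> R :=
  normal_trace Om (xget (0 : E -> E) [set q | lifts_mhalf (shat u) q]).

Definition Lform (f : E -> R) (v : testT) : R := ip Om f v.1.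

Definition aform_0 (beta : R) (u v : trialT) : R :=
  bform u (Theta_beta beta v) + gamman u (gamma0 v).

Definition aform_n (beta : R) (u v : trialT) : R :=
  bform u (Theta_beta beta v) + gamman v (gamma0 u).

Definition aform_s (beta : R) (u v : trialT) : R :=
  bform u (Theta_beta beta v) + 2^-1 * (gamman u (gamma0 v) + gamman v (gamma0 u)).

Definition aform (star : variant) : R -> trialT -> trialT -> R :=
  match star with variant_0 => aform_0 | variant_n => aform_n | variant_s => aform_s end.

Definition Fform (f : E -> R) (beta : R) (v : trialT) : R := Lform f (Theta_beta beta v).

Definition P0_mesh (u : E -> R) : Prop :=
  forall k, exists c : R, ae_eq leb (T k) u (cst c).

Definition P0v_mesh (q : E -> E) : Prop :=
  forall k, exists c : E, ae_eq leb (T k) q (cst c).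

Definition S1_skel (uh : 'I_N -> E -> R) : Prop :=
  exists g : E -> R,
    [/\ {within \bigcup_k boundary (T k), continuous g},
        forall k j, exists (p : E) (c : R),
          forall x, facet (V k) j x -> g x = dotp p x + c &
        forall k, has_trace (T k) (uh k) g].

(* sigmahat|_{bd T_k} is the function equal to c j on the facet j: the duality
   extends the L^2(bd T_k) inner product, and traces of Lipschitz functions
   are dense in H^{1/2}(bd T_k). *)
Definition P0_skel (sh : 'I_N -> (E -> R) -> R) : Prop :=
  forall k, exists c : 'I_n.+2 -> R, forall v phi, has_trace (T k) v phi ->
    sh k v = \sum_j c j * facet_integral (V k) j phi.

Definition Uh (u : trialT) : Prop :=
  inU u /\
  [/\ P0_mesh (fld u), P0v_mesh (flux u), S1_skel (uhat u) & P0_skel (shat u)].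

Definition Kh (star : variant) (u : trialT) : Prop :=
  let K0 := Uh u /\ half_nneg Om (gamma0 u) in
  let Kn := Uh u /\ mhalf_nneg Om (gamman u) in
  match star with
  | variant_0 => K0 | variant_n => Kn | variant_s => K0 /\ Kn
  end.

Definition solves_VI (star : variant) (beta : R) (f : E -> R) (u : trialT) : Prop :=
  Kh star u /\
  forall v, Kh star v -> Fform f beta (v - u) <= aform star beta u (v - u).

End dpg.

Arguments trialT : clear implicits.

(* Main.v *)
Require Import Defs.
From mathcomp Require Import all_boot all_order all_algebra.
From mathcomp Require Import all_classical all_reals all_analysis.
From mathcomp Require Import measurable_realfun.
From mathcomp Require Import zify ring lra.
Import Order.TTheory GRing.Theory Num.Theory.
Import numFieldNormedType.Exports.
Local Open Scope classical_set_scope.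
Local Open Scope ring_scope.

Set Implicit Arguments.
Unset Strict Implicit.
Unset Printing Implicit Defensive.

(** * Complete semi-inner product spaces *)

(** The form [aform star beta] is bounded and coercive on the trial space, and the admissible set
    [Kh] is a nonempty closed convex cone. The theorem of Lions and Stampacchia then gives a
    solution, and coercivity makes it unique.

    Coercivity is the heart of the matter. Write u and sigma for the field and the flux of a trial
    function, (z, t) for its image under [Theta], and grad, div for the piecewise operators. Testing
    the equation of [Theta] with pairs (v, 0) shows that sigma - grad z lies in H(div, Om), with
    divergence u - z and the normal traces [shat]. Testing with pairs (0, q) shows that u - div t
    lies in H^1(Om), with gradient sigma - t and the traces [uhat]. The boundary duality of a trial
    function with itself is therefore (sigma - grad z, sigma - t) + (u - z, u - div t). Since 2 (x -
    a, x - b) = |x - a - b|^2 + |x|^2 - |a|^2 - |b|^2, this is at least half of |u|^2 + |sigma|^2 -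
    |Theta u|^2, and beta |Theta u|^2 absorbs the negative term ([aform_coercive]).

    Trial functions are measured by |u|^2 + |sigma|^2 + |Theta u|^2 ([ipU]). By the identities above
    the skeleton unknowns are determined by the other data, so this seminorm is complete
    ([U_semiHilbert]) and its null vectors are zero in U ([inU_null]). Functions are never taken
    modulo equality almost everywhere. The Hilbert space theory is instead done for complete
    semi-inner products, and all identities that involve chosen weak derivatives hold up to null
    vectors.

    Closedness of the discrete space rests on [finite_relation_closed], which asks that zero
    coefficients describe only null elements. For continuous piecewise affine traces this means that
    a Lipschitz function of H^1 vanishing on the boundary belongs to H^1_0 ([lipschitz_H10]); the
    proof uses Bernstein polynomials and a smooth threshold. The sign condition on [gamma0] is
    closed because the weak sequential closure of a convex set is its strong closure
    ([half_nneg_adherent]); the one on [gamman] is an intersection of closed half-spaces. *)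

Lemma cvg_to0P {R : realType} (u : nat -> R) : (forall m, 0 <= u m) ->
  u @ \oo --> (0 : R) <->
  forall e, 0 < e -> exists n0, forall m, (n0 <= m)%N -> u m <= e.
Proof.
move=> u0; split=> [/cvgrPdist_le cu e /cu[n0 _ h]|h].
  by exists n0 => m /h /=; rewrite sub0r normrN ger0_norm.
apply/cvgrPdist_le => e /h[n0 hn]; exists n0 => // m /hn /=.
by rewrite sub0r normrN ger0_norm.
Qed.

Lemma small_invn {R : realType} (e : R) : 0 < e ->
  exists n0, forall m, (n0 <= m)%N -> m.+1%:R^-1 <= e.
Proof.
move=> e0; have /cvg_to0P h := @cvg_harmonic R.
by have [|n0] := h _ e e0; [move=> m; rewrite invr_ge0|exists n0].
Qed.

(** Elements of the spaces below are functions and functionals rather than classes, so a domain [D]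
    with a semi-inner product replaces a Hilbert space: distinct elements may be at distance 0, and
    limits are determined up to null vectors. *)
Record semiHilbert {R : realType} {X : lmodType R} (D : X -> Prop)
    (ip : X -> X -> R) : Prop := {
  sh0 : D 0;
  shL : forall a x y, D x -> D y -> D (a *: x + y);
  ipC : forall x y, D x -> D y -> ip x y = ip y x;
  ipL : forall a x y z, D x -> D y -> D z -> ip (a *: x + y) z = a * ip x z + ip y z;
  ip_ge0 : forall x, D x -> 0 <= ip x x;
  sh_complete : forall u : nat -> X, (forall m, D (u m)) ->
    (forall e, 0 < e -> exists n0, forall i j, (n0 <= i)%N -> (n0 <= j)%N ->
      Num.sqrt (ip (u i - u j) (u i - u j)) <= e) ->
    exists x, D x /\
      (fun m => Num.sqrt (ip (u m - x) (u m - x))) @ \oo --> (0 : R) }.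

Section semiHilbert_theory.
Context {R : realType} {X : lmodType R} (D : X -> Prop) (ip : X -> X -> R).
Hypothesis H : semiHilbert D ip.
Implicit Types (x y z : X) (u : nat -> X) (C : X -> Prop) (l : X -> R).

Definition snorm x : R := Num.sqrt (ip x x).
Definition linear_on (S : X -> Prop) l :=
  forall a x y, S x -> S y -> l (a *: x + y) = a * l x + l y.
Definition bounded_by (M : R) l := forall x, D x -> `|l x| <= M * snorm x.
Definition convex_pred C :=
  forall t x y, 0 <= t -> t <= 1 -> C x -> C y -> C (x + t *: (y - x)).
Definition adherent C x := D x /\ forall e, 0 < e -> exists y, C y /\ snorm (x - y) < e.
Definition closed_pred C := forall x, adherent C x -> C x.

Lemma shZ a x : D x -> D (a *: x).
Proof. by move=> Dx; rewrite -[_ *: _]addr0; apply: (shL H) => //; exact: sh0 H. Qed.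
Lemma shD x y : D x -> D y -> D (x + y).
Proof. by move=> Dx Dy; rewrite -[x]scale1r; exact: (shL H). Qed.
Lemma shN x : D x -> D (- x).
Proof. by move=> Dx; rewrite -scaleN1r; exact: shZ. Qed.
Lemma shB x y : D x -> D y -> D (x - y).
Proof. by move=> Dx Dy; apply: shD => //; exact: shN. Qed.

Lemma lin0 S l : S 0 -> linear_on S l -> l 0 = 0.
Proof.
move=> S0 /(_ 1 0 0 S0 S0); rewrite scale1r addr0 mul1r => /eqP.
by rewrite -subr_eq subrr => /eqP.
Qed.
Lemma linZ S l a x : S 0 -> linear_on S l -> S x -> l (a *: x) = a * l x.
Proof.
move=> S0 L Sx; rewrite -[a *: x]addr0 L// (lin0 S0 L) addr0//.
Qed.
Lemma linD S l x y : linear_on S l -> S x -> S y -> l (x + y) = l x + l y.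
Proof. by move=> L Sx Sy; rewrite -[x in LHS]scale1r L// mul1r. Qed.
Lemma linB S l x y : linear_on S l -> S x -> S y -> l (x - y) = l x - l y.
Proof. by move=> L Sx Sy; rewrite addrC -scaleN1r L// mulN1r addrC. Qed.

Lemma ip_linl z : D z -> linear_on D (ip ^~ z).
Proof. by move=> Dz a x y Dx Dy; exact: (ipL H). Qed.
Lemma ip_linr z : D z -> linear_on D (ip z).
Proof.
move=> Dz a x y Dx Dy; rewrite (ipC H)//; last exact: (shL H).
by rewrite (ipL H)// (ipC H Dx)// (ipC H Dy).
Qed.
Lemma ipBl x y z : D x -> D y -> D z -> ip (x - y) z = ip x z - ip y z.
Proof. by move=> Dx Dy Dz; exact: (linB (ip_linl Dz)). Qed.
Lemma ipDl x y z : D x -> D y -> D z -> ip (x + y) z = ip x z + ip y z.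
Proof. by move=> Dx Dy Dz; exact: (linD (ip_linl Dz)). Qed.
Lemma ipZl a x z : D x -> D z -> ip (a *: x) z = a * ip x z.
Proof. by move=> Dx Dz; apply: (linZ _ _ (ip_linl Dz)) => //; exact: sh0 H. Qed.
Lemma ipBr x y z : D x -> D y -> D z -> ip z (x - y) = ip z x - ip z y.
Proof. by move=> Dx Dy Dz; exact: (linB (ip_linr Dz)). Qed.
Lemma ipDr x y z : D x -> D y -> D z -> ip z (x + y) = ip z x + ip z y.
Proof. by move=> Dx Dy Dz; exact: (linD (ip_linr Dz)). Qed.
Lemma ipZr a x z : D x -> D z -> ip z (a *: x) = a * ip z x.
Proof. by move=> Dx Dz; apply: (linZ _ _ (ip_linr Dz)) => //; exact: sh0 H. Qed.

Lemma ip_comb a b x y : D x -> D y -> ip (a *: x + b *: y) (a *: x + b *: y) =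
  a ^+ 2 * ip x x + 2 * a * b * ip x y + b ^+ 2 * ip y y.
Proof.
move=> Dx Dy; have Dax := shZ a Dx; have Dby := shZ b Dy.
rewrite ipDl//; last exact: shD.
rewrite !ipDr// !ipZl// ?ipZr// (ipC H Dy Dx); ring.
Qed.

Lemma snorm_ge0 x : 0 <= snorm x. Proof. exact: sqrtr_ge0. Qed.
Lemma snorm_sqr x : D x -> snorm x ^+ 2 = ip x x.
Proof. by move=> Dx; rewrite sqr_sqrtr// (ip_ge0 H). Qed.
Lemma snormZ a x : D x -> snorm (a *: x) = `|a| * snorm x.
Proof.
move=> Dx; rewrite /snorm ipZl ?ipZr//; last exact: shZ.
by rewrite mulrA -expr2 sqrtrM ?sqr_ge0// sqrtr_sqr.
Qed.
Lemma snormN x : D x -> snorm (- x) = snorm x.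
Proof. by move=> Dx; rewrite -scaleN1r snormZ// normrN normr1 mul1r. Qed.
Lemma snorm_sub x y : D x -> D y -> snorm (x - y) = snorm (y - x).
Proof. by move=> Dx Dy; rewrite -opprB snormN//; exact: shB. Qed.
Lemma snorm0 : snorm 0 = 0.
Proof. by rewrite -(scale0r (0 : X)) snormZ ?normr0 ?mul0r//; exact: sh0 H. Qed.

Lemma cauchy_schwarz x y : D x -> D y -> `|ip x y| <= snorm x * snorm y.
Proof.
move=> Dx Dy; have gx := snorm_ge0 x; have gy := snorm_ge0 y.
rewrite -(@ler_pXn2r _ 2)// ?nnegrE ?mulr_ge0// exprMn !snorm_sqr// real_normK ?num_real//.
have key a b : 0 <= a ^+ 2 * ip x x - a * b * ip x y *+ 2 + b ^+ 2 * ip y y.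
  have Dax := shZ a Dx; have Dby := shZ b Dy.
  have := ip_ge0 H (shB Dax Dby); rewrite ipBl ?ipBr ?ipZl ?ipZr//; last exact: shB.
  by rewrite (ipC H Dy Dx); lra.
have px := ip_ge0 H Dx; have py := ip_ge0 H Dy.
move: px; rewrite le_eqVlt => /orP[/eqP p0|px].
  rewrite -p0 mul0r; have [->|c0] := eqVneq (ip x y) 0; first by rewrite expr0n.
  have := key ((ip y y + 1) / ip x y) 1; rewrite -p0 mulr0 add0r mulr1 divfK//; lra.
have : 0 <= ip x x * (ip x x * ip y y - ip x y ^+ 2).
  by have := key (ip x y) (ip x x); lra.
by rewrite pmulr_rge0// subr_ge0.
Qed.

Lemma snormD x y : D x -> D y -> snorm (x + y) <= snorm x + snorm y.
Proof.
move=> Dx Dy; rewrite -(@ler_pXn2r _ 2)// ?nnegrE ?addr_ge0 ?snorm_ge0//.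
rewrite sqrrD !snorm_sqr//; last exact: shD.
rewrite ipDl ?ipDr//; last exact: shD.
have := cauchy_schwarz Dx Dy; have := ler_norm (ip x y); rewrite (ipC H Dy Dx); lra.
Qed.
Lemma snorm_dist x y z : D x -> D y -> D z ->
  snorm (x - z) <= snorm (x - y) + snorm (y - z).
Proof.
move=> Dx Dy Dz; have -> : x - z = (x - y) + (y - z) by rewrite addrA subrK.
by apply: snormD; exact: shB.
Qed.

Lemma ip_bounded z : D z -> bounded_by (snorm z) (ip z).
Proof. by move=> Dz x Dx; exact: cauchy_schwarz. Qed.

Lemma lin_bounded_cvg l M u x : linear_on D l -> bounded_by M l ->
  (forall m, D (u m)) -> D x -> (fun m => snorm (u m - x)) @ \oo --> (0 : R) ->
  (l \o u) @ \oo --> l x.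
Proof.
move=> L B Du Dx cu; apply/cvgrPdist_le => e e0.
have M1 : 0 < `|M| + 1 by rewrite ltr_wpDl.
move/cvgrPdist_le : cu => /(_ (e / (`|M| + 1))); rewrite divr_gt0// => /(_ isT).
apply: filterS => m; rewrite sub0r normrN ger0_norm ?snorm_ge0// => um.
rewrite /= distrC -(linB L)//; apply: le_trans (B _ _) _; first exact: shB.
apply: le_trans (_ : (`|M| + 1) * snorm (u m - x) <= _).
  by apply: ler_wpM2r; [exact: snorm_ge0|rewrite (le_trans (ler_norm _))// lerDl].
by rewrite mulrC -ler_pdivlMr.
Qed.

Lemma snorm_cvg u x : (forall m, D (u m)) -> D x ->
  (fun m => snorm (u m - x)) @ \oo --> (0 : R) -> (snorm \o u) @ \oo --> snorm x.
Proof.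
move=> Du Dx cu; apply/cvgrPdist_le => e e0.
move/cvgrPdist_le : cu => /(_ _ e0); apply: filterS => m.
rewrite sub0r normrN ger0_norm ?snorm_ge0// => um; apply: le_trans um.
rewrite ler_norml /=; have := snorm_dist Dx (Du m) (sh0 H).
have := snorm_dist (Du m) Dx (sh0 H); rewrite !subr0 (snorm_sub Dx)//; lra.
Qed.

(* Parallelogram identity: minimising sequences of [|x|^2/2 - l x] are Cauchy. *)
Theorem minimizer_exists C l M : (exists x, C x) -> (forall x, C x -> D x) ->
  convex_pred C -> closed_pred C -> linear_on D l -> bounded_by M l ->
  exists2 x, C x & forall y, C y -> l (y - x) <= ip x (y - x).
Proof.
move=> [x0 Cx0] CD Cc Ccl L B; pose J x := ip x x / 2 - l x.
have Jlb x : D x -> - (M ^+ 2 / 2) <= J x.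
  move=> Dx; rewrite /J -snorm_sqr//.
  by have := B _ Dx; have := ler_norm (l x); have := sqr_ge0 (M - snorm x); nra.
pose E := [set J x | x in C].
have Einf : has_inf E.
  split; first by exists (J x0), x0.
  by exists (- (M ^+ 2 / 2)) => _ [x Cx <-]; apply/Jlb/CD.
pose m := inf E.
have mlb x : C x -> m <= J x by move=> Cx; apply: ge_inf; [exact: Einf.2|exists x].
have ex n : exists x, C x /\ J x < m + n.+1%:R^-1.
  have i0 : 0 < n.+1%:R^-1 :> R by rewrite invr_gt0.
  by have [_ [x Cx <-] Jx] := inf_adherent i0 Einf; exists x.
have [u uP] := choice ex.
have Cu n : C (u n) := (uP n).1; have Du n := CD _ (Cu n).
have uc i j : snorm (u i - u j) ^+ 2 <= 4 * (i.+1%:R^-1 + j.+1%:R^-1).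
  have Dh : D (u i + 2^-1 *: (u j - u i)) by apply/shD/shZ/shB.
  have := mlb _ (Cc (2^-1) _ _ ltac:(lra) ltac:(lra) (Cu i) (Cu j)).
  have := (uP i).2; have := (uP j).2; rewrite /J snorm_sqr; last exact: shB.
  rewrite (linD L)//; last exact/shZ/shB.
  rewrite (linZ 2^-1 (sh0 H) L) ?(linB L)//; last exact: shB.
  have -> : u i + 2^-1 *: (u j - u i) = 2^-1 *: u i + 2^-1 *: u j.
    rewrite scalerBr addrCA addrC; congr (_ + _); rewrite -{1}[u i]scale1r -scalerBl.
    by congr (_ *: _); lra.
  have -> : u i - u j = 1 *: u i + (-1) *: u j by rewrite scale1r scaleN1r.
  by rewrite !ip_comb//; move: (i.+1%:R^-1) (j.+1%:R^-1) => p r; lra.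
have [|x [Dx ux]] := sh_complete H Du.
  move=> e e0; have d0 : 0 < e ^+ 2 / 8 by rewrite divr_gt0// exprn_gt0.
  have [n0 le0] := small_invn d0.
  exists n0 => i j ni nj; rewrite -(@ler_pXn2r _ 2)// ?nnegrE ?sqrtr_ge0 ?(ltW e0)//.
  apply: le_trans (uc i j) _; have := le0 _ ni; have := le0 _ nj; move: (i.+1%:R^-1) (j.+1%:R^-1) => p r; lra.
have Cx : C x.
  apply: Ccl; split=> // e e0; move/cvgrPdist_lt : ux => /(_ _ e0)[n0 _ /(_ n0 (leqnn _))] /=.
  rewrite sub0r normrN ger0_norm ?sqrtr_ge0// => h; exists (u n0); split=> //.
  by rewrite snorm_sub.
have Jx : J x <= m.
  have cJ : (J \o u) @ \oo --> J x.
    have -> : J \o u = (fun n => snorm (u n) ^+ 2 / 2 - (l \o u) n).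
      by apply/funext => n /=; rewrite snorm_sqr.
    rewrite /J -snorm_sqr//; apply: cvgB; last exact: lin_bounded_cvg B _ _ _.
    apply: cvgMl; rewrite expr2; apply: cvgM; exact: snorm_cvg.
  have cm : (fun n => m + n.+1%:R^-1) @ \oo --> m + (0 : R).
    by apply: cvgD; [exact: cvg_cst|exact: cvg_harmonic].
  rewrite -[m in _ <= m]addr0; apply: ler_cvg_to cJ cm _.
  by apply: nearW => n; apply/ltW; exact: (uP n).2.
exists x => // y Cy; rewrite -subr_ge0; apply/ler_addgt0Pl => e e0.
have Dy := CD _ Cy; have : D (y - x) by exact: shB.
have := fun t t0 t1 => Cc t x y t0 t1 Cx Cy; move: (y - x) => d Cd Dd.
(* With a step of this size from [x] towards [y] the quadratic term of [J] is at most t e / 2.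
   Dividing J x <= J (x + t d) by t gives the inequality up to [e]. *)
pose t := Num.min 1 (e / (ip d d + 1)).
have d1 : 0 < ip d d + 1 by rewrite ltr_wpDl// (ip_ge0 H).
have t0 : 0 < t by rewrite lt_min ltr01 divr_gt0.
have t1 : t <= 1 by rewrite ge_min lexx.
have td : t * ip d d <= e.
  apply: le_trans (_ : t * (ip d d + 1) <= _); first by rewrite ler_pM2l// lerDl.
  by rewrite -ler_pdivlMr// ge_min lexx orbT.
have Dtd : D (t *: d) by exact: shZ.
have := le_trans Jx (mlb _ (Cd t (ltW t0) t1)); rewrite /J.
rewrite (linD L)// (linZ t (sh0 H) L)// ipDl// ?ipDr// ?ipZl// ?ipZr//; last exact: shD.
rewrite (ipC H Dd Dx) => h.
have : 0 <= t * (ip x d + t * ip d d / 2 - l d) by lra.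
rewrite pmulr_rge0// => h2; lra.
Qed.

(** Minimising over all of [D] turns the variational inequality into an equality, by testing with
    [x + y] and [x - y]. *)
Corollary riesz l M : linear_on D l -> bounded_by M l ->
  exists2 x, D x & forall y, D y -> ip x y = l y.
Proof.
move=> L B.
have [|||x Dx xP] := @minimizer_exists D l M _ (fun _ => id) _ _ L B.
- by exists 0; exact: sh0 H.
- by move=> t x y _ _ Dx Dy; apply/shD/shZ/shB.
- by move=> x [].
exists x => // y Dy; have h1 := xP _ (shD Dx Dy); have h2 := xP _ (shB Dx Dy).
rewrite addrAC subrr add0r in h1; rewrite addrAC subrr add0r in h2.
rewrite -scaleN1r (linZ _ (sh0 H) L)// ipZr// in h2; lra.
Qed.

Lemma adherent_closed C : (forall x, C x -> D x) -> closed_pred (adherent C).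
Proof.
move=> CD x [Dx xP]; split=> // e e0; have e2 : 0 < e / 2 by lra.
have [y [[Dy yP] xy]] := xP _ e2; have [z [Cz yz]] := yP _ e2; exists z; split => //.
have := snorm_dist Dx Dy (CD _ Cz); lra.
Qed.

Lemma adherent_convex C : (forall x, C x -> D x) -> convex_pred C ->
  convex_pred (adherent C).
Proof.
move=> CD Cc t x y t0 t1 [Dx xP] [Dy yP]; split; first by apply/shD/shZ/shB.
move=> e e0; have e2 : 0 < e / 2 by lra.
have [x' [Cx xx]] := xP _ e2; have [y' [Cy yy]] := yP _ e2.
exists (x' + t *: (y' - x')); split; first exact: Cc.
have Dx' := CD _ Cx; have Dy' := CD _ Cy.
have -> : x + t *: (y - x) - (x' + t *: (y' - x')) =
    (1 - t) *: (x - x') + t *: (y - y').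
  rewrite opprD addrACA -scalerBr scalerBl scale1r -[RHS]addrA; congr (_ + _).
  by rewrite [RHS]addrC -scalerBr; congr (_ *: _); rewrite !opprD !opprK addrACA.
have Dxx := shB Dx Dx'; have Dyy := shB Dy Dy'.
apply: le_lt_trans (snormD (shZ _ Dxx) (shZ _ Dyy)) _; rewrite !snormZ// !ger0_norm//; last lra.
have : (1 - t) * snorm (x - x') <= (1 - t) * (e / 2) by apply: ler_wpM2l; lra.
have : t * snorm (y - y') <= t * (e / 2) by apply: ler_wpM2l; lra.
lra.
Qed.

(** Minimising |x|^2 / 2 - (z, x) over [C] amounts to minimising the distance to [z]. *)
Corollary projection C z : (exists x, C x) -> (forall x, C x -> D x) ->
  convex_pred C -> closed_pred C -> D z ->
  exists2 x, C x & forall y, C y -> ip (z - x) (y - x) <= 0.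
Proof.
move=> C0 CD Cc Ccl Dz.
have [x Cx xP] := minimizer_exists C0 CD Cc Ccl (ip_linr Dz) (ip_bounded Dz).
exists x => // y Cy; rewrite ipBl ?subr_le0//; [exact: xP|exact: CD|].
by apply: shB; exact: CD.
Qed.

End semiHilbert_theory.

(** * Coercive variational inequalities *)

Section lions_stampacchia.
Context {R : realType} {X : lmodType R} (D : X -> Prop) (ip : X -> X -> R).
Hypothesis H : semiHilbert D ip.
Local Notation nm := (snorm ip).

(** As [a] may fail to be symmetric, the solution is found as a fixed point instead of a minimiser:
    [T w] is the projection on [C] of w - r (R w - F), where R is the Riesz representation of [a]
    and [F] stands for its own representative. For a suitable r this is a contraction, and its
    iterates converge to a point at distance 0 from its image. *)
Theorem lions_stampacchia (C : X -> Prop) (a : X -> X -> R) (F : X -> R) (A B c : R) :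
  (exists x, C x) -> (forall x, C x -> D x) -> convex_pred C -> closed_pred D ip C ->
  (forall y, D y -> linear_on D (a ^~ y)) -> (forall x, D x -> linear_on D (a x)) ->
  (forall x y, D x -> D y -> `|a x y| <= A * nm x * nm y) ->
  0 < c -> (forall x, D x -> c * nm x ^+ 2 <= a x x) ->
  linear_on D F -> bounded_by D ip B F ->
  exists2 x, C x & forall y, C y -> F (y - x) <= a x (y - x).
Proof.
move=> [x0 Cx0] CD Cc Ccl al ar ab c0 ac Fl Fb.
(* Enlarging the bound makes it exceed [c], so that 1 - c^2 / A'^2 is positive. *)
pose A' := `|A| + c + 1.
have A0 : 0 < A' by rewrite ltr_wpDl// addr_ge0// ltW.
have cA : c < A' by have := normr_ge0 A; rewrite /A'; lra.
have ab' x y : D x -> D y -> `|a x y| <= A' * nm x * nm y.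
  move=> Dx Dy; apply: le_trans (ab _ _ Dx Dy) _.
  apply: ler_wpM2r; first exact: snorm_ge0.
  apply: ler_wpM2r; first exact: snorm_ge0.
  by have := ler_norm A; rewrite /A'; lra.
have exR x : exists z, D x -> D z /\ forall y, D y -> ip z y = a x y.
  have [Dx|nDx] := pselect (D x); last by exists 0.
  have [|z Dz zP] := riesz H (ar _ Dx) (_ : bounded_by D ip (A' * nm x) (a x)).
    by move=> y Dy; exact: ab'.
  by exists z.
have [Rz RzP] := choice exR.
pose r := c / A' ^+ 2.
have r0 : 0 < r by rewrite divr_gt0// exprn_gt0.
pose th := Num.sqrt (1 - r * c).
have k0 : 0 < 1 - r * c.
  by rewrite subr_gt0 /r mulrAC ltr_pdivrMr ?exprn_gt0// mul1r -expr2 ltr_pXn2r// nnegrE ltW.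
have thE : th ^+ 2 = 1 - r * c by rewrite sqr_sqrtr// ltW.
have th0 : 0 <= th by exact: sqrtr_ge0.
have th1 : th < 1 by rewrite -[ltRHS]sqrtr1 ltr_sqrt// ltrBlDr ltrDl mulr_gt0.
(* |e - r R e|^2 = |e|^2 - 2 r a(e, e) + r^2 |R e|^2 is at most (1 - 2 r c + r^2 A'^2) |e|^2, and r
   A'^2 = c. *)
have step e : D e -> nm (e - r *: Rz e) <= th * nm e.
  move=> De; have [DRz RzE] := RzP _ De.
  rewrite -(@ler_pXn2r _ 2)// ?nnegrE ?mulr_ge0 ?snorm_ge0//.
  rewrite exprMn thE.
  have -> : e - r *: Rz e = 1 *: e + (- r) *: Rz e by rewrite scale1r scaleNr.
  have Dv : D (1 *: e + (- r) *: Rz e) by apply: (shD H); exact: (shZ H).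
  rewrite (snorm_sqr H Dv).
  rewrite (ip_comb H)// -!(snorm_sqr H)// (ipC H De DRz) RzE//.
  have hO : nm (Rz e) <= A' * nm e.
    have : nm (Rz e) ^+ 2 <= A' * nm e * nm (Rz e).
      by rewrite (snorm_sqr H)// RzE//; apply: le_trans (ler_norm _) (ab' _ _ _ _).
    have := snorm_ge0 ip (Rz e); rewrite le_eqVlt => /orP[/eqP <- _|p].
      by rewrite mulr_ge0 ?snorm_ge0// ltW.
    by rewrite expr2 ler_pM2r.
  have hO2 : nm (Rz e) ^+ 2 <= A' ^+ 2 * nm e ^+ 2.
    by rewrite -exprMn ler_pXn2r ?nnegrE ?mulr_ge0 ?snorm_ge0// ltW.
  have e1 : r ^+ 2 * nm (Rz e) ^+ 2 <= r * c * nm e ^+ 2.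
    apply: le_trans (_ : r ^+ 2 * (A' ^+ 2 * nm e ^+ 2) <= _).
      by apply: ler_wpM2l => //; exact: sqr_ge0.
    rewrite mulrA; suff -> : r ^+ 2 * A' ^+ 2 = r * c by [].
    by rewrite expr2 -mulrA [r * A' ^+ 2]divfK// expf_neq0// gt_eqF.
  have := ler_wpM2l (ltW r0) (ac _ De); nra.
pose l w y := ip w y - r * (a w y - F y).
have ll w : D w -> linear_on D (l w).
  move=> Dw b x y Dx Dy; rewrite /l (ip_linr H)// ar// Fl//; ring.
have lb w : D w -> bounded_by D ip (nm w + r * (A' * nm w + `|B|)) (l w).
  move=> Dw y Dy; rewrite /l; apply: le_trans (ler_normB _ _) _.
  rewrite mulrDl; apply: lerD; first exact: (cauchy_schwarz H).
  rewrite normrM gtr0_norm// -mulrA; apply: ler_wpM2l; first exact: ltW.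
  apply: le_trans (ler_normB _ _) _; rewrite mulrDl; apply: lerD; first exact: ab'.
  apply: le_trans (Fb _ Dy) _; apply: ler_wpM2r; [exact: snorm_ge0|exact: ler_norm].
have exT w : exists t, D w -> C t /\ forall y, C y -> l w (y - t) <= ip t (y - t).
  have [Dw|nDw] := pselect (D w); last by exists 0.
  have [x Cx xP] := minimizer_exists H (ex_intro _ x0 Cx0) CD Cc Ccl (ll _ Dw) (lb _ Dw).
  by exists x.
have [T TP] := choice exT.
have Tc w1 w2 : D w1 -> D w2 -> nm (T w1 - T w2) <= th * nm (w1 - w2).
  move=> D1 D2; have [C1 h1] := TP _ D1; have [C2 h2] := TP _ D2.
  have DT1 := CD _ C1; have DT2 := CD _ C2; have Dd := shB H DT1 DT2.
  have De := shB H D1 D2; have [DRz RzE] := RzP _ De.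
  have := h1 _ C2; rewrite (linB (ll _ D1))// (ipBr H)// => k1.
  have := h2 _ C1; rewrite (linB (ll _ D2))// (ipBr H)// => k2.
  have : nm (T w1 - T w2) ^+ 2 <= nm (w1 - w2 - r *: Rz (w1 - w2)) * nm (T w1 - T w2).
    have Dv : D (w1 - w2 - r *: Rz (w1 - w2)) by apply: (shB H) => //; exact: (shZ H).
    apply: le_trans (le_trans (ler_norm _) (cauchy_schwarz H Dv Dd)).
    rewrite (snorm_sqr H Dd) (ipBl H De (shZ H r DRz) Dd) (ipZl H r DRz Dd) RzE//.
    rewrite (ipBl H D1 D2 Dd) (linB (al _ Dd) D1 D2) (ipBl H DT1 DT2 Dd).
    rewrite !(linB (ar _ _))// !(ipBr H)//.
    move: k1 k2; rewrite /l; have := ipC H DT1 DT2; lra.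
  have := snorm_ge0 ip (T w1 - T w2); rewrite le_eqVlt => /orP[/eqP <- _|p].
    by rewrite mulr_ge0// snorm_ge0.
  by rewrite expr2 ler_pM2r// => /le_trans; apply; exact: step.
pose w n := iter n T x0.
have Cw n : C (w n).
  by elim: n => [//|n ih]; exact: (TP _ (CD _ ih)).1.
have Dw n := CD _ (Cw n).
have DT n : D (T (w n)) := Dw n.+1.
have sn n : nm (w n - T (w n)) <= th ^+ n * nm (x0 - T x0).
  elim: n => [|n ih]; first by rewrite mul1r.
  rewrite exprS -mulrA; apply: le_trans (Tc _ _ (Dw n) (DT n)) _.
  exact: ler_wpM2l.
have sn0 : (fun n => nm (w n - T (w n))) @ \oo --> (0 : R).
  apply: (@squeeze_cvgr _ _ _ _ (fun=> 0) (fun n => th ^+ n * nm (x0 - T x0))).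
  - by apply: nearW => n; rewrite snorm_ge0 sn.
  - exact: cvg_cst.
  - rewrite -[X in _ --> X](mul0r (nm (x0 - T x0))).
    by apply: cvgMl; apply: cvg_expr; rewrite ger0_norm.
have /cvg_to0P sn1 := sn0.
have ww i j : (1 - th) * nm (w i - w j) <= nm (w i - T (w i)) + nm (w j - T (w j)).
  have := snorm_dist H (Dw i) (DT i) (Dw j).
  have := snorm_dist H (DT i) (DT j) (Dw j).
  have := Tc _ _ (Dw i) (Dw j); rewrite (snorm_sub H (DT j))//; lra.
have th2 : 0 < 1 - th by rewrite subr_gt0.
have [|x [Dx wx]] := sh_complete H Dw.
  move=> e e0; have [||n0 hn] := sn1 _ ((1 - th) * e / 2).
  - by move=> m; exact: snorm_ge0.
  - by rewrite divr_gt0// mulr_gt0.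
  exists n0 => i j ni nj; rewrite -[_ <= e](ler_pM2l th2); apply: le_trans (ww i j) _.
  have := hn _ ni; have := hn _ nj; lra.
have Cx : C x.
  apply: Ccl; split=> // e e0; move/cvgrPdist_lt : wx => /(_ _ e0)[n0 _ /(_ n0 (leqnn _))] /=.
  rewrite sub0r normrN ger0_norm ?sqrtr_ge0// => h; exists (w n0); split=> //.
  by rewrite (snorm_sub H).
have [CTx TxP] := TP _ Dx; have DTx := CD _ CTx.
have xTx : nm (x - T x) = 0.
  apply/eqP; rewrite eq_le snorm_ge0 andbT.
  have c2 : (fun n => 2 * nm (w n - x) + nm (w n - T (w n))) @ \oo --> (2 * 0 + 0 : R).
    by apply: cvgD => //; exact: cvgMr.
  rewrite mulr0 addr0 in c2; apply: ler_cvg_to (cvg_cst _) c2 _.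
  apply: nearW => n; have := snorm_dist H Dx (Dw n) DTx.
  have := snorm_dist H (Dw n) (DT n) DTx; have := Tc _ _ (Dw n) Dx.
  have : th * nm (w n - x) <= nm (w n - x) by rewrite ler_piMl ?snorm_ge0// ltW.
  rewrite (snorm_sub H Dx (Dw n)); lra.
(* The limit agrees with [T x] only up to a null vector. Bounded linear forms do not see the
   difference, so the inequality satisfied by [T x] can be rewritten for [x]. *)
have null (g : X -> R) M : linear_on D g -> bounded_by D ip M g -> g x = g (T x).
  move=> gl gb; apply/eqP; rewrite -subr_eq0 -(linB gl)// -normr_le0.
  by apply: le_trans (gb _ (shB H Dx DTx)) _; rewrite xTx mulr0.
exists x => // y Cy; have Dy := CD _ Cy.
have e1 := null _ _ (ip_linr H Dy) (ip_bounded H Dy).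
have e2 := null _ _ (ip_linr H Dx) (ip_bounded H Dx).
have e3 := null _ _ (ip_linr H DTx) (ip_bounded H DTx).
have e4 := null _ _ (ll _ Dx) (lb _ Dx).
have := TxP _ Cy; rewrite (linB (ll _ Dx))// -e4 (ipBr H)// -e3.
rewrite (ipC H DTx Dy) -e1 (ipC H DTx Dx) -e2 /l (linB Fl)// (linB (ar _ Dx))//.
rewrite (ipC H Dy Dx) => h.
have : 0 <= r * (a x y - a x x - (F y - F x)) by lra.
by rewrite pmulr_rge0// subr_ge0.
Qed.

End lions_stampacchia.

(** * A substitute for weak compactness *)

Section weak_limits.
Context {R : realType} {X : lmodType R} (D : X -> Prop) (ip : X -> X -> R).
Hypothesis H : semiHilbert D ip.
Local Notation nm := (snorm ip).

(* The elements of least norm among those with [g <= 1 / k] form a Cauchy sequence. *)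
Lemma bounded_adherent (C : X -> Prop) (g : X -> R) (M : R) :
  (forall x, C x -> D x) -> convex_pred C ->
  (forall x y, D x -> D y -> g (x + 2^-1 *: (y - x)) <= (g x + g y) / 2) ->
  (forall x y, D x -> D y -> g x <= g y + nm (x - y)) ->
  (forall e, 0 < e -> exists x, [/\ C x, nm x <= M & g x <= e]) ->
  exists2 x, adherent D ip C x & g x <= 0.
Proof.
move=> CD Cc gc gl ex.
pose i k : R := k.+1%:R^-1.
have i0 k : 0 < i k by rewrite /i invr_gt0.
have imono k l : (k <= l)%N -> i l <= i k by move=> kl; rewrite lef_pV2 ?posrE// ler_nat.
(* The least squared norm [d k] at level [i k] increases with [k] and is bounded by [M ^+ 2]. The
   midpoint of two near-minimisers stays in the sublevel set, so the parallelogram identity makes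
   them close once [d k] is near its supremum. *)
pose S k := [set nm x ^+ 2 | x in [set x | C x /\ g x <= i k]].
have Sinf k : has_inf (S k).
  split; first by have [x [Cx _ gx]] := ex _ (i0 k); exists (nm x ^+ 2), x.
  by exists 0 => _ [x _ <-]; exact: sqr_ge0.
pose d k := inf (S k).
have dub k : d k <= M ^+ 2.
  have [x [Cx Mx gx]] := ex _ (i0 k); apply: le_trans (_ : nm x ^+ 2 <= _).
    by apply: ge_inf; [exact: (Sinf k).2|exists x].
  by have := snorm_ge0 ip x => ?; rewrite ler_pXn2r ?nnegrE// (le_trans _ Mx).
have cP k : exists x, [/\ C x, g x <= i k & nm x ^+ 2 < d k + i k].
  by have [_ [x [Cx gx] <-] h] := inf_adherent (i0 k) (Sinf k); exists x.
have [c cP'] := choice cP.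
have Cc' k : C (c k) by case: (cP' k). have Dc k := CD _ (Cc' k).
have supd : has_sup (range d).
  by split; [exists (d 0%N), 0%N|exists (M ^+ 2) => _ [k _ <-]].
have dle k : d k <= sup (range d) by apply: ub_le_sup; [exact: supd.2|exists k].
have cc k0 k l : (k0 <= k)%N -> (k0 <= l)%N ->
    nm (c k - c l) ^+ 2 <= 4 * (sup (range d) - d k0) + 4 * i k0.
  move=> kk ll; have [_ gk nk] := cP' k; have [_ gl' nl] := cP' l.
  have : d k0 <= nm (c k + 2^-1 *: (c l - c k)) ^+ 2.
    apply: ge_inf; first exact: (Sinf k0).2.
    exists (c k + 2^-1 *: (c l - c k)) => //; split; first by apply: Cc => //; lra.
    apply: le_trans (gc _ _ (Dc k) (Dc l)) _.
    have := imono _ _ kk; have := imono _ _ ll; lra.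
  have -> : c k + 2^-1 *: (c l - c k) = 2^-1 *: c k + 2^-1 *: c l.
    rewrite scalerBr addrCA addrC; congr (_ + _); rewrite -{1}[c k]scale1r -scalerBl.
    by congr (_ *: _); lra.
  have -> : c k - c l = 1 *: c k + (-1) *: c l by rewrite scale1r scaleN1r.
  have D1 : D (2^-1 *: c k + 2^-1 *: c l) by apply: (shD H); exact: (shZ H).
  have D2 : D (1 *: c k + (-1) *: c l) by apply: (shD H); exact: (shZ H).
  rewrite (snorm_sqr H D1) (snorm_sqr H D2) !(ip_comb H)// -!(snorm_sqr H)//.
  have := dle k; have := dle l; have := imono _ _ kk; have := imono _ _ ll; lra.
have [|x [Dx cx]] := sh_complete H Dc.
  move=> e e0; have d0 : 0 < e ^+ 2 / 8 by rewrite divr_gt0// exprn_gt0.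
  have [n0 n0P] := small_invn d0.
  have [_ [k _ <-] hk] := sup_adherent d0 supd.
  have dmono a b : (a <= b)%N -> d a <= d b.
    move=> ab; apply: lb_le_inf => [|_ [y [Cy gy] <-]]; first exact: (Sinf b).1.
    by apply: ge_inf; [exact: (Sinf a).2|exists y; split=> //; apply: le_trans gy _; exact: imono].
  exists (maxn n0 k) => a b na nb; rewrite -(@ler_pXn2r _ 2)// ?nnegrE ?sqrtr_ge0 ?(ltW e0)//.
  apply: le_trans (cc _ _ _ na nb) _.
  have := dmono _ _ (leq_maxr n0 k); have := n0P _ (leq_maxl n0 k); rewrite -/(i _); lra.
have cx0 := (cvg_to0P (fun m => snorm_ge0 ip (c m - x))).1 cx.
exists x.
  split=> // e e0; have e2 : 0 < e / 2 by lra.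
  have [n0 hn] := cx0 _ e2; exists (c n0); split=> //; rewrite (snorm_sub H)//.
  by apply: le_lt_trans (hn _ (leqnn _)) _; lra.
apply/ler_addgt0Pl => e e0; rewrite addr0.
have e2 : 0 < e / 2 by lra.
have [n0 hn] := cx0 _ e2.
have [n1 h1] := small_invn e2; pose k := maxn n0 n1; have := gl _ _ Dx (Dc k).
rewrite (snorm_sub H Dx (Dc k)).
have := hn _ (leq_maxl n0 n1); have := h1 _ (leq_maxr n0 n1); rewrite -/(i _) -/k.
have [_ gk _] := cP' k; rewrite /snorm; lra.
Qed.

End weak_limits.

(* A linear relation between finitely many coordinates and a seminormed space
   has a closed range as soon as zero coordinates only give null vectors. *)
Section finite_dimensional_relation.
Context {R : realType} {I : eqType} {Q : lmodType R} (P : Q -> R -> Prop).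
Hypothesis PZ : forall a q t, P q t -> P (a *: q) (`|a| * t).
Hypothesis PD : forall q q' t t', P q t -> P q' t' -> P (q + q') (t + t').
Hypothesis Pge0 : forall q t, P q t -> 0 <= t.
Hypothesis Ple : forall q t t', t <= t' -> P q t -> P q t'.

Lemma lin_funE a (c c' : I -> R) i : (a *: c + c') i = a * c i + c' i.
Proof. by []. Qed.

Definition null_vector q := forall t, 0 < t -> P q t.

Lemma null_vectorZ a q : null_vector q -> null_vector (a *: q).
Proof.
move=> nq t t0; have a1 : 0 < `|a| + 1 by rewrite ltr_wpDl.
have /(PZ a) := nq _ (divr_gt0 t0 a1); apply: Ple.
by rewrite mulrA ler_pdivrMr// mulrC ler_wpM2l ?(ltW t0)// lerDl.
Qed.

(** [P q t] stands for: the seminorm of [q] is at most [t]. The proof is by induction on the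
    coordinates that may be nonzero. If some related [e] has coordinate 1 at [i], subtracting
    multiples of [e] kills this coordinate. Either [e] is a limit of vectors with coordinate 0 at
    [i], and can be traded for one of them, or it stays at a distance [d] from them, and then the
    coordinate at [i] converges along the approximations of [q]. *)
Lemma finite_relation_closed (s : seq I) (Rel : (I -> R) -> Q -> Prop) (q : Q) :
  (forall a c q c' q', Rel c q -> Rel c' q' -> Rel (a *: c + c') (a *: q + q')) ->
  (forall c q, Rel c q -> exists t, P q t) ->
  (forall c q i, Rel c q -> i \notin s -> c i = 0) ->
  (forall c q, Rel c q -> (forall i, c i = 0) -> null_vector q) ->
  (forall t, 0 < t -> exists c q', Rel c q' /\ P (q - q') t) ->
  exists c q', Rel c q' /\ null_vector (q - q').
Proof.
elim: s Rel q => [|i s IH] Rel q RL Rb Rs Rn Rq.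
  have [c [q1 [Rc1 P1]]] := Rq _ ltr01.
  exists c, q1; split=> // t t0; have t2 : 0 < t / 2 by lra.
  have [c' [q' [Rc P']]] := Rq _ t2.
  have n1 := Rn _ _ Rc1 (fun i => Rs _ _ i Rc1 isT).
  have n' := Rn _ _ Rc (fun i => Rs _ _ i Rc isT).
  have := RL (-1) _ _ _ _ Rc1 Rc; rewrite !scaleN1r => Rd.
  have nd := Rn _ _ Rd (fun i => Rs _ _ i Rd isT).
  have := PD P' (nd _ t2); rewrite -splitr; congr P.
  by rewrite [-q1 + _]addrC addrA subrK.
pose Rel0 c q := Rel c q /\ c i = 0.
have IH0 q0 : (forall t, 0 < t -> exists c q', Rel0 c q' /\ P (q0 - q') t) ->
    exists c q', Rel0 c q' /\ null_vector (q0 - q').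
  apply: IH.
  - move=> a c1 q1 c2 q2 [R1 z1] [R2 z2]; split; first exact: RL.
    by rewrite lin_funE z1 z2 mulr0 addr0.
  - by move=> c q1 [/Rb].
  - move=> c q1 j [Rc z] js; have [->//|ji] := eqVneq j i.
    by apply: (Rs _ _ _ Rc); rewrite inE negb_or ji.
  - by move=> c q1 [Rc _]; exact: Rn.
have [[c0 [e [Re c01]]]|nR] := pselect (exists c e, Rel c e /\ c i = 1); last first.
  have z c q' : Rel c q' -> c i = 0.
    move=> Rc; apply/eqP/negPn/negP => ci0; apply: nR.
    have R0 : Rel 0 0.
      by have := RL (-1) _ _ _ _ Rc Rc; rewrite !scaleN1r !addNr.
    exists ((c i)^-1 *: c), ((c i)^-1 *: q'); split.
      by rewrite -[_ *: c]addr0 -[_ *: q']addr0; exact: RL.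
    by rewrite -[_ *: c]addr0 lin_funE mulVf// addr0.
  have [|c [q' [[Rc _] n]]] := IH0 q; last by exists c, q'.
  move=> t /Rq [c [q' [Rc Pq]]]; exists c, q'; split=> //; split=> //; exact: z Rc.
have split_e c q' : Rel c q' -> Rel0 (- c i *: c0 + c) (- c i *: e + q').
  by move=> Rc; split; [exact: RL|rewrite lin_funE c01 mulr1 addNr].
have [far|near_e] := pselect (exists d, 0 < d /\ forall c y, Rel0 c y -> ~ P (e - y) d); last first.
  have [|c1 [y [[Ry zy] ny]]] := IH0 e.
    move=> t t0; apply: contrapT => h; apply: near_e; exists t; split=> // c y R0 Py.
    by apply: h; exists c, y.
  have [|c [q' [[Rc _] n]]] := IH0 q; last by exists c, q'.
  move=> t t0; have t2 : 0 < t / 2 by lra.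
  have [c [q' [Rc Pq]]] := Rq _ t2.
  have [R1 z1] := split_e _ _ Rc.
  exists (c i *: c1 + (- c i *: c0 + c)), (c i *: y + (- c i *: e + q')); split.
    split; first exact: RL.
    by rewrite lin_funE z1 zy mulr0 addr0.
  have := PD Pq (null_vectorZ (c i) ny t2); rewrite -splitr; congr P.
  rewrite scalerBr scaleNr !opprD !opprK -!addrA; congr (_ + _).
  by rewrite [in RHS]addrA [RHS]addrC; congr (_ + _); exact: addrC.
have [d [d0 hd]] := far.
(* Otherwise the difference of the two approximations, divided by the difference of their
   coordinates, would bring [e] within [d] of a vector with coordinate 0. *)
have diff c q1 t c' q1' t' : Rel c q1 -> P (q - q1) t -> Rel c' q1' -> P (q - q1') t' ->
    c i - t / d <= c' i + t' / d.
  move=> R1 P1 R2 P2; rewrite leNgt; apply/negP => lt.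
  have t0 := Pge0 P1; have t0' := Pge0 P2.
  pose l := c i - c' i.
  have tt : (t + t') / d < l by rewrite mulrDl /l; lra.
  have l0 : 0 < l by apply: le_lt_trans tt; rewrite divr_ge0 ?addr_ge0// ltW.
  pose y := e - l^-1 *: (q1 - q1').
  have R0 : Rel0 (c0 - l^-1 *: (c - c')) y.
    split; last first.
      rewrite (_ : _ i = c0 i - l^-1 * (c i - c' i))// c01 mulVf ?subrr//.
      by rewrite gt_eqF.
    have R3 := RL (-1) _ _ _ _ R2 R1; have := RL (- l^-1) _ _ _ _ R3 Re.
    by rewrite /y !scaleN1r !scaleNr ![- _ + e]addrC ![- _ + c0]addrC
      ![- _ + q1]addrC ![- _ + c]addrC.
  apply: (hd _ _ R0); rewrite /y opprB addrC subrK.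
  have -> : q1 - q1' = (q - q1') + (-1) *: (q - q1).
    by rewrite scaleN1r opprB [RHS]addrC addrA subrK.
  have := PZ l^-1 (PD P2 (PZ (-1) P1)); apply: Ple.
  rewrite normrN normr1 mul1r gtr0_norm ?invr_gt0// mulrC ler_pdivrMr// mulrC.
  by rewrite addrC -ler_pdivrMr// ltW.
(* An approximation with error [t] confines the limit coordinate to the interval of radius t / d
   around [c i]. By [diff] no left end exceeds a right end, so the supremum of the left ends lies in
   all these intervals. *)
pose A := [set r | exists c q1 t, [/\ Rel c q1, P (q - q1) t & r = c i - t / d]].
have As : has_sup A.
  split.
    by have [c [q1 [Rc Pc]]] := Rq _ ltr01; exists (c i - 1 / d), c, q1, 1.
  have [c [q1 [Rc Pc]]] := Rq _ ltr01; exists (c i + 1 / d).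
  by move=> _ [c' [q' [t [R' P' ->]]]]; exact: (diff _ _ _ _ _ _ R' P' Rc Pc).
pose l := sup A.
have lP c q1 t : Rel c q1 -> P (q - q1) t -> `|c i - l| <= t / d.
  move=> Rc Pc; rewrite ler_norml; apply/andP; split.
    suff : l <= c i + t / d by lra.
    apply: ge_sup; first exact: As.1.
    by move=> _ [c' [q' [t' [R' P' ->]]]]; exact: (diff _ _ _ _ _ _ R' P' Rc Pc).
  suff : c i - t / d <= l by lra.
  by apply: ub_le_sup; [exact: As.2|exists c, q1, t].
have [T eT] := Rb _ _ Re.
have T0 := Pge0 eT.
have [|c [y [[Rc z] ny]]] := IH0 (q - l *: e).
  (* An error t / K on [q] causes an error t / (K d) on the coordinate, which is multiplied by the
     size [T] of [e]; the two contributions add up to [t]. *)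
  move=> t t0; pose K := 1 + T / d.
  have K0 : 0 < K by rewrite ltr_pwDl// divr_ge0// ltW.
  have [c [q1 [Rc Pc]]] := Rq _ (divr_gt0 t0 K0).
  exists (- c i *: c0 + c), (- c i *: e + q1); split; first exact: split_e.
  have -> : q - l *: e - (- c i *: e + q1) = (q - q1) + (c i - l) *: e.
    rewrite scalerBl scaleNr opprD opprK [_ *: e - q1]addrC addrACA.
    by congr (_ + _); rewrite addrC.
  have := PD Pc (PZ (c i - l) eT); apply: Ple.
  have := lP _ _ _ Rc Pc => h.
  apply: le_trans (_ : t / K + t / K / d * T <= _).
    by rewrite lerD2l; exact: ler_wpM2r.
  have E : t / K * (1 + T / d) = t by exact: divfK (lt0r_neq0 K0) t.
  by rewrite -[leRHS]E mulrDr mulr1 mulrA [t / K * T / d]mulrAC.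
exists (l *: c0 + c), (l *: e + y); split; first exact: RL.
by move: ny; rewrite opprD addrA.
Qed.

End finite_dimensional_relation.

(** * Lebesgue measure on row vectors *)

Section row_vectors.
Context {R : realType} {n : nat}.
Implicit Types (x y : 'rV[R]_n) (e : R).

Lemma rV_ballP x y e : 0 < e ->
  ball x e y <-> forall j, `|x ord0 j - y ord0 j| < e.
Proof.
move=> e0; split=> [[_ h] j|h]; first exact: h.
by split=> // i j; rewrite !ord1; exact: h.
Qed.

Lemma rV_normP x e : 0 <= e -> `|x| <= e <-> forall j, `|x ord0 j| <= e.
Proof.
move=> e0; rewrite /Num.norm /= mx_normrE; split=> [/bigmax_leP[_ h] j|h].
  exact: (h (ord0, j) isT).
by apply/bigmax_leP; split=> // -[i j] _ /=; rewrite ord1; exact: h.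
Qed.

Lemma rV_coord_norm x j : `|x ord0 j| <= `|x|.
Proof. exact: ((rV_normP x (normr_ge0 x)).1 (lexx _) j). Qed.

(** The sigma-algebra is generated by the coordinates, so an open set is written as the union of the
    countably many cubes inside it with rational centres and radii 1 / (k + 1). *)
Lemma rV_open_measurable (A : set 'rV[R]_n) : open A -> measurable A.
Proof.
move=> oA.
pose B (q : 'rV[rat]_n * nat) : set 'rV[R]_n :=
  [set x | forall j, `|ratr (q.1 ord0 j) - x ord0 j| < q.2.+1%:R^-1].
pose C q := if pselect (B q `<=` A) then B q else set0.
have mB q : measurable (B q).
  have -> : B q = \bigcap_(j in [set: 'I_n])
      ((fun x : 'rV[R]_n => x ord0 j : measurableTypeR R) @^-1`
        (ball (ratr (q.1 ord0 j) : R) q.2.+1%:R^-1)).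
    by apply/seteqP; split=> [x Bx j _|x Bx j]; [exact: Bx|exact: (Bx j)].
  apply: fin_bigcap_measurable; first exact: finite_finset.
  move=> j _; rewrite -[X in measurable X]setTI; apply: measurable_coord => //.
  by apply: open_measurable; apply: ball_open; rewrite invr_gt0.
have -> : A = \bigcup_q C q.
  apply/seteqP; split=> [x Ax|x [q _]]; last first.
    by rewrite /C; case: pselect => // h /h.
  have /nbhs_ballP[e /= e0 eA] := open_nbhs_nbhs (conj oA Ax).
  have e2 : 0 < e / 2 by rewrite divr_gt0.
  have [k hk] : exists k, (k.+1%:R^-1 : R) <= e / 2.
    by have [k h] := small_invn e2; exists k; exact: h.
  have k0 : 0 < k.+1%:R^-1 :> R by rewrite invr_gt0.
  have [p pE] : exists p : R, p = k.+1%:R^-1 by eexists.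
  rewrite -pE in hk k0.
  have exq (j : 'I_n) : exists r : rat, `|ratr r - x ord0 j| < p.
    have [r] := @rat_in_itvoo R (x ord0 j - p) (x ord0 j + p) ltac:(lra).
    rewrite in_itv /= => /andP[h1 h2]; exists r; rewrite ltr_norml; lra.
  have [r rP] := choice exq.
  have Bx : B (\row_j r j, k) x by move=> j; rewrite /= mxE -pE.
  exists (\row_j r j, k) => //; rewrite /C; case: pselect => // -[] y By.
  apply: eA; apply/rV_ballP => // j.
  have := By j; have := Bx j; rewrite /= !mxE -pE !ltr_norml; lra.
apply: countable_bigcupT_measurable; first exact: countableP.
by move=> q; rewrite /C; case: pselect => h; [exact: mB|exact: measurable0].
Qed.

Lemma rV_closed_measurable (A : set 'rV[R]_n) : closed A -> measurable A.
Proof.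
move=> cA; rewrite -[A]setCK; apply: measurableC; apply: rV_open_measurable.
exact: closed_openC.
Qed.

Lemma rV_continuous_measurable (f : 'rV[R]_n -> R) : continuous f ->
  measurable_fun setT f.
Proof.
move=> cf; apply: (measurability _ (RGenOpens.measurableE R)) => _ [_ [a [b ->] <-]].
rewrite setTI; apply: rV_open_measurable.
by apply: open_comp => [x _|]; [exact: cf|exact: interval_open].
Qed.

Lemma rV_box_measurable (a b : R) :
  measurable [set x : 'rV[R]_n | forall j, a <= x ord0 j <= b].
Proof.
apply: rV_closed_measurable.
rewrite (_ : mkset _ = \bigcap_(j in [set: 'I_n]) ((fun x : 'rV[R]_n => x ord0 j) @^-1` `[a, b])).
  apply: closed_bigI => j _; apply: closed_comp; last exact: interval_closed.
  by move=> x _; exact: coord_continuous.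
apply/seteqP; split=> [x h j _|x h j] /=; first by rewrite in_itv /=; exact: h.
by have := h j I; rewrite /= in_itv.
Qed.

Lemma measurable_dotp (a : 'rV[R]_n) : measurable_fun setT (fun x => dotp a x).
Proof.
rewrite /dotp; apply: measurable_sum => j; apply: measurable_funM => //.
exact: measurable_coord.
Qed.

End row_vectors.

Section lebesgue_rV.
Context {R : realType}.
Local Notation leb n := (@lebesgue_rV R n).

Lemma lebesgue_rVS n (A : set 'rV[R]_n.+1) :
  leb n.+1 A = (@lebesgue_measure R \x leb n)%E (@rV_cons R n @^-1` A).
Proof. by []. Qed.

Lemma lebesgue_rV_box_lty n (a b : R) :
  (leb n [set x : 'rV[R]_n | forall j, (a <= x ord0 j <= b)%R] < +oo)%E.
Proof.
elim: n => [|n ih].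
  by rewrite /= diracE; case: (_ \in _); rewrite ltry.
rewrite lebesgue_rVS.
rewrite (_ : _ @^-1` _ = `[a, b] `*` [set x : 'rV[R]_n | forall j, a <= x ord0 j <= b]).
  rewrite product_measure1E//; last exact: rV_box_measurable.
  have lt : (@lebesgue_measure R `[a, b]%classic < +oo)%E.
    by rewrite lebesgue_measure_itv /=; case: ifP => _; rewrite ?ltry// -EFinB ltry.
  by apply: lte_mul_pinfty => //; rewrite ge0_fin_numE.
apply/seteqP; split=> [[x y] h|[x y] [/= h1 h2] j].
  split=> /=; first by have := h ord0; rewrite mxE unlift_none /= in_itv.
  by move=> j; have := h (lift ord0 j); rewrite mxE liftK.
rewrite mxE; case: unliftP => [k _|_] /=; [exact: h2|by move: h1; rewrite in_itv].
Qed.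

Lemma lebesgue_rV_bounded_lty n (A : set 'rV[R]_n) : measurable A ->
  bounded_set A -> (leb n A < +oo)%E.
Proof.
move=> mA [M [_ hM]].
apply: le_lt_trans (lebesgue_rV_box_lty n (- (M + 1)) (M + 1)).
apply: le_measure; rewrite ?inE//; first exact: rV_box_measurable.
move=> x Ax j; rewrite -ler_norml.
by apply: le_trans (rV_coord_norm x j) (hM _ _ _ Ax); rewrite ltrDl.
Qed.

(** Fubini on the first coordinate: if the rest [a'] of the normal vanishes, the set is a point
    times the whole space; otherwise each of its sections is a hyperplane of lower dimension. *)
Lemma lebesgue_rV_hyperplane n (a : 'rV[R]_n) (c : R) : a != 0 ->
  leb n [set x | dotp a x = c] = 0%E.
Proof.
elim: n a c => [|n ih] a c a0.
  by rewrite (_ : a = 0) ?eqxx// in a0; apply/rowP; case.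
pose a' := \row_j a ord0 (lift ord0 j).
have dE (x : R) y : dotp a (rV_cons (x, y)) = a ord0 ord0 * x + dotp a' y.
  rewrite /dotp big_ord_recl mxE unlift_none; congr (_ + _).
  by apply: eq_bigr => j _; rewrite !mxE liftK.
have mH m (b : 'rV[R]_m) : measurable [set x | dotp b x = c].
  rewrite (_ : mkset _ = (fun x => dotp b x) @^-1` [set c])// -[X in measurable X]setTI.
  exact: measurable_dotp.
rewrite lebesgue_rVS; have [a'0|a'0] := eqVneq a' 0.
  have a00 : a ord0 ord0 != 0.
    apply: contra a0 => /eqP z; apply/eqP/rowP => j; rewrite mxE.
    case: (unliftP ord0 j) => [k ->|->//].
    by have /rowP/(_ k) := a'0; rewrite !mxE.
  rewrite (_ : _ @^-1` _ = [set c / a ord0 ord0] `*` setT).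
    rewrite product_measure1E//; last first.
    have z : @lebesgue_measure R [set c / a ord0 ord0] = 0%E by exact: lebesgue_measure_set1.
    by rewrite [X in (X * _)%E]z mul0e.
  have d0 (y : 'rV[R]_n) : dotp a' y = 0.
    by rewrite a'0 /dotp big1// => i _; rewrite mxE mul0r.
  apply/seteqP; split=> [[x y] /=|[x y] [/= -> _]]; rewrite dE d0 addr0.
    by move=> <-; split=> //; rewrite mulrAC divff// mul1r.
  by rewrite mulrC divfK.
rewrite /product_measure1 integral0_eq// => x _ /=.
rewrite (_ : xsection _ _ = [set y | dotp a' y = c - a ord0 ord0 * x]) ?ih//.
apply/seteqP; split=> y; rewrite /xsection /= inE /= dE.
  by move=> <-; rewrite addrAC subrr add0r.
by move=> ->; rewrite addrCA subrr addr0.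
Qed.

End lebesgue_rV.

(** * The space of square integrable functions *)

Lemma geometric_sum_le {R : realType} (z : R) m : 0 <= z -> z < 1 ->
  \sum_(0 <= k < m) z ^+ k <= (1 - z)^-1.
Proof.
move=> z0 z1; have h : 0 < 1 - z by rewrite subr_gt0.
rewrite -[leRHS]mul1r ler_pdivlMr// mulrC big_mkord -opprB mulNr -subrX1 opprB.
by rewrite gerBl exprn_ge0.
Qed.

Lemma nneseries_le {R : realType} (f : nat -> \bar R) (B : \bar R) :
  (forall k, 0 <= f k)%E -> (forall m, \sum_(0 <= k < m) f k <= B)%E ->
  (\sum_(0 <= k <oo) f k <= B)%E.
Proof.
move=> f0 fB; apply: lime_le; first by apply: is_cvg_nneseries => k _ _; exact: f0.
by apply: nearW => m; exact: fB.
Qed.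

Lemma limn_einf_le {R : realType} (f : nat -> \bar R) (B : \bar R) m :
  (forall k, (m <= k)%N -> f k <= B)%E -> (limn_einf f <= B)%E.
Proof.
move=> fB; rewrite limn_einf_lim; apply: lime_le; first exact: is_cvg_einfs.
exists m => // k /= mk; apply: le_trans (fB _ mk).
by apply: ereal_inf_lbound; exists k => /=.
Qed.

Section square_integrable.
Context {R : realType} {d : nat}.
Local Notation E := 'rV[R]_d.
Local Notation leb := (@lebesgue_rV R d).
Variable w : set E.
Hypothesis mw : measurable w.
Implicit Types f g h : E -> R.

Lemma L2_0 : L2 w 0.
Proof.
split; first exact: measurable_cst.
rewrite (_ : _ \o _ = cst 0%E); first exact: integrable0.
by apply/funext => x /=; rewrite expr0n.
Qed.

Lemma L2_lin a f g : L2 w f -> L2 w g -> L2 w (a *: f + g).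
Proof.
move=> [mf f2] [mg g2].
have m : measurable_fun w (a *: f + g).
  by apply: measurable_funD => //; apply: measurable_funM => //; exact: measurable_cst.
split=> //.
have i : leb.-integrable w (EFin \o (fun x => 2 * a ^+ 2 * f x ^+ 2 + 2 * g x ^+ 2)).
  have i1 := integrableZl mw (2 * a ^+ 2) f2; have i2 := integrableZl mw 2 g2.
  by apply: eq_integrable (integrableD mw i1 i2) => // x _ /=; rewrite -!EFinM -EFinD.
apply: le_integrable i => //.
  by apply/measurable_EFinP; apply: measurable_funX.
move=> x wx /=; rewrite lee_fin ger0_norm ?sqr_ge0// ger0_norm; last first.
  by rewrite addr_ge0// mulr_ge0 ?sqr_ge0// mulr_ge0 ?sqr_ge0.
have := sqr_ge0 (a * f x - g x); rewrite [(a *: f + g) x](_ : _ = a * f x + g x)//; nra.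
Qed.

Lemma L2_mul_integrable f g : L2 w f -> L2 w g ->
  leb.-integrable w (EFin \o (fun x => f x * g x)).
Proof.
move=> [mf f2] [mg g2].
have i : leb.-integrable w (EFin \o (fun x => f x ^+ 2 + g x ^+ 2)).
  by apply: eq_integrable (integrableD mw f2 g2) => // x _ /=; rewrite -EFinD.
apply: le_integrable i => //; first exact/measurable_EFinP/measurable_funM.
move=> x wx /=; rewrite lee_fin [leRHS]ger0_norm ?addr_ge0 ?sqr_ge0// normrM.
have := sqr_ge0 (`|f x| - `|g x|); have := sqr_ge0 (`|f x| + `|g x|).
by rewrite -[f x ^+ 2]real_normK ?num_real// -[g x ^+ 2]real_normK ?num_real//; nra.
Qed.

Lemma ip_sqr f : L2 w f -> (ip w f f)%:E = (\int[leb]_(x in w) (f x ^+ 2)%:E)%E.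
Proof.
move=> Lf; rewrite /ip /Rintegral fineK; first by apply: eq_integral => x _; rewrite expr2.
by apply: integrable_fin_num => //; exact: L2_mul_integrable.
Qed.

Lemma L2_bounded f g : measurable_fun w f -> measurable_fun w g ->
  (forall x, w x -> `|f x| <= `|g x|) -> L2 w g -> L2 w f.
Proof.
move=> mf mg fg [_ ig]; split=> //; apply: le_integrable ig => //.
  by apply/measurable_EFinP; exact: measurable_funX.
by move=> x wx /=; rewrite lee_fin !normrX ler_pXn2r ?nnegrE//; exact: fg.
Qed.

Let L2B f g : L2 w f -> L2 w g -> L2 w (f - g).
Proof. by move=> Lf Lg; rewrite addrC -scaleN1r; exact: L2_lin. Qed.

Let ip_posL f : L2 w f -> 0 <= ip w f f.
Proof. by move=> _; apply: Rintegral_ge0 => x _; rewrite -expr2 sqr_ge0. Qed.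

Lemma L2_norm_le f (e : R) : L2 w f -> 0 <= e -> Num.sqrt (ip w f f) <= e ->
  (\int[leb]_(x in w) (f x ^+ 2)%:E <= (e ^+ 2)%:E)%E.
Proof.
move=> Lf e0; rewrite -ip_sqr// lee_fin => h.
by rewrite -(sqr_sqrtr (ip_posL Lf)) ler_pXn2r ?nnegrE ?sqrtr_ge0.
Qed.

Section completeness.
Variable u : nat -> E -> R.
Hypothesis uL : forall m, L2 w (u m).
Hypothesis du : forall m k, (m <= k)%N ->
  (\int[leb]_(x in w) ((u k x - u m x) ^+ 2)%:E <= ((8^-1) ^+ m)%:E)%E.

(** The weights 2^m keep the series integrable, its m-th term having integral at most 4^-m, while
    finiteness of the sum at a point forces the increments of [u] to be absolutely summable
    there. *)
Let S x : \bar R := (\sum_(0 <= m <oo) (2 ^+ m * (u m.+1 x - u m x) ^+ 2)%:E)%E.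
Let mterm m : measurable_fun w (fun x => (2 ^+ m * (u m.+1 x - u m x) ^+ 2)%:E).
Proof.
apply/measurable_EFinP; apply: measurable_funM; first exact: measurable_cst.
by apply: measurable_funX; apply: measurable_funB; [case: (uL m.+1)|case: (uL m)].
Qed.
Let term0 m x : (0 <= (2 ^+ m * (u m.+1 x - u m x) ^+ 2)%:E)%E.
Proof. by rewrite lee_fin mulr_ge0 ?sqr_ge0// exprn_ge0. Qed.
Let S0 x : (0 <= S x)%E. Proof. exact: nneseries_ge0. Qed.
Let mS : measurable_fun w S.
Proof. by apply: ge0_emeasurable_sum. Qed.

Let iS : leb.-integrable w S.
Proof.
apply/integrableP; split=> //.
under eq_integral do rewrite gee0_abs//.
rewrite /S integral_nneseries//.
apply: (@le_lt_trans _ _ (\sum_(0 <= m <oo) ((4^-1) ^+ m)%:E : \bar R)%E).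
  apply: lee_nneseries => [m _ _|m _]; first by apply: integral_ge0 => x _; exact: term0.
  under eq_integral do rewrite EFinM.
  have mm : measurable_fun w (fun x => ((u m.+1 x - u m x) ^+ 2)%:E).
    by apply/measurable_EFinP/measurable_funX/measurable_funB; [case: (uL m.+1)|case: (uL m)].
  have mm0 x : w x -> (0 <= ((u m.+1 x - u m x) ^+ 2)%:E)%E by rewrite lee_fin sqr_ge0.
  rewrite (ge0_integralZl_EFin leb mw mm0 mm) ?exprn_ge0//.
  apply: (@le_trans _ _ ((2 ^+ m)%:E * ((8^-1) ^+ m)%:E)%E).
    by rewrite lee_pmul2l ?lte_fin ?exprn_gt0//; exact: du.
  rewrite -EFinM lee_fin -exprMn (_ : 2 * 8^-1 = 4^-1)//; lra.
apply: le_lt_trans (nneseries_le (B := ((1 - 4^-1 : R)^-1)%:E) _ _) (ltry _).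
  by move=> k; rewrite lee_fin exprn_ge0.
by move=> m; rewrite sumEFin lee_fin geometric_sum_le//; lra.
Qed.

Let G := w `&` [set x | (S x < +oo)%E].
Let mG : measurable G.
Proof. by apply: emeasurable_fun_lt. Qed.

Let nG : {ae leb, forall x, w x -> G x}.
Proof.
apply: filterS (integrable_ae mw iS) => x h wx; split=> //.
by rewrite /= -ge0_fin_numE//; exact: h.
Qed.

Let cvG x : G x -> cvgn (u ^~ x).
Proof.
move=> [wx Sx].
have -> : u ^~ x = (fun m => u 0%N x + series (fun k => u k.+1 x - u k x) m).
  by apply/funext => m; rewrite /series /= telescope_sumr// addrC subrK.
apply: is_cvgD; first exact: is_cvg_cst.
apply: normed_cvg.
apply: (@nondecreasing_is_cvgn _ [normed series _]).
  by apply: nondecreasing_series => k _ _; rewrite normr_ge0.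
exists (2 + fine (S x)) => _ [m _ <-]; rewrite /series /=.
(* Termwise |a| <= 2^-k + 2^k a^2, by completing the square, and both sums are bounded. *)
apply: (@le_trans _ _ (\sum_(0 <= k < m) (2^-1 ^+ k + 2 ^+ k * (u k.+1 x - u k x) ^+ 2))).
  apply: ler_sum => k _; set a := (X in `|X|).
  have k0 : 0 < 2 ^+ k :> R by rewrite exprn_gt0.
  rewrite -real_normK ?num_real// exprVn -subr_ge0.
  rewrite (_ : _ - _ = (2 ^+ k)^-1 * ((2 ^+ k * `|a| - 2^-1) ^+ 2 + 3 / 4)); last first.
    by field; rewrite gt_eqF.
  by rewrite mulr_ge0 ?invr_ge0 ?(ltW k0)// addr_ge0 ?sqr_ge0//; lra.
rewrite big_split /=; apply: lerD.
  have := @geometric_sum_le R 2^-1 m; rewrite (_ : (1 - 2^-1)^-1 = 2); last by field.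
  by apply; lra.
rewrite -lee_fin fineK ?ge0_fin_numE// -sumEFin.
exact: nneseries_lim_ge.
Qed.

(** The second clause is Fatou's lemma: the limit is no farther from [g] than all late terms are.
    Taking for [g] a term of the sequence yields both membership in L^2 and convergence. *)
Lemma L2_complete_fast : exists2 v, L2 w v & forall g m (e : R), L2 w g ->
   (forall k, (m <= k)%N -> (\int[leb]_(x in w) ((u k x - g x) ^+ 2)%:E <= e%:E)%E) ->
   (\int[leb]_(x in w) ((v x - g x) ^+ 2)%:E <= e%:E)%E.
Proof.
(* Off the set [G], which has full measure in [w], the terms are replaced by 0, so that [v] is a
   limit everywhere and hence measurable. *)
pose v x := limn (fun k => (u k \_ G) x).
have uG k x : G x -> (u k \_ G) x = u k x by move=> Gx; rewrite patchT// inE.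
have uGn k x : ~ G x -> (u k \_ G) x = 0 by move=> Gx; rewrite patchN// notin_setE.
have cv x : (fun k => (u k \_ G) x) @ \oo --> v x.
  have [Gx|nGx] := pselect (G x).
    rewrite /v (_ : (fun k => _) = u ^~ x); first exact: cvG.
    by apply/funext => k; rewrite uG.
  rewrite /v (_ : (fun k => _) = cst 0); first exact: is_cvg_cst.
  by apply/funext => k; rewrite uGn.
have mu k : measurable_fun w (u k \_ G).
  apply: measurable_funTS; apply/(measurable_restrictT _ mG).
  by apply: (measurable_funS mw _ (uL k).1) => x [].
have mv : measurable_fun w v by apply: measurable_fun_cvg mu _ => x _; exact: cv.
have key g m (e : R) : L2 w g ->
   (forall k, (m <= k)%N -> (\int[leb]_(x in w) ((u k x - g x) ^+ 2)%:E <= e%:E)%E) ->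
   (\int[leb]_(x in w) ((v x - g x) ^+ 2)%:E <= e%:E)%E.
  move=> [mg _] h.
  have mf k : measurable_fun w (fun x => (((u k \_ G) x - g x) ^+ 2)%:E).
    by apply/measurable_EFinP/measurable_funX/measurable_funB.
  have := fatou leb mw mf (fun k x _ => ltac:(by rewrite lee_fin sqr_ge0)).
  rewrite (_ : (\int[leb]_(x in w) _)%E = (\int[leb]_(x in w) ((v x - g x) ^+ 2)%:E)%E); last first.
    apply: eq_integral => x _.
    have h1 : (fun k => (((u k \_ G) x - g x) ^+ 2)%:E) @ \oo --> ((v x - g x) ^+ 2)%:E.
      apply: cvg_EFin; first exact: nearW.
      have -> : fine \o (fun k => (((u k \_ G) x - g x) ^+ 2)%:E) =
        (fun k => ((u k \_ G) x - g x) * ((u k \_ G) x - g x)) by apply/funext => k /=; rewrite expr2.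
      by rewrite expr2; apply: cvgM; apply: cvgB => //; exact: cvg_cst.
    by have [->] := cvg_limn_einf_sup h1.
  move=> /le_trans; apply.
  apply: limn_einf_le (_ : forall k, (m <= k)%N -> _ <= e%:E)%E => k mk.
  apply: le_trans (h _ mk); rewrite le_eqVlt; apply/orP; left; apply/eqP.
  apply: ge0_ae_eq_integral => //.
  - by apply/measurable_EFinP/measurable_funX/measurable_funB; [case: (uL k)|].
  - by move=> x _; rewrite lee_fin sqr_ge0.
  - by move=> x _; rewrite lee_fin sqr_ge0.
  - by apply: filterS nG => x Gx wx; rewrite uG//; exact: Gx.
exists v => //; rewrite -[v](subrK (u 0%N)).
have k0 := key _ 0%N 1 (uL 0%N) (fun k k0 => du k0).
rewrite -[v - _]scale1r; apply: L2_lin => //; split.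
  by apply: measurable_funB => //; case: (uL 0%N).
apply/integrableP; split.
  by apply/measurable_EFinP/measurable_funX/measurable_funB => //; case: (uL 0%N).
under eq_integral do rewrite gee0_abs ?lee_fin ?sqr_ge0//.
exact: le_lt_trans k0 (ltry _).
Qed.

End completeness.

Lemma L2_semiHilbert : semiHilbert (L2 w) (ip w).
Proof.
split.
- exact: L2_0.
- by move=> a f g; exact: L2_lin.
- by move=> f g _ _; apply: eq_Rintegral => x _; rewrite mulrC.
- move=> a f g h Lf Lg Lh; rewrite /ip -RintegralZl//; last exact: L2_mul_integrable.
  rewrite -RintegralD//; first by apply: eq_Rintegral => x _; rewrite [(a *: f + g) x](_ : _ = a * f x + g x)// mulrDl mulrA.
  + by apply: eq_integrable (integrableZl mw a (L2_mul_integrable Lf Lh)) => // x _ /=.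
  + exact: L2_mul_integrable.
- exact: ip_posL.
move=> u Lu cu.
have exn m : exists n0, forall i j, (n0 <= i)%N -> (n0 <= j)%N ->
    Num.sqrt (ip w (u i - u j) (u i - u j)) <= 8^-1 ^+ m.
  by apply: cu; rewrite exprn_gt0.
have [k kP] := choice exn.
(* Partial sums of the thresholds give a monotone choice of indices with [s m] at least [k m] and at
   least [m]. *)
pose s m := (\sum_(i < m.+1) (k i).+1)%N.
have ks m : (k m <= s m)%N by rewrite /s big_ord_recr /= (leq_trans (leqnSn _))// leq_addl.
have ms l : (l <= s l)%N.
  elim: l => [//|l ih]; apply: (leq_ltn_trans ih); rewrite [in leqRHS]/s big_ord_recr /= -/(s l); lia.
have smono m l : (m <= l)%N -> (s m <= s l)%N.
  elim: l => [|l ih]; first by rewrite leqn0 => /eqP->.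
  rewrite leq_eqVlt => /orP[/eqP->//|/ih h]; apply: leq_trans h _.
  by rewrite [in leqRHS]/s big_ord_recr /= leq_addr.
have [||v Lv vP] := @L2_complete_fast (u \o s).
- by move=> m; exact: Lu.
- move=> m l ml; apply: le_trans (L2_norm_le _ _ (kP m (s l) (s m) _ _)) _.
  + exact: L2B.
  + by rewrite exprn_ge0.
  + exact: leq_trans (ks m) (smono _ _ ml).
  + exact: ks.
  + rewrite lee_fin expr2 ler_piMr ?exprn_ge0// exprn_ile1//; lra.
exists v; split=> //; apply/cvg_to0P => [m|e e0]; first exact: sqrtr_ge0.
have [n0 n0P] := cu _ e0; exists n0 => m nm.
have Lvm := L2B Lv (Lu m); have Lmv := L2B (Lu m) Lv.
rewrite -[leRHS](ger0_norm (ltW e0)) -sqrtr_sqr; apply: ler_wsqrtr.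
rewrite -lee_fin ip_sqr//.
under eq_integral do rewrite -sqrrN opprB.
apply: (vP (u m) n0 (e ^+ 2) (Lu m)) => k' nk.
apply: (L2_norm_le (L2B (Lu (s k')) (Lu m)) (ltW e0)).
by apply: n0P => //; apply: leq_trans nk (ms _).
Qed.

End square_integrable.

(** * Smooth functions with compact support *)

Section flat.
Context {R : realType}.
Implicit Types (P : {poly R}) (t y : R).

(* The functions [t |-> P(1/t) exp(-1/t)], extended by 0 for [t <= 0], are
   closed under differentiation. *)
Definition flat P t : R := if 0 < t then P.[t^-1] * expR (- t^-1) else 0.

Lemma pow_exp_bounded k : exists C : R, forall y, 0 < y -> y ^+ k * expR (- y) <= C.
Proof.
case: k => [|k].
  by exists 1 => y y0; rewrite mul1r -[leRHS]expR0 ler_expR oppr_le0 ltW.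
exists (k.+1`!%:R) => y y0; have := @expR_ge1Dxn R y k (ltW y0); rewrite expRN => h.
rewrite ler_pdivrMr ?expR_gt0// mulrC -ler_pdivrMr ?ltr0n ?fact_gt0//.
by apply: le_trans h; rewrite lerDr.
Qed.

Lemma poly_exp_bounded P k :
  exists C : R, forall y, 0 < y -> `|P.[y]| * (y ^+ k * expR (- y)) <= C.
Proof.
elim/poly_ind: P k => [|P c ih] k.
  by exists 0 => y _; rewrite horner0 normr0 mul0r.
have [C1 h1] := ih k.+1; have [C2 h2] := pow_exp_bounded k.
exists (C1 + `|c| * C2) => y y0; rewrite hornerMXaddC.
have e0 : 0 <= y ^+ k * expR (- y) by rewrite mulr_ge0 ?expR_ge0// exprn_ge0// ltW.
apply: le_trans (ler_wpM2r e0 (ler_normD _ _)) _; rewrite mulrDl; apply: lerD.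
  by rewrite normrM (gtr0_norm y0) -mulrA [y * _]mulrA -exprS; exact: h1.
by apply: ler_wpM2l => //; exact: h2.
Qed.

Lemma flat_bound P : exists C : R, forall t, `|flat P t| <= C * t ^+ 2.
Proof.
have [C hC] := poly_exp_bounded P 2; have C0 : 0 <= C.
  by apply: le_trans (hC 1 ltr01); rewrite !mulr_ge0 ?expR_ge0// exprn_ge0.
exists C => t; rewrite /flat; case: ifPn => t0; last by rewrite normr0 mulr_ge0 ?sqr_ge0.
rewrite -ler_pdivrMr ?exprn_gt0// normrM (gtr0_norm (expR_gt0 _)).
have := hC t^-1; rewrite invr_gt0 => /(_ t0); apply: le_trans.
by rewrite -mulrA [expR _ * _]mulrC exprVn.
Qed.

(** For t > 0 the chain rule gives t^-2 (P - P')(1/t) exp(-1/t), and the factor t^-2 is absorbed as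
    'X^2. At 0 the quadratic bound [flat_bound] makes the difference quotient tend to 0. *)
Lemma is_derive_flat P t : is_derive t 1 (flat P) (flat ('X^2 * (P - P^`())) t).
Proof.
have [t0|t0|->] := ltgtP t 0.
- rewrite {2}/flat lt_gtF//; apply: near_eq_is_derive (is_derive_cst (0 : R) t 1).
  near=> s; rewrite /flat lt_gtF//; near: s; exact: lt_nbhsl.
- rewrite {2}/flat t0; have tn : t != 0 by rewrite gt_eqF.
  have dV : is_derive t 1 (fun s : R => s^-1) (- t ^- 2).
    by have := is_deriveV tn (is_derive_id t (1 : R)); rewrite /GRing.scale /= mulr1.
  have dP : is_derive t 1 (fun s : R => P.[s^-1]) (P^`().[t^-1] * - t ^- 2).
    exact: (@is_derive1_comp _ (horner P) _ _ _ _ (is_derive_poly P _) dV).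
  have dE : is_derive t 1 (fun s : R => expR (- s^-1)) (expR (- t^-1) * t ^- 2).
    have := @is_derive1_comp _ expR (fun s : R => - s^-1) t _ _ (is_derive_expR _) (is_deriveN dV).
    by rewrite opprK.
  have := is_deriveM dP dE.
  rewrite (_ : _ *: _ + _ = ('X^2 * (P - P^`())).[t^-1] * expR (- t^-1)); last first.
    by rewrite !hornerE /GRing.scale /= exprVn; ring.
  apply: near_eq_is_derive.
  by near=> s; rewrite /flat ifT//; near: s; exact: lt_nbhsr.
- rewrite {2}/flat ltxx.
  have [C hC] := flat_bound P.
  have nz : C * `|h| @[h --> (0 : R)^'] --> (0 : R).
    have h1 : `|h| @[h --> (0 : R)^'] --> `|0 : R|.
      by apply: cvg_within_filter; exact: norm_continuous.
    by have := cvgM (cvg_cst C) h1; rewrite normr0 mulr0; apply.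
  have cv : h^-1 *: (flat P (h *: 1 + 0) - flat P 0) @[h --> 0^'] --> (0 : R).
    apply: (@squeeze_cvgr _ _ _ _ (fun h => - (C * `|h|)) (fun h => C * `|h|)).
    + near=> h; rewrite -ler_norml {2}/flat ltxx subr0 addr0 scaler1 normrZ.
      have h0 : h != 0 by near: h; exact: nbhs_dnbhs_neq.
      rewrite normrV ?unitfE// mulrC ler_pdivrMr ?normr_gt0// -mulrA -expr2.
      by rewrite real_normK ?num_real.
    + by rewrite -[X in _ --> X]oppr0; exact: cvgN.
    + exact: nz.
  by split; [apply/cvg_ex; exists 0|exact: cvg_lim].
Unshelve. all: by end_near. Qed.

End flat.

Section smooth_functions.
Context {R : realType} {d : nat}.
Local Notation E := 'rV[R]_d.
Implicit Types (f g h : E -> R) (x v : E) (w : set E).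

(** A class of differentiable functions stable under partial derivatives serves as the invariant for
    the induction on the list of derivatives in [smooth]. *)
Lemma smooth_stable (S : (E -> R) -> Prop) :
  (forall f, S f -> (forall x, differentiable f x) /\ forall i, S (pderiv i f)) ->
  forall f, S f -> smooth f.
Proof.
move=> HS f Sf s; suff : S (foldr pderiv f s) by move/HS => [].
by elim: s => [//|i s ih] /=; exact: (HS _ ih).2.
Qed.

Lemma smooth_diff f : smooth f -> forall x, differentiable f x.
Proof. by move=> sf; exact: (sf [::]). Qed.

Lemma smooth_pderiv i f : smooth f -> smooth (pderiv i f).
Proof. by move=> sf s x; rewrite -(foldr_rcons pderiv f s i); exact: sf. Qed.

Lemma smooth_derivable f x v : smooth f -> derivable f x v.
Proof. by move=> sf; apply: diff_derivable; exact: smooth_diff. Qed.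

Lemma smooth_continuous f : smooth f -> continuous f.
Proof. by move=> sf x; apply: differentiable_continuous; exact: smooth_diff. Qed.

Lemma pderiv_lin i a f g : (forall x, differentiable f x) ->
  (forall x, differentiable g x) -> pderiv i (a *: f + g) = a *: pderiv i f + pderiv i g.
Proof.
move=> df dg; apply/funext => x; rewrite /pderiv.
have f1 := diff_derivable (df x) (v := delta_mx ord0 i); have g1 := diff_derivable (dg x) (v := delta_mx ord0 i).
rewrite deriveD//; last exact: derivableZ.
by rewrite deriveZ.
Qed.

Lemma smooth_lin a f g : smooth f -> smooth g -> smooth (a *: f + g).
Proof.
move=> sf sg; apply: (@smooth_stable (fun k => exists f g, [/\ smooth f, smooth g & k = a *: f + g])).
  move=> _ [f1 [g1 [sf1 sg1 ->]]]; split=> [x|i].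
    by apply: differentiableD; [apply: differentiableZ|]; exact: smooth_diff.
  exists (pderiv i f1), (pderiv i g1); split; [exact: smooth_pderiv..|].
  by apply: pderiv_lin; exact: smooth_diff.
by exists f, g.
Qed.

Lemma pderivM i f g : (forall x, differentiable f x) -> (forall x, differentiable g x) ->
  pderiv i (f * g) = f * pderiv i g + g * pderiv i f.
Proof.
by move=> df dg; apply/funext => x; rewrite /pderiv deriveM//; exact: diff_derivable.
Qed.

Lemma pderiv_coord i j x : pderiv i (fun x : E => x ord0 j) x = (i == j)%:R.
Proof.
rewrite /pderiv; apply/cvg_lim => //; apply: cvg_near_cst; near=> h.
have h0 : h != 0 by near: h; exact: nbhs_dnbhs_neq.
rewrite /= !mxE addrK eqxx /= [j == i]eq_sym /GRing.scale /= mulrA mulVf// mul1r.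
by [].
Unshelve. all: by end_near. Qed.

(** A class stable under partial derivatives, thanks to [is_derive_flat], and large enough for bump
    functions, Bernstein polynomials and smooth thresholds. All the test functions built from
    scratch below come from it. *)
Inductive elementary : (E -> R) -> Prop :=
| elem_cst c : elementary (cst c)
| elem_coord i : elementary (fun x => x ord0 i)
| elem_add f g : elementary f -> elementary g -> elementary (f + g)
| elem_mul f g : elementary f -> elementary g -> elementary (f * g)
| elem_flat P f : elementary f -> elementary (flat P \o f).

Lemma derive_comp1 (h dh : R -> R) f x v : (forall t : R, is_derive t (1 : R) h (dh t)) ->
  differentiable f x -> differentiable (h \o f) x /\ 'D_v (h \o f) x = dh (f x) * 'D_v f x.
Proof.
move=> hd df; have dh1 : differentiable h (f x).
  by apply/derivable1_diffP; have [] := hd (f x).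
split; first exact: differentiable_comp.
rewrite !deriveE//; last exact: differentiable_comp.
rewrite diff_comp//=; have e1 : 'd f x v = 'd f x v *: (1 : R) by rewrite /GRing.scale /= mulr1.
have e2 : 'd h (f x) (1 : R) = dh (f x).
  by rewrite -deriveE// (@derive_val _ _ _ _ _ _ _ (hd (f x))).
by rewrite [X in 'd h _ X]e1 linearZ /= e2 mulrC.
Qed.

Lemma elementary_diff f : elementary f ->
  (forall x, differentiable f x) /\ forall i, elementary (pderiv i f).
Proof.
elim=> {f}.
- move=> c; split=> [x|i]; first exact: differentiable_cst.
  by rewrite (_ : pderiv i _ = cst 0); [exact: elem_cst|apply/funext => x; exact: derive_cst].
- move=> j; split=> [x|i]; first exact: differentiable_coord.
  rewrite (_ : pderiv i _ = cst ((i == j)%:R)); first exact: elem_cst.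
  by apply/funext => x; exact: pderiv_coord.
- move=> f g _ [df ef] _ [dg eg]; split=> [x|i]; first exact: differentiableD.
  have := pderiv_lin i 1 df dg; rewrite !scale1r => ->; exact: elem_add.
- move=> f g Ef [df ef] Eg [dg eg]; split=> [x|i]; first exact: differentiableM.
  by rewrite pderivM//; apply: elem_add; exact: elem_mul.
- move=> P f Ef [df ef]; have dc x v := derive_comp1 v (is_derive_flat P) (df x).
  split=> [x|i]; first exact: (dc x 0).1.
  rewrite (_ : pderiv i _ = (flat ('X^2 * (P - P^`())) \o f) * pderiv i f).
    by apply: elem_mul => //; exact: elem_flat.
  by apply/funext => x; rewrite /pderiv (dc x _).2.
Qed.

Lemma near_eq_differentiable f g x : (\near x, f x = g x) ->
  differentiable f x -> differentiable g x.
Proof.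
move=> fg /diff_locallyP[cd /eqaddoP h].
have e : g \o shift x = cst (g x) + 'd f x +o_ (0 : E) id.
  apply/eqaddoP => e e0.
  have fg0 : \forall y \near (0 : E), f (y + x) = g (y + x).
    have sc : (fun y => y + x) @ (0 : E) --> x.
      have := @cvgD R E _ (nbhs (0 : E)) _ (fun y => y) (cst x) 0 x.
      by rewrite add0r; apply; [move=> A; exact|exact: cvg_cst].
    exact: (sc _ fg).
  have gx := nbhs_singleton fg; near=> y.
  have hy : `|f (y + x) - (f x + 'd f x y)| <= e * `|y| by near: y; exact: h.
  suff : `|g (y + x) - (g x + 'd f x y)| <= e * `|y| by [].
  by rewrite -gx (_ : g (y + x) = f (y + x)) //; apply/esym; near: y; exact: fg0.
apply/diff_locallyP; rewrite (diff_unique _ e)//.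
Unshelve. all: by end_near. Qed.

Lemma locally_elementary_smooth f :
  (forall x, exists2 h, elementary h & \near x, f x = h x) -> smooth f.
Proof.
apply: (@smooth_stable (fun f => forall x, exists2 h, elementary h & \near x, f x = h x)).
move=> {}f Hf; split=> [x|i x].
  have [h eh fh] := Hf x; apply: (@near_eq_differentiable h); last exact: (elementary_diff eh).1.
  by apply: filterS fh => y ->.
have [h eh fh] := Hf x; exists (pderiv i h); first exact: (elementary_diff eh).2.
have := nbhs_interior fh; apply: filterS => y fy.
exact: near_eq_derive.
Qed.

Lemma elementary_smooth f : elementary f -> smooth f.
Proof.
move=> ef; apply: locally_elementary_smooth => x; exists f => //; near=> y.
by [].
Unshelve. all: by end_near. Qed.

(** Near each point the extension by zero coincides with [h] or with 0; the latter holds near points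
    outside [w] because the complement of [K] is open. *)
Lemma test_function_elementary w (K : set E) h : open w -> compact K -> K `<=` w ->
  elementary h -> (forall x, w x -> ~ K x -> h x = 0) ->
  test_function w (h \_ w).
Proof.
move=> ow cK Kw eh h0; have clK : closed K by apply: compact_closed cK; exact: norm_hausdorff.
have off x : ~ K x -> (h \_ w) x = 0.
  by move=> nK; have [wx|nw] := pselect (w x);
    [rewrite patchT ?inE//; exact: h0|rewrite patchN// notin_setE].
split; last by exists K.
apply: locally_elementary_smooth => x; have [wx|nwx] := pselect (w x).
  exists h => //; have := open_nbhs_nbhs (conj ow wx); apply: filterS => y wy.
  by rewrite patchT// inE.
exists (cst 0); first exact: elem_cst.
have oK : open (~` K) by exact: closed_openC.
have Kx : (~` K) x by move=> /Kw.
have := open_nbhs_nbhs (conj oK Kx); apply: filterS => y nKy; exact: off.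
Qed.

Lemma test_function_lin w a f g : test_function w f -> test_function w g ->
  test_function w (a *: f + g).
Proof.
move=> [sf [K [cK Kw fK]]] [sg [L [cL Lw gL]]]; split; first exact: smooth_lin.
exists (K `|` L); split.
- exact: compactU.
- by move=> x [/Kw|/Lw].
- move=> x nKL; rewrite (_ : _ x = a * f x + g x)// fK ?gL ?mulr0 ?addr0//.
  + by move=> Lx; apply: nKL; right.
  + by move=> Kx; apply: nKL; left.
Qed.

Lemma test_function0 w : test_function w 0.
Proof.
split; first exact: (elementary_smooth (elem_cst 0)).
by exists set0; split=> //; exact: compact0.
Qed.

Lemma test_function_pderiv w i f : test_function w f -> test_function w (pderiv i f).
Proof.
move=> [sf [K [cK Kw fK]]]; split; first exact: smooth_pderiv.
exists K; split=> // x nKx; rewrite /pderiv -(derive_cst (0 : R) x (delta_mx ord0 i)).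
apply: near_eq_derive; have oK : open (~` K) by apply: closed_openC; apply: compact_closed cK; exact: norm_hausdorff.
have := open_nbhs_nbhs (conj oK nKx); apply: filterS => y; exact: fK.
Qed.

Lemma test_function_sub w w' f : w `<=` w' -> test_function w f -> test_function w' f.
Proof. by move=> ww [sf [K [cK Kw fK]]]; split=> //; exists K; split=> // x /Kw/ww. Qed.

Lemma test_function_bounded w f : test_function w f -> exists M, forall x, `|f x| <= M.
Proof.
move=> [sf [K [cK _ fK]]].
have /compact_bounded[M0 [_ hM]] : compact (f @` K).
  by apply: continuous_compact => //; apply: continuous_subspaceT; exact: smooth_continuous.
exists (`|M0| + 1) => x; have [Kx|/fK->] := pselect (K x); last by rewrite normr0 addr_ge0.
by apply: hM; [rewrite (le_lt_trans (ler_norm _))// ltrDl|exists x].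
Qed.

End smooth_functions.

(** * Bump functions and the fundamental lemma of the calculus of variations *)

Section fundamental_lemma.
Context {R : realType} {d : nat}.
Local Notation E := 'rV[R]_d.
Local Notation leb := (@lebesgue_rV R d).
Implicit Types (f g q : E -> R) (w V : set E) (x : E).

Lemma elem_prod (I : Type) (s : seq I) (F : I -> E -> R) :
  (forall i, elementary (F i)) -> elementary (fun x => \prod_(i <- s) F i x).
Proof.
move=> eF; elim: s => [|i s ih].
  by under eq_fun do rewrite big_nil; exact: (elem_cst 1).
by under eq_fun do rewrite big_cons; exact: elem_mul.
Qed.

Lemma elem_sum (I : Type) (s : seq I) (F : I -> E -> R) :
  (forall i, elementary (F i)) -> elementary (fun x => \sum_(i <- s) F i x).
Proof.
move=> eF; elim: s => [|i s ih].
  by under eq_fun do rewrite big_nil; exact: (elem_cst 0).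
by under eq_fun do rewrite big_cons; exact: elem_add.
Qed.

Lemma elem_affine a c f : elementary f -> elementary (fun x => a * f x + c).
Proof.
by move=> ef; exact: (elem_add (elem_mul (elem_cst a) ef) (elem_cst c)).
Qed.

Lemma flat1_gt0 (t : R) : 0 < t -> 0 < flat 1 t.
Proof. by move=> t0; rewrite /flat t0 hornerC mul1r expR_gt0. Qed.
Lemma flat1_le0 (t : R) : t <= 0 -> flat 1 t = 0.
Proof. by move=> t0; rewrite /flat ltNge t0. Qed.
Lemma flat1_ge0 (t : R) : 0 <= flat 1 t.
Proof. by have [/flat1_le0->|/flat1_gt0/ltW] := leP t 0. Qed.
Lemma flat1_le1 (t : R) : flat 1 t <= 1.
Proof.
have [/flat1_le0->//|t0] := leP t 0; rewrite /flat t0 hornerC mul1r.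
by rewrite -[leRHS]expR0 ler_expR oppr_le0 invr_ge0 ltW.
Qed.
Lemma flat1_cvg (t : R) : 0 < t -> (fun m => flat 1 (m.+1%:R * t)) @ \oo --> (1 : R).
Proof.
move=> t0; rewrite (_ : (fun m => _) = (fun m => expR (- (m.+1%:R^-1 * t^-1)))); last first.
  by apply/funext => m; rewrite /flat mulr_gt0// hornerC mul1r invfM.
rewrite -[X in _ --> X](@expR0 R); apply: continuous_cvg; first exact: continuous_expR.
rewrite -[X in _ --> X]oppr0 -(mul0r t^-1); apply: cvgN; apply: cvgMl.
exact: cvg_harmonic.
Qed.

(** [b c] is a product of one-dimensional bumps, positive exactly on an open cube with rational
    centre. Only the cubes whose closed version [B c] lies in [V] are kept, and they cover [V]. *)
Lemma open_bumps V : open V -> exists p : nat -> E -> R,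
  [/\ forall k, elementary (p k), forall k x, 0 <= p k x,
      forall k, exists K, [/\ compact K, K `<=` V & forall x, ~ K x -> p k x = 0] &
      forall x, V x -> exists k, 0 < p k x].
Proof.
move=> oV.
pose B (c : 'rV[rat]_d * nat) : set E :=
  [set x | forall j, `|x ord0 j - ratr (c.1 ord0 j)| <= c.2.+1%:R^-1].
pose b (c : 'rV[rat]_d * nat) x : R := \prod_(j < d)
  (flat 1 (1 * x ord0 j + (c.2.+1%:R^-1 - ratr (c.1 ord0 j))) *
   flat 1 ((-1) * x ord0 j + (c.2.+1%:R^-1 + ratr (c.1 ord0 j)))).
pose p k : E -> R := match unpickle k with
  | Some c => if pselect (B c `<=` V) then b c else cst 0
  | None => cst 0 end.
have eb c : elementary (b c).
  apply: elem_prod => j; apply: elem_mul; apply: elem_flat; apply: elem_affine; exact: elem_coord.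
have b0 c x : 0 <= b c x.
  by apply: prodr_ge0 => j _; apply: mulr_ge0; exact: flat1_ge0.
exists p; split.
- by move=> k; rewrite /p; case: unpickle => [c|]; [case: pselect => h|]; try exact: elem_cst; exact: eb.
- by move=> k x; rewrite /p; case: unpickle => [c|]; [case: pselect => h|]; rewrite /= ?lexx//; exact: b0.
- move=> k; rewrite /p; case: unpickle => [c|]; last first.
    by exists set0; split=> //; exact: compact0.
  case: pselect => [BV|nBV]; last by exists set0; split=> //; exact: compact0.
  exists (B c); split=> //.
    rewrite (_ : B c = [set v : E | forall j, v ord0 j \in `[ratr (c.1 ord0 j) - c.2.+1%:R^-1, ratr (c.1 ord0 j) + c.2.+1%:R^-1]]); last first.
      by apply/seteqP; split=> x h j; have := h j; rewrite /= in_itv /= ler_distl.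
    have := @rV_compact R d (fun j => [set` `[ratr (c.1 ord0 j) - c.2.+1%:R^-1, ratr (c.1 ord0 j) + c.2.+1%:R^-1]]).
    by apply=> j; exact: segment_compact.
  move=> x /existsNP[j /negP]; rewrite -ltNge => h; rewrite /= /b (bigD1 j)//=.
  have [h1|h1] := leP (1 * x ord0 j + (c.2.+1%:R^-1 - ratr (c.1 ord0 j))) 0.
    by rewrite (flat1_le0 h1) !mul0r.
  rewrite (@flat1_le0 (-1 * _ + _)) ?mulr0 ?mul0r//.
  move: h h1; move: (c.2.+1%:R^-1) => r; rewrite ltr_normr => /orP[]; lra.
- move=> x Vx; have /nbhs_ballP[e /= e0 eV] := open_nbhs_nbhs (conj oV Vx).
  have e2 : 0 < e / 2 by rewrite divr_gt0.
  have [m hm] := small_invn e2.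
  have [r rE] : exists r : R, r = m.+1%:R^-1 by eexists.
  have r0 : 0 < r by rewrite rE invr_gt0.
  have {hm}hm : r <= e / 2 by rewrite rE; exact: hm.
  have exq (j : 'I_d) : exists s : rat, `|x ord0 j - ratr s| < r.
    have [s] := @rat_in_itvoo R (x ord0 j - r) (x ord0 j + r) ltac:(lra).
    rewrite in_itv /= => /andP[h1 h2]; exists s; rewrite ltr_norml; lra.
  have [s sP] := choice exq.
  pose c := (\row_j s j, m); exists (pickle c); rewrite /p pickleK.
  case: pselect => [h|[]].
    rewrite /b; apply: prodr_gt0 => j _; rewrite /c /= mxE -rE.
    by have := sP j; rewrite ltr_norml => /andP[h1 h2]; rewrite mulr_gt0// flat1_gt0//; lra.
  move=> y By; apply: eV; apply/rV_ballP => // j.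
  have := By j; have := sP j; rewrite /= mxE -rE ler_norml !ltr_norml; lra.
Qed.

(** [flat 1] tends to 1 at infinity. On [V] the argument [m.+1%:R * s m x] tends to infinity,
    because the partial sums [s m] of the bumps are eventually bounded below by one positive
    term. *)
Lemma open_bump_sequence V : open V -> exists phi : nat -> E -> R,
  [/\ forall m, test_function V (phi m), forall m x, 0 <= phi m x <= 1,
      forall m x, ~ V x -> phi m x = 0 &
      forall x, V x -> (fun m => phi m x) @ \oo --> (1 : R)].
Proof.
move=> oV; have [p [ep p0 pK pV]] := open_bumps oV.
have [K KP] := choice pK.
pose s m x := \sum_(k <- iota 0 m.+1) p k x.
have es m : elementary (s m) by exact: elem_sum.
pose phi m := flat 1 \o (fun x => m.+1%:R * s m x + 0).
have eph m : elementary (phi m) by apply: elem_flat; exact: elem_affine.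
pose L m := \big[setU/set0]_(k < m.+1) K k.
have cL m : compact (L m).
  by apply: big_ind => //; [exact: compact0|exact: compactU|move=> k _; case: (KP k)].
have LV m : L m `<=` V.
  rewrite /L => x; rewrite -bigcup_mkord => -[k _ Kx].
  by have [_ KV _] := KP k; exact: KV.
have phi0 m x : ~ L m x -> phi m x = 0.
  move=> nL; rewrite /phi /= /s big1_seq ?mulr0 ?addr0 ?flat1_le0// => k /andP[_].
  rewrite mem_iota add0n => /andP[_ km]; have [_ _ ->//] := KP k.
  by move=> Kx; apply: nL; rewrite /L -bigcup_mkord; exists k.
exists phi; split.
- move=> m; split; first exact: elementary_smooth.
  by exists (L m); split=> // x; exact: phi0.
- by move=> m x; rewrite flat1_ge0 flat1_le1.
- by move=> m x nV; apply: phi0 => /LV.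
- move=> x /pV[k pk].
  apply: (@squeeze_cvgr _ _ _ _ (fun m => flat 1 (m.+1%:R * p k x)) (cst 1)).
  + near=> m; rewrite flat1_le1 andbT /phi /= addr0.
    have km : (k <= m)%N by near: m; exists k.
    have ps : p k x <= s m x.
      rewrite /s (bigD1_seq k) ?iota_uniq ?mem_iota//.
      by rewrite lerDl; apply: sumr_ge0.
    rewrite /flat !mulr_gt0//; last exact: lt_le_trans ps.
    rewrite !hornerC !mul1r ler_expR lerN2 lef_pV2 ?posrE ?mulr_gt0//; last exact: lt_le_trans ps.
    by rewrite ler_pM2l.
  + exact: flat1_cvg.
  + exact: cvg_cst.
Unshelve. all: by end_near. Qed.

Lemma rV_measurable_opens : @measurable _ E = <<s open >>.
Proof.
apply/seteqP; split; last first.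
  by apply: smallest_sub; [exact: sigma_algebra_measurable|exact: rV_open_measurable].
apply: smallest_sub; first exact: smallest_sigma_algebra.
move=> A; rewrite -bigcup_seq => -[i _ [C mC <-]]; rewrite setTI.
pose F := [set D : set R | <<s (@open E) >> ((fun x : E => x ord0 i) @^-1` D)].
suff : @measurable _ (measurableTypeR R) `<=` F by apply.
have sF : sigma_algebra setT F.
  have [h0 hC hU] := @smallest_sigma_algebra _ setT (@open E).
  split; first by rewrite /F /= preimage_set0.
    by move=> D FD; rewrite /F /= setTD preimage_setC -setTD; exact: hC.
  by move=> D FD; rewrite /F /= preimage_bigcup; exact: hU.
rewrite RGenOpens.measurableE; apply: smallest_sub => // _ [a [b ->]].
apply: sub_sigma_algebra; apply: open_comp; first by move=> x _; exact: coord_continuous.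
exact: interval_open.
Qed.

Lemma L2_integrable w V q : measurable w -> measurable V -> V `<=` w ->
  (leb V < +oo)%E -> L2 w q -> leb.-integrable V (EFin \o q).
Proof.
move=> mw mV Vw Voo [mq iq].
have i2 : leb.-integrable V (EFin \o (fun x => 1 + q x ^+ 2)).
  have i1 : leb.-integrable V (EFin \o cst 1).
    by apply: measurable_bounded_integrable => //; exists 1; split=> // M M1 x _ /=; rewrite normr1 ltW.
  by apply: eq_integrable (integrableD mV i1 (integrableS mw mV Vw iq)) => // x _.
apply: le_integrable i2 => //.
  by apply/measurable_EFinP; apply: measurable_funS mq.
move=> x _ /=; rewrite lee_fin [leRHS]ger0_norm ?addr_ge0 ?sqr_ge0//.
by rewrite -real_normK ?num_real//; have := sqr_ge0 (`|q x| - 2^-1); nra.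
Qed.

Lemma compact_support_integrable g K : continuous g -> compact K ->
  (forall x, ~ K x -> g x = 0) -> leb.-integrable setT (EFin \o g).
Proof.
move=> cg cK gK; have clK : closed K by apply: compact_closed cK; exact: norm_hausdorff.
have mK := rV_closed_measurable clK.
have -> : EFin \o g = (EFin \o g) \_ K.
  apply/funext => x; rewrite patchE; case: ifPn => // /negP nK /=; rewrite gK//.
  by move=> Kx; apply: nK; exact: mem_set.
apply/(integrable_mkcond _ mK); apply: measurable_bounded_integrable => //.
- by apply: lebesgue_rV_bounded_lty => //; exact: compact_bounded.
- by apply: measurable_funTS; exact: rV_continuous_measurable.
- have /compact_bounded[M0 [M0r hM]] : compact (g @` K).
    by apply: continuous_compact => //; exact: continuous_subspaceT.
  by exists M0; split=> // M MM x Kx; apply: hM => //; exists x.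
Qed.

Lemma test_function_L2 w w' phi : measurable w' -> test_function w phi -> L2 w' phi.
Proof.
move=> mw' [sphi [K [cK _ phiK]]]; have cphi := smooth_continuous sphi; split.
  by apply: measurable_funTS; exact: rV_continuous_measurable.
apply: (@integrableS _ _ _ _ setT) => //; apply: (@compact_support_integrable _ K) => //.
  rewrite (_ : (fun x => _) = phi * phi); last by apply/funext => y; rewrite expr2.
  by move=> x; exact: cvgM (cphi x) (cphi x).
by move=> x /phiK ->; rewrite expr0n.
Qed.

(** Dominated convergence along bumps tending to the indicator of an open set shows that the
    integral of [q] over this set vanishes; the pieces [W m] of [w] are bounded so that [q] is
    integrable on them. Dynkin's theorem passes from open to measurable sets, and countably many
    pieces exhaust [w]. *)
Lemma fundamental_lemma w q : open w -> L2 w q ->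
  (forall phi, test_function w phi -> ip w q phi = 0) ->
  {ae leb, forall x, w x -> q x = 0}.
Proof.
move=> ow Lq q0; have mw := rV_open_measurable ow.
pose W m := w `&` ball (0 : E) m.+1%:R.
have oW m : open (W m) by apply: openI => //; apply: ball_open.
have mW m := rV_open_measurable (oW m).
have Ww m : W m `<=` w by move=> x [].
have Woo m : (leb (W m) < +oo)%E.
  apply: lebesgue_rV_bounded_lty => //; exists m.+1%:R; split=> // M mM x [_ bx].
  by apply: ltW; apply: lt_trans mM; move: bx; rewrite -ball_normE /= sub0r normrN.
have iW m : leb.-integrable (W m) (EFin \o q) by exact: (@L2_integrable w).
have open0 m U : open U -> (\int[leb]_(x in U `&` W m) (q x)%:E = 0)%E.
  move=> oU; pose V := U `&` W m.
  have oV : open V by exact: openI.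
  have mV := rV_open_measurable oV.
  have Vw : V `<=` w by move=> x [_ []].
  have [phi [tphi phi01 phi0 phi1]] := open_bump_sequence oV.
  have iV : leb.-integrable V (EFin \o q) by apply: integrableS (iW m) => //; exact: subIsetr.
  have mq : measurable_fun V q by apply/measurable_EFinP; exact: measurable_int iV.
  have mphi k : measurable_fun setT (phi k).
    by apply: rV_continuous_measurable; apply: smooth_continuous; case: (tphi k).
  have [| | | | |_ _] := @dominated_convergence _ _ _ leb V mV (fun k => EFin \o (fun x => q x * phi k x))
    (EFin \o q) (abse \o (EFin \o q)).
  - move=> k; apply/measurable_EFinP; apply: measurable_funM => //; exact: measurable_funTS.
  - exact/measurable_EFinP.
  - apply: aeW => x Vx; apply: cvg_EFin; first exact: nearW.
    by rewrite -[q x]mulr1; apply: cvgM; [exact: cvg_cst|exact: phi1].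
  - exact: integrable_abse.
  - apply: aeW => x k Vx /=; rewrite lee_fin normrM ler_piMr//.
    by have /andP[p0 p1] := phi01 k x; rewrite ger0_norm.
  have z k : (\int[leb]_(x in V) (q x * phi k x)%:E = 0)%E.
    have tw := test_function_sub Vw (tphi k).
    have Lphi : L2 w (phi k) by exact: test_function_L2 tw.
    have := q0 _ tw; rewrite /ip /Rintegral => q0k.
    have : (\int[leb]_(x in w) (q x * phi k x)%:E)%E = 0%E.
      have fn : (\int[leb]_(x in w) (q x * phi k x)%:E)%E \is a fin_num.
        by apply: integrable_fin_num => //; exact: L2_mul_integrable.
      by rewrite -(fineK fn) q0k.
    rewrite integral_mkcond [in X in _ -> X]integral_mkcond => <-.
    apply: eq_integral => x _; rewrite !patchE; case: ifPn => [|/negP nV].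
      by move=> /set_mem/Vw wx; rewrite mem_set.
    case: ifPn => // _; rewrite phi0 ?mulr0//; move=> Vx; apply: nV; exact: mem_set.
  rewrite (_ : [sequence _]_n = cst 0%E); last by apply/funext => k; exact: z.
  by move=> h; exact: esym (cvg_unique (@ereal_hausdorff R) (cvg_cst _) h).
have key m : {ae leb, forall x, W m x -> q x = 0}.
  have : ae_eq leb (W m) (EFin \o q) (cst 0%E).
    apply: (@integral_ae_eq _ _ _ leb) => // A AW mA.
    rewrite integral0 -(setIidl AW).
    suff P S : <<s (@open E) >> S -> (\int[leb]_(x in S `&` W m) (q x)%:E = 0)%E.
      by apply: P; rewrite -rV_measurable_opens.
    move: S; apply: (@dynkin_induction _ E open
      (fun S => (\int[leb]_(x in S `&` W m) (q x)%:E = 0)%E) rV_measurable_opens).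
    - by move=> U V; exact: openI.
    - by apply: open0; exact: openT.
    - by move=> U; exact: open0.
    - move=> S mS S0; have := open0 m setT openT.
      have mq : measurable_fun (W m) (EFin \o q) by exact: measurable_int (iW m).
      rewrite setTI -[X in integral _ X _]setTI -(setUv S) setIUl integral_setU//=.
      + by rewrite S0 add0e.
      + exact: measurableI.
      + by apply: measurableI => //; exact: measurableC.
      + by apply: measurable_funS mq => // x [[]|[]].
      + by apply/disj_set2P/seteqP; split=> // x [[Sx _] [nSx _]]; exact: nSx.
    - move=> F mF tF F0; rewrite setI_bigcupl integral_bigcup.
      + by rewrite eseries0// => k _ _; exact: F0.
      + apply/trivIsetP => i j _ _ ij; move/trivIsetP : tF => /(_ i j I I ij) Fij.
        by rewrite setIACA Fij set0I.
      + by move=> k; exact: measurableI.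
      + apply: integrableS (iW m) => //; last by move=> x [k _ []].
        by apply: bigcup_measurable => k _; exact: measurableI.
  by apply: filterS => x h /h [].
apply: filterS (ae_foralln key) => x h wx.
have [m hm] : exists m : nat, `|x| < m.+1%:R.
  by exists (Num.truncn `|x|); rewrite truncnS_gt.
by apply: (h m); split=> //; rewrite -ball_normE /= sub0r normrN.
Qed.

End fundamental_lemma.

(** * Integration by parts against test functions *)

Section integration_by_parts.
Context {R : realType}.

Lemma rV_cons_addl n (x h : R) (y : 'rV[R]_n) :
  rV_cons (h + x, y) = h *: delta_mx ord0 ord0 + rV_cons (x, y).
Proof.
apply/rowP => i; rewrite !mxE eqxx /=; case: (unliftP ord0 i) => [j ->|->].
  by rewrite /= mulr0 add0r.
by rewrite /= mulr1.
Qed.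

Lemma rV_cons_addr n (x h : R) (y : 'rV[R]_n) j :
  rV_cons (x, h *: delta_mx ord0 j + y) = h *: delta_mx ord0 (lift ord0 j) + rV_cons (x, y).
Proof.
apply/rowP => i; rewrite !mxE eqxx /=; case: (unliftP ord0 i) => [k ->|->].
  by rewrite /= !mxE eqxx (inj_eq lift_inj).
by rewrite /= mulr0 add0r.
Qed.

Lemma rV_cons_continuousl n (y : 'rV[R]_n) : continuous (fun x : R => rV_cons (x, y)).
Proof.
move=> x; apply/cvgrPdist_le => e e0; near=> t.
apply/(rV_normP _ (ltW e0)) => i; rewrite !mxE; case: unliftP => [j _|_] /=.
  by rewrite subrr normr0 ltW.
by near: t; exact: cvgr_dist_le.
Unshelve. all: by end_near. Qed.

Lemma rV_cons_continuousr n (x : R) : continuous (fun y : 'rV[R]_n => rV_cons (x, y)).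
Proof.
move=> y; apply/(@cvgrPdist_le _ _ _ (nbhs y) (nbhs_filter y)) => e e0; near=> t.
apply/(rV_normP _ (ltW e0)) => i; rewrite !mxE; case: unliftP => [j _|_] /=; last first.
  by rewrite subrr normr0 ltW.
have -> : y ord0 j - t ord0 j = (y - t) ord0 j by rewrite !mxE.
apply: le_trans (rV_coord_norm _ _) _; near: t.
by apply/nbhs_ballP; exists e => //= t; rewrite -ball_normE /= => /ltW.
Unshelve. all: by end_near. Qed.

Lemma derive_line (U V : normedModType R) (f : U -> R) (g : V -> R) x v y u :
  (forall h : R, f (h *: v + x) = g (h *: u + y)) ->
  'D_v f x = 'D_u g y /\ (derivable f x v -> derivable g y u).
Proof.
move=> fg; have f0 : f x = g y by have := fg 0; rewrite !scale0r !add0r.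
have E : (fun h : R => h^-1 *: ((f \o shift x) (h *: v) - f x)) =
    (fun h => h^-1 *: ((g \o shift y) (h *: u) - g y)).
  by apply/funext => h /=; rewrite fg f0.
by split; [rewrite /derive E|rewrite /derivable E].
Qed.

Lemma lebesgue_rVS_integral n (g : 'rV[R]_n.+1 -> R) :
  (@lebesgue_rV R n.+1).-integrable setT (EFin \o g) ->
  (\int[@lebesgue_rV R n.+1]_x (g x)%:E =
   \int[(@lebesgue_measure R \x @lebesgue_rV R n)%E]_p (g (rV_cons p))%:E)%E /\
  (@lebesgue_measure R \x @lebesgue_rV R n)%E.-integrable setT (EFin \o g \o @rV_cons R n).
Proof.
move=> ig; have mc := @measurable_rV_cons R n.
have mg : measurable_fun setT (EFin \o g) by exact: measurable_int ig.
have i2 : (@lebesgue_measure R \x @lebesgue_rV R n)%E.-integrable setT (EFin \o g \o @rV_cons R n).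
  apply/integrableP; split; first exact: measurableT_comp.
  have /integrableP[_] := ig; apply: le_lt_trans.
  rewrite [leRHS](_ : _ = (\int[pushforward (@lebesgue_measure R \x @lebesgue_rV R n)%E (@rV_cons R n)]_x
     `|(EFin \o g) x|)%E)//.
  by rewrite ge0_integral_pushforward//; exact: measurableT_comp.
split=> //.
rewrite [LHS](_ : _ = (\int[pushforward (@lebesgue_measure R \x @lebesgue_rV R n)%E (@rV_cons R n)]_(x in setT) (g x)%:E)%E)//.
rewrite (@integral_pushforward _ _ _ _ _ _ mc _ setT)//.
Qed.

Lemma integral_derive1_0 (F f : R -> R) (M : R) :
  (forall x, is_derive x (1 : R) F (f x)) -> continuous f ->
  (forall x, M < `|x| -> F x = 0 /\ f x = 0) ->
  (\int[@lebesgue_measure R]_x (f x)%:E = 0)%E.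
Proof.
move=> dF cf F0; pose A := `|M| + 1.
have MA : M < A by rewrite (le_lt_trans (ler_norm _))// ltrDl.
have A0 : 0 < A by rewrite ltr_wpDl.
have cF : continuous F.
  by move=> x; apply/differentiable_continuous/derivable1_diffP; case: (dF x).
have -> : (\int[@lebesgue_measure R]_x (f x)%:E = \int[@lebesgue_measure R]_(x in [set` `[- A, A]%R]) (f x)%:E)%E.
  rewrite [RHS]integral_mkcond; apply: eq_integral => x _; rewrite patchE; case: ifPn => //.
  move=> /negP nx; have [|_ ->//] := F0 x; apply: lt_trans MA _; rewrite ltNge; apply/negP.
  by rewrite ler_norml => h; apply: nx; rewrite mem_set//= in_itv.
rewrite (@continuous_FTC2 _ f F).
- rewrite (F0 A _).1 ?(F0 (- A) _).1 ?subee//; first by rewrite normrN gtr0_norm.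
  by rewrite gtr0_norm.
- lra.
- exact: continuous_subspaceT.
- split; first by move=> x _; case: (dF x).
  + by apply: cvg_at_right_filter; exact: cF.
  + by apply: cvg_at_left_filter; exact: cF.
- by move=> x _; rewrite derive1E (@derive_val _ _ _ _ _ _ _ (dF x)).
Qed.

(** Fubini singles out the first coordinate. A derivative along it integrates to 0 on each line by
    the fundamental theorem of calculus, and a derivative along another coordinate does so on each
    slice by induction on the dimension. *)
Lemma integral_pderiv_0 n (i : 'I_n) (f : 'rV[R]_n -> R) (M : R) :
  (forall x, derivable f x (delta_mx ord0 i)) -> continuous (pderiv i f) ->
  (forall x, M < `|x| -> f x = 0 /\ pderiv i f x = 0) ->
  (\int[@lebesgue_rV R n]_x (pderiv i f x)%:E = 0)%E.
Proof.
elim: n i f => [|n ih] i f; first by case: i.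
move=> df cf f0.
have ig : (@lebesgue_rV R n.+1).-integrable setT (EFin \o pderiv i f).
  apply: (@compact_support_integrable _ _ _ [set x | `|x| <= M]) => //.
    apply: bounded_closed_compact; first by exists M; split=> [|N MN x /= /le_trans]; [exact: num_real|apply; exact: ltW].
    apply: (@closed_comp _ _ _ [set r | r <= M]); last exact: closed_le.
    by move=> x _; exact: norm_continuous.
  by move=> x /= /negP; rewrite -ltNge => /f0[].
have [-> ip] := lebesgue_rVS_integral ig.
case: (unliftP ord0 i) => [j|] iE; rewrite {i}iE in df cf f0 ig ip *.
  rewrite -(integral12_prod_meas1 ip) /fubini_F integral0_eq// => x _ /=.
  have E y : pderiv (lift ord0 j) f (rV_cons (x, y)) = pderiv j (fun y => f (rV_cons (x, y))) y.
    by apply: (derive_line _).1 => h; rewrite rV_cons_addr.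
  under eq_integral do rewrite E.
  apply: ih.
  - move=> y; apply: (derive_line _).2 (df (rV_cons (x, y))) => h.
    by rewrite rV_cons_addr.
  - rewrite (_ : pderiv j _ = pderiv (lift ord0 j) f \o (fun y => rV_cons (x, y))).
      by move=> y; apply: continuous_comp; [exact: rV_cons_continuousr|exact: cf].
    by apply/funext => y /=; rewrite E.
  - move=> y My; rewrite -E; apply: f0; apply: lt_le_trans My _.
    apply/(rV_normP _ (normr_ge0 _)) => k; apply: le_trans (rV_coord_norm _ (lift ord0 k)).
    by rewrite mxE liftK.
rewrite -(integral21_prod_meas1 ip) /fubini_G integral0_eq// => y _ /=.
apply: (@integral_derive1_0 (fun x => f (rV_cons (x, y))) _ M).
- move=> x; have L h : f (h *: delta_mx ord0 ord0 + rV_cons (x, y)) = f (rV_cons (h *: (1 : R) + x, y)).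
    by rewrite /GRing.scale /= mulr1 rV_cons_addl.
  by split; [exact: (derive_line L).2|rewrite -(derive_line L).1].
- move=> x; apply: (@continuous_comp _ _ _ (fun x => rV_cons (x, y)) (pderiv ord0 f)); last exact: cf.
  exact: rV_cons_continuousl.
- move=> x Mx; apply: f0; apply: lt_le_trans Mx _.
  by apply: le_trans (rV_coord_norm _ ord0); rewrite mxE unlift_none.
Qed.

(** By the product rule the two sides differ by the integral of a partial derivative of [f * g],
    which is compactly supported in [w]. *)
Lemma integration_by_parts d (w : set 'rV[R]_d) (f g : 'rV[R]_d -> R) i :
  measurable w -> smooth f -> test_function w g ->
  ip w f (pderiv i g) = - ip w (pderiv i f) g.
Proof.
move=> mw sf tg; have [sg [K [cK Kw gK]]] := tg.
have df := smooth_diff sf; have dg := smooth_diff sg.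
have [_ [K' [cK' K'w g'K]]] := test_function_pderiv i tg.
have suppT h : continuous h -> (forall x, ~ (K `|` K') x -> h x = 0) ->
    (@lebesgue_rV R d).-integrable setT (EFin \o h).
  by move=> ch h0; apply: compact_support_integrable ch _ h0; exact: compactU.
have restrict h : (forall x, ~ (K `|` K') x -> h x = 0) ->
    \int[@lebesgue_rV R d]_(x in w) h x = \int[@lebesgue_rV R d]_x h x.
  move=> h0; rewrite Rintegral_mkcond; apply: eq_Rintegral => x _; rewrite patchE.
  case: ifPn => // /negP nw; rewrite h0//; case=> [/Kw|/K'w] wx; apply: nw; exact: mem_set.
have s1 x : ~ (K `|` K') x -> f x * pderiv i g x = 0.
  by move=> n; rewrite g'K ?mulr0// => Kx; apply: n; right.
have s2 x : ~ (K `|` K') x -> pderiv i f x * g x = 0.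
  by move=> n; rewrite gK ?mulr0// => Kx; apply: n; left.
have cdf := smooth_continuous (smooth_pderiv i sf).
have cdg := smooth_continuous (smooth_pderiv i sg).
have cf := smooth_continuous sf; have cg := smooth_continuous sg.
rewrite /ip !restrict//; apply/eqP; rewrite -addr_eq0; apply/eqP.
rewrite -RintegralD//; last 2 first.
- by apply: suppT s1; move=> x; exact: cvgM (cf x) (cdg x).
- by apply: suppT s2; move=> x; exact: cvgM (cdf x) (cg x).
have E x : f x * pderiv i g x + pderiv i f x * g x = pderiv i (f * g) x.
  by rewrite pderivM// [pderiv i f x * _]mulrC.
under eq_Rintegral do rewrite E.
rewrite /Rintegral.
have [M0 [_ hM]] : bounded_set (K `|` K') by apply: compact_bounded; exact: compactU.
rewrite (@integral_pderiv_0 _ i (f * g) (M0 + 1))//.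
- by move=> x; apply: derivableM; exact: smooth_derivable.
- rewrite pderivM// => x.
  exact: (cvgD (cvgM (cf x) (cdg x)) (cvgM (cg x) (cdf x))).
- move=> x Mx; have nK : ~ (K `|` K') x.
    have M1 : M0 < M0 + 1 by rewrite ltrDl.
    by move=> /(hM _ M1 _) /=; rewrite leNgt Mx.
  rewrite -E s1// s2// addr0; split=> //.
  by rewrite (_ : (f * g) x = f x * g x)// gK ?mulr0// => Kx; apply: nK; left.
Qed.

End integration_by_parts.

(** * Completeness transported along finitely many components *)

Section pullback.
Context {R : realType} {X Z : lmodType R} {I : finType}.
Variables (DZ : Z -> Prop) (ipZ : Z -> Z -> R).
Hypothesis HZ : semiHilbert DZ ipZ.
Variables (D : X -> Prop) (ipX : X -> X -> R) (c : I -> X -> Z).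
Local Notation nZ := (snorm ipZ).
Local Notation nX := (snorm ipX).
Hypothesis D0 : D 0.
Hypothesis DL : forall a x y, D x -> D y -> D (a *: x + y).
Hypothesis Dc : forall i x, D x -> DZ (c i x).
(* The components need only be linear up to null vectors, as is the case of
   weak derivatives. *)
Hypothesis cL : forall i a x y, D x -> D y -> nZ (c i (a *: x + y) - (a *: c i x + c i y)) = 0.
Hypothesis ipE : forall x y, D x -> D y -> ipX x y = \sum_i ipZ (c i x) (c i y).

Lemma null_bounded (l : Z -> R) M x y : linear_on DZ l -> bounded_by DZ ipZ M l ->
  DZ x -> DZ y -> nZ (x - y) = 0 -> l x = l y.
Proof.
move=> L B Dx Dy n0; apply/eqP; rewrite -subr_eq0 -(linB L)// -normr_le0.
by apply: le_trans (B _ (shB HZ Dx Dy)) _; rewrite n0 mulr0.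
Qed.

Lemma null_ipl x x' y : DZ x -> DZ x' -> DZ y -> nZ (x - x') = 0 -> ipZ x y = ipZ x' y.
Proof.
move=> Dx Dx' Dy n0; rewrite (ipC HZ Dx Dy) (ipC HZ Dx' Dy).
exact: (null_bounded (ip_linr HZ Dy) (ip_bounded HZ Dy)).
Qed.

Lemma null_snorm x y : DZ x -> DZ y -> nZ (x - y) = 0 -> nZ x = nZ y.
Proof.
move=> Dx Dy n0; rewrite /snorm (null_ipl Dx Dy Dx n0) (ipC HZ Dy Dx) (null_ipl Dx Dy Dy n0).
by [].
Qed.

Lemma comp_sub i x y : D x -> D y -> nZ (c i (x - y)) = nZ (c i x - c i y).
Proof.
move=> Dx Dy; have Dxy : D (x - y) by rewrite addrC -scaleN1r; exact: DL.
apply: null_snorm; [exact: Dc|by apply: (shB HZ); exact: Dc|].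
have := cL i (-1) Dy Dx; rewrite !scaleN1r.
by rewrite [- y + x]addrC [- c i y + _]addrC.
Qed.

Lemma comp_le i x : D x -> nZ (c i x) <= nX x.
Proof.
move=> Dx; rewrite /snorm ler_sqrt; last first.
  by rewrite ipE//; apply: sumr_ge0 => j _; apply: (ip_ge0 HZ); exact: Dc.
rewrite ipE// (bigD1 i)//= lerDl; apply: sumr_ge0 => j _.
by apply: (ip_ge0 HZ); exact: Dc.
Qed.

Lemma snorm_le_sum x : D x -> nX x <= \sum_i nZ (c i x).
Proof.
move=> Dx; rewrite -(@ler_pXn2r _ 2)// ?nnegrE ?sqrtr_ge0 ?sumr_ge0//; last first.
  by move=> i _; exact: snorm_ge0.
rewrite sqr_sqrtr; last first.
  by rewrite ipE//; apply: sumr_ge0 => j _; apply: (ip_ge0 HZ); exact: Dc.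
rewrite ipE// (eq_bigr (fun i => nZ (c i x) ^+ 2)); last first.
  by move=> i _; rewrite (snorm_sqr HZ)//; exact: Dc.
have : forall s : seq I, \sum_(i <- s) nZ (c i x) ^+ 2 <= (\sum_(i <- s) nZ (c i x)) ^+ 2.
  elim=> [|i s ih]; first by rewrite !big_nil expr0n.
  rewrite !big_cons sqrrD -addrA lerD2l; apply: le_trans ih _; rewrite lerDr.
  apply: mulrn_wge0; apply: mulr_ge0; first exact: snorm_ge0.
  by apply: sumr_ge0 => j _; exact: snorm_ge0.
by apply.
Qed.

(** The components map [X] isometrically to a finite power of [Z], so completeness of [X] amounts to
    closedness of the range up to null vectors, which is the hypothesis. Square integrable fields,
    H^1, the broken test space and the trial space all get their completeness from here. *)
Lemma semiHilbert_pullback :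
  (forall (u : nat -> X) (z : I -> Z), (forall m, D (u m)) -> (forall i, DZ (z i)) ->
    (forall i, (fun m => nZ (c i (u m) - z i)) @ \oo --> (0 : R)) ->
    exists x, D x /\ forall i, nZ (z i - c i x) = 0) ->
  semiHilbert D ipX.
Proof.
move=> cl; have DB x y : D x -> D y -> D (x - y).
  by move=> Dx Dy; rewrite addrC -scaleN1r; exact: DL.
split=> //.
- move=> x y Dx Dy; rewrite !ipE//; apply: eq_bigr => i _; apply: (ipC HZ); exact: Dc.
- move=> a x y z Dx Dy Dz; rewrite (ipE (DL a Dx Dy) Dz) (ipE Dx Dz) (ipE Dy Dz) mulr_sumr -big_split /=.
  apply: eq_bigr => i _; have Dx' := Dc i Dx; have Dy' := Dc i Dy; have Dz' := Dc i Dz.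
  by rewrite (null_ipl _ _ _ (cL i a Dx Dy)) ?(ipL HZ)//; [exact/Dc/DL|exact: (shL HZ)].
- move=> x Dx; rewrite ipE//; apply: sumr_ge0 => i _; apply: (ip_ge0 HZ); exact: Dc.
move=> u Du cu.
have exz i : exists z, DZ z /\ (fun m => nZ (c i (u m) - z)) @ \oo --> (0 : R).
  apply: (sh_complete HZ) => [m|e /cu[n0 hn]]; first exact: Dc.
  exists n0 => a b na nb; rewrite -/(nZ _) -comp_sub//.
  by apply: le_trans (hn _ _ na nb); exact/comp_le/DB.
have [z zP] := choice exz.
have [x [Dx xP]] := cl u z Du (fun i => (zP i).1) (fun i => (zP i).2).
exists x; split=> //.
apply: (@squeeze_cvgr _ _ _ _ (fun=> 0) (fun m => \sum_i nZ (c i (u m) - z i))).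
- apply: nearW => m; rewrite sqrtr_ge0 /=.
  apply: le_trans (snorm_le_sum (DB _ _ (Du m) Dx)) _; apply: ler_sum => i _.
  rewrite comp_sub//; apply: le_trans (snorm_dist HZ _ (zP i).1 _) _; [exact: Dc..|].
  by rewrite xP addr0.
- exact: cvg_cst.
- suff : forall s : seq I, (fun m => \sum_(i <- s) nZ (c i (u m) - z i)) @ \oo --> (0 : R) by apply.
  elim=> [|i s ih]; first by under eq_fun do rewrite big_nil; exact: cvg_cst.
  rewrite (_ : (fun m => _) = (fun m => nZ (c i (u m) - z i)) + (fun m => \sum_(i <- s) nZ (c i (u m) - z i))).
    by have h := cvgD (zP i).2 ih; rewrite addr0 in h; exact: h.
  by apply/funext => m; rewrite big_cons.
Qed.

End pullback.

Section null_functions.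
Context {R : realType} {d : nat}.
Local Notation E := 'rV[R]_d.
Local Notation leb := (@lebesgue_rV R d).
Variable w : set E.
Hypothesis mw : measurable w.
Implicit Types f g h : E -> R.
Let HL := L2_semiHilbert mw.
Local Notation nm := (snorm (ip w)).

Lemma null_ae f : L2 w f -> nm f = 0 <-> {ae leb, forall x, w x -> f x = 0}.
Proof.
move=> Lf; have mf2 : measurable_fun w (fun x => (f x ^+ 2)%:E).
  by apply/measurable_EFinP/measurable_funX; case: Lf.
have -> : (nm f = 0) <-> (\int[leb]_(x in w) `|(f x ^+ 2)%:E| = 0)%E.
  under eq_integral do rewrite gee0_abs ?lee_fin ?sqr_ge0//.
  rewrite -ip_sqr// -(snorm_sqr HL)//; split=> [->|[] /eqP]; first by rewrite expr0n.
  by rewrite sqrf_eq0 => /eqP.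
rewrite ae_eq_integral_abs//; split; apply: filterS => x h wx.
  by have [/eqP] := h wx; rewrite sqrf_eq0 => /eqP.
by rewrite h// expr0n.
Qed.

Lemma ae_eq_L2 f g : measurable_fun w g -> L2 w f ->
  {ae leb, forall x, w x -> f x = g x} -> L2 w g.
Proof.
move=> mg [mf iff] fg; split=> //; apply/integrableP; split.
  by apply/measurable_EFinP/measurable_funX.
have /integrableP[_] := iff; rewrite (@ae_eq_integral _ _ _ leb w (abse \o (EFin \o (fun x => g x ^+ 2))))//.
- by apply/measurableT_comp => //; apply/measurable_EFinP/measurable_funX.
- by apply/measurableT_comp => //; apply/measurable_EFinP/measurable_funX.
- by apply: filterS fg => x h wx /=; rewrite h.
Qed.

End null_functions.

(** * Sobolev spaces *)

Lemma big_unit {R : Type} (idx : R) (op : Monoid.law idx) (F : unit -> R) :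
  \big[op/idx]_(i : unit) F i = F tt.
Proof. by rewrite (big_pred1 tt)//; case. Qed.

Section vector_fields.
Context {R : realType} {d : nat}.
Local Notation E := 'rV[R]_d.
Local Notation leb := (@lebesgue_rV R d).
Variable w : set E.
Hypothesis mw : measurable w.
Implicit Types (f g h u v : E -> R) (q r : E -> E).
Let HL := L2_semiHilbert mw.
Local Notation nm := (snorm (ip w)).

Definition cmp (i : 'I_d) q : E -> R := fun x => q x ord0 i.

Lemma cmp_lin i a q r : cmp i (a *: q + r) = a *: cmp i q + cmp i r.
Proof. by apply/funext => x; rewrite /cmp /= !mxE. Qed.

Lemma ipvE q r : L2v w q -> L2v w r -> ipv w q r = \sum_i ip w (cmp i q) (cmp i r).
Proof.
move=> Lq Lr; rewrite /ipv /dotp.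
have ii i : leb.-integrable w (EFin \o (fun x => cmp i q x * cmp i r x)).
  by apply: L2_mul_integrable => //; [exact: Lq|exact: Lr].
suff : forall s : seq 'I_d, \int[leb]_(x in w) (\sum_(i <- s) q x ord0 i * r x ord0 i) =
    \sum_(i <- s) ip w (cmp i q) (cmp i r) by apply.
elim=> [|i s ih].
  rewrite big_nil (@eq_Rintegral _ _ _ leb w (cst 0)); last by move=> x _; rewrite big_nil.
  by rewrite /Rintegral integral0.
rewrite big_cons -ih (@eq_Rintegral _ _ _ leb w (fun x => cmp i q x * cmp i r x + \sum_(i <- s) q x ord0 i * r x ord0 i)).
  rewrite RintegralD//; rewrite (_ : _ \o _ = (fun x => (\sum_(i <- s) (cmp i q x * cmp i r x)%:E)%E)).
    by apply: integrable_sum => // i' _; exact: ii.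
  by apply/funext => x /=; rewrite sumEFin.
by move=> x _; rewrite big_cons.
Qed.

Lemma L2v_lin a q r : L2v w q -> L2v w r -> L2v w (a *: q + r).
Proof.
by move=> Lq Lr i; rewrite -/(cmp i _) cmp_lin; apply: (L2_lin mw); [exact: Lq|exact: Lr].
Qed.

Lemma L2v_0 : L2v w 0.
Proof.
by move=> i; rewrite (_ : (fun x => _) = 0); [exact: L2_0|apply/funext => x; rewrite mxE].
Qed.

Lemma L2v_semiHilbert : semiHilbert (L2v w) (ipv w).
Proof.
apply: (@semiHilbert_pullback _ _ _ _ _ _ HL (L2v w) (ipv w) cmp).
- exact: L2v_0.
- exact: L2v_lin.
- by move=> i q Lq; exact: Lq.
- by move=> i a q r _ _; rewrite cmp_lin subrr (snorm0 HL).
- exact: ipvE.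
- move=> u z _ Lz _; exists (fun x => \row_i z i x).
  have cE i : cmp i (fun x => \row_i z i x) = z i by apply/funext => x; rewrite /cmp mxE.
  by split=> i; [rewrite -/(cmp i _) cE|rewrite cE subrr (snorm0 HL)].
Qed.

Lemma ipv_lin_test q i phi : ipv w q (fun x => phi x *: delta_mx ord0 i) = ip w (cmp i q) phi.
Proof.
apply: eq_Rintegral => x _; rewrite /dotp (bigD1 i)//= !mxE !eqxx mulr1 big1 ?addr0//.
by move=> j ji; rewrite !mxE eqxx (negPf ji) !mulr0.
Qed.

End vector_fields.

Section sobolev_theory.
Context {R : realType} {d : nat}.
Local Notation E := 'rV[R]_d.
Local Notation leb := (@lebesgue_rV R d).
Variable w : set E.
Hypothesis ow : open w.
Implicit Types (f g h u v phi : E -> R) (q r : E -> E).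
Let mw := rV_open_measurable ow.
Let HL := L2_semiHilbert mw.
Local Notation nm := (snorm (ip w)).
Local Notation null f := (snorm (ip w) f = 0).

Lemma test_L2 phi : test_function w phi -> L2 w phi.
Proof. exact: test_function_L2. Qed.
Hint Resolve test_L2 : core.

Lemma test_pderiv_L2 i phi : test_function w phi -> L2 w (pderiv i phi).
Proof. by move=> t; apply: test_L2; exact: test_function_pderiv. Qed.

Lemma fundamental_null g : L2 w g -> (forall phi, test_function w phi -> ip w g phi = 0) -> null g.
Proof. by move=> Lg h; apply/(null_ae mw Lg); exact: fundamental_lemma. Qed.

Lemma nullN f g : L2 w f -> L2 w g -> null (f - g) -> null (g - f).
Proof. by move=> Lf Lg <-; exact: (snorm_sub HL). Qed.

Lemma ip_nulll f f' g : L2 w f -> L2 w f' -> L2 w g -> null (f - f') -> ip w f g = ip w f' g.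
Proof. exact: null_ipl. Qed.

Lemma ip_nullr f f' g : L2 w f -> L2 w f' -> L2 w g -> null (f - f') -> ip w g f = ip w g f'.
Proof. by move=> Lf Lf' Lg n; rewrite (ipC HL Lg Lf) (ipC HL Lg Lf'); exact: (null_ipl HL). Qed.

Lemma ip_cvg (u : nat -> E -> R) f g : (forall m, L2 w (u m)) -> L2 w f -> L2 w g ->
  (fun m => nm (u m - f)) @ \oo --> (0 : R) -> (fun m => ip w (u m) g) @ \oo --> ip w f g.
Proof.
move=> Lu Lf Lg cu; rewrite (ipC HL Lf Lg).
have -> : (fun m => ip w (u m) g) = ip w g \o u by apply/funext => m; rewrite /= (ipC HL).
exact: (lin_bounded_cvg HL (ip_linr HL Lg) (ip_bounded HL Lg)).
Qed.

Lemma is_wgrad_closed (u : nat -> E -> R) (q : nat -> E -> E) f r :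
  (forall m, L2 w (u m)) -> L2 w f -> L2v w r -> (forall m, is_wgrad w (u m) (q m)) ->
  (fun m => nm (u m - f)) @ \oo --> (0 : R) ->
  (forall i, (fun m => nm (cmp i (q m) - cmp i r)) @ \oo --> (0 : R)) -> is_wgrad w f r.
Proof.
move=> Lu Lf Lr gu cu cq; split=> // phi tphi i.
have Lq m : L2v w (q m) by case: (gu m).
have c1 := ip_cvg Lu Lf (test_pderiv_L2 i tphi) cu.
have c2 := ip_cvg (fun m => Lq m i) (Lr i) (test_L2 tphi) (cq i).
apply: (@cvg_unique _ (@Rhausdorff R) _ _ _ _ c1).
rewrite (_ : (fun m => _) = (fun m => - ip w (cmp i (q m)) phi)); first exact: cvgN.
by apply/funext => m; exact: (gu m).2.
Qed.

Lemma is_wgrad_lin a u v q r : L2 w u -> L2 w v -> is_wgrad w u q -> is_wgrad w v r ->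
  is_wgrad w (a *: u + v) (a *: q + r).
Proof.
move=> Lu Lv [Lq hq] [Lr hr]; split; first exact: L2v_lin.
move=> phi tphi i; rewrite -/(cmp i _) cmp_lin.
have Lp := test_L2 tphi; have Ldp := test_pderiv_L2 i tphi.
rewrite (ipL HL _ Lu Lv Ldp) (ipL HL _ (Lq i) (Lr i) Lp) hq// hr// mulrN opprD.
by [].
Qed.

Lemma is_wgrad_unique u u' q q' i : L2 w u -> L2 w u' -> is_wgrad w u q -> is_wgrad w u' q' ->
  null (u - u') -> null (cmp i q - cmp i q').
Proof.
move=> Lu Lu' [Lq hq] [Lq' hq'] n.
apply: fundamental_null => [|phi tphi]; first by apply: (shB HL); [exact: Lq|exact: Lq'].
rewrite (ipBl HL (Lq i) (Lq' i) (test_L2 tphi)).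
have := hq _ tphi i; have := hq' _ tphi i.
rewrite (ip_nulll Lu Lu' (test_pderiv_L2 i tphi) n) => -> /eqP.
by rewrite eqr_opp => /eqP ->; rewrite subrr.
Qed.

Lemma wgradP u : H1space w u -> is_wgrad w u (wgrad w u).
Proof. by move=> [_ /(xgetPex 0)]. Qed.

Lemma H1_L2 u : H1space w u -> L2 w u. Proof. by case. Qed.
Lemma H1_L2v u : H1space w u -> L2v w (wgrad w u). Proof. by move=> /wgradP[]. Qed.
Lemma H1_cmp i u : H1space w u -> L2 w (cmp i (wgrad w u)).
Proof. by move=> /H1_L2v; apply. Qed.

Lemma wgrad_eq u q i : L2 w u -> is_wgrad w u q -> null (cmp i (wgrad w u) - cmp i q).
Proof.
move=> Lu gq; have H1u : H1space w u by split=> //; exists q.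
by apply: is_wgrad_unique (wgradP H1u) gq _ => //; rewrite subrr (snorm0 HL).
Qed.

Lemma H1_0 : H1space w 0.
Proof.
split; first exact: L2_0.
exists 0; split; first exact: L2v_0.
move=> phi tphi i; rewrite (_ : (fun x => _) = 0); last by apply/funext => x; rewrite mxE.
have l0 f : L2 w f -> ip w 0 f = 0.
  by move=> Lf; rewrite -(scale0r (0 : E -> R)) (ipZl HL) ?mul0r//; exact: L2_0.
by rewrite !l0 ?oppr0//; [exact: test_L2|exact: test_pderiv_L2].
Qed.

Lemma H1_lin a u v : H1space w u -> H1space w v -> H1space w (a *: u + v).
Proof.
move=> Hu Hv; split; first by apply: (L2_lin mw); exact: H1_L2.
by exists (a *: wgrad w u + wgrad w v); apply: is_wgrad_lin (wgradP _) (wgradP _) => //; exact: H1_L2.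
Qed.

Definition ipH1 u v : R := ip w u v + ipv w (wgrad w u) (wgrad w v).

Definition cH1 (i : unit + 'I_d) u : E -> R :=
  match i with inl _ => u | inr j => cmp j (wgrad w u) end.

(** Weak gradients are picked by choice, so they are linear only up to a null vector, by
    uniqueness. *)
Lemma cH1_lin i a u v : H1space w u -> H1space w v ->
  null (cH1 i (a *: u + v) - (a *: cH1 i u + cH1 i v)).
Proof.
move=> Hu Hv; case: i => [i|j] /=; first by rewrite subrr (snorm0 HL).
rewrite -cmp_lin; apply: wgrad_eq; first exact: H1_L2 (H1_lin _ _ _).
by apply: is_wgrad_lin (wgradP _) (wgradP _) => //; exact: H1_L2.
Qed.

Lemma cH1_L2 i u : H1space w u -> L2 w (cH1 i u).
Proof. by move=> Hu; case: i => [i|j]; [exact: H1_L2|exact: H1_cmp]. Qed.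

Lemma ipH1E u v : H1space w u -> H1space w v -> ipH1 u v = \sum_i ip w (cH1 i u) (cH1 i v).
Proof.
by move=> Hu Hv; rewrite big_sumType big_unit /ipH1 (ipvE mw)//; exact: H1_L2v.
Qed.

Lemma H1_semiHilbert : semiHilbert (H1space w) ipH1.
Proof.
apply: (semiHilbert_pullback HL (c := cH1)).
- exact: H1_0.
- by move=> a u v; exact: H1_lin.
- by move=> i u; exact: cH1_L2.
- by move=> i a u v; exact: cH1_lin.
- exact: ipH1E.
move=> u z Hu Lz cz; pose r x := \row_j z (inr j) x.
have cr j : cmp j r = z (inr j) by apply/funext => x; rewrite /cmp mxE.
have g : is_wgrad w (z (inl tt)) r.
  apply: (is_wgrad_closed (fun m => H1_L2 (Hu m)) (Lz _) _ (fun m => wgradP (Hu m))).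
  - by move=> j; rewrite -/(cmp j r) cr.
  - exact: (cz (inl tt)).
  - by move=> j; rewrite cr; exact: (cz (inr j)).
exists (z (inl tt)); split; first by split=> //; exists r.
case=> [[]|j] /=; first by rewrite subrr (snorm0 HL).
rewrite -cr; apply: nullN (wgrad_eq _ _ g) => //; last exact: (g.1 j).
have Hz : H1space w (z (inl tt)) by split=> //; exists r.
exact: H1_cmp.
Qed.

Lemma H1normE u : H1norm w u = snorm ipH1 u. Proof. by []. Qed.

Lemma test_is_wgrad phi : test_function w phi -> is_wgrad w phi (grad phi).
Proof.
move=> tphi; split=> [i|psi tpsi i].
  rewrite (_ : (fun x => _) = pderiv i phi); first exact: test_pderiv_L2.
  by apply/funext => x; rewrite mxE.
rewrite (integration_by_parts i mw tphi.1 tpsi); congr (- ip _ _ _).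
by apply/funext => x; rewrite mxE.
Qed.

Lemma test_H1 phi : test_function w phi -> H1space w phi.
Proof. by move=> tphi; split; [exact: test_L2|exists (grad phi); exact: test_is_wgrad]. Qed.

Lemma cmp_grad i phi : cmp i (grad phi) = pderiv i phi.
Proof. by apply/funext => x; rewrite /cmp mxE. Qed.

Lemma grad_L2v phi : test_function w phi -> L2v w (grad phi).
Proof. by move=> /test_is_wgrad[]. Qed.

Lemma ipv_wgrad q u r : L2v w q -> L2 w u -> is_wgrad w u r -> ipv w q (wgrad w u) = ipv w q r.
Proof.
move=> Lq Lu gr; have H1u : H1space w u by split=> //; exists r.
rewrite !(ipvE mw)//; [|exact: gr.1|exact: H1_L2v]; apply: eq_bigr => i _.
by apply: ip_nullr; [exact: H1_cmp|exact: gr.1|exact: Lq|exact: wgrad_eq].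
Qed.

Lemma H10_adherent u : H10space w u <-> adherent (H1space w) ipH1 (test_function w) u.
Proof. by []. Qed.

Lemma is_wdiv_unique q q' f g : L2v w q -> L2v w q' -> (forall i, null (cmp i q - cmp i q')) ->
  is_wdiv w q f -> is_wdiv w q' g -> null (f - g).
Proof.
move=> Lq Lq' n [Lf hf] [Lg hg]; apply: fundamental_null => [|phi tphi]; first exact: (shB HL).
have Lgr := grad_L2v tphi.
rewrite (ipBl HL Lf Lg (test_L2 tphi)); have := hf _ tphi; have := hg _ tphi.
suff -> : ipv w q' (grad phi) = ipv w q (grad phi).
  by move=> -> /eqP; rewrite eqr_opp => /eqP ->; rewrite subrr.
rewrite !(ipvE mw)//; apply: eq_bigr => i _; apply/esym.
by apply: ip_nulll; [exact: Lq|exact: Lq'|exact: Lgr|].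
Qed.

Lemma wdivP q : Hdiv w q -> is_wdiv w q (wdiv w q).
Proof. by move=> [_ /(xgetPex 0)]. Qed.

Lemma wdiv_L2 q : Hdiv w q -> L2 w (wdiv w q). Proof. by move=> /wdivP[]. Qed.

Lemma wdiv_eq q g : L2v w q -> is_wdiv w q g -> null (wdiv w q - g).
Proof.
move=> Lq gq; have Hq : Hdiv w q by split=> //; exists g.
by apply: is_wdiv_unique (wdivP Hq) gq => // i; rewrite subrr (snorm0 HL).
Qed.

Lemma is_wdiv_lin a q r f g : L2v w q -> L2v w r -> is_wdiv w q f -> is_wdiv w r g ->
  is_wdiv w (a *: q + r) (a *: f + g).
Proof.
move=> Lq Lr [Lf hf] [Lg hg]; split; first exact: (L2_lin mw).
move=> phi tphi; have Lp := test_L2 tphi; have Lgr := grad_L2v tphi.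
rewrite (ipL HL)// (ipL (L2v_semiHilbert mw))// hf// hg// mulrN opprD.
by [].
Qed.

Lemma is_wdiv_closed (q : nat -> E -> E) (f : nat -> E -> R) r g :
  (forall m, L2v w (q m)) -> L2v w r -> L2 w g -> (forall m, is_wdiv w (q m) (f m)) ->
  (forall i, (fun m => nm (cmp i (q m) - cmp i r)) @ \oo --> (0 : R)) ->
  (fun m => nm (f m - g)) @ \oo --> (0 : R) -> is_wdiv w r g.
Proof.
move=> Lq Lr Lg gq cq cf; split=> // phi tphi.
have Lf m : L2 w (f m) by case: (gq m).
have c1 := ip_cvg Lf Lg (test_L2 tphi) cf; have Lgr := grad_L2v tphi.
have : forall s : seq 'I_d, (fun m => \sum_(i <- s) ip w (cmp i (q m)) (cmp i (grad phi))) @ \oo -->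
    \sum_(i <- s) ip w (cmp i r) (cmp i (grad phi)).
  elim=> [|i s ih]; first by rewrite big_nil; under eq_fun do rewrite big_nil; exact: cvg_cst.
  rewrite big_cons.
  rewrite (_ : (fun m => _) = (fun m => ip w (cmp i (q m)) (cmp i (grad phi))) +
    (fun m => \sum_(i <- s) ip w (cmp i (q m)) (cmp i (grad phi)))).
    exact: cvgD (ip_cvg (fun m => Lq m i) (Lr i) (Lgr i) (cq i)) ih.
  by apply/funext => m; rewrite big_cons.
move=> /(_ (index_enum 'I_d)) c2; rewrite (ipvE mw)//.
apply: (@cvg_unique _ (@Rhausdorff R) _ _ _ _ c2).
rewrite (_ : (fun m => _) = (fun m => - ip w (f m) phi)); first exact: cvgN.
by apply/funext => m; rewrite -(gq m).2// (ipvE mw).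
Qed.

Lemma Hdiv_0 : Hdiv w 0.
Proof.
split; first exact: L2v_0.
exists 0; split; first exact: L2_0.
move=> phi tphi; have Lp := test_L2 tphi; have Lgr := grad_L2v tphi.
have e1 : ip w 0 phi = 0 := lin0 (L2_0 w) (ip_linl HL Lp).
have e2 : ipv w 0 (grad phi) = 0 := lin0 (L2v_0 w) (ip_linl (L2v_semiHilbert mw) Lgr).
by rewrite e1 e2 oppr0.
Qed.

Lemma Hdiv_lin a q r : Hdiv w q -> Hdiv w r -> Hdiv w (a *: q + r).
Proof.
move=> Hq Hr; split; first by apply: (L2v_lin mw); [case: Hq|case: Hr].
exists (a *: wdiv w q + wdiv w r).
by apply: is_wdiv_lin (wdivP Hq) (wdivP Hr); [case: Hq|case: Hr].
Qed.

Lemma normal_trace_eq q f u : L2v w q -> is_wdiv w q f -> H1space w u ->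
  normal_trace w q u = ipv w q (wgrad w u) + ip w f u.
Proof.
move=> Lq gf Hu; have Hq : Hdiv w q by split=> //; exists f.
rewrite /normal_trace; congr (_ + _); apply: ip_nulll (wdiv_eq Lq gf).
- exact: wdiv_L2.
- by case: gf.
- exact: H1_L2.
Qed.

Lemma ipv_wgrad_lin q : L2v w q -> linear_on (H1space w) (fun u => ipv w q (wgrad w u)).
Proof.
move=> Lq a u v Hu Hv.
have gl := is_wgrad_lin a (H1_L2 Hu) (H1_L2 Hv) (wgradP Hu) (wgradP Hv).
rewrite (ipv_wgrad Lq (H1_L2 (H1_lin a Hu Hv)) gl).
by rewrite (ip_linr (L2v_semiHilbert mw) Lq)//; exact: H1_L2v.
Qed.

Lemma normal_trace_lin q : Hdiv w q -> linear_on (H1space w) (normal_trace w q).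
Proof.
move=> Hq a u v Hu Hv; rewrite /normal_trace.
have /= -> := ipv_wgrad_lin Hq.1 a Hu Hv.
have -> := ip_linr HL (wdiv_L2 Hq) a (H1_L2 Hu) (H1_L2 Hv).
move: (ipv w q (wgrad w u)) (ipv w q (wgrad w v)) (ip w (wdiv w q) u) (ip w (wdiv w q) v).
by move=> A B C D; rewrite mulrDr addrACA.
Qed.

Lemma snorm_L2_le u : H1space w u -> nm u <= snorm ipH1 u.
Proof. by move=> Hu; exact: (comp_le HL cH1_L2 ipH1E (inl tt) Hu). Qed.

Lemma snorm_wgrad_le u : H1space w u -> snorm (ipv w) (wgrad w u) <= snorm ipH1 u.
Proof.
move=> Hu; rewrite /snorm ler_sqrt; last by rewrite (ip_ge0 H1_semiHilbert).
by rewrite /ipH1 lerDr; apply: (ip_ge0 HL); exact: H1_L2.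
Qed.

Lemma normal_trace_bounded q : Hdiv w q ->
  bounded_by (H1space w) ipH1 (snorm (ipv w) q + nm (wdiv w q)) (normal_trace w q).
Proof.
move=> Hq u Hu; apply: le_trans (ler_normD _ _) _; rewrite mulrDl; apply: lerD.
  apply: le_trans (cauchy_schwarz (L2v_semiHilbert mw) Hq.1 (H1_L2v Hu)) _.
  by apply: ler_wpM2l; [exact: snorm_ge0|exact: snorm_wgrad_le].
apply: le_trans (cauchy_schwarz HL (wdiv_L2 Hq) (H1_L2 Hu)) _.
by apply: ler_wpM2l; [exact: snorm_ge0|exact: snorm_L2_le].
Qed.

Lemma normal_trace_test q phi : Hdiv w q -> test_function w phi -> normal_trace w q phi = 0.
Proof.
move=> Hq tphi; rewrite /normal_trace (ipv_wgrad Hq.1 (test_L2 tphi) (test_is_wgrad tphi)).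
by rewrite (wdivP Hq).2// addNr.
Qed.

Lemma vanish_adherent (C : (E -> R) -> Prop) l M : (forall u, C u -> H1space w u) ->
  linear_on (H1space w) l -> bounded_by (H1space w) ipH1 M l ->
  (forall u, C u -> l u = 0) -> forall u, adherent (H1space w) ipH1 C u -> l u = 0.
Proof.
move=> CH L B l0 u [Hu uP]; apply/eqP; rewrite -normr_le0; apply/ler_addgt0Pl => e e0.
have M1 : 0 < `|M| + 1 by rewrite ltr_wpDl.
have [v [Cv uv]] := uP _ (divr_gt0 e0 M1).
have Huv := shB H1_semiHilbert Hu (CH _ Cv).
have := B _ Huv; rewrite (linB L)//; last exact: CH.
rewrite (l0 _ Cv) subr0 addr0 => /le_trans; apply.
apply: (@le_trans _ _ ((`|M| + 1) * snorm ipH1 (u - v))).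
  by apply: ler_wpM2r; [exact: snorm_ge0|rewrite (le_trans (ler_norm _))// lerDl].
by rewrite mulrC -ler_pdivlMr// ltW.
Qed.

(** A normal trace vanishes on test functions by the definition of the weak divergence, hence on
    their closure. Therefore it depends only on the trace of its argument. *)
Lemma normal_trace_H10 q u : Hdiv w q -> H10space w u -> normal_trace w q u = 0.
Proof.
move=> Hq; apply: (vanish_adherent test_H1 (normal_trace_lin Hq) (normal_trace_bounded Hq)).
by move=> v; exact: normal_trace_test.
Qed.

Lemma H10_H1 u : H10space w u -> H1space w u. Proof. by case. Qed.

Lemma H10_test phi : test_function w phi -> H10space w phi.
Proof.
move=> t; split; first exact: test_H1.
by move=> e e0; exists phi; split=> //; rewrite subrr H1normE (snorm0 H1_semiHilbert).
Qed.

Lemma H10_0 : H10space w 0. Proof. by apply: H10_test; exact: test_function0. Qed.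

Lemma H10_lin a u v : H10space w u -> H10space w v -> H10space w (a *: u + v).
Proof.
move=> [Hu uP] [Hv vP]; split; first exact: H1_lin.
have H := H1_semiHilbert.
move=> e e0; have e2 : 0 < e / 2 by lra.
have a1 : 0 < `|a| + 1 by rewrite ltr_wpDl.
have [f [tf uf]] := uP _ (divr_gt0 e2 a1); have [g [tg vg]] := vP _ e2.
exists (a *: f + g); split; first exact: test_function_lin.
have Huf := shB H Hu (test_H1 tf); have Hvg := shB H Hv (test_H1 tg).
rewrite opprD addrACA -scalerBr H1normE; apply: le_lt_trans (snormD H _ _) _ => //; first exact: (shZ H).
rewrite (snormZ H)// [e]splitr; apply: ler_ltD => //.
apply: (@le_trans _ _ ((`|a| + 1) * snorm ipH1 (u - f))).
  by apply: ler_wpM2r; [exact: snorm_ge0|rewrite lerDl].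
by rewrite mulrC -ler_pdivlMr// ltW.
Qed.

Lemma H10_closed : closed_pred (H1space w) ipH1 (H10space w).
Proof. exact: (adherent_closed H1_semiHilbert test_H1). Qed.

Lemma H10_sub u v : H10space w u -> H10space w v -> H10space w (u - v).
Proof.
move=> Hu Hv; have -> : u - v = (-1) *: v + u by rewrite scaleN1r [RHS]addrC.
exact: H10_lin.
Qed.

Lemma H10_convex : convex_pred (H10space w).
Proof.
move=> t u v t0 t1 Hu Hv.
have -> : u + t *: (v - u) = t *: (v - u) + u by rewrite [LHS]addrC.
exact: (H10_lin t (H10_sub Hv Hu) Hu).
Qed.

(* The orthogonal complement of H^1_0 consists of the [r] with [div grad r = r]. *)
Lemma normal_traces_H10 u : H1space w u ->
  (forall q, Hdiv w q -> normal_trace w q u = 0) -> H10space w u.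
Proof.
move=> Hu nt; have H := H1_semiHilbert.
have [p Hp pP] := projection H (ex_intro _ _ H10_0) H10_H1 H10_convex H10_closed Hu.
have Hup := shB H Hu (H10_H1 Hp).
have orth v : H10space w v -> ipH1 (u - p) v = 0.
  move=> Hv; have h1 := pP _ (H10_lin 1 Hv Hp); have h2 := pP _ (H10_lin (-1) Hv Hp).
  rewrite !addrK scale1r in h1; rewrite addrK scaleN1r in h2.
  have := ipZr H (-1) (H10_H1 Hv) Hup; rewrite scaleN1r mulN1r => E.
  by apply/eqP; rewrite eq_le h1 -oppr_le0 -E.
(* Orthogonality to the test functions says exactly that grad (u - p) has divergence u - p. Its
   normal trace against [u] is then the H^1 product of u - p with [u]. *)
have gdiv : is_wdiv w (wgrad w (u - p)) (u - p).
  split; first exact: H1_L2.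
  move=> phi tphi; apply/eqP; rewrite -addr_eq0 addrC; apply/eqP.
  rewrite -(orth _ (H10_test tphi)) /ipH1; congr (_ + _).
  by rewrite (ipv_wgrad (H1_L2v Hup) (test_L2 tphi) (test_is_wgrad tphi)).
have Hq : Hdiv w (wgrad w (u - p)) by split; [exact: H1_L2v|exists (u - p)].
have z : ipH1 (u - p) u = 0.
  by have := nt _ Hq; rewrite (normal_trace_eq (H1_L2v Hup) gdiv Hu) addrC.
have n0 : snorm ipH1 (u - p) = 0.
  by rewrite /snorm (ipBr H)//; [rewrite z orth// subrr sqrtr0|exact: H10_H1].
by apply: H10_closed; split=> // e e0; exists p; rewrite n0.
Qed.

End sobolev_theory.

(** * The cone of nonnegative traces and its closure *)

Section nonnegative_traces.
Context {R : realType} {d : nat}.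
Local Notation E := 'rV[R]_d.
Variable w : set E.
Hypothesis ow : open w.
Implicit Types (u v phi g : E -> R).
Let H := H1_semiHilbert ow.
Local Notation nH := (snorm (ipH1 w)).

Lemma lipschitzP (A : set E) u : [lipschitz u x | x in A] <->
  exists k, forall x y, A x -> A y -> `|u x - u y| <= k * `|x - y|.
Proof.
split=> [[M [_ hM]]|[k hk]].
  have M1 : M < `|M| + 1 by rewrite (le_lt_trans (ler_norm _))// ltrDl.
  by exists (`|M| + 1) => x y Ax Ay; exact: (hM _ M1 (x, y) (conj Ax Ay)).
exists k; split=> [|M kM [x y] [/= Ax Ay]]; first exact: num_real.
by apply: le_trans (hk _ _ Ax Ay) _; apply: ler_wpM2r => //; exact: ltW.
Qed.

Lemma lipschitz_lin (A : set E) a u v : [lipschitz u x | x in A] -> [lipschitz v x | x in A] ->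
  [lipschitz (a *: u + v) x | x in A].
Proof.
move=> /lipschitzP[k hk] /lipschitzP[l hl]; apply/lipschitzP.
exists (`|a| * k + l) => x y Ax Ay.
have -> : (a *: u + v) x - (a *: u + v) y = a * (u x - u y) + (v x - v y).
  rewrite (_ : (a *: u + v) x = a * u x + v x)// (_ : (a *: u + v) y = a * u y + v y)//.
  by rewrite opprD addrACA -mulrBr.
apply: le_trans (ler_normD _ _) _; rewrite mulrDl lerD ?hl// normrM -mulrA.
by apply: ler_wpM2l => //; exact: hk.
Qed.

Lemma lipschitz0 (A : set E) : [lipschitz (0 : E -> R) x | x in A].
Proof.
apply/lipschitzP; exists 1 => x y _ _.
by rewrite (_ : (0 : E -> R) x = 0)// (_ : (0 : E -> R) y = 0)// subrr normr0 mul1r.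
Qed.

Lemma same_trace_refl u : H1space w u -> same_trace w u u.
Proof. by move=> Hu; split=> //; rewrite subrr; exact: (H10_0 ow). Qed.

Lemma same_trace_sym u v : same_trace w u v -> same_trace w v u.
Proof.
move=> [Hu Hv uv]; split; [exact: Hv|exact: Hu|].
have -> : v - u = 0 - (u - v) by rewrite sub0r opprB.
exact: (H10_sub ow (H10_0 ow)).
Qed.

Lemma same_trace_trans u v g : same_trace w u v -> same_trace w v g -> same_trace w u g.
Proof.
move=> [Hu Hv uv] [_ Hg vg]; split; [exact: Hu|exact: Hg|].
have -> : u - g = 1 *: (u - v) + (v - g) by rewrite scale1r addrA subrK.
exact: H10_lin.
Qed.

Lemma same_trace_lin a u u' v v' : same_trace w u u' -> same_trace w v v' ->
  same_trace w (a *: u + v) (a *: u' + v').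
Proof.
move=> [Hu Hu' uu] [Hv Hv' vv]; split; [exact: H1_lin..|].
have -> : a *: u + v - (a *: u' + v') = a *: (u - u') + (v - v').
  by rewrite opprD addrACA scalerBr.
exact: H10_lin.
Qed.

Lemma same_trace_H10 u : H10space w u -> same_trace w u 0.
Proof. by move=> Hu; split; [case: Hu|exact: H1_0|rewrite subr0]. Qed.

Lemma has_trace_lin a u v phi psi : has_trace w u phi -> has_trace w v psi ->
  has_trace w (a *: u + v) (a *: phi + psi).
Proof.
move=> [g [Lg gphi ug]] [h [Lh hpsi vh]]; exists (a *: g + h); split.
- exact: lipschitz_lin.
- by move=> x bx; rewrite (_ : _ x = a * g x + h x)// gphi// hpsi.
- exact: same_trace_lin.
Qed.

Lemma has_trace_same u v phi : same_trace w v u -> has_trace w u phi -> has_trace w v phi.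
Proof.
move=> vu [g [Lg gphi ug]]; exists g; split; [exact: Lg|exact: gphi|].
exact: (same_trace_trans vu ug).
Qed.

Lemma has_trace0 : has_trace w 0 0.
Proof.
exists 0; split; [exact: lipschitz0|by []|].
by apply: same_trace_refl; exact: (H1_0 ow).
Qed.

(** The condition on the members of the sequences in [half_nneg]. Such functions form a convex cone
    in H^1 that is stable under adding elements of H^1_0. *)
Definition nneg_trace u : Prop := exists phi : E -> R,
  [/\ [lipschitz phi x | x in boundary w], forall x, boundary w x -> 0 <= phi x &
      has_trace w u phi].

Lemma nneg_trace_H1 u : nneg_trace u -> H1space w u.
Proof. by move=> [phi [_ _ [g [_ _ []]]]]. Qed.

Lemma nneg_trace_0 : nneg_trace 0.
Proof. by exists 0; split; [exact: lipschitz0|by []|exact: has_trace0]. Qed.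

Lemma nneg_trace_lin a u v : 0 <= a -> nneg_trace u -> nneg_trace v -> nneg_trace (a *: u + v).
Proof.
move=> a0 [phi [Lphi phi0 uphi]] [psi [Lpsi psi0 vpsi]]; exists (a *: phi + psi); split.
- exact: lipschitz_lin.
- by move=> x bx; rewrite (_ : _ x = a * phi x + psi x)// addr_ge0 ?mulr_ge0 ?phi0 ?psi0.
- exact: has_trace_lin.
Qed.

Lemma nneg_trace_convex : convex_pred nneg_trace.
Proof.
move=> t u v t0 t1 Cu Cv.
have -> : u + t *: (v - u) = (1 - t) *: u + (t *: v + 0).
  by rewrite addr0 scalerBl scale1r scalerBr addrA addrAC.
have t1' : 0 <= 1 - t by rewrite subr_ge0.
exact: (nneg_trace_lin t1' Cu (nneg_trace_lin t0 Cv nneg_trace_0)).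
Qed.

Lemma nneg_trace_H10 u h : nneg_trace u -> H10space w h -> nneg_trace (u + h).
Proof.
move=> Cu Hh; have Hu := nneg_trace_H1 Cu; have [phi [Lphi phi0 uphi]] := Cu.
exists phi; split; [exact: Lphi|exact: phi0|].
apply: has_trace_same uphi; split; [|exact: Hu|].
  exact: (shD H Hu (H10_H1 Hh)).
by have -> : u + h - u = h by rewrite addrC addKr.
Qed.

Local Notation adh := (adherent (H1space w) (ipH1 w) nneg_trace).

Lemma adherent_nneg_H10 u h : adh u -> H10space w h -> adh (u + h).
Proof.
move=> [Hu uP] Hh; split; first exact: (shD H Hu (H10_H1 Hh)).
move=> e /uP[v [Cv uv]]; exists (v + h); split; first exact: nneg_trace_H10.
by have -> : u + h - (v + h) = u - v by rewrite opprD addrACA subrr addr0.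
Qed.

(* The weak sequential closure of a convex set is its strong closure: the
   projection of a weak limit on the closure is the limit itself. *)
Lemma half_nneg_adherent u : half_nneg w u <-> adh u.
Proof.
split=> [[Hu [phi [un [unP unl]]]]|[Hu uP]].
  have C0 : exists v, adh v.
    exists 0; split=> [|e e0]; first exact: (H1_0 ow).
    by exists 0; rewrite subrr (snorm0 H); split; [exact: nneg_trace_0|exact: e0].
  have [p Ap pP] := projection H C0 (fun v (h : adh v) => h.1)
    (adherent_convex H nneg_trace_H1 nneg_trace_convex) (adherent_closed H nneg_trace_H1) Hu.
  have Hup := shB H Hu Ap.1.
  (* Weak convergence is tested only with functionals on traces, so the product with u - p has to
     vanish on H^1_0. It does, because the closed cone is invariant under H^1_0 and the projection
     inequality applies to both h and -h. *)
  have Hm : Hmhalf w (ipH1 w (u - p)).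
    split.
    - exact: (ip_linr H Hup).
    - move=> v v' [Hv Hv' vv].
      have D1 h : H10space w h -> ipH1 w (u - p) h <= 0.
        by move=> Hh; have := pP _ (adherent_nneg_H10 Ap Hh); have -> : p + h - p = h by rewrite addrC addKr.
      have h1 := D1 _ vv; have h2 := D1 _ (H10_sub ow (H10_0 ow) vv).
      rewrite sub0r opprB (ipBr H Hv' Hv Hup) in h2; rewrite (ipBr H Hv Hv' Hup) in h1.
      by move: h1 h2; move: (ipH1 w (u - p) v) (ipH1 w (u - p) v') => a b; lra.
    - by exists (nH (u - p)); exact: (ip_bounded H Hup).
  have le m : ipH1 w (u - p) (un m) <= ipH1 w (u - p) p.
    have [Lphi phi0 uphi] := unP m.
    have Cm : nneg_trace (un m) by exists (phi m).
    have Hm' := nneg_trace_H1 Cm.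
    have : ipH1 w (u - p) (un m - p) <= 0.
      apply: pP; split; first exact: Hm'.
      by move=> e e0; exists (un m); rewrite subrr (snorm0 H); split; [exact: Cm|exact: e0].
    by rewrite (ipBr H Hm' Ap.1 Hup) subr_le0.
  have := ler_cvg_to (unl _ Hm) (cvg_cst _) (nearW _ le).
  rewrite -subr_le0 -(ipBr H Hu Ap.1 Hup) => le0.
  have n0 : nH (u - p) = 0.
    by apply/eqP; rewrite /snorm sqrtr_eq0; exact: le0.
  apply: (adherent_closed H nneg_trace_H1); split; first exact: Hu.
  by move=> e e0; exists p; rewrite n0; split; [exact: Ap|exact: e0].
split; first exact: Hu.
have ex (m : nat) : exists v, nneg_trace v /\ nH (u - v) < m.+1%:R^-1.
  by apply: uP; rewrite invr_gt0.
have [un unP] := choice ex.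
have [phi phiP] := choice (fun m => (unP m).1).
exists phi, un; split; first exact: phiP.
move=> l [Ll _ [C lC]].
have Hun m : H1space w (un m) by apply: nneg_trace_H1; case: (unP m).
apply: (lin_bounded_cvg H Ll lC Hun Hu).
apply: (@squeeze_cvgr _ _ _ _ (fun=> 0) (fun m => m.+1%:R^-1)).
- by apply: nearW => m; rewrite snorm_ge0 (snorm_sub H)// ltW//; exact: (unP m).2.
- exact: cvg_cst.
- exact: cvg_harmonic.
Qed.

End nonnegative_traces.

(** * Lipschitz functions vanishing on the boundary *)

Section random_walk.
Context {R : realType} {d : nat}.
Local Notation E := 'rV[R]_d.
Variables (M delta : R).
Hypothesis M0 : 0 < M.
Hypothesis delta0 : 0 <= delta.
Implicit Types (f h : E -> R) (s : seq 'I_d) (v x : E).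

(** Affine from 0 at x_i = -M to 1 at x_i = M: a walk that starts at -M and has total length 2 M in
    each direction ends at [x] in the mean. *)
Definition prob i x : R := (2 * M)^-1 * x ord0 i + 2^-1.

(* The expectation of [f] at the end of a random walk started at [v], whose
   step along [i] has length [delta] with probability [prob i x] and 0 otherwise;
   for [s] consisting of [m] copies of each direction this is a Bernstein
   polynomial of [f]. *)
Fixpoint walk f s v x : R :=
  if s is i :: s' then
    prob i x * walk f s' (v + delta *: delta_mx ord0 i) x + (1 - prob i x) * walk f s' v x
  else f v.

Lemma prob_range i x : `|x| <= M -> 0 <= prob i x <= 1.
Proof.
move=> xM; have := le_trans (rV_coord_norm x i) xM; rewrite ler_norml => /andP[h1 h2].
have MM : (2 * M)^-1 * M = 2^-1 by rewrite invfM -mulrA mulVf ?mulr1// gt_eqF.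
have i0 : 0 < (2 * M)^-1 by rewrite invr_gt0 mulr_gt0.
have := ler_wpM2l (ltW i0) h1; have := ler_wpM2l (ltW i0) h2; rewrite /prob mulrN MM => k1 k2; apply/andP; split; lra.
Qed.

Lemma prob_elementary i : elementary (prob i).
Proof. by apply: elem_affine; exact: elem_coord. Qed.

Lemma walk_elementary f s v : elementary (walk f s v).
Proof.
elim: s v => [|i s ih] v /=; first exact: elem_cst.
apply: elem_add; apply: elem_mul => //; first exact: prob_elementary.
have := elem_affine (-1) 1 (prob_elementary i).
by rewrite (_ : (fun x => _) = (fun x => 1 - prob i x))//; apply/funext => x; rewrite mulN1r addrC.
Qed.

(** Monotonicity of the expectation, as all the weights lie between 0 and 1. *)
Lemma walk_le f h c s v x : `|x| <= M -> (forall v, `|f v - c| <= h v) ->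
  `|walk f s v x - c| <= walk h s v x.
Proof.
move=> xM fh; elim: s v => [|i s ih] v /=; first exact: fh.
have /andP[p0 p1] := prob_range i xM; have q0 : 0 <= 1 - prob i x by rewrite subr_ge0.
set v1 := v + delta *: delta_mx ord0 i; move: (ih v1) (ih v).
move: (walk f s v1 x) (walk f s v x) (walk h s v1 x) (walk h s v x) => a b a' b' ha hb.
have -> : prob i x * a + (1 - prob i x) * b - c = prob i x * (a - c) + (1 - prob i x) * (b - c) by ring.
apply: le_trans (ler_normD _ _) _; rewrite !normrM (ger0_norm p0) (ger0_norm q0).
by apply: lerD; apply: ler_wpM2l.
Qed.

Lemma walk_affine a c h s v x :
  walk (fun v => a * h v + c) s v x = a * walk h s v x + c.
Proof. by elim: s v => [//|i s ih] v /=; rewrite !ih; ring. Qed.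

Lemma walk_shift f (L : R) s v b x : `|x| <= M -> 0 <= L ->
  (forall u u', `|f u - f u'| <= L * `|u - u'|) ->
  `|walk f s (v + b) x - walk f s v x| <= L * `|b|.
Proof.
move=> xM L0 fL; elim: s v => [|i s ih] v /=.
  by apply: le_trans (fL _ _) _; rewrite [v + b]addrC addrK.
have /andP[p0 p1] := prob_range i xM; have q0 : 0 <= 1 - prob i x by rewrite subr_ge0.
rewrite [v + b + _]addrAC; set v1 := v + delta *: delta_mx ord0 i; move: (ih v1) (ih v).
move: (walk f s (v1 + b) x) (walk f s v1 x) (walk f s (v + b) x) (walk f s v x) => a1 a2 b1 b2 ha hb.
have -> : prob i x * a1 + (1 - prob i x) * b1 - (prob i x * a2 + (1 - prob i x) * b2) =
  prob i x * (a1 - a2) + (1 - prob i x) * (b1 - b2) by ring.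
apply: le_trans (ler_normD _ _) _; rewrite !normrM (ger0_norm p0) (ger0_norm q0).
have := ler_wpM2l p0 ha; have := ler_wpM2l q0 hb; lra.
Qed.

Lemma pderiv_prob j i x : pderiv j (prob i) x = (2 * M)^-1 * (j == i)%:R.
Proof.
have dc y : differentiable (fun x : E => x ord0 i) y by exact: differentiable_coord.
have -> : prob i = (2 * M)^-1 *: (fun x : E => x ord0 i) + cst 2^-1 by [].
rewrite pderiv_lin//.
rewrite (_ : pderiv j (cst _) = cst 0); last by apply/funext => y; exact: derive_cst.
rewrite (_ : (_ + _) x = (2 * M)^-1 * pderiv j (fun x : E => x ord0 i) x + 0)// addr0.
by rewrite pderiv_coord.
Qed.

(** Differentiating the weight of one step along [j] gives 1 / (2 M) times the difference of two
    expectations whose starting points are [delta] apart, and [walk_shift] bounds this difference.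
    Steps along other directions contribute nothing. *)
Lemma walk_pderiv f (L : R) j s v x : `|x| <= M -> 0 <= L ->
  (forall u u', `|f u - f u'| <= L * `|u - u'|) ->
  `|pderiv j (walk f s v) x| <= (count_mem j s)%:R * (L * delta / (2 * M)).
Proof.
move=> xM L0 fL; elim: s v => [|i s ih] v.
  by rewrite (_ : walk f [::] v = cst (f v))// /pderiv derive_cst normr0 mul0r.
have dw u y : differentiable (walk f s u) y := (elementary_diff (walk_elementary f s u)).1 y.
have dp y : differentiable (prob i) y := (elementary_diff (prob_elementary i)).1 y.
set v1 := v + delta *: delta_mx ord0 i.
have E1 : walk f (i :: s) v = 1 *: (prob i * (walk f s v1 + (-1) *: walk f s v)) + walk f s v.
  apply/funext => y /=; rewrite scale1r.
  rewrite (_ : (_ + _) y = prob i y * (walk f s v1 y + (-1) * walk f s v y) + walk f s v y)//.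
  by rewrite -/v1; ring.
have d1 y : differentiable (walk f s v1 + (-1) *: walk f s v) y.
  by apply: differentiableD => //; exact: differentiableZ.
have d2 y : differentiable (prob i * (walk f s v1 + (-1) *: walk f s v)) y by exact: differentiableM.
have E2 : pderiv j (walk f s v1 + (-1) *: walk f s v) = pderiv j (walk f s v1) + (-1) *: pderiv j (walk f s v).
  by rewrite addrC pderiv_lin// addrC.
rewrite E1 (pderiv_lin _ _ d2 (dw v)) (pderivM _ dp d1) E2 scale1r.
rewrite (_ : (_ + _) x = prob i x * (pderiv j (walk f s v1) x + (-1) * pderiv j (walk f s v) x) +
  (walk f s v1 x + (-1) * walk f s v x) * pderiv j (prob i) x + pderiv j (walk f s v) x)//.
rewrite pderiv_prob.
have := ih v1; have := ih v; have := walk_shift s v (delta *: delta_mx ord0 i) xM L0 fL.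
rewrite -/v1.
have /andP[p0 p1] := prob_range i xM; have q0 : 0 <= 1 - prob i x by rewrite subr_ge0.
have nd : `|delta *: delta_mx ord0 i : E| <= delta.
  apply/rV_normP => // k; rewrite !mxE eqxx /=; case: (k == i) => /=; rewrite ?mulr1 ?mulr0 ?normr0//.
  by rewrite ger0_norm.
move: (pderiv j (walk f s v1) x) (pderiv j (walk f s v) x) (walk f s v1 x) (walk f s v x) => a b c e hce hb ha.
have i0 : 0 <= (2 * M)^-1 by rewrite invr_ge0 mulr_ge0// ltW.
have -> : prob i x * (a + -1 * b) + (c + -1 * e) * ((2 * M)^-1 * (j == i)%:R) + b =
   prob i x * a + (1 - prob i x) * b + (c - e) * ((2 * M)^-1 * (j == i)%:R) by ring.
apply: le_trans (ler_normD _ _) _; rewrite /= natrD [leRHS]mulrDl [leLHS]addrC; apply: lerD.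
  rewrite [j == i]eq_sym; case: (i == j) => /=; last by rewrite !mulr0 normr0 mul0r.
  rewrite mulr1 mul1r normrM (ger0_norm i0); apply: ler_wpM2r => //.
  by apply: le_trans hce _; exact: ler_wpM2l.
apply: le_trans (ler_normD _ _) _; rewrite !normrM (ger0_norm p0) (ger0_norm q0).
have := ler_wpM2l p0 ha; have := ler_wpM2l q0 hb; lra.
Qed.

(** Squared bias plus variance, each step along [i] adding delta^2 p (1 - p) to the variance. *)
Lemma walk_variance x s v : walk (fun v => \sum_i (v ord0 i - x ord0 i) ^+ 2) s v x =
  \sum_i ((v ord0 i + (count_mem i s)%:R * delta * prob i x - x ord0 i) ^+ 2 +
          (count_mem i s)%:R * delta ^+ 2 * (prob i x * (1 - prob i x))).
Proof.
elim: s v => [|j s ih] v /=.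
  by apply: eq_bigr => i _; rewrite !mul0r !addr0.
rewrite !ih !mulr_sumr -big_split /=; apply: eq_bigr => i _; rewrite !mxE eqxx /= natrD.
rewrite [j == i]eq_sym; have [->|ij] := eqVneq i j; rewrite ?mulr1 ?mulr0 ?addr0 /=; last by ring.
by ring.
Qed.

End random_walk.

Section soft_threshold.
Context {R : realType}.

(* [t * flat 1 (t^2 - 1)] vanishes for [|t| <= 1] and is at bounded distance
   from the identity. *)
Lemma threshold_dist (t : R) : `|t * flat 1 (t ^+ 2 - 1) - t| <= 2.
Proof.
have f0 := flat1_ge0 (t ^+ 2 - 1); have f1 := flat1_le1 (t ^+ 2 - 1).
have -> : t * flat 1 (t ^+ 2 - 1) - t = t * (flat 1 (t ^+ 2 - 1) - 1) by ring.
rewrite normrM (@ler0_norm _ (flat _ _ - 1)) ?subr_le0// opprB.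
have [t2|t2] := leP `|t| 2.
  by apply: le_trans t2; rewrite ler_piMr//; lra.
have tt : `|t| ^+ 2 = t ^+ 2 by rewrite real_normK ?num_real.
have p0 : 0 < t ^+ 2 - 1 by rewrite -tt; nra.
rewrite /flat p0 hornerC mul1r.
have h := expR_ge1Dx (- (t ^+ 2 - 1)^-1).
apply: (@le_trans _ _ (`|t| * (t ^+ 2 - 1)^-1)); first by apply: ler_wpM2l => //; lra.
by rewrite ler_pdivrMr// -tt; nra.
Qed.

(** The sum dominates the derivative of t flat 1 (t^2 - 1). With s = t^2 - 1 > 0 its second term is
    2 (s + 1) s^-2 exp(-1/s), and s^-k exp(-1/s) is bounded for k = 1 and k = 2. *)
Lemma threshold_deriv_bound : exists C : R, forall t : R,
  `|flat 1 (t ^+ 2 - 1)| + `|2 * t ^+ 2 * flat ('X^2 * (1 - 1^`())) (t ^+ 2 - 1)| <= C.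
Proof.
have [C1 h1] := @pow_exp_bounded R 1; have [C2 h2] := @pow_exp_bounded R 2.
exists (1 + 2 * (C1 + C2)) => t; apply: lerD.
  by rewrite ger0_norm ?flat1_ge0// flat1_le1.
have C0 : 0 <= C1 + C2.
  have := h1 1 ltr01; have := h2 1 ltr01; rewrite !expr1n !mul1r.
  by have := expR_gt0 (- 1 : R); lra.
rewrite /flat; case: ifPn => [t0|_]; last by rewrite mulr0 normr0 mulr_ge0.
rewrite derivC subr0 mulr1 hornerXn ger0_norm; last first.
  by apply: mulr_ge0; apply: mulr_ge0; rewrite ?sqr_ge0 ?expR_ge0.
rewrite -mulrA; apply: ler_wpM2l => //.
move: t0; set s := t ^+ 2 - 1 => s0; have -> : t ^+ 2 = s + 1 by rewrite subrK.
have i0 : 0 < s^-1 by rewrite invr_gt0.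
have := h1 _ i0; have := h2 _ i0; rewrite expr1.
have E : (s + 1) * s^-1 ^+ 2 = s^-1 + s^-1 ^+ 2.
  by rewrite mulrDl mul1r expr2 mulrA divff ?mul1r// gt_eqF.
by rewrite mulrA E; move: (expR _) => e; nra.
Qed.

End soft_threshold.

Section lipschitz_vanishing.
Context {R : realType} {d : nat}.
Local Notation E := 'rV[R]_d.
Local Notation leb := (@lebesgue_rV R d).
Variable w : set E.
Hypothesis ow : open w.
Hypothesis bw : bounded_set w.
Implicit Types (g u p : E -> R) (x y : E).
Let mw := rV_open_measurable ow.
Let HL := L2_semiHilbert mw.
Let H := H1_semiHilbert ow.

(** The supremum of the parameters at which the segment lies in [w] gives a boundary point: it is a
    limit of such parameters and, as [w] is open and does not contain [y], it is not one of them. *)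
Lemma segment_boundary x y : w x -> ~ w y ->
  exists t : R, [/\ 0 <= t, t <= 1 & boundary w (x + t *: (y - x))].
Proof.
move=> wx nwy; pose S := [set t : R | [/\ 0 <= t, t <= 1 & w (x + t *: (y - x))]].
have S0 : S 0 by split=> //; rewrite scale0r addr0.
have Ssup : has_sup S by split; [exists 0|exists 1 => t []].
pose t := sup S.
have t0 : 0 <= t by apply: ub_le_sup => //; exact: Ssup.2.
have t1 : t <= 1 by apply: ge_sup; [exists 0|move=> s []].
pose gm (s : R) : E := x + s *: (y - x).
have cg : continuous gm.
  by move=> s; apply: cvgD; [exact: cvg_cst|apply: cvgZ; [exact: cvg_id|exact: cvg_cst]].
exists t; split=> //; split.
  move=> B nB; have := cg t B nB => /nbhs_ballP[e /= e0 eB].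
  have [s [s0 s1 ws] ts] := sup_adherent e0 Ssup.
  exists (gm s); split; first exact: ws.
  apply: eB; rewrite /= -ball_normE /= ger0_norm; first by rewrite -/t in ts *; lra.
  by rewrite subr_ge0; apply: ub_le_sup; [exact: Ssup.2|].
move=> /interior_subset wt.
have [t1'|t1'] := eqVneq t 1.
  by apply: nwy; move: wt; rewrite -/t t1' scale1r addrC subrK.
have tl : t < 1 by rewrite lt_neqAle t1'.
have := cg t w (open_nbhs_nbhs (conj ow wt)) => /nbhs_ballP[e /= e0 eB].
pose s := t + Num.min (e / 2) (1 - t).
have m0 : 0 < Num.min (e / 2) (1 - t) by rewrite lt_min divr_gt0//= subr_gt0.
have me : Num.min (e / 2) (1 - t) <= e / 2 by rewrite ge_min lexx.
have m1 : Num.min (e / 2) (1 - t) <= 1 - t by rewrite ge_min lexx orbT.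
have Ss : S s.
  split; [rewrite /s; lra|rewrite /s; lra|].
  apply: (eB s); rewrite /= -ball_normE /= /s opprD addrA subrr sub0r normrN ger0_norm ?(ltW m0)//.
  by lra.
have : s <= t by apply: ub_le_sup => //; exact: Ssup.2.
by rewrite /s; lra.
Qed.

(** A segment from a point of [w] to a point outside crosses the boundary, where [g] vanishes. *)
Lemma lipschitz_extension_by_0 g : [lipschitz g x | x in closure w] ->
  (forall x, boundary w x -> g x = 0) ->
  exists2 L : R, 0 <= L & forall x y, `|(g \_ w) x - (g \_ w) y| <= L * `|x - y|.
Proof.
move=> /lipschitzP[k hk] g0; exists (Num.max k 0); first by rewrite le_max lexx orbT.
have hk' x y : closure w x -> closure w y -> `|g x - g y| <= Num.max k 0 * `|x - y|.
  move=> cx cy; apply: le_trans (hk _ _ cx cy) _; apply: ler_wpM2r => //.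
  by rewrite le_max lexx.
have k0 : 0 <= Num.max k 0 by rewrite le_max lexx orbT.
have cw x : w x -> closure w x by exact: subset_closure.
have mixed x y : w x -> ~ w y -> `|g x| <= Num.max k 0 * `|x - y|.
  move=> wx nwy; have [t [t0 t1 bt]] := segment_boundary wx nwy.
  have := hk' _ _ (cw _ wx) bt.1; rewrite (g0 _ bt) subr0 => /le_trans; apply.
  apply: ler_wpM2l => //; rewrite opprD addrA subrr sub0r normrN normrZ ger0_norm//.
  by rewrite -[leRHS]mul1r distrC ler_wpM2r.
move=> x y; rewrite !patchE.
have [wx|nwx] := pselect (w x); have [wy|nwy] := pselect (w y).
- by rewrite !mem_set//; apply: hk'; exact: cw.
- by rewrite mem_set// memNset// subr0; exact: mixed.
- by rewrite memNset// mem_set// sub0r normrN distrC; exact: mixed.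
- by rewrite !memNset// subrr normr0 mulr_ge0.
Qed.

(** Bernstein polynomials: the walk starts at the corner (-M, ..., -M) and takes m + 1 steps of
    length 2 M / (m + 1) in each direction. Its end has mean [x] and variance at most M^2 / (m + 1)
    per coordinate. The choice of this approximation is due to its partial derivatives, which stay
    below the Lipschitz constant of [u]. *)
Lemma smooth_approximation u (L M : R) : 0 <= L -> 0 < M ->
  (forall x y, `|u x - u y| <= L * `|x - y|) ->
  forall e, 0 < e -> exists p, [/\ elementary p,
    forall x, `|x| <= M -> `|p x - u x| <= e &
    forall x j, `|x| <= M -> `|pderiv j p x| <= L].
Proof.
move=> L0 M0 uL e e0.
(* The length scale that balances the two halves of the estimate [fh]; the resulting error is L
   eta. *)
pose eta := e / (L + 1).
have eta0 : 0 < eta by rewrite divr_gt0// ltr_wpDl.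
pose V := d%:R * M ^+ 2.
have V0 : 0 <= V by rewrite mulr_ge0// sqr_ge0.
have e2 : 0 < eta ^+ 2 / (V + 1) by rewrite divr_gt0 ?exprn_gt0// ltr_wpDl.
have [m hm] := small_invn e2.
have m0 : 0 < m.+1%:R :> R by [].
pose delta := 2 * M / m.+1%:R.
have delta0 : 0 <= delta by rewrite divr_ge0// mulr_ge0// ltW.
pose s := flatten (nseq m.+1 (enum 'I_d)).
have cs i : count_mem i s = m.+1.
  rewrite count_flatten map_nseq sumn_nseq.
  by rewrite count_uniq_mem ?enum_uniq// mem_enum mul1n.
pose v0 : E := const_mx (- M).
exists (walk M delta u s v0); split; first exact: walk_elementary.
  move=> x xM; pose Q (v : E) : R := \sum_i (v ord0 i - x ord0 i) ^+ 2.
  (* The inequality r <= r^2 / (2 eta) + eta / 2 replaces the distance in the Lipschitz bound by its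
     square, whose expectation is the variance. *)
  have fh (v : E) : `|u v - u x| <= L / (2 * eta) * Q v + L * eta / 2.
    apply: le_trans (uL _ _) _.
    have -> : L / (2 * eta) * Q v + L * eta / 2 = L * (Q v / (2 * eta) + eta / 2).
      by rewrite mulrDr !mulrA [L / _ * _]mulrAC.
    apply: ler_wpM2l => //; apply/rV_normP => [|j].
      have Q0 : 0 <= Q v by apply: sumr_ge0 => i _; exact: sqr_ge0.
      have h0 := ltW eta0.
      by apply: addr_ge0; apply: divr_ge0 => //; exact: mulr_ge0.
    rewrite !mxE; set a := (X in `|X|).
    have aQ : a ^+ 2 <= Q v by rewrite /Q (bigD1 j)//= lerDl sumr_ge0// => i _; exact: sqr_ge0.
    apply: (@le_trans _ _ (a ^+ 2 / (2 * eta) + eta / 2)); last first.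
      by rewrite lerD2r ler_wpM2r// invr_ge0 mulr_ge0// ltW.
    rewrite -[a ^+ 2]real_normK ?num_real// -subr_ge0.
    have -> : `|a| ^+ 2 / (2 * eta) + eta / 2 - `|a| = (`|a| - eta) ^+ 2 / (2 * eta).
      by field; rewrite gt_eqF.
    by rewrite divr_ge0 ?sqr_ge0// mulr_ge0// ltW.
  apply: le_trans (walk_le delta M0 s v0 xM fh) _.
  rewrite (walk_affine M delta (L / (2 * eta)) (L * eta / 2) Q) walk_variance.
  have QV : \sum_i ((v0 ord0 i + (count_mem i s)%:R * delta * prob M i x - x ord0 i) ^+ 2 +
      (count_mem i s)%:R * delta ^+ 2 * (prob M i x * (1 - prob M i x))) <= V * m.+1%:R^-1.
    rewrite /V -mulrA -[X in X%:R * _]card_ord -sum1_card natr_sum mulr_suml.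
    apply: ler_sum => i _; rewrite cs mxE mul1r.
    have -> : - M + m.+1%:R * delta * prob M i x - x ord0 i = 0.
      by rewrite /delta /prob; field; rewrite ?gt_eqF.
    rewrite expr0n add0r.
    have -> : m.+1%:R * delta ^+ 2 = 4 * (M ^+ 2 * m.+1%:R^-1).
      by rewrite /delta; field.
    have K0 : 0 <= M ^+ 2 * m.+1%:R^-1 by rewrite mulr_ge0 ?sqr_ge0.
    move: (prob M i x) K0 => pr; move: (M ^+ 2 * m.+1%:R^-1) => K K0.
    have := sqr_ge0 (2 * pr - 1); nra.
  have mV : V * m.+1%:R^-1 <= eta ^+ 2.
    apply: (@le_trans _ _ (V * (eta ^+ 2 / (V + 1)))); first by apply: ler_wpM2l => //; exact: hm.
    by rewrite mulrA ler_pdivrMr ?ltr_wpDl//; have := sqr_ge0 eta; nra.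
  have LE : L * eta <= e.
    by rewrite /eta mulrA ler_pdivrMr ?ltr_wpDl//; nra.
  have c0 : 0 <= L / (2 * eta) by rewrite divr_ge0// mulr_ge0// ltW.
  have := ler_wpM2l c0 (le_trans QV mV).
  have -> : L / (2 * eta) * eta ^+ 2 = L * eta / 2 by field; rewrite gt_eqF.
  by lra.
move=> x j xM; apply: le_trans (walk_pderiv M0 delta0 j s v0 xM L0 uL) _.
rewrite cs (_ : _ * _ = L)// /delta; field; rewrite gt_eqF//=.
Qed.

End lipschitz_vanishing.

Section lipschitz_in_H10.
Context {R : realType} {d : nat}.
Local Notation E := 'rV[R]_d.
Local Notation leb := (@lebesgue_rV R d).
Variable w : set E.
Hypothesis ow : open w.
Hypothesis bw : bounded_set w.
Implicit Types (f g u p phi : E -> R) (x y : E).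
Let mw := rV_open_measurable ow.
Let HL := L2_semiHilbert mw.
Let H := H1_semiHilbert ow.
Let leb_fin : (leb w < +oo)%E := lebesgue_rV_bounded_lty mw bw.

Lemma snorm_bounded f (B : R) : L2 w f -> 0 <= B -> (forall x, w x -> `|f x| <= B) ->
  snorm (ip w) f <= B * Num.sqrt (fine (leb w)).
Proof.
move=> Lf B0 fB; have m0 : 0 <= fine (leb w) by apply: fine_ge0.
have mE : Num.sqrt (fine (leb w)) ^+ 2 = fine (leb w) by rewrite sqr_sqrtr.
rewrite -(@ler_pXn2r _ 2)// ?nnegrE ?mulr_ge0 ?sqrtr_ge0// exprMn mE.
rewrite (snorm_sqr HL)// -lee_fin ip_sqr// EFinM fineK ?ge0_fin_numE// -integral_cst//.
apply: ge0_le_integral => //.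
- by move=> x _; rewrite lee_fin sqr_ge0.
- by apply/measurable_EFinP/measurable_funX; case: Lf.
- by move=> x wx; rewrite lee_fin -real_normK ?num_real// ler_pXn2r ?nnegrE// fB.
Qed.

(** Uniqueness of weak gradients: functions that agree almost everywhere are also at distance 0 in
    H^1. *)
Lemma null_H1 u v : H1space w u -> H1space w v -> snorm (ip w) (u - v) = 0 ->
  snorm (ipH1 w) (u - v) = 0.
Proof.
move=> Hu Hv n; apply/eqP; rewrite eq_le snorm_ge0 andbT.
have Huv := shB H Hu Hv.
apply: le_trans (snorm_le_sum HL (cH1_L2 (w := w)) (ipH1E ow) Huv) _.
rewrite big1// => i _.
rewrite (comp_sub HL (H1_lin ow) (cH1_L2 (w := w)) (cH1_lin ow))//.
case: i => [i|j]; first exact: n.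
exact: (is_wgrad_unique ow j (H1_L2 Hu) (H1_L2 Hv) (wgradP Hu) (wgradP Hv) n).
Qed.

(** The thresholded function vanishes where |p| < e, whereas |p| <= e / 2 on the boundary. Its
    support in [w] is thus contained in a compact set that misses the boundary. *)
Lemma threshold_test p u (e M : R) : elementary p -> 0 < e ->
  (forall x, w x -> `|x| <= M) -> (forall x, `|x| <= M -> `|p x - u x| <= e / 2) ->
  (forall x, boundary w x -> u x = 0) ->
  test_function w ((fun x => p x * flat 1 ((p x / e) ^+ 2 - 1)) \_ w).
Proof.
move=> ep e0 wM pu u0.
have cwM x : closure w x -> `|x| <= M.
  have cl : closed [set x : E | `|x| <= M].
    apply: (@closed_comp _ _ _ [set r | r <= M]); last exact: closed_le.
    by move=> y _; exact: norm_continuous.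
  move=> cx; have wM' : w `<=` [set x : E | `|x| <= M] by [].
  by have := closure_subset wM' cx; rewrite -((closure_id _).1 cl).
pose K := closure w `&` [set x | e <= `|p x|].
have cp : continuous p by exact: smooth_continuous (elementary_smooth ep).
have clK : closed K.
  apply: closedI; first exact: closed_closure.
  apply: (@closed_comp _ _ (fun x => `|p x|) [set r | e <= r]); last exact: closed_ge.
  by move=> x _; apply: continuous_comp; [exact: cp|exact: norm_continuous].
apply: (@test_function_elementary _ _ w K) => //.
- apply: bounded_closed_compact => //; exists M; split=> [|N MN x [cx _]]; first exact: num_real.
  by apply: le_trans (cwM _ cx) _; exact: ltW.
- move=> x [cx ex]; apply: contrapT => nwx.
  have bx : boundary w x by split=> // /interior_subset.
  by have := pu x (cwM _ cx); rewrite u0// subr0 => h; move: ex => /= ex; lra.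
- apply: elem_mul => //; apply: elem_flat.
  have := elem_affine 1 (-1) (elem_mul (elem_affine e^-1 0 ep) (elem_affine e^-1 0 ep)).
  rewrite (_ : (fun x => _) = (fun x => (p x / e) ^+ 2 - 1))//.
  apply/funext => x; rewrite mul1r; congr (_ - _).
  by rewrite (_ : (_ * _) x = (e^-1 * p x + 0) * (e^-1 * p x + 0))// addr0 -expr2 mulrC.
- move=> x wx nKx; have px : `|p x| < e.
    rewrite ltNge; apply/negP => h; apply: nKx; split; [exact: subset_closure|exact: h].
  rewrite flat1_le0 ?mulr0// subr_le0 -real_normK ?num_real// normrM normfV (gtr0_norm e0).
  by rewrite exprn_ile1 ?divr_ge0 ?(ltW e0)// ler_pdivrMr// mul1r ltW.
Qed.

(** The function is e theta(p / e) with theta(t) = t flat 1 (t^2 - 1), and this scaling leaves the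
    bound on the derivative independent of [e]. *)
Lemma threshold_pderiv p (e B x0 : R) j x : elementary p -> 0 < e ->
  (forall t : R, `|flat 1 (t ^+ 2 - 1)| + `|2 * t ^+ 2 * flat ('X^2 * (1 - 1^`())) (t ^+ 2 - 1)| <= B) ->
  `|pderiv j p x| <= x0 -> w x ->
  `|pderiv j ((fun x => p x * flat 1 ((p x / e) ^+ 2 - 1)) \_ w) x| <= B * x0.
Proof.
move=> ep e0 hB px wx.
have [dp _] := elementary_diff ep.
have -> : pderiv j ((fun x => p x * flat 1 ((p x / e) ^+ 2 - 1)) \_ w) x =
    pderiv j (fun x => p x * flat 1 ((p x / e) ^+ 2 - 1)) x.
  apply: near_eq_derive; have := open_nbhs_nbhs (conj ow wx); apply: filterS => y wy.
  by rewrite patchT// inE.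
have is1 (t : R) : is_derive t (1 : R) (fun t : R => t * flat 1 ((t / e) ^+ 2 - 1))
    (flat 1 ((t / e) ^+ 2 - 1) + 2 * (t / e) ^+ 2 * flat ('X^2 * (1 - 1^`())) ((t / e) ^+ 2 - 1)).
  have d1 : is_derive t (1 : R) (fun t : R => (t / e) ^+ 2 - 1) (2 * t / e ^+ 2).
    have di := is_derive_id t (1 : R).
    have := is_deriveB (is_deriveX 2 (is_deriveM di (is_derive_cst e^-1 t (1 : R)))) (is_derive_cst (1 : R) t (1 : R)).
    rewrite (_ : _ - _ = 2 * t / e ^+ 2)//.
    rewrite (_ : (id * cst e^-1) t = t / e)// /GRing.scale /= subr0 mulr0 add0r mulr1 expr1 /cst.
    by field; rewrite gt_eqF.
  have d2 := @is_derive1_comp _ (flat 1) (fun t : R => (t / e) ^+ 2 - 1) t _ _ (is_derive_flat 1 ((t / e) ^+ 2 - 1)) d1.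
  have := is_deriveM (is_derive_id t (1 : R)) d2.
  rewrite (_ : _ *: _ + _ *: _ = flat 1 ((t / e) ^+ 2 - 1) + 2 * (t / e) ^+ 2 * flat ('X^2 * (1 - 1^`())) ((t / e) ^+ 2 - 1))//.
  by rewrite /GRing.scale /= mulr1 addrC; congr (_ + _); field; rewrite gt_eqF.
rewrite /pderiv (derive_comp1 _ is1 (dp x)).2 normrM.
apply: ler_pM => //; apply: le_trans (ler_normD _ _) (hB (p x / e)).
Qed.

(** Smoothing the Lipschitz extension by zero and removing its values below [e] gives test functions
    that are within a multiple of [e] of [g] in L^2 but merely bounded in H^1. [bounded_adherent],
    applied to the L^2 distance to [g], extracts from them an element of H^1_0 that equals [g]
    almost everywhere. *)
Lemma lipschitz_H10 g : H1space w g -> [lipschitz g x | x in closure w] ->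
  (forall x, boundary w x -> g x = 0) -> H10space w g.
Proof.
move=> Hg Lg g0; have [L L0 uL] := lipschitz_extension_by_0 ow Lg g0.
pose u := g \_ w.
have ug x : w x -> u x = g x by move=> wx; rewrite /u patchT// inE.
have u0 x : boundary w x -> u x = 0.
  move=> [_ nx]; rewrite /u patchN// notin_setE => wx; apply: nx.
  exact: (open_nbhs_nbhs (conj ow wx)).
have [M [M0 wM]] : exists M, 0 < M /\ forall x, w x -> `|x| <= M.
  have [M [_ hM]] := bw; exists (`|M| + 1); split; first by rewrite ltr_wpDl.
  by move=> x wx; apply: (hM (`|M| + 1)) => //; rewrite (le_lt_trans (ler_norm _))// ltrDl.
have [B hB] := @threshold_deriv_bound R.
have B0 : 0 <= B by apply: le_trans (hB 0); rewrite addr_ge0.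
pose m := Num.sqrt (fine (leb w)).
have m0 : 0 <= m by exact: sqrtr_ge0.
(* A bound, component by component, for the H^1 norm of all the approximations with e <= 1. *)
pose N := \sum_(i : unit + 'I_d) (if i is inr _ then B * L * m else snorm (ip w) g + 3 * m).
have [|||||c [Hc cP] cg] := @bounded_adherent _ _ _ _ H (test_function w) (fun v => snorm (ip w) (v - g)) N.
- by move=> phi; exact: test_H1.
- move=> t x y _ _ tx ty.
  have -> : x + t *: (y - x) = (1 - t) *: x + (t *: y + 0).
    by rewrite addr0 scalerBl scale1r scalerBr addrA addrAC.
  by apply: test_function_lin => //; apply: test_function_lin => //; exact: test_function0.
- move=> x y Hx Hy.
  have -> : x + 2^-1 *: (y - x) - g = 2^-1 *: (x - g) + 2^-1 *: (y - g).
    apply/funext => z.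
    change (x z + 2^-1 * (y z - x z) - g z = 2^-1 * (x z - g z) + 2^-1 * (y z - g z)).
    lra.
  have Lx := shB HL (H1_L2 Hx) (H1_L2 Hg); have Ly := shB HL (H1_L2 Hy) (H1_L2 Hg).
  apply: le_trans (snormD HL (shZ HL _ Lx) (shZ HL _ Ly)) _.
  by rewrite !(snormZ HL)// ger0_norm//; lra.
- move=> x y Hx Hy.
  have := snorm_dist HL (H1_L2 Hx) (H1_L2 Hy) (H1_L2 Hg).
  have := snorm_L2_le ow (shB H Hx Hy); lra.
- move=> e' e'0; pose e := Num.min 1 (e' / (3 * (m + 1))).
  have m1 : 0 < 3 * (m + 1) by rewrite mulr_gt0// ltr_wpDl.
  have e0 : 0 < e by rewrite lt_min ltr01 divr_gt0.
  have e1 : e <= 1 by rewrite ge_min lexx.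
  have ee : e * (3 * m) <= e'.
    have : e * (3 * (m + 1)) <= e' by rewrite -ler_pdivlMr// ge_min lexx orbT.
    by move: e0 e1 => e0 _; nra.
  have e2 : 0 < e / 2 by lra.
  have [p [ep pu pd]] := smooth_approximation L0 M0 uL e2.
  have tt := threshold_test ep e0 wM pu u0.
  set phi := (_ \_ w) in tt; have Hphi := test_H1 ow tt.
  have Lphi := H1_L2 Hphi.
  have phig : snorm (ip w) (phi - g) <= 3 * e * m.
    apply: snorm_bounded; [exact: (shB HL Lphi (H1_L2 Hg))|by lra|].
    move=> x wx; rewrite (_ : (phi - g) x = phi x - g x)// -ug// /phi patchT ?inE//.
    have h1 := pu x (wM _ wx).
    have h2 := ler_wpM2l (ltW e0) (threshold_dist (p x / e)).
    rewrite -{1}(ger0_norm (ltW e0)) -normrM mulrBr mulrA [e * (p x / e)]mulrC divfK ?gt_eqF// in h2.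
    have -> : p x * flat 1 ((p x / e) ^+ 2 - 1) - u x =
      (p x * flat 1 ((p x / e) ^+ 2 - 1) - p x) + (p x - u x) by ring.
    apply: le_trans (ler_normD _ _) _; lra.
  exists phi; split; first exact: tt.
    apply: le_trans (snorm_le_sum HL (cH1_L2 (w := w)) (ipH1E ow) Hphi) _.
    apply: ler_sum => -[i|j] _ /=.
      have := snorm_dist HL Lphi (H1_L2 Hg) (sh0 HL); rewrite !subr0.
      have : 3 * e * m <= 3 * m by rewrite ler_wpM2r// ler_piMr.
      by move: phig; lra.
    have gj : is_wgrad w phi (grad phi) by exact: test_is_wgrad.
    rewrite (null_snorm HL (H1_cmp j Hphi) (gj.1 j) (wgrad_eq ow j Lphi gj)) -/(cmp j _) cmp_grad.
    apply: snorm_bounded; [exact: test_pderiv_L2|by rewrite mulr_ge0|].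
    by move=> x wx; apply: threshold_pderiv => //; apply: pd; exact: wM.
  by apply: le_trans phig _; rewrite mulrAC -mulrA mulrC; move: ee; lra.
have n0 : snorm (ip w) (g - c) = 0.
  rewrite (snorm_sub HL (H1_L2 Hg) (H1_L2 Hc)); apply/eqP; rewrite eq_le snorm_ge0 andbT.
  exact: cg.
have n1 := null_H1 Hg Hc n0.
apply: (H10_closed ow); split; first exact: Hg.
move=> e e0; exists c; split; first exact: (conj Hc cP).
by rewrite n1.
Qed.

End lipschitz_in_H10.

(** * Barycentric coordinates and the boundary of a simplex *)

Section barycentric_coordinates.
Context {R : realType} {n : nat}.
Variable V : 'M[R]_(n.+2, n.+1).
Hypothesis aV : affinely_independent V.
Implicit Types (x : 'rV[R]_n.+1) (l : 'rV[R]_n.+2) (j : 'I_n.+2).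

Let A := \matrix_(i < n.+1) (row (lift ord0 i) V - row ord0 V).
Let uA : A \in unitmx. Proof. by rewrite -row_free_unit. Qed.
Let lam x := (x - row ord0 V) *m invmx A.

(** [lam x] holds the coordinates of [x] along the edges issued from vertex 0, and the coordinate of
    vertex 0 completes the sum to 1. *)
Definition bary x : 'rV[R]_n.+2 :=
  \row_j oapp (fun k => lam x ord0 k) (1 - \sum_k lam x ord0 k) (unlift ord0 j).

Let bary0 x : bary x ord0 ord0 = 1 - \sum_k lam x ord0 k.
Proof. by rewrite mxE unlift_none. Qed.

Let baryS x k : bary x ord0 (lift ord0 k) = lam x ord0 k.
Proof. by rewrite mxE liftK. Qed.

Lemma bary_sum x : \sum_j bary x ord0 j = 1.
Proof.
rewrite big_ord_recl bary0.
have -> : \sum_k bary x ord0 (lift ord0 k) = \sum_k lam x ord0 k.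
  by apply: eq_bigr => k _; exact: baryS.
by rewrite subrK.
Qed.

Let mulE l : \sum_j l ord0 j = 1 ->
  l *m V = row ord0 V + (\row_k l ord0 (lift ord0 k)) *m A.
Proof.
rewrite big_ord_recl => l1; rewrite !mulmx_sum_row big_ord_recl.
have -> : l ord0 ord0 = 1 - \sum_k l ord0 (lift ord0 k) by rewrite -l1 addrK.
rewrite scalerBl scale1r scaler_suml -addrA; congr (_ + _).
rewrite addrC -sumrB; apply: eq_bigr => k _.
by rewrite mxE rowK scalerBr.
Qed.

Lemma baryK l : \sum_j l ord0 j = 1 -> bary (l *m V) = l.
Proof.
move=> l1; have lamE : lam (l *m V) = \row_k l ord0 (lift ord0 k).
  by rewrite /lam mulE// addrAC subrr add0r mulmxK.
apply/rowP => j; case: (unliftP ord0 j) => [k ->|->]; first by rewrite baryS lamE mxE.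
rewrite bary0 lamE -l1 big_ord_recl.
have -> : \sum_k (\row_k l ord0 (lift ord0 k)) ord0 k = \sum_k l ord0 (lift ord0 k) :> R.
  by apply: eq_bigr => k _; rewrite mxE.
by rewrite addrK.
Qed.

Lemma bary_mul x : bary x *m V = x.
Proof.
have -> : bary x *m V = row ord0 V + (\row_k bary x ord0 (lift ord0 k)) *m A.
  exact/mulE/bary_sum.
have -> : \row_k bary x ord0 (lift ord0 k) = lam x by apply/rowP => k; rewrite mxE baryS.
have -> : lam x *m A = x - row ord0 V by rewrite /lam (mulmxKV uA).
by rewrite addrC subrK.
Qed.

(** The linear part is nonzero because the coordinate is 1 at vertex [j] and 0 at any other
    vertex. *)
Lemma bary_affine j : exists (a : 'rV[R]_n.+1) c, a != 0 /\
  forall x, bary x ord0 j = dotp a x + c.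
Proof.
have [a [c acE]] : exists (a : 'rV[R]_n.+1) c, forall x, bary x ord0 j = dotp a x + c.
  pose b k := \row_i invmx A i k; pose e k := - (row ord0 V *m invmx A) ord0 k.
  have lE x k : lam x ord0 k = dotp (b k) x + e k.
    rewrite /lam mulmxBl mxE; congr (_ + _); last by rewrite [LHS]mxE.
    by rewrite mxE; apply: eq_bigr => i _; rewrite mxE mulrC.
  case: (unliftP ord0 j) => [k ->|->].
    by exists (b k), (e k) => x; rewrite baryS.
  exists (- \sum_k b k), (1 - \sum_k e k) => x; rewrite bary0 (eq_bigr _ (fun k _ => lE x k)).
  rewrite big_split/= opprD addrCA; congr (_ + _).
  rewrite /dotp exchange_big/= -sumrN; apply: eq_bigr => i _.
  by rewrite mxE summxE mulNr -mulr_suml.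
exists a, c; split=> //; apply/eqP => a0.
have vE (i : 'I_n.+2) : bary (row i V) ord0 j = (i == j)%:R.
  rewrite rowE baryK; first by rewrite mxE eqxx eq_sym.
  by rewrite (bigD1 i)//= !mxE !eqxx big1 ?addr0// => k /negPf ki; rewrite mxE ki andbF.
have cst x : bary x ord0 j = c.
  by rewrite acE a0 /dotp big1 ?add0r// => i _; rewrite mxE mul0r.
have [i ij] : exists i : 'I_n.+2, i != j.
  by exists (lift j ord0); rewrite eq_sym neq_lift.
by have := vE j; have := vE i; rewrite !cst eqxx (negPf ij) => -> /eqP; rewrite eq_sym oner_eq0.
Qed.

Lemma bary_continuous j : continuous (fun x => bary x ord0 j).
Proof.
have [a [c [_ acE]]] := bary_affine j; apply/smooth_continuous/elementary_smooth.
have -> : (fun x => bary x ord0 j) = (dotp a : 'rV[R]_n.+1 -> R) + cst c by exact/funext.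
apply: elem_add (elem_cst c).
by apply: elem_sum => i; apply: elem_mul; [exact: elem_cst|exact: elem_coord].
Qed.

Lemma simplexP x : simplex V x <-> forall j, 0 < bary x ord0 j.
Proof.
split=> [[l [l0 l1 ->]] j|b0]; first by rewrite baryK.
by exists (bary x); rewrite bary_sum bary_mul.
Qed.

Lemma facetP j x : (forall i, 0 <= bary x ord0 i) -> bary x ord0 j = 0 -> facet V j x.
Proof.
move=> b0 bj; exists (bary x); rewrite bary_sum bary_mul; split=> // i.
by rewrite !inE negbK => /eqP ->.
Qed.

Lemma simplex_open : open (simplex V).
Proof.
rewrite openE => x /simplexP bx.
have : \forall y \near x, forall j, 0 < bary y ord0 j.
  apply: (@filter_forall _ _ (fun j y => 0 < bary y ord0 j) (nbhs x)) => j.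
  exact: (@cvgr_gt _ _ (nbhs x) _ (fun y => bary y ord0 j) _ (@bary_continuous j x) _ (bx j)).
by apply: filterS => y /simplexP.
Qed.

Lemma closure_simplex x j : closure (simplex V) x -> 0 <= bary x ord0 j.
Proof.
have cl : closed [set x | 0 <= bary x ord0 j].
  apply: (@closed_comp _ _ (fun x => bary x ord0 j) [set r | 0 <= r]); last exact: closed_ge.
  by move=> y _; exact: (@bary_continuous j y).
have sub : simplex V `<=` [set x | 0 <= bary x ord0 j].
  by move=> y /simplexP h; exact: ltW.
by move/(closure_subset sub); rewrite -((closure_id _).1 cl).
Qed.

Lemma simplex_boundary_facet x : boundary (simplex V) x ->
  exists2 j, facet V j x & bary x ord0 j = 0.
Proof.
move=> [cx nx]; have bx j := closure_simplex j cx.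
suff [j bj] : exists j, bary x ord0 j = 0 by exists j => //; exact: facetP.
apply: contrapT => h; apply: nx; apply: (open_nbhs_nbhs (conj simplex_open _)).
by apply/simplexP => j; rewrite lt_neqAle bx andbT; apply/eqP => bj; apply: h; exists j.
Qed.

(** The boundary is covered by finitely many hyperplanes, the zero sets of the barycentric
    coordinates. *)
Lemma simplex_boundary_null : lebesgue_rV n.+1 (boundary (simplex V)) = 0%E.
Proof.
have mb : measurable (boundary (simplex V)).
  apply: measurableD; first by apply: rV_closed_measurable; exact: closed_closure.
  by apply: rV_open_measurable; exact: open_interior.
have nj j : (@lebesgue_rV R n.+1).-negligible [set x | bary x ord0 j = 0].
  have [a [c [a0 acE]]] := bary_affine j; have := lebesgue_rV_hyperplane (- c) a0.
  have <- : [set x | bary x ord0 j = 0] = [set x | dotp a x = - c].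
    apply/seteqP; split=> x /=; rewrite acE; last by move=> ->; rewrite addNr.
    by move/eqP; rewrite addr_eq0 => /eqP.
  move=> h; exists [set x | bary x ord0 j = 0]; split=> //.
  rewrite (_ : mkset _ = (fun x => bary x ord0 j) @^-1` [set 0])// -[X in measurable X]setTI.
  by apply: rV_continuous_measurable => //; exact: bary_continuous.
have : (@lebesgue_rV R n.+1).-negligible (\big[setU/set0]_j [set x | bary x ord0 j = 0]).
  elim/big_ind: _ => //; [exact: negligible_set0|move=> *; exact: negligibleU].
move/negligibleS => /(_ (boundary (simplex V))) h.
apply/(@negligibleP _ _ _ _ _ mb)/h => x /simplex_boundary_facet[j _ bj].
by rewrite -bigcup_seq; exists j; rewrite //= mem_index_enum.
Qed.

End barycentric_coordinates.

(** * Restriction to open subsets and extension by zero *)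

Section restriction.
Context {R : realType} {d : nat}.
Local Notation E := 'rV[R]_d.
Local Notation leb := (@lebesgue_rV R d).
Implicit Types (w : set E) (f g u v : E -> R) (q r : E -> E).

Lemma L2_congr w f g : measurable w -> (forall x, w x -> f x = g x) -> L2 w f -> L2 w g.
Proof.
move=> mw fg [mf If]; split.
  by apply: eq_measurable_fun mf => x /[!inE]; exact: fg.
by apply: eq_integrable If => // x /[!inE] wx; rewrite /= fg.
Qed.

Lemma ip_congr w f f' g g' : (forall x, w x -> f x = f' x) -> (forall x, w x -> g x = g' x) ->
  ip w f g = ip w f' g'.
Proof. by move=> ff gg; apply: eq_Rintegral => x /[!inE] wx; rewrite ff// gg. Qed.

Lemma ipv_congr w q q' r r' : (forall x, w x -> q x = q' x) -> (forall x, w x -> r x = r' x) ->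
  ipv w q r = ipv w q' r'.
Proof. by move=> ff gg; apply: eq_Rintegral => x /[!inE] wx; rewrite ff// gg. Qed.

Lemma L2v_congr w q q' : measurable w -> (forall x, w x -> q x = q' x) -> L2v w q -> L2v w q'.
Proof. by move=> mw qq Lq i; apply: (L2_congr mw) (Lq i) => x wx; rewrite qq. Qed.

Lemma is_wgrad_congr w u u' q : (forall x, w x -> u x = u' x) -> is_wgrad w u q -> is_wgrad w u' q.
Proof.
move=> uu [Lq hq]; split=> // phi tphi i; rewrite -hq//.
by apply: ip_congr => // x wx; rewrite uu.
Qed.

Lemma is_wdiv_congr w q q' f : (forall x, w x -> q x = q' x) -> is_wdiv w q f -> is_wdiv w q' f.
Proof.
move=> qq [Lf hf]; split=> // phi tphi; rewrite -hf//.
by apply: ipv_congr => // x wx; rewrite qq.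
Qed.

Lemma H1_congr w u u' : measurable w -> (forall x, w x -> u x = u' x) -> H1space w u -> H1space w u'.
Proof.
move=> mw uu [Lu [q hq]]; split; first exact: (L2_congr mw) Lu.
by exists q; exact: is_wgrad_congr hq.
Qed.

Lemma Hdiv_congr w q q' : measurable w -> (forall x, w x -> q x = q' x) -> Hdiv w q -> Hdiv w q'.
Proof.
move=> mw qq [Lq [f hf]]; split; first exact: (L2v_congr mw) Lq.
by exists f; exact: is_wdiv_congr hf.
Qed.

Lemma L2_ae_eq w f g : measurable w -> L2 w f -> L2 w g ->
  snorm (ip w) (f - g) = 0 <-> ae_eq leb w f g.
Proof.
move=> mw Lf Lg; have Lfg := shB (L2_semiHilbert mw) Lf Lg.
have [h1 h2] := null_ae mw Lfg; split=> [/h1|h].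
  by apply: filterS => x h wx; apply/eqP; rewrite -subr_eq0; apply/eqP; exact: h.
by apply: h2; apply: filterS h => x h wx; rewrite !fctE h// subrr.
Qed.

Section subset.
Variables w w' : set E.
Hypotheses (ow : open w) (ow' : open w') (sw : w' `<=` w).
Let mw := rV_open_measurable ow.
Let mw' := rV_open_measurable ow'.
Let HL := L2_semiHilbert mw.
Let HL' := L2_semiHilbert mw'.

Lemma L2_restrict f : L2 w f -> L2 w' f.
Proof.
move=> [mf If]; split; first exact: measurable_funS mf.
exact: integrableS If.
Qed.

Lemma L2v_restrict q : L2v w q -> L2v w' q.
Proof. by move=> Lq i; exact: L2_restrict. Qed.

Lemma snorm_restrict f : L2 w f -> snorm (ip w') f <= snorm (ip w) f.
Proof.
move=> Lf; rewrite ler_wsqrtr// -lee_fin !ip_sqr//; last exact: L2_restrict.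
apply: ge0_subset_integral => //; first by apply/measurable_EFinP/measurable_funX; case: Lf.
by move=> x _; rewrite lee_fin sqr_ge0.
Qed.

Lemma ip_support f g : (forall x, ~ w' x -> g x = 0) -> ip w f g = ip w' f g.
Proof.
move=> g0; rewrite /ip -[in RHS](setIidr sw) Rintegral_mkcondr.
apply: eq_Rintegral => x _; rewrite patchE; case: ifPn => //; rewrite notin_setE => nx.
by rewrite g0// mulr0.
Qed.

Lemma ipv_support q r : (forall x, ~ w' x -> r x = 0) -> ipv w q r = ipv w' q r.
Proof.
move=> r0; rewrite /ipv -[in RHS](setIidr sw) Rintegral_mkcondr.
apply: eq_Rintegral => x _; rewrite patchE; case: ifPn => //; rewrite notin_setE => nx.
by rewrite r0// /dotp big1// => i _; rewrite mxE mulr0.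
Qed.

Lemma test_function_off phi : test_function w' phi -> forall x, ~ w' x -> phi x = 0.
Proof. by move=> [_ [K [_ Kw K0]]] x nx; apply: K0 => /Kw. Qed.

Lemma is_wgrad_restrict u q : is_wgrad w u q -> is_wgrad w' u q.
Proof.
move=> [Lq hq]; split; first exact: L2v_restrict.
move=> phi tphi i; rewrite -!ip_support.
- exact/hq/(test_function_sub sw).
- exact: test_function_off.
- exact/test_function_off/test_function_pderiv.
Qed.

Lemma is_wdiv_restrict q f : is_wdiv w q f -> is_wdiv w' q f.
Proof.
move=> [Lf hf]; split; first exact: L2_restrict.
move=> phi tphi; rewrite -ip_support; last exact: test_function_off.
rewrite -ipv_support; first exact/hf/(test_function_sub sw).
move=> x nx; apply/rowP => i; rewrite !mxE.
by apply: test_function_off => //; exact: test_function_pderiv.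
Qed.

Lemma H1_restrict u : H1space w u -> H1space w' u.
Proof.
move=> [Lu [q hq]]; split; first exact: L2_restrict.
by exists q; exact: is_wgrad_restrict.
Qed.

Lemma Hdiv_restrict q : Hdiv w q -> Hdiv w' q.
Proof.
move=> [Lq [f hf]]; split; first exact: L2v_restrict.
by exists f; exact: is_wdiv_restrict.
Qed.

Lemma L2_extend f : L2 w' f -> L2 w (f \_ w').
Proof.
move=> [mf If]; split.
  apply/(measurable_restrict _ mw' mw).
  by rewrite setIidr.
have -> : EFin \o (fun x => (f \_ w') x ^+ 2) = (EFin \o (fun x => f x ^+ 2)) \_ w'.
  by apply/funext => x; rewrite /= !patchE; case: ifP => //; rewrite expr0n.
apply: integrableS (subsetT w) _ => //.
by rewrite -(integrable_mkcond _ mw').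
Qed.

End subset.

Section open_set.
Variable w : set E.
Hypothesis ow : open w.
Let mw := rV_open_measurable ow.
Let HL := L2_semiHilbert mw.

Lemma normal_traceE q f u r : L2v w q -> is_wdiv w q f -> L2 w u -> is_wgrad w u r ->
  normal_trace w q u = ipv w q r + ip w f u.
Proof.
move=> Lq hf Lu hr; have Hu : H1space w u by split=> //; exists r.
by rewrite (normal_trace_eq ow Lq hf Hu) (ipv_wgrad ow Lq Lu hr).
Qed.

Lemma null_H10 u : H1space w u -> snorm (ip w) u = 0 -> H10space w u.
Proof.
move=> Hu n; have H0 := H1_0 ow.
have := null_H1 ow Hu H0; rewrite subr0 => /(_ n) n1.
apply: (H10_closed ow); split; first exact: Hu.
move=> e e0; exists 0; split; first exact: H10_0.
by rewrite subr0 n1.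
Qed.

Lemma zero_H10 u : (forall x, w x -> u x = 0) -> H10space w u.
Proof.
move=> u0; apply: null_H10.
  by apply: (H1_congr mw) (H1_0 ow) => x wx; rewrite u0.
by rewrite /snorm (@ip_congr w u 0 u 0 u0 u0) -/(snorm _ _) (snorm0 HL).
Qed.

End open_set.

End restriction.

(** * Decomposition over an open partition up to a null set *)

Section open_partition.
Context {R : realType} {d N : nat}.
Local Notation E := 'rV[R]_d.
Local Notation leb := (@lebesgue_rV R d).
Variables (Om : set E) (W : 'I_N -> set E).
Hypotheses (oOm : open Om) (oW : forall k, open (W k)) (sW : forall k, W k `<=` Om).
Hypothesis dW : forall k l, k != l -> W k `&` W l = set0.
Hypothesis nW : leb (Om `\` \bigcup_k W k) = 0%E.
Implicit Types (f g u v : E -> R) (q r : E -> E).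
Let mOm := rV_open_measurable oOm.
Let mW k := rV_open_measurable (@oW k).
Let HL := L2_semiHilbert mOm.

Lemma Rintegral_partition f : leb.-integrable Om (EFin \o f) ->
  \int[leb]_(x in Om) f x = \sum_k \int[leb]_(x in W k) f x.
Proof.
move=> If; have UE : \bigcup_k W k = \big[setU/set0]_k W k.
  rewrite -bigcup_seq; apply: eq_bigcupl; split=> k _ //=; exact: mem_index_enum.
have mU : measurable (\bigcup_k W k) by rewrite UE; exact: bigsetU_measurable.
have mN : measurable (Om `\` \bigcup_k W k) by exact: measurableD.
have sU : \bigcup_k W k `<=` Om by move=> x [k _]; exact: sW.
have EU : Om `\` (Om `\` \bigcup_k W k) = \bigcup_k W k by rewrite setDD setIidr.
rewrite /Rintegral (negligible_integral mN mOm If nW) EU UE.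
have IU : leb.-integrable (\bigcup_k W k) (EFin \o f) by exact: integrableS If.
have Ik k : leb.-integrable (W k) (EFin \o f) by exact: integrableS If.
rewrite integral_bigsetU_EFin//.
- by rewrite -sum_fine// => k _; exact: integrable_fin_num.
- exact: index_enum_uniq.
- move=> k l _ _ [x kl]; apply/eqP; apply: contraPT kl => kl; by rewrite dW.
- by rewrite -UE; exact: measurable_int IU.
Qed.

Lemma ip_partition f g : L2 Om f -> L2 Om g -> ip Om f g = \sum_k ip (W k) f g.
Proof. by move=> Lf Lg; apply: Rintegral_partition; exact: L2_mul_integrable. Qed.

Lemma ipv_partition q r : L2v Om q -> L2v Om r -> ipv Om q r = \sum_k ipv (W k) q r.
Proof.
move=> Lq Lr; rewrite ipvE// (eq_bigr _ (fun i _ => ip_partition (Lq i) (Lr i))) exchange_big/=.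
apply: eq_bigr => k _; rewrite ipvE//; exact: (L2v_restrict oOm (@oW k) (@sW k)).
Qed.

Definition glue (F : 'I_N -> E -> R) : E -> R := fun x => \sum_k (\1_(W k) x : R) * F k x.

Lemma glueE F k x : W k x -> glue F x = F k x.
Proof.
move=> kx; rewrite /glue (bigD1 k)//= indicE mem_set// mul1r big1 ?addr0// => l lk.
rewrite indicE memNset ?mul0r// => lx; have : (W l `&` W k) x by [].
by rewrite dW.
Qed.

Lemma glue_L2 F : (forall k, L2 (W k) (F k)) -> L2 Om (glue F).
Proof.
move=> LF; have -> : glue F = \sum_k (F k \_ (W k)).
  apply/funext => x; rewrite /glue fct_sumE; apply: eq_bigr => k _.
  by rewrite patchE indicE; case: ifP => _; rewrite ?mul1r ?mul0r.
elim/big_ind: _ => [|f g Lf Lg|k _]; [exact: L2_0|exact: (shD HL Lf Lg)|].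
exact: (L2_extend oOm (@oW k) (@sW k) (LF k)).
Qed.

Lemma wgrad_restrict u k i : H1space Om u ->
  snorm (ip (W k)) (cmp i (wgrad Om u) - cmp i (wgrad (W k) u)) = 0.
Proof.
move=> Hu; have Hk := H1_restrict oOm (@oW k) (@sW k) Hu.
apply: (is_wgrad_unique (@oW k)); [exact: H1_L2 Hk|exact: H1_L2 Hk| | |].
- exact: (is_wgrad_restrict oOm (@oW k) (@sW k) (wgradP Hu)).
- exact: wgradP.
- by rewrite subrr (snorm0 (L2_semiHilbert (mW k))).
Qed.

Lemma normal_trace_partition q u : Hdiv Om q -> H1space Om u ->
  normal_trace Om q u = \sum_k normal_trace (W k) q u.
Proof.
move=> Hq Hu; have Gu := wgradP Hu; have Dq := wdivP Hq.
have [Lq _] := Hq; have Lu := H1_L2 Hu.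
rewrite (normal_traceE oOm Lq Dq Lu Gu) (ipv_partition Lq Gu.1) (ip_partition Dq.1 Lu) -big_split.
apply: eq_bigr => k _; rewrite (normal_traceE (@oW k) (f := wdiv Om q) (r := wgrad Om u))//.
- exact: (L2v_restrict oOm (@oW k) (@sW k)).
- exact: (is_wdiv_restrict oOm (@oW k) (@sW k)).
- exact: (L2_restrict oOm (@oW k) (@sW k)).
- exact: (is_wgrad_restrict oOm (@oW k) (@sW k)).
Qed.

(** Normal traces detect membership in H^1_0 by [normal_traces_H10], and they add up over the
    pieces. *)
Lemma H10_partition u : H1space Om u -> (forall k, H10space (W k) u) -> H10space Om u.
Proof.
move=> Hu Hk; apply: (normal_traces_H10 oOm Hu) => q Hq.
rewrite normal_trace_partition//; apply: big1 => k _.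
exact: (normal_trace_H10 (@oW k) (Hdiv_restrict oOm (@oW k) (@sW k) Hq) (Hk k)).
Qed.

End open_partition.

(** * Bounded linear forms *)

Section bounded_linear_forms.
Context {R : realType} {X : lmodType R} (D : X -> Prop) (ip : X -> X -> R).
Hypothesis H : semiHilbert D ip.
Local Notation nm := (snorm ip).

Definition bounded_linear (l : X -> R) := linear_on D l /\ exists M, bounded_by D ip M l.

Lemma bounded_linear_eq l l' : (forall x, D x -> l x = l' x) -> bounded_linear l -> bounded_linear l'.
Proof.
move=> ll [L [M B]]; split=> [a x y Dx Dy|]; last by exists M => x Dx; rewrite -ll//; exact: B.
by rewrite -!ll//; [exact: L|exact: (shL H)].
Qed.

Lemma bounded_linear0 : bounded_linear (fun=> 0).
Proof.
split=> [a x y _ _|]; first by rewrite mulr0 addr0.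
by exists 0 => x _; rewrite normr0 mul0r.
Qed.

Lemma bounded_linear_lin a l l' : bounded_linear l -> bounded_linear l' ->
  bounded_linear (fun x => a * l x + l' x).
Proof.
move=> [L [M B]] [L' [M' B']]; split=> [b x y Dx Dy|].
  by rewrite L// L'//; ring.
exists (`|a| * M + M') => x Dx; apply: le_trans (ler_normD _ _) _.
rewrite mulrDl normrM -mulrA lerD//; last exact: B'.
by rewrite ler_wpM2l//; exact: B.
Qed.

Lemma bounded_linearD l l' : bounded_linear l -> bounded_linear l' ->
  bounded_linear (fun x => l x + l' x).
Proof.
move=> bl bl'; apply: bounded_linear_eq (bounded_linear_lin 1 bl bl') => x _.
by rewrite mul1r.
Qed.

Lemma bounded_linearN l : bounded_linear l -> bounded_linear (fun x => - l x).
Proof.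
move=> bl; apply: bounded_linear_eq (bounded_linear_lin (-1) bl bounded_linear0) => x _.
by rewrite addr0 mulN1r.
Qed.

Lemma bounded_linear_sum (I : Type) (s : seq I) (l : I -> X -> R) :
  (forall i, bounded_linear (l i)) -> bounded_linear (fun x => \sum_(i <- s) l i x).
Proof.
move=> bl; elim: s => [|i s ih].
  by apply: bounded_linear_eq bounded_linear0 => x _; rewrite big_nil.
by apply: bounded_linear_eq (bounded_linearD (bl i) ih) => x _; rewrite big_cons.
Qed.

Lemma bounded_linear_bounded l (M : R) : (forall x, D x -> `|l x| <= M * nm x) ->
  linear_on D l -> bounded_linear l.
Proof. by move=> B L; split=> //; exists M. Qed.

End bounded_linear_forms.

(** * The broken test space *)

Section broken_spaces.
Context {R : realType} {n N : nat}.
Local Notation E := 'rV[R]_n.+1.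
Local Notation leb := (@lebesgue_rV R n.+1).
Variables (Om : set E) (V : 'I_N -> 'M[R]_(n.+2, n.+1)).
Local Notation T k := (simplex (V k)).
Hypotheses (oOm : open Om) (oT : forall k, open (T k)) (sT : forall k, T k `<=` Om).
Hypothesis dT : forall k l, k != l -> T k `&` T l = set0.
Hypothesis nT : leb (Om `\` \bigcup_k T k) = 0%E.
Implicit Types (f g : E -> R) (q r t : E -> E) (k : 'I_N) (v w : testT (R := R) (n := n)).
Let mOm := rV_open_measurable oOm.
Let mT k := rV_open_measurable (@oT k).
Let HL := L2_semiHilbert mOm.
Let HT k := L2_semiHilbert (mT k).
Local Notation nm := (snorm (ip Om)).
Local Notation glueT := (glue (fun k => T k)).
Local Notation inV := (inV Om V).
Local Notation ipV := (ipV Om V).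
Local Notation pw_grad := (pw_grad V).
Local Notation pw_div := (pw_div V).

Lemma L2T f k : L2 Om f -> L2 (T k) f.
Proof. exact: (L2_restrict oOm (@oT k) (@sT k)). Qed.

Lemma cvgT (u : nat -> E -> R) f k : (forall m, L2 Om (u m)) -> L2 Om f ->
  (fun m => nm (u m - f)) @ \oo --> (0 : R) ->
  (fun m => snorm (ip (T k)) (u m - f)) @ \oo --> (0 : R).
Proof.
move=> Lu Lf /(cvg_to0P (fun m => snorm_ge0 (ip Om) _)) h.
apply/(cvg_to0P (fun m => snorm_ge0 (ip (T k)) _)) => e /h[n0 hn0].
exists n0 => m nm0; apply: le_trans (hn0 m nm0).
exact: (snorm_restrict oOm (@oT k) (@sT k) (shB HL (Lu m) Lf)).
Qed.

Lemma nullT f k : L2 Om f -> nm f = 0 -> snorm (ip (T k)) f = 0.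
Proof.
move=> Lf nf; apply/eqP; rewrite eq_le snorm_ge0 andbT -nf.
exact: (snorm_restrict oOm (@oT k) (@sT k) Lf).
Qed.

Lemma null_partition f : L2 Om f -> (forall k, snorm (ip (T k)) f = 0) -> nm f = 0.
Proof.
move=> Lf fk; suff : nm f ^+ 2 = 0 by move/eqP; rewrite sqrf_eq0 => /eqP.
rewrite (snorm_sqr HL Lf) (ip_partition oOm oT sT dT nT Lf Lf).
apply: big1 => k _; have := snorm_sqr (HT k) (L2T k Lf).
by rewrite fk expr0n /= => <-.
Qed.

Lemma cmp_pw_grad f i : cmp i (pw_grad f) = glueT (fun k => cmp i (wgrad (T k) f)).
Proof.
apply/funext => x; rewrite /cmp /glue summxE; apply: eq_bigr => k _.
by rewrite mxE.
Qed.

Lemma pw_gradE f k x : T k x -> pw_grad f x = wgrad (T k) f x.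
Proof.
move=> kx; apply/rowP => i.
by rewrite -[LHS]/(cmp i (pw_grad f) x) cmp_pw_grad (glueE dT _ kx).
Qed.

Lemma pw_divE q k x : T k x -> pw_div q x = wdiv (T k) q x.
Proof. exact: (@glueE _ _ _ (fun k => T k) dT (fun k => wdiv (T k) q) k x). Qed.

Lemma pw_grad_L2v f : (forall k, H1space (T k) f) -> L2v Om (pw_grad f).
Proof.
move=> Hf i; change (L2 Om (cmp i (pw_grad f))); rewrite cmp_pw_grad.
by apply: (glue_L2 oOm oT sT) => k; exact: H1_cmp.
Qed.

Lemma pw_div_L2 q : (forall k, Hdiv (T k) q) -> L2 Om (pw_div q).
Proof. by move=> Hq; apply: (glue_L2 oOm oT sT) => k; exact: wdiv_L2. Qed.

Lemma pw_gradP f k : H1space (T k) f -> is_wgrad (T k) f (pw_grad f).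
Proof.
move=> /wgradP[Lf hf]; split.
  by apply: (L2v_congr (mT k)) Lf => x kx; rewrite (pw_gradE _ kx).
by move=> phi tphi i; rewrite hf//; congr (- _); apply: ip_congr => // x kx; rewrite (pw_gradE _ kx).
Qed.

Lemma pw_divP q k : Hdiv (T k) q -> is_wdiv (T k) q (pw_div q).
Proof.
move=> /wdivP[Lf hf]; split.
  by apply: (L2_congr (mT k)) Lf => x kx; rewrite (pw_divE _ kx).
by move=> phi tphi; rewrite hf//; congr (- _); apply: ip_congr => // x kx; rewrite (pw_divE _ kx).
Qed.

Lemma pw_grad_unique f q i : L2 Om f -> (forall k, H1space (T k) f) -> L2v Om q ->
  (forall k, is_wgrad (T k) f q) -> nm (cmp i (pw_grad f) - cmp i q) = 0.
Proof.
move=> Lf Hf Lq hq; apply: null_partition; first exact: (shB HL (pw_grad_L2v Hf i) (Lq i)).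
move=> k; apply: (is_wgrad_unique (@oT k) i (L2T k Lf) (L2T k Lf) (pw_gradP (Hf k)) (hq k)).
by rewrite subrr (snorm0 (HT k)).
Qed.

Lemma pw_div_unique q f : L2v Om q -> (forall k, Hdiv (T k) q) -> L2 Om f ->
  (forall k, is_wdiv (T k) q f) -> nm (pw_div q - f) = 0.
Proof.
move=> Lq Hq Lf hf; apply: null_partition; first exact: (shB HL (pw_div_L2 Hq) Lf).
move=> k; apply: (is_wdiv_unique (@oT k) (fun i => L2T k (Lq i)) (fun i => L2T k (Lq i)) _ (pw_divP (Hq k)) (hf k)).
by move=> i; rewrite subrr (snorm0 (HT k)).
Qed.

Definition cV (i : (unit + 'I_n.+1) + ('I_n.+1 + unit)) v : E -> R :=
  match i with
  | inl (inl _) => v.1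
  | inl (inr j) => cmp j (pw_grad v.1)
  | inr (inl j) => cmp j v.2
  | inr (inr _) => pw_div v.2
  end.

Lemma cV_L2 i v : inV v -> L2 Om (cV i v).
Proof.
move=> [Lv Hv Lt Ht]; case: i => [[_|j]|[j|_]] /=.
- exact: Lv.
- exact: (pw_grad_L2v Hv).
- exact: Lt.
- exact: pw_div_L2.
Qed.

Lemma inV_lin a v w : inV v -> inV w -> inV (a *: v + w).
Proof.
move=> [Lv Hv Lt Ht] [Lw Hw Ls Hs]; split.
- exact: (shL HL).
- by move=> k; apply: H1_lin.
- exact: L2v_lin.
- by move=> k; apply: Hdiv_lin.
Qed.

Lemma inV_0 : inV 0.
Proof.
split; [exact: L2_0|by move=> k; exact: H1_0|exact: L2v_0|by move=> k; exact: Hdiv_0].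
Qed.

Lemma cV_lin i a v w : inV v -> inV w ->
  nm (cV i (a *: v + w) - (a *: cV i v + cV i w)) = 0.
Proof.
move=> Vv Vw; have [Lvw Hvw Ltw Htw] := inV_lin a Vv Vw.
case: (Vv) (Vw) => [Lv Hv Lt Ht] [Lw Hw Ls Hs]; case: i => [[_|j]|[j|_]] /=.
- by rewrite subrr (snorm0 HL).
- rewrite -cmp_lin; apply: pw_grad_unique => //.
    by apply: L2v_lin; [|exact: pw_grad_L2v|exact: pw_grad_L2v].
  by move=> k; apply: is_wgrad_lin (pw_gradP (Hv k)) (pw_gradP (Hw k)) => //; exact: L2T.
- by rewrite (_ : cmp j _ - _ = 0) ?(snorm0 HL)// -cmp_lin subrr.
- apply: pw_div_unique => //.
    by apply: (shL HL); exact: pw_div_L2.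
  move=> k; apply: is_wdiv_lin (pw_divP (Ht k)) (pw_divP (Hs k)) => //.
    by move=> i; exact: (L2T k (Lt i)).
  by move=> i; exact: (L2T k (Ls i)).
Qed.

Lemma ipVE v w : inV v -> inV w -> ipV v w = \sum_i ip Om (cV i v) (cV i w).
Proof.
move=> Vv Vw; case: (Vv) (Vw) => [Lv Hv Lt Ht] [Lw Hw Ls Hs].
rewrite !big_sumType /= !big_unit /= /ipV (ipvE mOm (pw_grad_L2v Hv) (pw_grad_L2v Hw)) (ipvE mOm Lt Ls).
by rewrite -!addrA.
Qed.

(** Weak derivatives pass to L^2 limits on each element, so the limits of the derivative components
    are, up to null functions, the derivatives of the limits. *)
Lemma cV_closed (u : nat -> testT) (z : (unit + 'I_n.+1) + ('I_n.+1 + unit) -> E -> R) :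
  (forall m, inV (u m)) -> (forall i, L2 Om (z i)) ->
  (forall i, (fun m => nm (cV i (u m) - z i)) @ \oo --> (0 : R)) ->
  exists v, inV v /\ forall i, nm (z i - cV i v) = 0.
Proof.
move=> uV zL cz.
pose q : E -> E := fun x => \row_j z (inl (inr j)) x.
pose t : E -> E := fun x => \row_j z (inr (inl j)) x.
pose g := z (inl (inl tt)); pose f := z (inr (inr tt)).
have cq j : cmp j q = z (inl (inr j)) by apply/funext => x; rewrite /cmp mxE.
have ct j : cmp j t = z (inr (inl j)) by apply/funext => x; rewrite /cmp mxE.
have Lq : L2v Om q by move=> j; change (L2 Om (cmp j q)); rewrite cq.
have Lt : L2v Om t by move=> j; change (L2 Om (cmp j t)); rewrite ct.
have Lu m i : L2 Om (cV i (u m)) by exact: cV_L2.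
have gq k : is_wgrad (T k) g q.
  apply: (@is_wgrad_closed _ _ _ (@oT k) (fun m => (u m).1) (fun m => pw_grad (u m).1)).
  - by move=> m; exact: (L2T k (Lu m (inl (inl tt)))).
  - exact: (L2T k (zL (inl (inl tt)))).
  - by move=> j; exact: (L2T k (Lq j)).
  - by move=> m; apply: pw_gradP; case: (uV m).
  - exact: (cvgT k (fun m => Lu m (inl (inl tt))) (zL _) (cz _)).
  - move=> j; rewrite cq; exact: (cvgT k (fun m => Lu m (inl (inr j))) (zL _) (cz _)).
have tf k : is_wdiv (T k) t f.
  apply: (@is_wdiv_closed _ _ _ (@oT k) (fun m => (u m).2) (fun m => pw_div (u m).2)).
  - by move=> m j; exact: (L2T k (Lu m (inr (inl j)))).
  - by move=> j; exact: (L2T k (Lt j)).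
  - exact: (L2T k (zL (inr (inr tt)))).
  - by move=> m; apply: pw_divP; case: (uV m).
  - move=> j; rewrite ct; exact: (cvgT k (fun m => Lu m (inr (inl j))) (zL _) (cz _)).
  - exact: (cvgT k (fun m => Lu m (inr (inr tt))) (zL _) (cz _)).
have Hg k : H1space (T k) g by split; [exact: (L2T k (zL (inl (inl tt))))|exists q].
have Ht k : Hdiv (T k) t by split; [move=> j; exact: (L2T k (Lt j))|exists f].
exists (g, t); split; first by split=> //; exact: zL.
case=> [[[]|j]|[j|[]]] /=.
- by rewrite subrr (snorm0 HL).
- rewrite -cq (snorm_sub HL (Lq j) (pw_grad_L2v Hg j)).
  exact: (pw_grad_unique j (zL (inl (inl tt))) Hg Lq gq).
- by rewrite ct subrr (snorm0 HL).
- rewrite (snorm_sub HL (zL _) (pw_div_L2 Ht)).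
  exact: (pw_div_unique Lt Ht (zL (inr (inr tt))) tf).
Qed.

Lemma V_semiHilbert : semiHilbert inV ipV.
Proof. exact: (semiHilbert_pullback HL inV_0 inV_lin cV_L2 cV_lin ipVE cV_closed). Qed.

Lemma cV_le i v : inV v -> nm (cV i v) <= snorm ipV v.
Proof. by move=> Vv; apply: (comp_le HL cV_L2 ipVE). Qed.

Lemma ip_cV_bounded_linear f i : L2 Om f -> bounded_linear inV ipV (fun v => ip Om f (cV i v)).
Proof.
move=> Lf; split=> [a v w Vv Vw|].
  rewrite (ip_nullr oOm (cV_L2 i (inV_lin a Vv Vw)) _ Lf (cV_lin i a Vv Vw)).
    by rewrite (ip_linr HL Lf a (cV_L2 i Vv) (cV_L2 i Vw)).
  exact: (shL HL a (cV_L2 i Vv) (cV_L2 i Vw)).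
exists (nm f) => v Vv; apply: le_trans (cauchy_schwarz HL Lf (cV_L2 i Vv)) _.
by rewrite ler_wpM2l ?snorm_ge0//; exact: cV_le.
Qed.

End broken_spaces.

(** * The operator [Theta] and the skeleton pairings *)

Section trial_space.
Context {R : realType} {n N : nat}.
Local Notation E := 'rV[R]_n.+1.
Local Notation leb := (@lebesgue_rV R n.+1).
Variables (Om : set E) (V : 'I_N -> 'M[R]_(n.+2, n.+1)).
Local Notation T k := (simplex (V k)).
Hypotheses (oOm : open Om) (oT : forall k, open (T k)) (sT : forall k, T k `<=` Om).
Hypothesis dT : forall k l, k != l -> T k `&` T l = set0.
Hypothesis nT : leb (Om `\` \bigcup_k T k) = 0%E.
Implicit Types (f g : E -> R) (q r t : E -> E) (k : 'I_N) (v w : testT (R := R) (n := n)).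
Implicit Types u : trialT R n N.
Let mOm := rV_open_measurable oOm.
Let mT k := rV_open_measurable (@oT k).
Let HL := L2_semiHilbert mOm.
Let HLv := L2v_semiHilbert mOm.
Let HT k := L2_semiHilbert (mT k).
Let HV := V_semiHilbert oOm oT sT dT nT.
Local Notation nm := (snorm (ip Om)).
Local Notation nV := (snorm (ipV Om V)).
Local Notation inV := (inV Om V).
Local Notation inU := (inU Om V).
Local Notation ipV := (ipV Om V).
Local Notation pw_grad := (pw_grad V).
Local Notation pw_div := (pw_div V).
Local Notation bform := (bform Om V).
Local Notation Theta := (Theta Om V).
Let L2T f k : L2 Om f -> L2 (T k) f := @L2T _ _ _ _ _ oOm oT sT f k.

Lemma normal_trace_linl k a q r f : Hdiv (T k) q -> Hdiv (T k) r -> H1space (T k) f ->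
  normal_trace (T k) (a *: q + r) f = a * normal_trace (T k) q f + normal_trace (T k) r f.
Proof.
move=> Hq Hr Hf; have Dq := wdivP Hq; have Dr := wdivP Hr; have [Lq _] := Hq; have [Lr _] := Hr.
rewrite (normal_trace_eq (@oT k) (L2v_lin (mT k) a Lq Lr) (is_wdiv_lin (@oT k) a Lq Lr Dq Dr) Hf).
rewrite (ip_linl (HT k) (H1_L2 Hf) a Dq.1 Dr.1).
rewrite (ip_linl (L2v_semiHilbert (mT k)) (H1_L2v Hf) a Lq Lr) /normal_trace.
move: (ipv _ _ _) (ipv _ _ _) (ip _ _ _) (ip _ _ _) => a1 a2 a3 a4; ring.
Qed.

Lemma normal_trace_congr k q r f : (forall x, T k x -> q x = r x) -> Hdiv (T k) q ->
  H1space (T k) f -> normal_trace (T k) q f = normal_trace (T k) r f.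
Proof.
move=> qr Hq Hf; have Dq := wdivP Hq; have [Lq _] := Hq.
rewrite (normal_trace_eq (@oT k) (L2v_congr (mT k) qr Lq) (is_wdiv_congr qr Dq) Hf).
by rewrite /normal_trace; congr (_ + _); apply: ipv_congr.
Qed.

Lemma normal_trace0l k f : H1space (T k) f -> normal_trace (T k) 0 f = 0.
Proof.
move=> Hf; have H0 := Hdiv_0 (@oT k).
have := normal_trace_linl (-1) H0 H0 Hf; rewrite scaleN1r oppr0 addr0 mulN1r.
by rewrite addNr.
Qed.

Lemma normal_trace_same k q f g : Hdiv (T k) q -> same_trace (T k) f g ->
  normal_trace (T k) q f = normal_trace (T k) q g.
Proof.
move=> Hq [Hf Hg h0]; have := normal_trace_H10 (@oT k) Hq h0.
rewrite (linB (normal_trace_lin (@oT k) Hq) Hf Hg).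
by move/eqP; rewrite subr_eq0 => /eqP.
Qed.

Lemma Hmhalf_bounded_linear k (l : (E -> R) -> R) : Hmhalf (T k) l ->
  bounded_linear inV ipV (fun v => l v.1).
Proof.
move=> [L _ [C hC]]; have inH v : inV v -> H1space (T k) v.1 by case.
apply: (@bounded_linear_bounded _ _ _ _ _ (`|C| * #|{: unit + 'I_n.+1}|%:R)) => [v Vv|].
  have Hv := inH _ Vv; have c0 : 0 <= H1norm (T k) v.1 by exact: sqrtr_ge0.
  apply: le_trans (hC _ Hv) _.
  apply: le_trans (_ : `|C| * H1norm (T k) v.1 <= _).
    by rewrite ler_wpM2r// ler_norm.
  rewrite -mulrA ler_wpM2l// H1normE.
  apply: le_trans (snorm_le_sum (HT k) (cH1_L2 (w := T k)) (ipH1E (@oT k)) Hv) _.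
  rewrite mulr_natl -sumr_const; apply: ler_sum => i _.
  have hV j : snorm (ip (T k)) (cV V j v) <= nV v.
    apply: le_trans (cV_le oOm oT sT j Vv).
    exact: (snorm_restrict oOm (@oT k) (@sT k) (cV_L2 oOm oT sT j Vv)).
  case: i => [i|j]; first exact: (hV (inl (inl tt))).
  rewrite (null_snorm (HT k) _ _ (_ : snorm _ (cH1 (T k) (inr j) v.1 - cV V (inl (inr j)) v) = 0)).
  - exact: hV.
  - exact: H1_cmp.
  - exact: (L2T k (cV_L2 oOm oT sT (inl (inr j)) Vv)).
  - exact: (wgrad_eq (@oT k) j (H1_L2 Hv) (pw_gradP oT dT Hv)).
by move=> a v w Vv Vw; apply: L; exact: inH.
Qed.

(** With [f] and its gradient extended by zero, the normal trace is a sum of L^2(Om) products with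
    components of [v]. *)
Lemma normal_trace_bounded_linear k f : H1space (T k) f ->
  bounded_linear inV ipV (fun v => normal_trace (T k) v.2 f).
Proof.
move=> Hf; pose Fe g := g \_ (T k).
have Le g : L2 (T k) g -> L2 Om (Fe g) by exact: (L2_extend oOm (@oT k) (@sT k)).
have ipe g h : ip Om (Fe g) h = ip (T k) h g.
  have -> : ip Om (Fe g) h = ip Om h (Fe g) by apply: eq_Rintegral => x _; rewrite mulrC.
  rewrite (ip_support (@sT k)); last by move=> x nx; rewrite /Fe patchN// notin_setE.
  by apply: ip_congr => // x kx; rewrite /Fe patchT// inE.
apply: (@bounded_linear_eq _ _ _ _ HV (fun v =>
  \sum_j ip Om (Fe (cmp j (wgrad (T k) f))) (cV V (inr (inl j)) v) +
  ip Om (Fe f) (cV V (inr (inr tt)) v))).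
  move=> v [Lv Hv Lt Ht]; have [Ltk _] := Ht k.
  rewrite (normal_trace_eq (@oT k) Ltk (pw_divP oT dT (Ht k)) Hf) (ipvE (mT k) Ltk (H1_L2v Hf)) ipe.
  by congr (_ + _); apply: eq_bigr => j _; rewrite ipe.
apply: (bounded_linearD HV).
  apply: (bounded_linear_sum HV) => j; apply: (ip_cV_bounded_linear oOm oT sT dT nT).
  by apply: Le; exact: H1_cmp.
by apply: (ip_cV_bounded_linear oOm oT sT dT nT); apply: Le; exact: H1_L2.
Qed.

Lemma bform_bounded_linear u : inU u -> bounded_linear inV ipV (bform u).
Proof.
move=> [Lf Ls [Hu _] [Hs _]]; rewrite /bform.
have bs j : L2 Om (cmp j (flux u)) by exact: Ls.
have bl := ip_cV_bounded_linear oOm oT sT dT nT.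
apply: (bounded_linearD HV); last first.
  apply: (bounded_linearN HV); apply: (bounded_linear_sum HV) => k.
  exact: normal_trace_bounded_linear.
apply: (bounded_linearD HV); last exact: (bl _ (inr (inr tt))).
apply: (bounded_linearD HV).
  apply: (bounded_linearD HV); last first.
    apply: (bounded_linearN HV); apply: (bounded_linear_sum HV) => k.
    exact: Hmhalf_bounded_linear.
  apply: (bounded_linearD HV); last exact: (bl _ (inl (inl tt))).
  apply: (bounded_linear_eq HV) (bounded_linear_sum HV _ (fun j => bl _ (inl (inr j)) (bs j))).
  by move=> v [_ Hv _ _]; rewrite (ipvE mOm Ls (pw_grad_L2v oOm oT sT Hv)).
apply: (bounded_linear_eq HV) (bounded_linear_sum HV _ (fun j => bl _ (inr (inl j)) (bs j))).
by move=> v [_ _ Lt _]; rewrite (ipvE mOm Ls Lt).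
Qed.

Lemma ThetaP u : inU u -> inV (Theta u) /\ forall v, inV v -> ipV (Theta u) v = bform u v.
Proof.
move=> Uu; have [L [M B]] := bform_bounded_linear Uu.
have [z Vz hz] := riesz HV L B.
by apply: (@xgetPex _ (0 : testT) [set z | inV z /\ forall v, inV v -> ipV z v = bform u v]); exists z.
Qed.

Lemma Theta_fst_L2 u : inU u -> L2 Om (Theta u).1.
Proof. by move=> /ThetaP[[]]. Qed.

Lemma is_wgrad0 (w : set E) : open w -> is_wgrad w 0 0.
Proof.
move=> ow; have mw := rV_open_measurable ow; have Hw := L2_semiHilbert mw.
split; first exact: (sh0 (L2v_semiHilbert mw)).
move=> phi tphi i; rewrite (_ : (fun x => _) = 0); last by apply/funext => x; rewrite mxE.
have Lp := test_L2 ow tphi; have Lp' := test_pderiv_L2 ow i tphi.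
by rewrite (lin0 (sh0 Hw) (ip_linl Hw Lp)) oppr0 (lin0 (sh0 Hw) (ip_linl Hw Lp')).
Qed.

Lemma ipv_pw_grad0 q : L2v Om q -> ipv Om q (pw_grad 0) = 0.
Proof.
move=> Lq; have H0 k : H1space (T k) 0 := H1_0 (@oT k).
have LG := pw_grad_L2v oOm oT sT H0.
have cmp0 j : cmp j (0 : E -> E) = 0 by apply/funext => x; rewrite /cmp mxE.
rewrite (ipvE mOm Lq LG); apply: big1 => j _.
have n0 := pw_grad_unique oOm oT sT dT nT j (sh0 HL) H0 (sh0 HLv) (fun k => is_wgrad0 (@oT k)).
rewrite cmp0 in n0; rewrite (ip_nullr oOm (LG j) (sh0 HL) (Lq j) n0).
exact: (lin0 (sh0 HL) (ip_linr HL (Lq j))).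
Qed.

Lemma ip_pw_div0 f : L2 Om f -> ip Om f (pw_div 0) = 0.
Proof.
move=> Lf; have H0 k : Hdiv (T k) 0 := Hdiv_0 (@oT k).
have n0 : nm (pw_div 0 - 0) = 0.
  apply: (pw_div_unique oOm oT sT dT nT (sh0 HLv) H0 (sh0 HL)) => k.
  split; first exact: L2_0.
  move=> phi tphi; have Lp := test_L2 (@oT k) tphi; have Lg := grad_L2v (@oT k) tphi.
  by rewrite (lin0 (sh0 (HT k)) (ip_linl (HT k) Lp)) oppr0 (lin0 (sh0 (L2v_semiHilbert (mT k))) (ip_linl (L2v_semiHilbert (mT k)) Lg)).
rewrite (ip_nullr oOm (pw_div_L2 oOm oT sT H0) (sh0 HL) Lf n0).
exact: (lin0 (sh0 HL) (ip_linr HL Lf)).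
Qed.

(** The equation of [Theta u] tested with the pair (f, 0) and solved for the skeleton term. *)
Lemma pair_shatE u f : inU u -> L2 Om f -> (forall k, H1space (T k) f) ->
  pair_shat (shat u) f =
    ipv Om (flux u - pw_grad (Theta u).1) (pw_grad f) + ip Om (fld u - (Theta u).1) f.
Proof.
move=> Uu Lf Hf; have [VT hT] := ThetaP Uu; have [Lz Hz Lt Ht] := VT; have [Lu Ls [Hu _] _] := Uu.
have Vw : inV (f, 0).
  by split=> //=; [exact: L2v_0|move=> k; exact: Hdiv_0].
have := hT _ Vw; rewrite /ipV /bform /=.
have LG := pw_grad_L2v oOm oT sT Hf; have LZ := pw_grad_L2v oOm oT sT Hz.
rewrite (ipBl HLv Ls LZ LG) (ipBl HL Lu Lz Lf).
rewrite (ip_pw_div0 (pw_div_L2 oOm oT sT Ht)) (ip_pw_div0 Lu).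
rewrite (lin0 (sh0 HLv) (ip_linr HLv Lt)) (lin0 (sh0 HLv) (ip_linr HLv Ls)).
have -> : pair_uhat V (uhat u) 0 = 0 by rewrite /pair_uhat big1// => k _; exact: normal_trace0l.
move: (ip _ _ _) (ip _ _ _) (ipv _ _ _) (ipv _ _ _) (pair_shat _ _) => a1 a2 a3 a4 a5; lra.
Qed.

(** The companion identity, from the test pair (0, q). *)
Lemma pair_uhatE u q : inU u -> L2v Om q -> (forall k, Hdiv (T k) q) ->
  pair_uhat V (uhat u) q =
    ipv Om (flux u - (Theta u).2) q + ip Om (fld u - pw_div (Theta u).2) (pw_div q).
Proof.
move=> Uu Lq Hq; have [VT hT] := ThetaP Uu; have [Lz Hz Lt Ht] := VT; have [Lu Ls _ [Hs _]] := Uu.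
have Vw : inV (0, q).
  by split=> //=; [exact: L2_0|move=> k; exact: H1_0].
have := hT _ Vw; rewrite /ipV /bform /=.
have LD := pw_div_L2 oOm oT sT Hq; have LZ := pw_div_L2 oOm oT sT Ht.
rewrite (ipBl HLv Ls Lt Lq) (ipBl HL Lu LZ LD).
rewrite (ipv_pw_grad0 (pw_grad_L2v oOm oT sT Hz)) (ipv_pw_grad0 Ls).
rewrite (lin0 (sh0 HL) (ip_linr HL Lz)) (lin0 (sh0 HL) (ip_linr HL Lu)).
have -> : pair_shat (shat u) 0 = 0.
  rewrite /pair_shat big1// => k _; have [L _ _] := Hs k.
  exact: (lin0 (H1_0 (@oT k)) L).
move: (ip _ _ _) (ip _ _ _) (ipv _ _ _) (ipv _ _ _) (pair_uhat _ _ _) => a1 a2 a3 a4 a5; lra.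
Qed.

Lemma Om_H1_pw f : H1space Om f -> forall k, H1space (T k) f.
Proof. by move=> Hf k; exact: (H1_restrict oOm (@oT k) (@sT k)). Qed.

Lemma pw_grad_wgrad f j : H1space Om f -> nm (cmp j (pw_grad f) - cmp j (wgrad Om f)) = 0.
Proof.
move=> Hf; apply: (pw_grad_unique oOm oT sT dT nT j (H1_L2 Hf) (Om_H1_pw Hf) (H1_L2v Hf)) => k.
exact: (is_wgrad_restrict oOm (@oT k) (@sT k) (wgradP Hf)).
Qed.

Lemma ipv_pw_grad q f r : L2v Om q -> L2 Om f -> is_wgrad Om f r -> ipv Om q (pw_grad f) = ipv Om q r.
Proof.
move=> Lq Lf hr; have Hf : H1space Om f by split=> //; exists r.
have Lp := pw_grad_L2v oOm oT sT (Om_H1_pw Hf).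
rewrite -(ipv_wgrad oOm Lq Lf hr) (ipvE mOm Lq Lp) (ipvE mOm Lq (H1_L2v Hf)).
apply: eq_bigr => j _; exact: (ip_nullr oOm (Lp j) (H1_cmp j Hf) (Lq j) (pw_grad_wgrad j Hf)).
Qed.

Lemma lift_normal_trace u q f : lifts_mhalf Om V (shat u) q -> H1space Om f ->
  normal_trace Om q f = pair_shat (shat u) f.
Proof.
move=> [Hq hq] Hf; rewrite (normal_trace_partition oOm oT sT dT nT Hq Hf).
by apply: eq_bigr => k _; rewrite hq//; exact: Om_H1_pw.
Qed.

(** The unknown [shat u] consists of the normal traces of one field in H(div, Om), so its pairings
    with a test function of [Om] sum to zero. What remains of [pair_shatE] is the definition of the
    weak divergence on all of [Om]. *)
Lemma flux_residual_div u : inU u ->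
  is_wdiv Om (flux u - pw_grad (Theta u).1) (fld u - (Theta u).1).
Proof.
move=> Uu; have [[Lz Hz Lt Ht] _] := ThetaP Uu; have [Lu Ls _ [_ [q lq]]] := Uu.
have LZ := pw_grad_L2v oOm oT sT Hz; have Lr := shB HLv Ls LZ.
split; first exact: (shB HL Lu Lz).
move=> phi tphi; have Hp := test_H1 oOm tphi; have Lp := H1_L2 Hp.
have := lift_normal_trace lq Hp; rewrite (pair_shatE Uu Lp (Om_H1_pw Hp)).
rewrite (normal_trace_test oOm lq.1 tphi) (ipv_pw_grad Lr Lp (test_is_wgrad oOm tphi)).
move: (ip _ _ _) (ipv _ _ _) => a b; lra.
Qed.

Lemma gammanE u f r : inU u -> L2 Om f -> is_wgrad Om f r -> gamman Om V u f =
  ipv Om (flux u - pw_grad (Theta u).1) r + ip Om (fld u - (Theta u).1) f.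
Proof.
move=> Uu Lf hr; have [[Lz Hz Lt Ht] _] := ThetaP Uu; have [Lu Ls _ [_ lq]] := Uu.
have LZ := pw_grad_L2v oOm oT sT Hz; have Lr := shB HLv Ls LZ.
have Hf : H1space Om f by split=> //; exists r.
rewrite /gamman (lift_normal_trace (xgetPex 0 lq) Hf) (pair_shatE Uu Lf (Om_H1_pw Hf)).
by rewrite (ipv_pw_grad Lr Lf hr).
Qed.

(** [pair_shatE] localises: the extension of [f] by zero is an admissible broken test function
    supported in one element. *)
Lemma shat_eq u k f : inU u -> H1space (T k) f -> shat u k f =
  ipv (T k) (flux u - pw_grad (Theta u).1) (wgrad (T k) f) + ip (T k) (fld u - (Theta u).1) f.
Proof.
move=> Uu Hf; have [_ _ _ [_ [q [Hq hq]]]] := Uu; have [Lu Ls _ [Hs _]] := Uu.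
have [[Lz Hz Lt Ht] _] := ThetaP Uu.
have LZ := pw_grad_L2v oOm oT sT Hz; have Lr := shB HLv Ls LZ.
pose g := f \_ (T k).
have gl l x : l != k -> T l x -> g x = 0.
  move=> lk lx; rewrite /g patchN// notin_setE => kx.
  by have : (T l `&` T k) x by []; rewrite dT.
have gk x : T k x -> g x = f x by move=> kx; rewrite /g patchT// inE.
have Lg : L2 Om g by apply: (L2_extend oOm (@oT k) (@sT k)); exact: H1_L2.
have Hgl l : l != k -> H10space (T l) g by move=> lk; apply: zero_H10 => // x; exact: gl.
have Hgk : H1space (T k) g by apply: (H1_congr (mT k)) Hf => x kx; rewrite gk.
have Hg l : H1space (T l) g by have [->|/Hgl/H10_H1] := eqVneq l k.
have := pair_shatE Uu Lg Hg.
rewrite /pair_shat (bigD1 k)//= big1 => [|l lk]; last first.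
  have [L st _] := Hs l; rewrite (st _ 0 (same_trace_H10 (@oT l) (Hgl l lk))).
  exact: (lin0 (H1_0 (@oT l)) L).
have [_ st _] := Hs k; rewrite addr0 (st g f); last first.
  split; [exact: Hgk|exact: Hf|apply: (zero_H10 (@oT k)) => x kx].
  by rewrite !fctE gk// subrr.
move=> ->; congr (_ + _); last first.
  rewrite (ip_support (@sT k)); first exact: ip_congr.
  by move=> x nx; rewrite /g patchN// notin_setE.
rewrite (ipv_partition oOm oT sT dT nT Lr (pw_grad_L2v oOm oT sT Hg)).
have Lrl l : L2v (T l) (flux u - pw_grad (Theta u).1).
  exact: (L2v_restrict oOm (@oT l) (@sT l)).
have pE l : ipv (T l) (flux u - pw_grad (Theta u).1) (pw_grad g) =
    ipv (T l) (flux u - pw_grad (Theta u).1) (wgrad (T l) g).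
  by apply: ipv_congr => // x lx; rewrite (pw_gradE dT _ lx).
rewrite (bigD1 k)//= big1 ?addr0 => [|l lk].
  rewrite pE; apply: (ipv_wgrad (@oT k) (Lrl k) (H1_L2 Hgk)).
  by apply: is_wgrad_congr (wgradP Hf) => x kx; rewrite gk.
rewrite pE (ipv_wgrad (@oT l) (Lrl l) (H1_L2 (Hg l)) (r := 0)).
  exact: (lin0 (sh0 (L2v_semiHilbert (mT l))) (ip_linr (L2v_semiHilbert (mT l)) (Lrl l))).
by apply: is_wgrad_congr (is_wgrad0 (@oT l)) => x lx; rewrite (gl l).
Qed.

End trial_space.

Section null_vectors.
Context {R : realType} {X : lmodType R} (D : X -> Prop) (ip : X -> X -> R).
Hypothesis H : semiHilbert D ip.
Local Notation nm := (snorm ip).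

Lemma snorm_null_trans x y z : D x -> D y -> D z -> nm (x - y) = 0 -> nm (y - z) = 0 ->
  nm (x - z) = 0.
Proof.
move=> Dx Dy Dz xy yz; apply/eqP; rewrite eq_le snorm_ge0 andbT.
by have := snorm_dist H Dx Dy Dz; rewrite xy yz addr0.
Qed.

Lemma snorm_cvg_null (u : nat -> X) x y : (forall m, D (u m)) -> D x -> D y ->
  (fun m => nm (u m - x)) @ \oo --> (0 : R) -> nm (x - y) = 0 ->
  (fun m => nm (u m - y)) @ \oo --> (0 : R).
Proof.
move=> Du Dx Dy /(cvg_to0P (fun m => snorm_ge0 ip _)) h xy.
apply/(cvg_to0P (fun m => snorm_ge0 ip _)) => e /h[n0 hn0]; exists n0 => m /hn0 le.
by have := snorm_dist H (Du m) Dx Dy; rewrite xy addr0 => /le_trans; apply.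
Qed.

Lemma snorm_cvgB (u v : nat -> X) x y : (forall m, D (u m)) -> (forall m, D (v m)) -> D x -> D y ->
  (fun m => nm (u m - x)) @ \oo --> (0 : R) -> (fun m => nm (v m - y)) @ \oo --> (0 : R) ->
  (fun m => nm (u m - v m - (x - y))) @ \oo --> (0 : R).
Proof.
move=> Du Dv Dx Dy /(cvg_to0P (fun m => snorm_ge0 ip _)) ux /(cvg_to0P (fun m => snorm_ge0 ip _)) vy.
apply/(cvg_to0P (fun m => snorm_ge0 ip _)) => e e0.
have e2 : 0 < e / 2 by lra.
have [n1 h1] := ux _ e2; have [n2 h2] := vy _ e2; exists (maxn n1 n2) => m.
rewrite geq_max => /andP[/h1 l1 /h2 l2].
have -> : u m - v m - (x - y) = (u m - x) - (v m - y) by rewrite !opprB addrACA [RHS]addrACA; congr (_ + _); exact: addrC.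
have Dux := shB H (Du m) Dx; have Dvy := shB H (Dv m) Dy.
apply: le_trans (snormD H Dux (shN H Dvy)) _; rewrite (snormN H Dvy).
by move: (nm _) (nm _) l1 l2 => a b; lra.
Qed.

Lemma ip_snorm0 x y : D x -> D y -> nm x = 0 -> ip x y = 0.
Proof.
by move=> Dx Dy x0; have := cauchy_schwarz H Dx Dy; rewrite x0 mul0r normr_le0 => /eqP.
Qed.

End null_vectors.

(** * Lifts of the skeleton unknowns computed from [Theta] *)

Section trial_norm.
Context {R : realType} {n N : nat}.
Local Notation E := 'rV[R]_n.+1.
Local Notation leb := (@lebesgue_rV R n.+1).
Variables (Om : set E) (V : 'I_N -> 'M[R]_(n.+2, n.+1)).
Local Notation T k := (simplex (V k)).
Hypotheses (oOm : open Om) (oT : forall k, open (T k)) (sT : forall k, T k `<=` Om).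
Hypothesis dT : forall k l, k != l -> T k `&` T l = set0.
Hypothesis nT : leb (Om `\` \bigcup_k T k) = 0%E.
Implicit Types (f g : E -> R) (q r t : E -> E) (k : 'I_N).
Implicit Types u v : trialT R n N.
Let mOm := rV_open_measurable oOm.
Let mT k := rV_open_measurable (@oT k).
Let HL := L2_semiHilbert mOm.
Let HLv := L2v_semiHilbert mOm.
Let HT k := L2_semiHilbert (mT k).
Let HV := V_semiHilbert oOm oT sT dT nT.
Local Notation nm := (snorm (ip Om)).
Local Notation nmv := (snorm (ipv Om)).
Local Notation nV := (snorm (ipV Om V)).
Local Notation inV := (inV Om V).
Local Notation inU := (inU Om V).
Local Notation ipV := (ipV Om V).
Local Notation pw_grad := (pw_grad V).
Local Notation pw_div := (pw_div V).
Local Notation bform := (bform Om V).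
Local Notation Theta := (Theta Om V).
Let L2T f k : L2 Om f -> L2 (T k) f := @L2T _ _ _ _ _ oOm oT sT f k.
Let L2vT q k : L2v Om q -> L2v (T k) q := fun Lq => L2v_restrict oOm (@oT k) (@sT k) Lq.
Let tP := ThetaP oOm oT sT dT nT.

(** The residual is a field in H(div, Om) with divergence [residual_div u] and normal traces
    [shat u]. Likewise [potential u] is in H^1(Om) with gradient [potential_grad u] and traces
    [uhat u]. Both are explicit in the field, the flux and [Theta u]. *)
Definition residual u : E -> E := flux u - pw_grad (Theta u).1.
Definition residual_div u : E -> R := fld u - (Theta u).1.
Definition potential u : E -> R := fld u - pw_div (Theta u).2.
Definition potential_grad u : E -> E := flux u - (Theta u).2.

Lemma residual_L2v u : inU u -> L2v Om (residual u).
Proof.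
move=> Uu; have [[Lz Hz Lt Ht] _] := tP Uu; have [Lu Ls _ _] := Uu.
exact: (shB HLv Ls (pw_grad_L2v oOm oT sT Hz)).
Qed.

Lemma residual_wdiv u : inU u -> is_wdiv Om (residual u) (residual_div u).
Proof. exact: flux_residual_div. Qed.

Lemma potential_L2 u : inU u -> L2 Om (potential u).
Proof.
move=> Uu; have [[Lz Hz Lt Ht] _] := tP Uu; have [Lu Ls _ _] := Uu.
exact: (shB HL Lu (pw_div_L2 oOm oT sT Ht)).
Qed.

Lemma potential_grad_L2v u : inU u -> L2v Om (potential_grad u).
Proof.
move=> Uu; have [[Lz Hz Lt Ht] _] := tP Uu; have [Lu Ls _ _] := Uu.
exact: (shB HLv Ls Lt).
Qed.

(** Test [pair_uhatE] with the field phi e_i, whose divergence is the i-th derivative of phi. The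
    skeleton term is the normal trace of this field against a lift of [uhat u], and it vanishes
    because phi has compact support in [Om]. *)
Lemma potential_wgrad u : inU u -> is_wgrad Om (potential u) (potential_grad u).
Proof.
move=> Uu; have [_ _ [_ [w [Hw lw]]] _] := Uu.
split; first exact: potential_grad_L2v.
move=> phi tphi i; pose q : E -> E := fun x => phi x *: delta_mx ord0 i.
have Lp := test_L2 oOm tphi; have Lp' := test_pderiv_L2 oOm i tphi.
have qE j x : q x ord0 j = (j == i)%:R * phi x by rewrite /q !mxE eqxx mulrC.
have Lq : L2v Om q.
  move=> j; apply: (L2_congr mOm) (shZ HL (j == i)%:R Lp) => x _.
  by rewrite qE.
have dq : is_wdiv Om q (pderiv i phi).
  split; first exact: Lp'.
  move=> psi tpsi; have -> : ipv Om q (grad psi) = ip Om phi (pderiv i psi).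
    apply: eq_Rintegral => x _; rewrite /dotp (bigD1 i)//= qE eqxx mul1r mxE big1 ?addr0// => j ji.
    by rewrite qE (negPf ji) !mul0r.
  rewrite ((test_is_wgrad oOm tphi).2 _ tpsi i); congr (- _).
  by rewrite -/(cmp i (grad phi)) cmp_grad.
have Hq : Hdiv Om q by split=> //; exists (pderiv i phi).
have Hqk k : Hdiv (T k) q by exact: (Hdiv_restrict oOm (@oT k) (@sT k)).
have := pair_uhatE oOm oT sT dT nT Uu Lq Hqk.
have -> : pair_uhat V (uhat u) q = normal_trace Om q w.
  rewrite (normal_trace_partition oOm oT sT dT nT Hq Hw); apply: eq_bigr => k _.
  exact: (normal_trace_same oT (Hqk k) (lw k)).
have ipq r : ipv Om q r = ip Om phi (cmp i r).
  apply: eq_Rintegral => x _; rewrite /dotp (bigD1 i)//= qE eqxx mul1r big1 ?addr0// => j ji.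
  by rewrite qE (negPf ji) !mul0r.
rewrite (normal_traceE oOm Lq dq (H1_L2 Hw) (wgradP Hw)) ipq.
rewrite (ipC HL Lp' (H1_L2 Hw)) ((wgradP Hw).2 _ tphi i) -/(cmp i (wgrad Om w)).
rewrite (ipC HL Lp (H1_cmp i Hw)) subrr -/(potential u) -/(potential_grad u).
have LD := pw_div_L2 oOm oT sT Hqk.
have n0 : nm (pw_div q - pderiv i phi) = 0.
  apply: (pw_div_unique oOm oT sT dT nT Lq Hqk Lp') => k.
  exact: (is_wdiv_restrict oOm (@oT k) (@sT k)).
rewrite (ip_nullr oOm LD Lp' (potential_L2 Uu) n0).
rewrite (ipC HLv (potential_grad_L2v Uu) Lq) ipq (ipC HL Lp (potential_grad_L2v Uu i)).
move: (ip _ _ _) (ip _ _ _) => a b; lra.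
Qed.

Lemma potential_H1 u : inU u -> H1space Om (potential u).
Proof.
move=> Uu; split; first exact: potential_L2.
by exists (potential_grad u); exact: potential_wgrad.
Qed.

(** Testing [pair_uhatE] with fields of one element extended by zero shows that every normal trace
    takes the same value on both functions, and normal traces separate traces by
    [normal_traces_H10]. *)
Lemma potential_trace u k : inU u -> same_trace (T k) (uhat u k) (potential u).
Proof.
move=> Uu; have [_ _ [Hu _] _] := Uu; have Hp := potential_H1 Uu.
have Hpk := H1_restrict oOm (@oT k) (@sT k) Hp.
split; [exact: Hu|exact: Hpk|].
apply: (normal_traces_H10 (@oT k)); first exact: (shB (H1_semiHilbert (@oT k)) (Hu k) Hpk).
move=> q Hq; have [Lq _] := Hq.
rewrite (linB (normal_trace_lin (@oT k) Hq) (Hu k) Hpk).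
pose qe : E -> E := fun x => (\1_(T k) x : R) *: q x.
have off x : ~ T k x -> qe x = 0 by move=> nx; rewrite /qe indicE memNset// scale0r.
have qel l x : l != k -> T l x -> qe x = 0.
  by move=> lk lx; apply: off => kx; have : (T l `&` T k) x by []; rewrite dT.
have qek x : T k x -> q x = qe x by move=> kx; rewrite /qe indicE mem_set// scale1r.
have Le : L2v Om qe.
  move=> j; apply: (L2_congr mOm) (L2_extend oOm (@oT k) (@sT k) (Lq j)) => x _.
  by rewrite /qe patchE indicE mxE; case: ifP => _; rewrite ?mul1r ?mul0r.
have Hl l : l != k -> Hdiv (T l) qe.
  by move=> lk; apply: (Hdiv_congr (mT l)) (Hdiv_0 (@oT l)) => x lx; rewrite (qel l).
have Hk : Hdiv (T k) qe by exact: (Hdiv_congr (mT k)) Hq.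
have He l : Hdiv (T l) qe by have [->|/Hl] := eqVneq l k.
have := pair_uhatE oOm oT sT dT nT Uu Le He.
rewrite /pair_uhat (bigD1 k)//= big1 ?addr0 => [|l lk]; last first.
  rewrite -(normal_trace_congr oT (q := 0) _ (Hdiv_0 (@oT l)) (Hu l)).
    exact: (normal_trace0l oT (Hu l)).
  by move=> x lx; rewrite (qel l).
rewrite -(normal_trace_congr oT qek Hq (Hu k)) => ->.
rewrite -/(potential u) -/(potential_grad u).
have wk := is_wgrad_restrict oOm (@oT k) (@sT k) (potential_wgrad Uu).
have Lpk := H1_L2 Hpk; have Lgk := L2vT k (potential_grad_L2v Uu).
rewrite (normal_traceE (@oT k) Lq (wdivP Hq) Lpk wk).
rewrite (ipv_support (@sT k) _ off) (@ipv_congr _ _ _ _ (potential_grad u) qe q)//; last first.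
  by move=> x kx; rewrite qek.
rewrite (ipC (L2v_semiHilbert (mT k)) Lgk Lq).
have -> : ip Om (potential u) (pw_div qe) = ip (T k) (potential u) (wdiv (T k) q).
  rewrite (ip_partition oOm oT sT dT nT (potential_L2 Uu) (pw_div_L2 oOm oT sT He)).
  have nul l g : is_wdiv (T l) qe g -> ip (T l) (potential u) (pw_div qe) = ip (T l) (potential u) g.
    move=> hg; have LD := pw_divP oT dT (He l).
    apply: (ip_nullr (@oT l) LD.1 hg.1 (L2T l (potential_L2 Uu))).
    apply: (is_wdiv_unique (@oT l) (L2vT l Le) (L2vT l Le) _ LD hg) => i.
    by rewrite subrr (snorm0 (HT l)).
  rewrite (bigD1 k)//= big1 ?addr0 => [|l lk].
    by apply: nul; apply: is_wdiv_congr (wdivP Hq).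
  rewrite (nul l 0) ?(lin0 (sh0 (HT l)) (ip_linr (HT l) (L2T l (potential_L2 Uu))))//.
  apply: (is_wdiv_congr (q := 0)) => [x lx|]; first by rewrite (qel l).
  split; first exact: (sh0 (HT l)).
  move=> phi tphi; have Lp := test_L2 (@oT l) tphi; have Lg := grad_L2v (@oT l) tphi.
  rewrite (lin0 (sh0 (HT l)) (ip_linl (HT l) Lp)) oppr0.
  exact: (lin0 (sh0 (L2v_semiHilbert (mT l))) (ip_linl (L2v_semiHilbert (mT l)) Lg)).
rewrite (ipC (HT k) (L2T k (potential_L2 Uu)) (wdivP Hq).1).
move: (ip _ _ _) (ipv _ _ _) => a b; lra.
Qed.

Lemma gamma0_potential u : inU u -> same_trace Om (gamma0 Om V u) (potential u).
Proof.
move=> Uu; have [_ _ [_ lw] _] := Uu.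
have [Hg gl] := xgetPex (0 : E -> R) lw; rewrite -/(gamma0 Om V u) in Hg gl.
have Hp := potential_H1 Uu; split; [exact: Hg|exact: Hp|].
apply: (H10_partition oOm oT sT dT nT); first exact: (shB (H1_semiHilbert oOm) Hg Hp).
move=> k; have [] // := same_trace_trans (@oT k) (same_trace_sym (@oT k) (gl k)) (potential_trace k Uu).
Qed.

(** The duality depends only on the traces, so the chosen lifts can be replaced by the residual of
    [u] and the potential of [v]; it then becomes an integral over [Om]. *)
Lemma gamman_gamma0 u v : inU u -> inU v -> gamman Om V u (gamma0 Om V v) =
  ipv Om (residual u) (potential_grad v) + ip Om (residual_div u) (potential v).
Proof.
move=> Uu Uv; have [_ _ _ [_ lq]] := Uu; have [Hg Hp h10] := gamma0_potential Uv.
have [Hq _] := xgetPex (0 : E -> E) lq.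
rewrite -(gammanE oOm oT sT dT nT Uu (potential_L2 Uv) (potential_wgrad Uv)).
have := normal_trace_H10 oOm Hq h10; rewrite (linB (normal_trace_lin oOm Hq) Hg Hp).
by move/eqP; rewrite subr_eq0 => /eqP.
Qed.

End trial_norm.

(** * Completeness of the trial space *)

Section trial_hilbert.
Context {R : realType} {n N : nat}.
Local Notation E := 'rV[R]_n.+1.
Local Notation leb := (@lebesgue_rV R n.+1).
Variables (Om : set E) (V : 'I_N -> 'M[R]_(n.+2, n.+1)).
Local Notation T k := (simplex (V k)).
Hypotheses (oOm : open Om) (oT : forall k, open (T k)) (sT : forall k, T k `<=` Om).
Hypothesis dT : forall k l, k != l -> T k `&` T l = set0.
Hypothesis nT : leb (Om `\` \bigcup_k T k) = 0%E.
Implicit Types (f g : E -> R) (q r t : E -> E) (k : 'I_N).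
Implicit Types u v : trialT R n N.
Let mOm := rV_open_measurable oOm.
Let mT k := rV_open_measurable (@oT k).
Let HL := L2_semiHilbert mOm.
Let HLv := L2v_semiHilbert mOm.
Let HT k := L2_semiHilbert (mT k).
Let HV := V_semiHilbert oOm oT sT dT nT.
Local Notation nm := (snorm (ip Om)).
Local Notation nmv := (snorm (ipv Om)).
Local Notation nV := (snorm (ipV Om V)).
Local Notation inV := (inV Om V).
Local Notation inU := (inU Om V).
Local Notation ipV := (ipV Om V).
Local Notation pw_grad := (pw_grad V).
Local Notation pw_div := (pw_div V).
Local Notation bform := (bform Om V).
Local Notation Theta := (Theta Om V).
Let L2T f k : L2 Om f -> L2 (T k) f := @L2T _ _ _ _ _ oOm oT sT f k.
Let L2vT q k : L2v Om q -> L2v (T k) q := fun Lq => L2v_restrict oOm (@oT k) (@sT k) Lq.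
Let tP := ThetaP oOm oT sT dT nT.

Lemma Hmhalf_lin k (a : R) (l l' : (E -> R) -> R) : Hmhalf (T k) l -> Hmhalf (T k) l' ->
  Hmhalf (T k) (a *: l + l').
Proof.
move=> [L S [C hC]] [L' S' [C' hC']]; split=> [b f g Hf Hg|f g fg|].
- rewrite -![(a *: l + l') _]/(a * l _ + l' _) L// L'//; ring.
- by rewrite -![(a *: l + l') _]/(a * l _ + l' _) (S _ _ fg) (S' _ _ fg).
- exists (`|a| * C + C') => f Hf; apply: le_trans (ler_normD _ _) _.
  rewrite mulrDl; apply: lerD; last exact: hC'.
  by rewrite -[(a *: l) f]/(a * l f) normrM -mulrA ler_wpM2l//; exact: hC.
Qed.

Lemma inU_lin a u v : inU u -> inU v -> inU (a *: u + v).
Proof.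
move=> [Lu Ls [Hu [w [Hw lw]]] [Hs [q [Hq lq]]]] [Lv Lr [Hv [w' [Hw' lw']]] [Hr [q' [Hq' lq']]]].
split; [exact: (shL HL a Lu Lv)|exact: (shL HLv a Ls Lr)|split|split].
- by move=> k; exact: (H1_lin (@oT k) a (Hu k) (Hv k)).
- exists (a *: w + w'); split; first exact: (H1_lin oOm a Hw Hw').
  by move=> k; exact: (same_trace_lin (@oT k) a (lw k) (lw' k)).
- by move=> k; exact: (Hmhalf_lin a (Hs k) (Hr k)).
- exists (a *: q + q'); split; first exact: (Hdiv_lin oOm a Hq Hq').
  move=> k f Hf; rewrite (normal_trace_linl oT a _ _ Hf).
  + by rewrite -lq// -lq'.
  + exact: (Hdiv_restrict oOm (@oT k) (@sT k) Hq).
  + exact: (Hdiv_restrict oOm (@oT k) (@sT k) Hq').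
Qed.

Lemma Hmhalf_normal_trace k q : Hdiv (T k) q -> Hmhalf (T k) (normal_trace (T k) q).
Proof.
move=> Hq; split.
- exact: (normal_trace_lin (@oT k) Hq).
- by move=> f g; exact: normal_trace_same.
- by exists (snorm (ipv (T k)) q + snorm (ip (T k)) (wdiv (T k) q)) => f; exact: normal_trace_bounded.
Qed.

Lemma inU_0 : inU 0.
Proof.
split; [exact: (sh0 HL)|exact: (sh0 HLv)|split|split].
- by move=> k; exact: (H1_0 (@oT k)).
- exists 0; split; first exact: (H1_0 oOm).
  by move=> k; exact: (same_trace_refl (@oT k) (H1_0 (@oT k))).
- move=> k; split=> [a f g _ _|//|].
    by rewrite -![(shat 0 k) _]/0 mulr0 addr0.
  by exists 0 => f _; rewrite -[(shat 0 k) _]/0 normr0 mul0r.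
- exists 0; split; first exact: (Hdiv_0 oOm).
  by move=> k f Hf; rewrite (normal_trace0l oT Hf).
Qed.

Lemma bform_linl a u v y : inU u -> inU v -> inV y ->
  bform (a *: u + v) y = a * bform u y + bform v y.
Proof.
move=> [Lu Ls [Hu _] _] [Lv Lr [Hv _] _] [Ly Hy Lt Ht]; rewrite /bform.
have LG := pw_grad_L2v oOm oT sT Hy; have LD := pw_div_L2 oOm oT sT Ht.
rewrite (ip_linl HLv LG a Ls Lr) (ip_linl HL Ly a Lu Lv) (ip_linl HLv Lt a Ls Lr) (ip_linl HL LD a Lu Lv).
have -> : pair_shat (shat (a *: u + v)) y.1 = a * pair_shat (shat u) y.1 + pair_shat (shat v) y.1.
  by rewrite /pair_shat mulr_sumr -big_split.
have -> : pair_uhat V (uhat (a *: u + v)) y.2 = a * pair_uhat V (uhat u) y.2 + pair_uhat V (uhat v) y.2.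
  rewrite /pair_uhat mulr_sumr -big_split; apply: eq_bigr => k _.
  exact: (normal_trace_lin (@oT k) (Ht k) a (Hu k) (Hv k)).
move: (pair_shat _ _) (pair_shat _ _) (pair_uhat _ _ _) (pair_uhat _ _ _) (ip _ _ _) (ip _ _ _)
  (ip _ _ _) (ip _ _ _) (ipv _ _ _) (ipv _ _ _) (ipv _ _ _) (ipv _ _ _) => *; ring.
Qed.

Lemma Theta_unique u y : inU u -> inV y -> (forall x, inV x -> ipV y x = bform u x) ->
  nV (Theta u - y) = 0.
Proof.
move=> Uu Vy hy; have [VT hT] := tP Uu; have Vd := shB HV VT Vy.
by rewrite /snorm (ipBl HV VT Vy Vd) hT// hy// subrr sqrtr0.
Qed.

Lemma cV_null i y y' : inV y -> inV y' -> nV (y - y') = 0 -> nm (cV V i y - cV V i y') = 0.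
Proof.
move=> Vy Vy' n0; rewrite -(comp_sub HL (inV_lin oOm oT) (cV_L2 oOm oT sT) (cV_lin oOm oT sT dT nT) i Vy Vy').
apply/eqP; rewrite eq_le snorm_ge0 andbT -n0; exact: (cV_le oOm oT sT i (shB HV Vy Vy')).
Qed.

Lemma Theta_lin a u v : inU u -> inU v ->
  nV (Theta (a *: u + v) - (a *: Theta u + Theta v)) = 0.
Proof.
move=> Uu Uv; have [Vu hu] := tP Uu; have [Vv hv] := tP Uv.
apply: Theta_unique; [exact: inU_lin|exact: (shL HV a Vu Vv)|move=> y Vy].
by rewrite (ip_linl HV Vy a Vu Vv) (bform_linl a Uu Uv Vy) hu// hv.
Qed.

Definition cU (i : (unit + 'I_n.+1) + ((unit + 'I_n.+1) + ('I_n.+1 + unit))) u : E -> R :=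
  match i with
  | inl (inl _) => fld u
  | inl (inr j) => cmp j (flux u)
  | inr i => cV V i (Theta u)
  end.

Lemma cU_L2 i u : inU u -> L2 Om (cU i u).
Proof.
move=> Uu; have [Lu Ls _ _] := Uu; case: i => [[[]|j]|i]; [exact: Lu|exact: Ls|].
by apply: (cV_L2 oOm oT sT); case: (tP Uu).
Qed.

Lemma cU_lin i a u v : inU u -> inU v -> nm (cU i (a *: u + v) - (a *: cU i u + cU i v)) = 0.
Proof.
move=> Uu Uv; case: i => [[[]|j]|i] /=.
- by rewrite [X in snorm _ X](_ : _ = 0) ?(snorm0 HL)// subrr.
- by rewrite [X in snorm _ X](_ : _ = 0) ?(snorm0 HL)// -cmp_lin subrr.
- have [Vu _] := tP Uu; have [Vv _] := tP Uv; have [Vw _] := tP (inU_lin a Uu Uv).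
  have VL := shL HV a Vu Vv.
  have LL := cV_L2 oOm oT sT i.
  apply: (snorm_null_trans HL (LL _ Vw) (LL _ VL)); first exact: (shL HL a (LL _ Vu) (LL _ Vv)).
    exact: (cV_null i Vw VL (Theta_lin a Uu Uv)).
  exact: (cV_lin oOm oT sT dT nT i a Vu Vv).
Qed.

(** This product stands in for the one of U: through the lifts above, the field, the flux and
    [Theta u] also control the skeleton unknowns. *)
Definition ipU u v : R := ip Om (fld u) (fld v) + ipv Om (flux u) (flux v) + ipV (Theta u) (Theta v).

Local Notation nU := (snorm ipU).

Lemma ipUE u v : inU u -> inU v -> ipU u v = \sum_i ip Om (cU i u) (cU i v).
Proof.
move=> Uu Uv; have [Vu _] := tP Uu; have [Vv _] := tP Uv.
have [_ Ls _ _] := Uu; have [_ Lr _ _] := Uv.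
by rewrite /ipU (ipVE oOm oT sT Vu Vv) (ipvE mOm Ls Lr) [RHS]big_sumType /=; congr (_ + _); rewrite big_sumType big_unit.
Qed.

Lemma pair_normal_trace q f g : L2v Om q -> is_wdiv Om q g -> L2 Om f -> (forall k, H1space (T k) f) ->
  \sum_k normal_trace (T k) q f = ipv Om q (pw_grad f) + ip Om g f.
Proof.
move=> Lq dq Lf Hf.
rewrite (ipv_partition oOm oT sT dT nT Lq (pw_grad_L2v oOm oT sT Hf)).
rewrite (ip_partition oOm oT sT dT nT dq.1 Lf) -big_split; apply: eq_bigr => k _.
apply: (normal_traceE (@oT k) (L2vT k Lq) _ (L2T k Lf) (pw_gradP oT dT (Hf k))).
exact: (is_wdiv_restrict oOm (@oT k) (@sT k)).
Qed.

Lemma pair_potential q f r : L2 Om f -> is_wgrad Om f r -> L2v Om q -> (forall k, Hdiv (T k) q) ->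
  \sum_k normal_trace (T k) q f = ipv Om q r + ip Om (pw_div q) f.
Proof.
move=> Lf gf Lq Hq.
rewrite (ipv_partition oOm oT sT dT nT Lq gf.1).
rewrite (ip_partition oOm oT sT dT nT (pw_div_L2 oOm oT sT Hq) Lf) -big_split; apply: eq_bigr => k _.
apply: (normal_traceE (@oT k) (L2vT k Lq) (pw_divP oT dT (Hq k)) (L2T k Lf)).
exact: (is_wgrad_restrict oOm (@oT k) (@sT k)).
Qed.

(** The two differential conditions hold for every trial function with [y] = [Theta u]. Conversely
    they allow the skeleton unknowns to be defined as the traces of the two lifts, and integration
    by parts on each element then shows that [y] satisfies the equation of [Theta]. *)
Lemma trial_of_limits f s y : L2 Om f -> L2v Om s -> inV y ->
  is_wdiv Om (s - pw_grad y.1) (f - y.1) -> is_wgrad Om (f - pw_div y.2) (s - y.2) ->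
  exists u, [/\ inU u, fld u = f, flux u = s & nV (Theta u - y) = 0].
Proof.
move=> Lf Ls Vy dr gp; have [Lz Hz Lt Ht] := Vy.
have LZ := pw_grad_L2v oOm oT sT Hz; have LD := pw_div_L2 oOm oT sT Ht.
have Lr := shB HLv Ls LZ; have Lp := shB HL Lf LD.
have Hr : Hdiv Om (s - pw_grad y.1) by split=> //; exists (f - y.1).
have Hp : H1space Om (f - pw_div y.2) by split=> //; exists (s - y.2).
have Hpk k : H1space (T k) (f - pw_div y.2) by exact: (H1_restrict oOm (@oT k) (@sT k)).
pose u : trialT R n N := (f, s, fun k => f - pw_div y.2, fun k => normal_trace (T k) (s - pw_grad y.1)).
have Uu : inU u.
  split; [exact: Lf|exact: Ls|split|split].
  - exact: Hpk.
  - exists (f - pw_div y.2); split; first exact: Hp.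
    by move=> k; exact: (same_trace_refl (@oT k) (Hpk k)).
  - by move=> k; apply: Hmhalf_normal_trace; exact: (Hdiv_restrict oOm (@oT k) (@sT k)).
  - by exists (s - pw_grad y.1); split.
exists u; split=> //; apply: (Theta_unique Uu Vy) => x Vx; have [Lx Hx Lw Hw] := Vx.
have LGx := pw_grad_L2v oOm oT sT Hx; have LDx := pw_div_L2 oOm oT sT Hw.
rewrite /ipV /bform.
have -> : pair_shat (shat u) x.1 = ipv Om (s - pw_grad y.1) (pw_grad x.1) + ip Om (f - y.1) x.1.
  exact: pair_normal_trace.
have -> : pair_uhat V (uhat u) x.2 = ipv Om x.2 (s - y.2) + ip Om (pw_div x.2) (f - pw_div y.2).
  exact: pair_potential.
rewrite (ipBl HLv Ls LZ LGx) (ipBl HL Lf Lz Lx) (ipBr HLv Ls Lt Lw) (ipBr HL Lf LD LDx).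
rewrite (ipC HLv Lw Ls) (ipC HLv Lw Lt) (ipC HL LDx Lf) (ipC HL LDx LD) /=.
move: (ip _ _ _) (ip _ _ _) (ip _ _ _) (ip _ _ _) (ipv _ _ _) (ipv _ _ _) (ipv _ _ _) (ipv _ _ _) => *; ring.
Qed.

(** Limits of the components satisfy the conditions of [trial_of_limits], because weak gradients and
    divergences are closed under L^2 limits. *)
Lemma U_semiHilbert : semiHilbert inU ipU.
Proof.
apply: (semiHilbert_pullback HL inU_0 inU_lin cU_L2 cU_lin ipUE) => u z uU zL cz.
pose s : E -> E := fun x => \row_j z (inl (inr j)) x.
have cs j : cmp j s = z (inl (inr j)) by apply/funext => x; rewrite /cmp mxE.
have Ls : L2v Om s by move=> j; change (L2 Om (cmp j s)); rewrite cs.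
pose f := z (inl (inl tt)); have Lf : L2 Om f by exact: zL.
have uV m : inV (Theta (u m)) by case: (tP (uU m)).
have [y [Vy yz]] := cV_closed oOm oT sT dT nT uV (fun i => zL (inr i)) (fun i => cz (inr i)).
have Ly i := cV_L2 oOm oT sT i Vy.
have LT m i := cV_L2 oOm oT sT i (uV m).
have cy i : (fun m => nm (cV V i (Theta (u m)) - cV V i y)) @ \oo --> (0 : R).
  exact: (snorm_cvg_null HL (fun m => LT m i) (zL (inr i)) (Ly i) (cz (inr i)) (yz i)).
have [Lz Hz Lt Ht] := Vy.
have LZ := pw_grad_L2v oOm oT sT Hz; have LD := pw_div_L2 oOm oT sT Ht.
have cmpB j q r : cmp j (q - r) = cmp j q - cmp j r.
  by apply/funext => x; rewrite /cmp !fctE !mxE.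
have LuU m i := cU_L2 i (uU m).
have dr : is_wdiv Om (s - pw_grad y.1) (f - y.1).
  apply: (@is_wdiv_closed _ _ _ oOm (fun m => residual Om V (u m)) (fun m => residual_div Om V (u m))).
  - by move=> m; exact: residual_L2v.
  - exact: (shB HLv Ls LZ).
  - exact: (shB HL Lf Lz).
  - by move=> m; exact: residual_wdiv.
  - move=> j; rewrite (_ : (fun m => _) = (fun m => nm (cU (inl (inr j)) (u m) - cU (inr (inl (inr j))) (u m) -
        (z (inl (inr j)) - cV V (inl (inr j)) y)))).
      exact: (snorm_cvgB HL (fun m => LuU m (inl (inr j))) (fun m => LuU m (inr (inl (inr j)))) (zL (inl (inr j))) (Ly (inl (inr j))) (cz (inl (inr j))) (cy (inl (inr j)))).
    by apply/funext => m; rewrite cmpB cs /residual cmpB.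
  - exact: (snorm_cvgB HL (fun m => LuU m (inl (inl tt))) (fun m => LuU m (inr (inl (inl tt)))) (zL (inl (inl tt))) (Ly (inl (inl tt))) (cz (inl (inl tt))) (cy (inl (inl tt)))).
have gp : is_wgrad Om (f - pw_div y.2) (s - y.2).
  apply: (@is_wgrad_closed _ _ _ oOm (fun m => potential Om V (u m)) (fun m => potential_grad Om V (u m))).
  - by move=> m; exact: potential_L2.
  - exact: (shB HL Lf LD).
  - exact: (shB HLv Ls Lt).
  - by move=> m; exact: potential_wgrad.
  - exact: (snorm_cvgB HL (fun m => LuU m (inl (inl tt))) (fun m => LuU m (inr (inr (inr tt)))) (zL (inl (inl tt))) (Ly (inr (inr tt))) (cz (inl (inl tt))) (cy (inr (inr tt)))).
  - move=> j; rewrite (_ : (fun m => _) = (fun m => nm (cU (inl (inr j)) (u m) - cU (inr (inr (inl j))) (u m) -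
        (z (inl (inr j)) - cV V (inr (inl j)) y)))).
      exact: (snorm_cvgB HL (fun m => LuU m (inl (inr j))) (fun m => LuU m (inr (inr (inl j)))) (zL (inl (inr j))) (Ly (inr (inl j))) (cz (inl (inr j))) (cy (inr (inl j)))).
    by apply/funext => m; rewrite cmpB cs /potential_grad cmpB.
have [v [Uv fv sv ny]] := trial_of_limits Lf Ls Vy dr gp.
have [VT _] := tP Uv; exists v; split; first exact: Uv.
case=> [[[]|j]|i] /=.
- by rewrite fv subrr (snorm0 HL).
- by rewrite sv cs subrr (snorm0 HL).
- apply: (snorm_null_trans HL (zL (inr i)) (Ly i) (cV_L2 oOm oT sT i VT) (yz i)).
  by apply: (cV_null i Vy VT); rewrite (snorm_sub HV Vy VT).
Qed.

Lemma cU_le i u : inU u -> nm (cU i u) <= nU u.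
Proof. by move=> Uu; apply: (comp_le HL cU_L2 ipUE). Qed.

Lemma cU_bounded_linear f i : L2 Om f -> bounded_linear inU ipU (fun u => ip Om f (cU i u)).
Proof.
move=> Lf; split=> [a u v Uu Uv|].
  have Lw := shL HL a (cU_L2 i Uu) (cU_L2 i Uv).
  apply: (etrans (ip_nullr oOm (cU_L2 i (inU_lin a Uu Uv)) Lw Lf (cU_lin i a Uu Uv))).
  exact: (ip_linr HL Lf a (cU_L2 i Uu) (cU_L2 i Uv)).
exists (nm f) => u Uu; apply: le_trans (cauchy_schwarz HL Lf (cU_L2 i Uu)) _.
by rewrite ler_wpM2l ?snorm_ge0//; exact: cU_le.
Qed.

Lemma trial_norms_le u : inU u ->
  [/\ nm (fld u) <= nU u, nmv (flux u) <= nU u, nm (Theta u).1 <= nU u,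
      nmv (pw_grad (Theta u).1) <= nU u & nmv (Theta u).2 <= nU u /\ nm (pw_div (Theta u).2) <= nU u].
Proof.
move=> Uu; have [VT _] := tP Uu; have [Lz Hz Lt Ht] := VT; have [Lu Ls _ _] := Uu.
have LZ := pw_grad_L2v oOm oT sT Hz; have LD := pw_div_L2 oOm oT sT Ht.
have := ip_ge0 HL Lu; have := ip_ge0 HLv Ls; have := ip_ge0 HL Lz; have := ip_ge0 HLv LZ.
have := ip_ge0 HLv Lt; have := ip_ge0 HL LD.
rewrite /snorm /ipU /ipV.
move: (ip Om (fld u) (fld u)) (ipv Om (flux u) (flux u)) (ip Om (Theta u).1 (Theta u).1)
  (ipv Om (pw_grad (Theta u).1) (pw_grad (Theta u).1)) (ipv Om (Theta u).2 (Theta u).2)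
  (ip Om (pw_div (Theta u).2) (pw_div (Theta u).2)) => a1 a2 a3 a4 a5 a6 *.
by do ![split]; rewrite ler_wsqrtr//; lra.
Qed.

(** If the field, the flux and [Theta u] are null, so are the potential and the residual, and with
    them the traces that they carry. *)
Lemma inU_null u k : inU u -> nU u = 0 ->
  [/\ nm (fld u) = 0, nmv (flux u) = 0, same_trace (T k) (uhat u k) 0 &
      forall f, H1space (T k) f -> shat u k f = 0].
Proof.
move=> Uu n0; have [VT _] := tP Uu; have [Lz Hz Lt Ht] := VT; have [Lu Ls [Hu _] _] := Uu.
have LZ := pw_grad_L2v oOm oT sT Hz; have LD := pw_div_L2 oOm oT sT Ht.
have [l1 l2 l3 l4 [l5 l6]] := trial_norms_le Uu; rewrite n0 in l1 l2 l3 l4 l5 l6.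
have le0 (r : R) : 0 <= r -> r <= 0 -> r = 0 by move=> r0 r1; apply/eqP; rewrite eq_le r1.
split; [exact: (le0 _ (snorm_ge0 _ _) l1)|exact: (le0 _ (snorm_ge0 _ _) l2)| |].
  have pt := potential_trace oOm oT sT dT nT k Uu.
  apply: (same_trace_trans (@oT k) pt); apply: (same_trace_H10 (@oT k)).
  have [_ Hp _] := pt; apply: (null_H10 (@oT k) Hp); apply: (nullT oOm oT sT).
    exact: potential_L2.
  apply: le0; first exact: snorm_ge0.
  apply: le_trans (snormD HL Lu (shN HL LD)) _; rewrite (snormN HL LD).
  by move: l1 l6; move: (nm _) (nm _) => a b; lra.
move=> f Hf; rewrite (shat_eq oOm oT sT dT nT Uu Hf) -/(residual Om V u) -/(residual_div Om V u).
have HTv := L2v_semiHilbert (mT k).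
have Lr := residual_L2v oOm oT sT dT nT Uu.
have nr : snorm (ipv (T k)) (residual Om V u) = 0.
  have nr : nmv (residual Om V u) = 0.
    apply: le0; first exact: snorm_ge0.
    apply: le_trans (snormD HLv Ls (shN HLv LZ)) _; rewrite (snormN HLv LZ).
    by move: l2 l4; move: (nmv _) (nmv _) => a b; lra.
  have /eqP := ip_snorm0 HLv Lr Lr nr; rewrite (ipvE mOm Lr Lr) psumr_eq0 => [/allP h|i _]; last exact: (ip_ge0 HL (Lr i)).
  rewrite /snorm (ipvE (mT k) (L2vT k Lr) (L2vT k Lr)) big1 ?sqrtr0// => i _.
  have /eqP h0 := h i (mem_index_enum i).
  have : snorm (ip (T k)) (cmp i (residual Om V u)) = 0.
    by apply: (nullT oOm oT sT k (Lr i)); rewrite /snorm h0 sqrtr0.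
  by move/(ip_snorm0 (HT k) (L2T k (Lr i)) (L2T k (Lr i))).
rewrite (ip_snorm0 HTv (L2vT k Lr) (H1_L2v Hf) nr) add0r.
have Ld : L2 Om (residual_div Om V u) by exact: (shB HL Lu Lz).
apply: (ip_snorm0 (HT k) (L2T k Ld) (H1_L2 Hf)); apply: (nullT oOm oT sT k Ld).
apply: le0; first exact: snorm_ge0.
apply: le_trans (snormD HL Lu (shN HL Lz)) _; rewrite (snormN HL Lz).
by move: l1 l3; move: (nm _) (nm _) => a b; lra.
Qed.

Lemma ipv_null_ae q r : L2v Om q -> L2v Om r -> nmv (q - r) = 0 -> ae_eq leb Om q r.
Proof.
move=> Lq Lr n0; have Lqr := shB HLv Lq Lr.
have /eqP := ip_snorm0 HLv Lqr Lqr n0.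
rewrite (ipvE mOm Lqr Lqr) psumr_eq0 => [/allP h|i _]; last exact: (ip_ge0 HL (Lqr i)).
have hi i : ae_eq leb Om (cmp i q) (cmp i r).
  apply/(L2_ae_eq mOm (Lq i) (Lr i)).
  have -> : cmp i q - cmp i r = cmp i (q - r) by apply/funext => x; rewrite /cmp !fctE !mxE.
  by have /eqP h0 := h i (mem_index_enum i); rewrite /snorm h0 sqrtr0.
have : {ae leb, forall x, forall i, Om x -> cmp i q x = cmp i r x}.
  exact: (@filter_forall _ _ (fun i x => Om x -> cmp i q x = cmp i r x) _ _ hi).
by apply: filterS => x h' Ox; apply/rowP => i; exact: h'.
Qed.

Lemma eqU_of_null u v : inU u -> inU v -> nU (u - v) = 0 -> eqU Om V u v.
Proof.
move=> Uu Uv n0; have Uw := shB U_semiHilbert Uu Uv.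
have [Lu Ls [Hu _] _] := Uu; have [Lv Lr [Hv _] _] := Uv.
have [l1 l2 l3 l4 [l5 l6]] := trial_norms_le Uw; rewrite n0 in l1 l2.
split.
- by apply/(L2_ae_eq mOm Lu Lv); apply/eqP; rewrite eq_le l1 snorm_ge0.
- by apply: (ipv_null_ae Ls Lr); apply/eqP; rewrite eq_le l2 snorm_ge0.
- move=> k; have [_ _ [_ _ h] _] := inU_null k Uw n0; split; [exact: Hu|exact: Hv|].
  by move: h; rewrite subr0.
- move=> k f Hf; have [_ _ _ h] := inU_null k Uw n0.
  by apply/eqP; rewrite -subr_eq0; apply/eqP; exact: (h f Hf).
Qed.

End trial_hilbert.

(** * Boundedness and coercivity of the forms *)

Section dpg_forms.
Context {R : realType} {n N : nat}.
Local Notation E := 'rV[R]_n.+1.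
Local Notation leb := (@lebesgue_rV R n.+1).
Variables (Om : set E) (V : 'I_N -> 'M[R]_(n.+2, n.+1)).
Local Notation T k := (simplex (V k)).
Hypotheses (oOm : open Om) (oT : forall k, open (T k)) (sT : forall k, T k `<=` Om).
Hypothesis dT : forall k l, k != l -> T k `&` T l = set0.
Hypothesis nT : leb (Om `\` \bigcup_k T k) = 0%E.
Implicit Types (f g : E -> R) (q r t : E -> E) (k : 'I_N).
Implicit Types u v : trialT R n N.
Let mOm := rV_open_measurable oOm.
Let mT k := rV_open_measurable (@oT k).
Let HL := L2_semiHilbert mOm.
Let HLv := L2v_semiHilbert mOm.
Let HT k := L2_semiHilbert (mT k).
Let HV := V_semiHilbert oOm oT sT dT nT.
Local Notation nm := (snorm (ip Om)).
Local Notation nmv := (snorm (ipv Om)).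
Local Notation nV := (snorm (ipV Om V)).
Local Notation inV := (inV Om V).
Local Notation inU := (inU Om V).
Local Notation ipV := (ipV Om V).
Local Notation pw_grad := (pw_grad V).
Local Notation pw_div := (pw_div V).
Local Notation bform := (bform Om V).
Local Notation Theta := (Theta Om V).
Let L2T f k : L2 Om f -> L2 (T k) f := @L2T _ _ _ _ _ oOm oT sT f k.
Let L2vT q k : L2v Om q -> L2v (T k) q := fun Lq => L2v_restrict oOm (@oT k) (@sT k) Lq.
Let tP := ThetaP oOm oT sT dT nT.
Let HU := U_semiHilbert oOm oT sT dT nT.
Let ULin := inU_lin oOm oT sT.
Local Notation ipU := (ipU Om V).
Local Notation nU := (snorm ipU).
Local Notation cU := (cU Om V).
Local Notation residual := (residual Om V).
Local Notation residual_div := (residual_div Om V).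
Local Notation potential := (potential Om V).
Local Notation potential_grad := (potential_grad Om V).

Lemma cmpB j q r : cmp j (q - r) = cmp j q - cmp j r.
Proof. by apply/funext => x; rewrite /cmp !fctE !mxE. Qed.

Lemma cmp_residual j u : cmp j (residual u) = cU (inl (inr j)) u - cU (inr (inl (inr j))) u.
Proof. exact: cmpB. Qed.

Lemma cmp_potential_grad j u :
  cmp j (potential_grad u) = cU (inl (inr j)) u - cU (inr (inr (inl j))) u.
Proof. exact: cmpB. Qed.

Lemma residual_norms u : inU u ->
  [/\ nmv (residual u) <= 2 * nU u, nm (residual_div u) <= 2 * nU u,
      nm (potential u) <= 2 * nU u & nmv (potential_grad u) <= 2 * nU u].
Proof.
move=> Uu; have [[Lz Hz Lt Ht] _] := tP Uu; have [Lu Ls _ _] := Uu.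
have LZ := pw_grad_L2v oOm oT sT Hz; have LD := pw_div_L2 oOm oT sT Ht.
have [l1 l2 l3 l4 [l5 l6]] := trial_norms_le oOm oT sT dT nT Uu.
split.
- apply: le_trans (snormD HLv Ls (shN HLv LZ)) _; rewrite (snormN HLv LZ).
  by move: l2 l4; move: (nmv _) (nmv _) (nU u) => *; lra.
- apply: le_trans (snormD HL Lu (shN HL Lz)) _; rewrite (snormN HL Lz).
  by move: l1 l3; move: (nm _) (nm _) (nU u) => *; lra.
- apply: le_trans (snormD HL Lu (shN HL LD)) _; rewrite (snormN HL LD).
  by move: l1 l6; move: (nm _) (nm _) (nU u) => *; lra.
- apply: le_trans (snormD HLv Ls (shN HLv Lt)) _; rewrite (snormN HLv Lt).
  by move: l2 l5; move: (nmv _) (nmv _) (nU u) => *; lra.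
Qed.

Lemma residual_div_L2 u : inU u -> L2 Om (residual_div u).
Proof. by move=> Uu; have [] := residual_wdiv oOm oT sT dT nT Uu. Qed.

(** The boundary duality as volume products of the lifts, a form in which its linearity in both
    arguments and its bound can be read off. *)
Definition trace_form u v : R :=
  ipv Om (residual u) (potential_grad v) + ip Om (residual_div u) (potential v).

Lemma trace_formE u v : inU u -> inU v -> gamman Om V u (gamma0 Om V v) = trace_form u v.
Proof. exact: gamman_gamma0. Qed.

Lemma trace_form_bounded u v : inU u -> inU v -> `|trace_form u v| <= 8 * nU u * nU v.
Proof.
move=> Uu Uv; have [r1 r2 _ _] := residual_norms Uu; have [_ _ p1 p2] := residual_norms Uv.
apply: le_trans (ler_normD _ _) _.
have c1 := cauchy_schwarz HLv (residual_L2v oOm oT sT dT nT Uu) (potential_grad_L2v oOm oT sT dT nT Uv).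
have c2 := cauchy_schwarz HL (residual_div_L2 Uu) (potential_L2 oOm oT sT dT nT Uv).
have m1 := ler_pM (snorm_ge0 _ _) (snorm_ge0 _ _) r1 p2.
have m2 := ler_pM (snorm_ge0 _ _) (snorm_ge0 _ _) r2 p1.
have e (a b : R) : 8 * a * b = 2 * a * (2 * b) + 2 * a * (2 * b) by ring.
rewrite e.
exact: lerD (le_trans c1 m1) (le_trans c2 m2).
Qed.

Lemma trace_form_linl v : inU v -> bounded_linear inU ipU (trace_form^~ v).
Proof.
move=> Uv; have Lp := potential_L2 oOm oT sT dT nT Uv; have Lg := potential_grad_L2v oOm oT sT dT nT Uv.
have bl := cU_bounded_linear oOm oT sT dT nT.
apply: (@bounded_linear_eq _ _ _ _ HU (fun u =>
  \sum_j (ip Om (cmp j (potential_grad v)) (cU (inl (inr j)) u) +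
          - ip Om (cmp j (potential_grad v)) (cU (inr (inl (inr j))) u)) +
  (ip Om (potential v) (cU (inl (inl tt)) u) + - ip Om (potential v) (cU (inr (inl (inl tt))) u)))).
  move=> u Uu; have LU i := cU_L2 oOm oT sT dT nT i Uu; rewrite /trace_form.
  have Lr := residual_L2v oOm oT sT dT nT Uu.
  rewrite (ipC HLv Lr Lg) (ipvE mOm Lg Lr) (ipC HL (residual_div_L2 Uu) Lp).
  congr (_ + _); last by rewrite -(ipBr HL (LU (inl (inl tt))) (LU (inr (inl (inl tt)))) Lp).
  by apply: eq_bigr => j _; rewrite -(ipBr HL (LU (inl (inr j))) (LU (inr (inl (inr j)))) (Lg j)) cmp_residual.
apply: (bounded_linearD HU).
  apply: (bounded_linear_sum HU) => j; apply: (bounded_linearD HU); first exact: (bl _ _ (Lg j)).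
  by apply: (bounded_linearN HU); exact: (bl _ _ (Lg j)).
by apply: (bounded_linearD HU); [|apply: (bounded_linearN HU)]; exact: bl.
Qed.

Lemma trace_form_linr u : inU u -> bounded_linear inU ipU (trace_form u).
Proof.
move=> Uu; have Lr := residual_L2v oOm oT sT dT nT Uu; have Ld := residual_div_L2 Uu.
have bl := cU_bounded_linear oOm oT sT dT nT.
apply: (@bounded_linear_eq _ _ _ _ HU (fun v =>
  \sum_j (ip Om (cmp j (residual u)) (cU (inl (inr j)) v) +
          - ip Om (cmp j (residual u)) (cU (inr (inr (inl j))) v)) +
  (ip Om (residual_div u) (cU (inl (inl tt)) v) + - ip Om (residual_div u) (cU (inr (inr (inr tt))) v)))).
  move=> v Uv; have LU i := cU_L2 oOm oT sT dT nT i Uv; rewrite /trace_form.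
  rewrite (ipvE mOm Lr (potential_grad_L2v oOm oT sT dT nT Uv)).
  congr (_ + _); last by rewrite -(ipBr HL (LU (inl (inl tt))) (LU (inr (inr (inr tt)))) Ld).
  by apply: eq_bigr => j _; rewrite -(ipBr HL (LU (inl (inr j))) (LU (inr (inr (inl j)))) (Lr j)) cmp_potential_grad.
apply: (bounded_linearD HU).
  apply: (bounded_linear_sum HU) => j; apply: (bounded_linearD HU); first exact: (bl _ _ (Lr j)).
  by apply: (bounded_linearN HU); exact: (bl _ _ (Lr j)).
by apply: (bounded_linearD HU); [|apply: (bounded_linearN HU)]; exact: bl.
Qed.

Lemma norm_half_le (a b c : R) : `|a| <= c -> `|b| <= c -> `|2^-1 * (a + b)| <= c.
Proof. by rewrite !ler_norml => /andP[? ?] /andP[? ?]; apply/andP; split; lra. Qed.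

(** Twice the difference of the two sides is |x - a - b|^2. *)
Lemma ip_sub_ge (X : lmodType R) (D : X -> Prop) (ipX : X -> X -> R) (x a b : X) :
  semiHilbert D ipX -> D x -> D a -> D b ->
  2^-1 * (ipX x x - ipX a a - ipX b b) <= ipX (x - a) (x - b).
Proof.
move=> H Dx Da Db; have Dxa := shB H Dx Da; have Dxb := shB H Dx Db.
have Dxab := shB H Dxa Db; have := ip_ge0 H Dxab.
rewrite (ipBl H Dxa Db Dxab) (ipBr H Dxa Db Dxa) (ipBr H Dxa Db Db) (ipBr H Dx Db Dxa).
rewrite (ipBl H Dx Da Dxa) (ipBr H Dx Da Dx) (ipBr H Dx Da Da).
rewrite (ipBl H Dx Da Dx) (ipBl H Dx Da Db) (ipBr H Dx Da Db) (ipC H Da Dx) (ipC H Db Dx) (ipC H Db Da).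
move: (ipX x x) (ipX a a) (ipX b b) (ipX x a) (ipX x b) (ipX a b) => *; lra.
Qed.

(** [ip_sub_ge] applied to (sigma - grad z, sigma - t) and to (u - z, u - div t): the four
    subtracted squares are those that make up |Theta u|^2. *)
Lemma trace_form_ge u : inU u ->
  2^-1 * (ip Om (fld u) (fld u) + ipv Om (flux u) (flux u) - ipV (Theta u) (Theta u)) <= trace_form u u.
Proof.
move=> Uu; have [[Lz Hz Lt Ht] _] := tP Uu; have [Lu Ls _ _] := Uu.
have LZ := pw_grad_L2v oOm oT sT Hz; have LD := pw_div_L2 oOm oT sT Ht.
have h1 := ip_sub_ge HL Lu Lz LD; have h2 := ip_sub_ge HLv Ls LZ Lt.
have := lerD h2 h1; apply: le_trans; rewrite /ipV -mulrDr ler_pM2l ?invr_gt0//.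
move: (ip _ _ _) (ip Om (Theta u).1 _) (ip Om (pw_div _) _) (ipv Om (flux u) _)
  (ipv Om (pw_grad _) _) (ipv Om (Theta u).2 _) => *; lra.
Qed.

Section variational_form.
Variables (star : variant) (beta : R).
Hypothesis beta2 : 2 <= beta.

Definition boundary_form u v : R :=
  match star with
  | variant_0 => trace_form u v
  | variant_n => trace_form v u
  | variant_s => 2^-1 * (trace_form u v + trace_form v u)
  end.

Lemma aformE u v : inU u -> inU v ->
  aform Om V star beta u v = beta * ipV (Theta u) (Theta v) + boundary_form u v.
Proof.
move=> Uu Uv; have [Vu hu] := tP Uu; have [Vv _] := tP Uv.
have bE : bform u (Theta_beta Om V beta v) = beta * ipV (Theta u) (Theta v).
  by rewrite -hu; [exact: (ipZr HV beta Vv Vu)|exact: (shZ HV beta Vv)].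
rewrite /aform /boundary_form /aform_0 /aform_n /aform_s; case: star.
- by rewrite bE trace_formE.
- by rewrite bE trace_formE.
- by rewrite bE !trace_formE.
Qed.

Lemma aform_linl v : inU v -> bounded_linear inU ipU (aform Om V star beta ^~ v).
Proof.
move=> Uv; have bl := cU_bounded_linear oOm oT sT dT nT; have [Vv _] := tP Uv.
apply: (@bounded_linear_eq _ _ _ _ HU (fun u =>
    beta * (\sum_i ip Om (cV V i (Theta v)) (cU (inr i) u)) + boundary_form u v)).
  move=> u Uu; have [Vu _] := tP Uu; rewrite aformE//; congr (_ * _ + _).
  by rewrite (ipC HV Vu Vv) (ipVE oOm oT sT Vv Vu).
apply: bounded_linear_lin; first by apply: (bounded_linear_sum HU) => i; apply: bl; exact: (cV_L2 oOm oT sT).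
have tl := trace_form_linl Uv; have tr := trace_form_linr Uv.
rewrite /boundary_form; case: star; [exact: tl|exact: tr|].
have := bounded_linear_lin 2^-1 (bounded_linearD HU tl tr) (bounded_linear0 inU ipU).
by apply: (bounded_linear_eq HU) => u _; rewrite addr0.
Qed.

Lemma aform_linr u : inU u -> bounded_linear inU ipU (aform Om V star beta u).
Proof.
move=> Uu; have bl := cU_bounded_linear oOm oT sT dT nT; have [Vu _] := tP Uu.
apply: (@bounded_linear_eq _ _ _ _ HU (fun v =>
    beta * (\sum_i ip Om (cV V i (Theta u)) (cU (inr i) v)) + boundary_form u v)).
  move=> v Uv; have [Vv _] := tP Uv; rewrite aformE//; congr (_ * _ + _).
  by rewrite (ipVE oOm oT sT Vu Vv).
apply: bounded_linear_lin; first by apply: (bounded_linear_sum HU) => i; apply: bl; exact: (cV_L2 oOm oT sT).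
have tl := trace_form_linl Uu; have tr := trace_form_linr Uu.
rewrite /boundary_form; case: star; [exact: tr|exact: tl|].
have := bounded_linear_lin 2^-1 (bounded_linearD HU tr tl) (bounded_linear0 inU ipU).
by apply: (bounded_linear_eq HU) => v _; rewrite addr0.
Qed.

Lemma Theta_norm_le u : inU u -> nV (Theta u) <= nU u.
Proof.
move=> Uu; have [Lu Ls _ _] := Uu; have [Vu _] := tP Uu; have := ip_ge0 HL Lu; have := ip_ge0 HLv Ls.
by rewrite /snorm => h1 h2; rewrite ler_wsqrtr// lerDr addr_ge0.
Qed.

Lemma aform_bounded u v : inU u -> inU v ->
  `|aform Om V star beta u v| <= (beta + 8) * nU u * nU v.
Proof.
move=> Uu Uv; rewrite aformE//; have [Vu _] := tP Uu; have [Vv _] := tP Uv.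
have b0 : 0 <= beta by exact: (le_trans (ler0n R 2) beta2).
have t1 := trace_form_bounded Uu Uv; have t2 := trace_form_bounded Uv Uu.
rewrite mulrAC in t2.
have tb : `|boundary_form u v| <= 8 * nU u * nU v.
  by rewrite /boundary_form; case: star; [exact: t1|exact: t2|exact: norm_half_le t1 t2].
have c := cauchy_schwarz HV Vu Vv.
have m := ler_pM (snorm_ge0 _ _) (snorm_ge0 _ _) (Theta_norm_le Uu) (Theta_norm_le Uv).
apply: le_trans (ler_normD _ _) _; rewrite -mulrA mulrDl mulrA; apply: lerD; last by rewrite mulrA.
by rewrite normrM (ger0_norm b0) -mulrA ler_wpM2l//; exact: le_trans c m.
Qed.

(** The term beta |Theta u|^2 outweighs the - |Theta u|^2 / 2 of [trace_form_ge] and leaves at least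
    |Theta u|^2 / 2. On the diagonal the three boundary forms agree. *)
Lemma aform_coercive u : inU u -> 2^-1 * nU u ^+ 2 <= aform Om V star beta u u.
Proof.
move=> Uu; rewrite aformE// (snorm_sqr HU Uu) /ipU.
have bE : boundary_form u u = trace_form u u by rewrite /boundary_form; case: star => //; lra.
have [VT _] := tP Uu; rewrite bE; have := trace_form_ge Uu; have := ip_ge0 HV VT.
move: (ipV _ _) (trace_form _ _) (ip _ _ _) (ipv _ _ _) => p tr a b p0; move: beta2; nra.
Qed.

Lemma Fform_bounded_linear f : L2 Om f -> bounded_linear inU ipU (Fform Om V f beta).
Proof.
move=> Lf; have bl := cU_bounded_linear oOm oT sT dT nT (inr (inl (inl tt))) Lf.
apply: (bounded_linear_eq HU) (bounded_linear_lin beta bl (bounded_linear0 inU ipU)) => u Uu.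
have [[Lz _ _ _] _] := tP Uu.
by rewrite addr0 /Fform /Lform (ipZr HL beta Lz Lf).
Qed.

End variational_form.
End dpg_forms.

(** * Closedness of the discrete space *)

Section discrete_spaces.
Context {R : realType} {n N : nat}.
Local Notation E := 'rV[R]_n.+1.
Local Notation leb := (@lebesgue_rV R n.+1).
Variables (Om : set E) (V : 'I_N -> 'M[R]_(n.+2, n.+1)).
Local Notation T k := (simplex (V k)).
Hypotheses (oOm : open Om) (oT : forall k, open (T k)) (sT : forall k, T k `<=` Om).
Hypothesis dT : forall k l, k != l -> T k `&` T l = set0.
Hypothesis aT : forall k, affinely_independent (V k).
Hypothesis bT : forall k, bounded_set (T k).
Hypothesis nT : leb (Om `\` \bigcup_k T k) = 0%E.
Implicit Types (f g : E -> R) (k : 'I_N).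
Implicit Types u : trialT R n N.
Let mOm := rV_open_measurable oOm.
Let mT k := rV_open_measurable (@oT k).
Let HL := L2_semiHilbert mOm.
Let HLv := L2v_semiHilbert mOm.
Let HT k := L2_semiHilbert (mT k).
Let HV := V_semiHilbert oOm oT sT dT nT.
Local Notation nm := (snorm (ip Om)).
Local Notation nmv := (snorm (ipv Om)).
Local Notation nV := (snorm (ipV Om V)).
Local Notation inV := (inV Om V).
Local Notation inU := (inU Om V).
Local Notation ipV := (ipV Om V).
Local Notation pw_grad := (pw_grad V).
Local Notation pw_div := (pw_div V).
Local Notation bform := (bform Om V).
Local Notation Theta := (Theta Om V).
Let L2T f k : L2 Om f -> L2 (T k) f := @L2T _ _ _ _ _ oOm oT sT f k.
Let L2vT q k : L2v Om q -> L2v (T k) q := fun Lq => L2v_restrict oOm (@oT k) (@sT k) Lq.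
Let tP := ThetaP oOm oT sT dT nT.
Let HU := U_semiHilbert oOm oT sT dT nT.
Local Notation ipU := (ipU Om V).
Local Notation nU := (snorm ipU).
Local Notation cU := (cU Om V).
Local Notation potential := (potential Om V).
Local Notation potential_grad := (potential_grad Om V).

Lemma potential_H1_le w u : open w -> w `<=` Om -> inU u ->
  snorm (ipH1 w) (potential u) <= 2 * #|{: unit + 'I_n.+1}|%:R * nU u.
Proof.
move=> ow sw Uu; have mw := rV_open_measurable ow; have Hw := L2_semiHilbert mw.
have Hp := potential_H1 oOm oT sT dT nT Uu; have Hpw := H1_restrict oOm ow sw Hp.
have [_ _ p1 p2] := residual_norms oOm oT sT dT nT Uu.
apply: le_trans (snorm_le_sum Hw (cH1_L2 (w := w)) (ipH1E ow) Hpw) _.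
have -> : 2 * #|{: unit + 'I_n.+1}|%:R * nU u = \sum_(i : unit + 'I_n.+1) (2 * nU u).
  by rewrite sumr_const -[RHS]mulr_natr; exact: mulrAC.
apply: ler_sum => -[i|j] _ /=.
  apply: le_trans p1; exact: (snorm_restrict oOm ow sw (H1_L2 Hp)).
have Lg := potential_grad_L2v oOm oT sT dT nT Uu.
have gw := is_wgrad_restrict oOm ow sw (potential_wgrad oOm oT sT dT nT Uu).
rewrite (null_snorm Hw (H1_cmp j Hpw) (gw.1 j) (wgrad_eq ow j (H1_L2 Hpw) gw)).
apply: le_trans (snorm_restrict oOm ow sw (Lg j)) _; apply: le_trans p2.
exact: (comp_le HL (c := fun j q => cmp j q) (fun i q (Lq : L2v Om q) => Lq i) (ipvE mOm) j Lg).
Qed.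

Lemma shat_bounded u k f : inU u -> H1space (T k) f ->
  `|shat u k f| <= 4 * nU u * H1norm (T k) f.
Proof.
move=> Uu Hf; have [r1 r2 _ _] := residual_norms oOm oT sT dT nT Uu.
have Lr := residual_L2v oOm oT sT dT nT Uu; have Ld := residual_div_L2 oOm oT sT dT nT Uu.
rewrite (shat_eq oOm oT sT dT nT Uu Hf) H1normE.
apply: le_trans (ler_normD _ _) _.
have c1 := cauchy_schwarz (L2v_semiHilbert (mT k)) (L2vT k Lr) (H1_L2v Hf).
have c2 := cauchy_schwarz (HT k) (L2T k Ld) (H1_L2 Hf).
have s1 : snorm (ipv (T k)) (residual Om V u) <= 2 * nU u.
  apply: le_trans r1; rewrite /snorm ler_wsqrtr// (ipvE (mT k) (L2vT k Lr) (L2vT k Lr)) (ipvE mOm Lr Lr).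
  apply: ler_sum => j _; rewrite -(snorm_sqr HL (Lr j)) -(snorm_sqr (HT k) (L2T k (Lr j))).
  rewrite ler_pXn2r ?nnegrE ?snorm_ge0//; exact: (snorm_restrict oOm (@oT k) (@sT k) (Lr j)).
have s2 := le_trans (snorm_restrict oOm (@oT k) (@sT k) Ld) r2.
have m1 := ler_pM (snorm_ge0 _ _) (snorm_ge0 _ _) s1 (snorm_wgrad_le (@oT k) Hf).
have m2 := ler_pM (snorm_ge0 _ _) (snorm_ge0 _ _) s2 (snorm_L2_le (@oT k) Hf).
have e (a b : R) : 4 * a * b = 2 * a * b + 2 * a * b by ring.
rewrite e; exact: lerD (le_trans c1 m1) (le_trans c2 m2).
Qed.

Section constants.
Variables (w : set E).
Hypothesis ow : open w.
Let mw := rV_open_measurable ow.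
Let Hw := L2_semiHilbert mw.

Lemma constants_lin a f g (c c' : R) : ae_eq leb w f (cst c) -> ae_eq leb w g (cst c') ->
  ae_eq leb w (a *: f + g) (cst (a * c + c')).
Proof.
move=> fc gc; apply: filterS2 fc gc => x hf hg wx.
by rewrite -[LHS]/(a * f x + g x) hf// hg.
Qed.

(** [finite_relation_closed] with the constant as the only coordinate; the value 0 gives a null
    function. *)
Lemma constants_closed f : L2 w f ->
  (forall e, 0 < e -> exists g c, [/\ L2 w g, ae_eq leb w g (cst c) & snorm (ip w) (f - g) <= e]) ->
  exists c : R, ae_eq leb w f (cst c).
Proof.
move=> Lf happ; pose P (g : E -> R) (t : R) := L2 w g /\ snorm (ip w) g <= t.
pose Rel (c : unit -> R) g := L2 w g /\ ae_eq leb w g (cst (c tt)).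
have [] := @finite_relation_closed _ unit (E -> R) P _ _ _ _ [:: tt] Rel f.
- move=> a g t [Lg gt]; split; first exact: (shZ Hw a Lg).
  by rewrite (snormZ Hw a Lg) ler_wpM2l.
- move=> g h t s' [Lg gt] [Lh ht]; split; first exact: (shD Hw Lg Lh).
  exact: le_trans (snormD Hw Lg Lh) (lerD gt ht).
- by move=> g t [_]; apply: le_trans; exact: snorm_ge0.
- by move=> g t t' tt' [Lg gt]; split=> //; exact: le_trans tt'.
- move=> a c g c' g' [Lg gc] [Lg' gc']; split; first exact: (shL Hw a Lg Lg').
  exact: constants_lin.
- by move=> c g [Lg _]; exists (snorm (ip w) g).
- by move=> c g [] _; rewrite inE.
- move=> c g [Lg gc] c0 t t0; split; first exact: Lg.
  have -> : snorm (ip w) g = 0; last exact: ltW.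
  by apply/(null_ae mw Lg); apply: filterS gc => x h wx; rewrite h// /cst c0.
- move=> e e0; have [g [c [Lg gc le]]] := happ e e0.
  by exists (fun=> c), g; split; split=> //; exact: (shB Hw Lf Lg).
move=> c [g [[Lg gc] nul]]; exists (c tt).
have n0 : snorm (ip w) (f - g) = 0.
  apply/eqP; rewrite eq_le snorm_ge0 andbT; apply/ler_addgt0Pl => e e0.
  by rewrite addr0; case: (nul e e0).
have fg := (L2_ae_eq mw Lf Lg).1 n0.
by apply: filterS2 fg gc => x h1 h2 wx; rewrite h1// h2.
Qed.

End constants.

Lemma P0_mesh_lin a f g : P0_mesh V f -> P0_mesh V g -> P0_mesh V (a *: f + g).
Proof.
move=> hf hg k; have [c fc] := hf k; have [c' gc'] := hg k.
by exists (a * c + c'); exact: constants_lin.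
Qed.

Lemma P0v_mesh_lin a (q r : E -> E) : P0v_mesh V q -> P0v_mesh V r -> P0v_mesh V (a *: q + r).
Proof.
move=> hf hg k; have [c fc] := hf k; have [c' gc'] := hg k.
exists (a *: c + c'); apply: filterS2 fc gc' => x h1 h2 kx.
by rewrite -[LHS]/(a *: q x + r x) h1// h2.
Qed.

Lemma S1_skel_lin a uh vh : S1_skel V uh -> S1_skel V vh -> S1_skel V (a *: uh + vh).
Proof.
move=> [g [cg ag tg]] [h [ch ah th]]; exists (a *: g + h); split.
- by move=> x; apply: cvgD; [apply: cvgZr; exact: cg|exact: ch].
- move=> k j; have [p [c gE]] := ag k j; have [p' [c' hE]] := ah k j.
  exists (a *: p + p'), (a * c + c') => x kx.
  rewrite -[LHS]/(a * g x + h x) gE// hE// mulrDr addrACA; congr (_ + _).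
  rewrite /dotp mulr_sumr -big_split; apply: eq_bigr => i _.
  by rewrite !mxE mulrDl mulrA.
- by move=> k; exact: (has_trace_lin (@oT k) a (tg k) (th k)).
Qed.

Lemma P0_skel_lin a sh th : P0_skel V sh -> P0_skel V th -> P0_skel V (a *: sh + th).
Proof.
move=> hs ht k; have [c hc] := hs k; have [c' hc'] := ht k.
exists (fun j => a * c j + c' j) => v phi vphi.
rewrite -[LHS]/(a * sh k v + th k v) (hc _ _ vphi) (hc' _ _ vphi) mulr_sumr -big_split.
by apply: eq_bigr => j _; rewrite mulrDl mulrA.
Qed.

Lemma Uh_lin a u v : Uh Om V u -> Uh Om V v -> Uh Om V (a *: u + v).
Proof.
move=> [Uu [u1 u2 u3 u4]] [Uv [v1 v2 v3 v4]]; split; first exact: (inU_lin oOm oT sT a Uu Uv).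
split; [exact: (P0_mesh_lin a u1 v1)|exact: (P0v_mesh_lin a u2 v2)|
  exact: (S1_skel_lin a u3 v3)|exact: (P0_skel_lin a u4 v4)].
Qed.

Lemma Uh_0 : Uh Om V 0.
Proof.
have zE x : dotp (0 : E) x = 0 :> R by rewrite /dotp big1// => i _; rewrite mxE mul0r.
split; first exact: (inU_0 oOm oT).
split.
- by move=> k; exists 0; apply: nearW.
- by move=> k; exists 0; apply: nearW.
- exists (cst 0); split.
  + exact: cst_continuous.
  + by move=> k j; exists 0, 0 => x _; rewrite zE addr0.
  + by move=> k; exact: (has_trace0 (@oT k)).
- move=> k; exists (fun=> 0) => v phi _; rewrite big1 // => j _; exact: mul0r.
Qed.

(** The facets cover the boundary of the simplex, so the Lipschitz representative vanishes there and
    [lipschitz_H10] applies. *)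
Lemma zero_on_facets_H10 k f (g : E -> R) : has_trace (T k) f g ->
  (forall j x, facet (V k) j x -> g x = 0) -> H10space (T k) f.
Proof.
move=> [g' [Lg' bg [Hf Hg' h10]]] g0.
have h' : H10space (T k) g'.
  apply: (lipschitz_H10 (@oT k) (@bT k) Hg' Lg') => x bx.
  by rewrite bg//; have [j fj _] := simplex_boundary_facet (@aT k) bx; exact: g0 fj.
have -> : f = 1 *: (f - g') + g' by rewrite scale1r subrK.
exact: (H10_lin (@oT k) 1 h10 h').
Qed.

(** The coordinates are the n + 2 coefficients of an affine function on each facet. Zero
    coefficients give zero traces by [zero_on_facets_H10], so [finite_relation_closed] applies with
    the quotient norms of H^1 by H^1_0. *)
Lemma S1_skel_closed u : inU u ->
  (forall e, 0 < e -> exists v, [/\ inU v, S1_skel V (uhat v) & nU (u - v) <= e]) ->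
  S1_skel V (uhat u).
Proof.
move=> Uu happ; have [_ _ [Hu _] _] := Uu.
pose I := ('I_N * 'I_n.+2 * option 'I_n.+1)%type.
(* A witness [h] in H^1_0 on each element expresses the bound on the quotient norm without its
   infimum. *)
pose P (q : 'I_N -> E -> R) (t : R) := 0 <= t /\ forall k, H1space (T k) (q k) /\
  exists h, H10space (T k) h /\ snorm (ipH1 (T k)) (q k - h) <= t.
pose Rel (c : I -> R) (q : 'I_N -> E -> R) := exists g : E -> R,
  [/\ {within \bigcup_k boundary (T k), continuous g},
      forall k j x, facet (V k) j x -> g x = dotp (\row_i c (k, j, Some i)) x + c (k, j, None) &
      forall k, has_trace (T k) (q k) g].
have Hk k := H1_semiHilbert (@oT k).
have HRel (c : I -> R) (q : 'I_N -> E -> R) k : Rel c q -> H1space (T k) (q k) by move=> [g [_ _ /(_ k) [g' [_ _ []]]]].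
have [] := @finite_relation_closed _ I _ P _ _ _ _ (enum {: I}) Rel (uhat u).
- move=> a q t [t0 h]; split; first by rewrite mulr_ge0.
  move=> k; have [Hq [h' [Hh le]]] := h k; split; first exact: (shZ (Hk k) a Hq).
  exists (a *: h'); split; first by rewrite -[_ *: _]addr0; exact: (H10_lin (@oT k) a Hh (H10_0 (@oT k))).
  rewrite -scalerBr (snormZ (Hk k) a (shB (Hk k) Hq (H10_H1 Hh))).
  by rewrite ler_wpM2l.
- move=> q q' t t' [t0 h] [t0' h']; split; first exact: addr_ge0.
  move=> k; have [Hq [g [Hg le]]] := h k; have [Hq' [g' [Hg' le']]] := h' k.
  split; first exact: (shD (Hk k) Hq Hq').
  exists (1 *: g + g'); split; first exact: (H10_lin (@oT k) 1 Hg Hg').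
  rewrite scale1r opprD addrACA.
  have D1 := shB (Hk k) Hq (H10_H1 Hg); have D2 := shB (Hk k) Hq' (H10_H1 Hg').
  exact: le_trans (snormD (Hk k) D1 D2) (lerD le le').
- by move=> q t [].
- move=> q t t' tt' [t0 h]; split; first exact: le_trans tt'.
  move=> k; have [Hq [g [Hg le]]] := h k; split=> //; exists g; split=> //; exact: le_trans tt'.
- move=> a c q c' q' [g [cg ag tg]] [h [ch ah th]]; exists (a *: g + h); split.
  + by move=> x; apply: cvgD; [apply: cvgZr; exact: cg|exact: ch].
  + move=> k j x kx; rewrite -[LHS]/(a * g x + h x) (ag k j)// (ah k j)// mulrDr addrACA; congr (_ + _).
    rewrite /dotp mulr_sumr -big_split; apply: eq_bigr => i _.
    by rewrite !mxE mulrDl mulrA.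
  + by move=> k; exact: (has_trace_lin (@oT k) a (tg k) (th k)).
- move=> c q rq; exists (\sum_k snorm (ipH1 (T k)) (q k)); split.
    by apply: sumr_ge0 => k _; exact: snorm_ge0.
  move=> k; split; first exact: HRel rq.
  exists 0; split; first exact: (H10_0 (@oT k)).
  by rewrite subr0 (bigD1 k)//= lerDl; apply: sumr_ge0 => l _; exact: snorm_ge0.
- by move=> c q i _; rewrite mem_enum.
- move=> c q [g [_ ag tg]] c0 t t0; split; first exact: ltW.
  move=> k; have [g' [_ _ [Hq _ _]]] := tg k; split; first exact: Hq.
  exists (q k); split; last by rewrite subrr (snorm0 (Hk k)) ltW.
  apply: (zero_on_facets_H10 (tg k)) => j x kx.
  by rewrite (ag k j)// c0 addr0 /dotp big1// => i _; rewrite mxE c0 mul0r.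
- move=> e e0; pose C : R := 2 * #|{: unit + 'I_n.+1}|%:R + 1.
  have C0 : 0 < C by rewrite ltr_wpDl ?mulr_ge0.
  have [v [Uv [g [cg ag tg]] le]] := happ _ (divr_gt0 e0 C0).
  have Uw := shB HU Uu Uv.
  have /choice[c hc] : forall kj : 'I_N * 'I_n.+2, exists pc : E * R,
      forall x, facet (V kj.1) kj.2 x -> g x = dotp pc.1 x + pc.2.
    by move=> [k j]; have [p [c gE]] := ag k j; exists (p, c).
  exists (fun i : I => if i.2 is Some j then (c i.1).1 ord0 j else (c i.1).2), (uhat v).
  split.
    exists g; split=> // k j x kx /=; rewrite (hc (k, j) x kx); congr (dotp _ x + _).
    by apply/rowP => i; rewrite mxE.
  split; first exact: ltW.
  move=> k; have [Hw' Hp h10] := potential_trace oOm oT sT dT nT k Uw.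
  split; first exact: Hw'.
  (* By [potential_trace] this difference lies in H^1_0. Removing it from [uhat (u - v) k] leaves
     the potential, whose H^1 norm is controlled by [ipU]. *)
  exists (uhat (u - v) k - potential (u - v)); split; first exact: h10.
  rewrite opprB addrC subrK.
  apply: le_trans (potential_H1_le (@oT k) (@sT k) Uw) _.
  have := snorm_ge0 ipU (u - v); move: (nU _) le => r; rewrite ler_pdivlMr// /C => le r0.
  by apply: le_trans le; rewrite mulrC ler_wpM2l// lerDl.
move=> c [q [[g [cg ag tg]] nul]]; exists g; split; [exact: cg| |move=> k].
  by move=> k j; exists (\row_i c (k, j, Some i)), (c (k, j, None)) => x; exact: ag.
apply: (has_trace_same (@oT k) _ (tg k)).
have [g' [_ _ [Hq _ _]]] := tg k; have Hd := shB (Hk k) (Hu k) Hq.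
split; [exact: Hu|exact: Hq|].
apply: (H10_closed (@oT k)); split; first exact: Hd.
move=> e e0; have e2 : 0 < e / 2 by rewrite divr_gt0.
have [_ /(_ k) [_ [h [Hh le]]]] := nul _ e2; exists h; split; first exact: Hh.
by apply: le_lt_trans le _; rewrite gtr_pMr// invf_lt1// ltr1n.
Qed.

(** The same scheme with one coordinate per facet and the dual norm. Functionals are compared only
    on functions with a Lipschitz trace, where [P0_skel] prescribes their values. *)
Lemma P0_skel_closed u : inU u ->
  (forall e, 0 < e -> exists v, [/\ inU v, P0_skel V (shat v) & nU (u - v) <= e]) ->
  P0_skel V (shat u).
Proof.
move=> Uu happ.
pose I := ('I_N * 'I_n.+2)%type.
have n0 k f : 0 <= H1norm (T k) f :> R by exact: sqrtr_ge0.
pose P (l : 'I_N -> (E -> R) -> R) (t : R) := 0 <= t /\ forall k v phi, has_trace (T k) v phi ->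
  `|l k v| <= t * H1norm (T k) v.
pose Rel (c : I -> R) (l : 'I_N -> (E -> R) -> R) := (forall k, Hmhalf (T k) (l k)) /\
  forall k v phi, has_trace (T k) v phi -> l k v = \sum_j c (k, j) * facet_integral (V k) j phi.
have [] := @finite_relation_closed _ I _ P _ _ _ _ (enum {: I}) Rel (shat u).
- move=> a l t [t0 h]; split; first by rewrite mulr_ge0.
  move=> k v phi vphi; rewrite -[(a *: l) k v]/(a * l k v) normrM -mulrA ler_wpM2l//.
  exact: h vphi.
- move=> l l' t t' [t0 h] [t0' h']; split; first exact: addr_ge0.
  move=> k v phi vphi; apply: le_trans (ler_normD _ _) _.
  by rewrite mulrDl; apply: lerD; [exact: h vphi|exact: h' vphi].
- by move=> l t [].
- move=> l t t' tt' [t0 h]; split; first exact: le_trans tt'.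
  move=> k v phi vphi; apply: le_trans (h k v phi vphi) _.
  by rewrite ler_wpM2r.
- move=> a c l c' l' [Hl hl] [Hl' hl']; split.
    by move=> k; exact: (Hmhalf_lin a (Hl k) (Hl' k)).
  move=> k v phi vphi; rewrite -[LHS]/(a * l k v + l' k v) (hl k v phi vphi) (hl' k v phi vphi).
  rewrite mulr_sumr -big_split; apply: eq_bigr => j _.
  by rewrite -[(a *: c + c') (k, j)]/(a * c (k, j) + c' (k, j)) mulrDl mulrA.
- move=> c l [Hl _].
  have /choice[C hC] : forall k, exists C : R, forall f, H1space (T k) f -> `|l k f| <= C * H1norm (T k) f.
    by move=> k; have [_ _] := Hl k.
  exists (\sum_k `|C k|); split; first by apply: sumr_ge0.
  move=> k v phi [g [_ _ [Hv _ _]]]; apply: le_trans (hC k v Hv) _.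
  rewrite ler_wpM2r//; apply: le_trans (ler_norm _) _.
  by rewrite (bigD1 k)//= lerDl; apply: sumr_ge0.
- by move=> c q i _; rewrite mem_enum.
- move=> c l [_ hl] c0 t t0; split; first exact: ltW.
  move=> k v phi vphi; rewrite (hl k v phi vphi) big1 ?normr0 ?mulr_ge0 ?(ltW t0)// => j _.
  by rewrite c0 mul0r.
- move=> e e0; have e4 : 0 < e / 4 by rewrite divr_gt0.
  have [v [Uv pv le]] := happ _ e4; have Uw := shB HU Uu Uv.
  have /choice[c hc] : forall k, exists c : 'I_n.+2 -> R, forall f phi, has_trace (T k) f phi ->
      shat v k f = \sum_j c j * facet_integral (V k) j phi by exact: pv.
  exists (fun i => c i.1 i.2), (shat v); split.
    split; last by move=> k f phi /hc.
    by have [_ _ _ [Hv _]] := Uv.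
  split; first exact: ltW.
  move=> k f phi [g [_ _ [Hf _ _]]].
  apply: le_trans (shat_bounded (u := u - v) Uw Hf) _; rewrite ler_wpM2r//.
  by rewrite mulrC -ler_pdivlMr.
move=> c [l [[Hl hl] nul]] k; exists (fun j => c (k, j)) => v phi vphi.
rewrite -(hl k v phi vphi); apply/eqP; rewrite -subr_eq0 -normr_le0; apply/ler_addgt0Pl => e e0.
have m0 : 0 < H1norm (T k) v + 1 by rewrite ltr_wpDl.
have [_ h] := nul _ (divr_gt0 e0 m0); rewrite addr0; apply: le_trans (h k v phi vphi) _.
by rewrite mulrAC ler_pdivrMr// ler_wpM2l ?(ltW e0)// lerDl.
Qed.

Lemma Uh_closed : closed_pred inU ipU (Uh Om V).
Proof.
move=> u [Uu happ].
have happ' e : 0 < e -> exists v, Uh Om V v /\ nU (u - v) <= e.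
  by move=> /happ[v [Vv le]]; exists v; split=> //; exact: ltW.
split; first exact: Uu.
have [Lu Ls _ _] := Uu; split.
- move=> k; apply: (constants_closed (@oT k) (L2T k Lu)) => e e0.
  have [v [[Uv [pv _ _ _]] le]] := happ' e e0; have [Lv _ _ _] := Uv.
  have [c vc] := pv k; exists (fld v), c; split; [exact: L2T|exact: vc|].
  apply: le_trans le; apply: le_trans (cU_le oOm oT sT dT nT (inl (inl tt)) (shB HU Uu Uv)).
  exact: (snorm_restrict oOm (@oT k) (@sT k) (shB HL Lu Lv)).
- move=> k; have /choice[c hc] : forall j, exists c : R, ae_eq leb (T k) (cmp j (flux u)) (cst c).
    move=> j; apply: (constants_closed (@oT k) (L2T k (Ls j))) => e e0.
    have [v [[Uv [_ pv _ _]] le]] := happ' e e0; have [_ Lv _ _] := Uv.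
    have [c vc] := pv k; exists (cmp j (flux v)), (c ord0 j); split; [exact: (L2T k (Lv j))| |].
      by apply: filterS vc => x h kx; rewrite /cmp h.
    apply: le_trans le; apply: le_trans (cU_le oOm oT sT dT nT (inl (inr j)) (shB HU Uu Uv)).
    rewrite -(_ : cmp j (flux (u - v)) = cmp j (flux u) - cmp j (flux v)); last exact: cmpB.
    exact: (snorm_restrict oOm (@oT k) (@sT k) (shB HLv Ls Lv j)).
  exists (\row_j c j).
  have : {ae leb, forall x, forall j, T k x -> cmp j (flux u) x = cst (c j) x}.
    exact: (@filter_forall _ _ (fun j x => T k x -> cmp j (flux u) x = cst (c j) x) _ _ hc).
  by apply: filterS => x h kx; apply/rowP => j; rewrite mxE; exact: h.
- apply: (S1_skel_closed Uu) => e e0; have [v [[Uv [_ _ pv _]] le]] := happ' e e0.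
  by exists v.
- apply: (P0_skel_closed Uu) => e e0; have [v [[Uv [_ _ _ pv]] le]] := happ' e e0.
  by exists v.
Qed.

End discrete_spaces.

(** * The admissible cones and the solution *)

Section cones.
Context {R : realType} {n N : nat}.
Local Notation E := 'rV[R]_n.+1.
Local Notation leb := (@lebesgue_rV R n.+1).
Variables (Om : set E) (V : 'I_N -> 'M[R]_(n.+2, n.+1)).
Local Notation T k := (simplex (V k)).
Hypotheses (oOm : open Om) (oT : forall k, open (T k)) (sT : forall k, T k `<=` Om).
Hypothesis dT : forall k l, k != l -> T k `&` T l = set0.
Hypothesis aT : forall k, affinely_independent (V k).
Hypothesis bT : forall k, bounded_set (T k).
Hypothesis nT : leb (Om `\` \bigcup_k T k) = 0%E.
Implicit Types (f g : E -> R) (k : 'I_N).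
Implicit Types u : trialT R n N.
Let mOm := rV_open_measurable oOm.
Let mT k := rV_open_measurable (@oT k).
Let HL := L2_semiHilbert mOm.
Let HLv := L2v_semiHilbert mOm.
Let HT k := L2_semiHilbert (mT k).
Let HV := V_semiHilbert oOm oT sT dT nT.
Local Notation nm := (snorm (ip Om)).
Local Notation nmv := (snorm (ipv Om)).
Local Notation nV := (snorm (ipV Om V)).
Local Notation inV := (inV Om V).
Local Notation inU := (inU Om V).
Local Notation ipV := (ipV Om V).
Local Notation pw_grad := (pw_grad V).
Local Notation pw_div := (pw_div V).
Local Notation bform := (bform Om V).
Local Notation Theta := (Theta Om V).
Let L2T f k : L2 Om f -> L2 (T k) f := @L2T _ _ _ _ _ oOm oT sT f k.
Let L2vT q k : L2v Om q -> L2v (T k) q := fun Lq => L2v_restrict oOm (@oT k) (@sT k) Lq.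
Let tP := ThetaP oOm oT sT dT nT.
Let HU := U_semiHilbert oOm oT sT dT nT.
Local Notation ipU := (ipU Om V).
Local Notation nU := (snorm ipU).
Local Notation cU := (cU Om V).
Local Notation potential := (potential Om V).

Variable star : variant.
Let HH := H1_semiHilbert oOm.
Local Notation adh := (adherent (H1space Om) (ipH1 Om) (nneg_trace Om)).
Let Hp := potential_H1 oOm oT sT dT nT.

Lemma gamman_shat u f : inU u -> H1space Om f -> gamman Om V u f = \sum_k shat u k f.
Proof.
move=> [_ _ _ [_ lq]] Hf; exact: (lift_normal_trace oOm oT sT dT nT (xgetPex (0 : E -> E) lq) Hf).
Qed.

(** The closed cone is invariant under H^1_0, so the chosen lift [gamma0] can be replaced by the
    potential, which is controlled by [ipU]. *)
Lemma half_nneg_potential u : inU u -> half_nneg Om (gamma0 Om V u) <-> adh (potential u).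
Proof.
move=> Uu; have st := gamma0_potential oOm oT sT dT nT Uu.
split=> [/(half_nneg_adherent oOm)|] h.
  have [_ _ h10] := same_trace_sym oOm st; have := adherent_nneg_H10 oOm h h10.
  by rewrite addrC subrK.
apply/(half_nneg_adherent oOm).
have [_ _ h10] := st; have := adherent_nneg_H10 oOm h h10.
by rewrite addrC subrK.
Qed.

(** The defect comes from [Theta] being linear only up to null vectors; it is a null function of
    H^1, and such functions belong to H^1_0. *)
Lemma potential_lin a u v : inU u -> inU v ->
  H10space Om (potential (a *: u + v) - (a *: potential u + potential v)).
Proof.
move=> Uu Uv; have Uw := inU_lin oOm oT sT a Uu Uv.
have Hl := shL HH a (Hp Uu) (Hp Uv).
apply: (null_H10 oOm); first exact: (shB HH (Hp Uw) Hl).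
pose i : (unit + 'I_n.+1) + ((unit + 'I_n.+1) + ('I_n.+1 + unit)) := inr (inr (inr tt)).
have -> : potential (a *: u + v) - (a *: potential u + potential v) =
    - (cU i (a *: u + v) - (a *: cU i u + cU i v)).
  apply/funext => x.
  change (a * fld u x + fld v x - cU i (a *: u + v) x -
    (a * (fld u x - cU i u x) + (fld v x - cU i v x)) =
    - (cU i (a *: u + v) x - (a * cU i u x + cU i v x))).
  move: (cU i _ x) (cU i _ x) (cU i _ x) => *; ring.
have LU := cU_L2 oOm oT sT dT nT i.
rewrite (snormN HL); first exact: (cU_lin oOm oT sT dT nT i a Uu Uv).
exact: (shB HL (LU _ Uw) (shL HL a (LU _ Uu) (LU _ Uv))).
Qed.

Lemma segment_eq (X : lmodType R) (p q w x : X) t :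
  t *: (q - w) + (p - (t *: q + x)) = p - (x + t *: w).
Proof. by rewrite scalerBr !opprD addrCA addrACA subrr add0r [- x - _]addrC. Qed.

Lemma difference_eq (X : lmodType R) (p q x : X) :
  p + ((-1) *: (q - ((-1) *: p + x)) + 0) = x - q.
Proof. by rewrite addr0 !scaleN1r opprB -addrA addNKr. Qed.

Lemma potential_segment t u v : inU u -> inU v ->
  H10space Om (potential (u + t *: (v - u)) - (potential u + t *: (potential v - potential u))).
Proof.
move=> Uu Uv; have Uw : inU ((-1) *: u + v) := inU_lin oOm oT sT (-1) Uu Uv.
have h1 := potential_lin (-1) Uu Uv; have h2 := potential_lin t Uw Uu.
have := H10_lin oOm t h1 h2.
rewrite !scaleN1r ![- _ + v]addrC ![- _ + potential v]addrC.
have -> : u + t *: (v - u) = t *: (v - u) + u by rewrite addrC.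
by rewrite segment_eq.
Qed.

Lemma Kh_inU u : Kh Om V star u -> inU u.
Proof. by rewrite /Kh; case: star => [[[]]|[[]]|[[[]]]]. Qed.

Lemma nneg_potential_convex t u v : 0 <= t -> t <= 1 -> inU u -> inU v ->
  half_nneg Om (gamma0 Om V u) -> half_nneg Om (gamma0 Om V v) ->
  half_nneg Om (gamma0 Om V (u + t *: (v - u))).
Proof.
move=> t0 t1 Uu Uv /(half_nneg_potential Uu) hu /(half_nneg_potential Uv) hv.
have Uw : inU (u + t *: (v - u)) by exact: (shD HU Uu (shZ HU t (shB HU Uv Uu))).
apply/(half_nneg_potential Uw).
have cv := adherent_convex HH (@nneg_trace_H1 _ _ Om) (nneg_trace_convex oOm) t0 t1 hu hv.
have := adherent_nneg_H10 oOm cv (potential_segment t Uu Uv).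
by rewrite addrC subrK.
Qed.

Lemma mhalf_nneg_convex t u v : 0 <= t -> t <= 1 -> inU u -> inU v ->
  mhalf_nneg Om (gamman Om V u) -> mhalf_nneg Om (gamman Om V v) ->
  mhalf_nneg Om (gamman Om V (u + t *: (v - u))).
Proof.
move=> t0 t1 Uu Uv hu hv f hf; have [Hf _] := hf.
have Uw : inU (u + t *: (v - u)) by exact: (shD HU Uu (shZ HU t (shB HU Uv Uu))).
have := hu f hf; have := hv f hf; rewrite !gamman_shat//.
have -> : \sum_k shat (u + t *: (v - u)) k f = \sum_k shat u k f + t * (\sum_k shat v k f - \sum_k shat u k f).
  by rewrite -sumrB mulr_sumr -big_split.
move: (\sum_k _) (\sum_k _) => b a a0 b0.
have -> : b + t * (a - b) = (1 - t) * b + t * a by ring.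
by rewrite addr_ge0 ?mulr_ge0// subr_ge0.
Qed.

Lemma Kh_convex : convex_pred (Kh Om V star).
Proof.
move=> t u v t0 t1.
have Uc : Uh Om V u -> Uh Om V v -> Uh Om V (u + t *: (v - u)).
  move=> hu hv; have -> : u + t *: (v - u) = t *: ((-1) *: u + v) + u by rewrite scaleN1r [- u + v]addrC [LHS]addrC.
  exact: (Uh_lin oOm oT sT t (Uh_lin oOm oT sT (-1) hu hv) hu).
rewrite /Kh; case: star.
- move=> [hu gu] [hv gv]; split; [exact: Uc|exact: (nneg_potential_convex t0 t1 hu.1 hv.1)].
- move=> [hu gu] [hv gv]; split; [exact: Uc|exact: (mhalf_nneg_convex t0 t1 hu.1 hv.1)].
- move=> [[hu gu] [_ mu]] [[hv gv] [_ mv]]; split; split; [exact: Uc| |exact: Uc|].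
    exact: (nneg_potential_convex t0 t1 hu.1 hv.1).
  exact: (mhalf_nneg_convex t0 t1 hu.1 hv.1).
Qed.

Lemma half_nneg_closed u : inU u ->
  (forall e, 0 < e -> exists v, [/\ inU v, half_nneg Om (gamma0 Om V v) & nU (u - v) < e]) ->
  half_nneg Om (gamma0 Om V u).
Proof.
move=> Uu happ; apply/(half_nneg_potential Uu).
apply: (adherent_closed HH (@nneg_trace_H1 _ _ Om)); split; first exact: Hp.
move=> e e0; pose C : R := 2 * #|{: unit + 'I_n.+1}|%:R + 1.
have C0 : 0 < C by rewrite ltr_wpDl ?mulr_ge0.
have [v [Uv hv le]] := happ _ (divr_gt0 e0 C0).
have Uw := shB HU Uu Uv.
(* This equals [potential v] up to H^1_0, hence lies in the closed cone, and its distance to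
   [potential u] is the norm of [potential (u - v)]. *)
exists (potential u - potential (u - v)); split.
  have h := H10_lin oOm (-1) (potential_lin (-1) Uv Uu) (H10_0 oOm).
  have h' := adherent_nneg_H10 oOm ((half_nneg_potential Uv).1 hv) h.
  by rewrite difference_eq scaleN1r [- v + u]addrC in h'.
rewrite opprB addrC subrK.
apply: le_lt_trans (potential_H1_le oOm oT sT dT nT oOm (@subset_refl _ Om) Uw) _.
have := snorm_ge0 ipU (u - v); move: (nU _) le => r; rewrite ltr_pdivlMr// /C => le r0.
by apply: le_lt_trans le; rewrite mulrC ler_wpM2l// lerDl.
Qed.

(** For a fixed [f] the pairing is the sum of the [shat u k f], each of which is continuous in [u]
    by [shat_bounded]. *)
Lemma mhalf_nneg_closed u : inU u ->
  (forall e, 0 < e -> exists v, [/\ inU v, mhalf_nneg Om (gamman Om V v) & nU (u - v) < e]) ->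
  mhalf_nneg Om (gamman Om V u).
Proof.
move=> Uu happ f hf; have [Hf _] := hf.
pose M := \sum_k H1norm (T k) f.
have M0 : 0 <= M by apply: sumr_ge0 => k _; exact: sqrtr_ge0.
have M1 : 0 < 4 * M + 1 by rewrite ltr_wpDl ?mulr_ge0.
apply/ler_addgt0Pl => e e0.
have [v [Uv hv le]] := happ _ (divr_gt0 e0 M1); have Uw := shB HU Uu Uv.
have Hfk := Om_H1_pw oOm oT sT Hf.
have := hv f hf; rewrite !gamman_shat// => v0.
have bw : `|\sum_k shat (u - v) k f| <= 4 * nU (u - v) * M.
  apply: le_trans (ler_norm_sum _ _ _) _; rewrite /M mulr_sumr; apply: ler_sum => k _.
  exact: (shat_bounded oOm oT sT dT nT Uw (Hfk k)).
have E : \sum_k shat (u - v) k f = \sum_k shat u k f - \sum_k shat v k f by rewrite -sumrB.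
rewrite E in bw; move: bw; rewrite ler_norml => /andP[bw _].
have le' : 4 * nU (u - v) * M <= e.
  have := snorm_ge0 ipU (u - v); move: (nU _) le => r; rewrite ltr_pdivlMr// => le r0.
  by apply: le_trans (ltW le); rewrite mulrDr mulr1 [4 * r]mulrC -mulrA lerDl.
by move: bw le' v0; move: (\sum_k _) (\sum_k _) (4 * _ * _) => a b c; lra.
Qed.

Lemma Kh_closed : closed_pred inU ipU (Kh Om V star).
Proof.
move=> u [Uu happ].
have hU : Uh Om V u.
  apply: (Uh_closed oOm oT sT dT aT bT nT); split; first exact: Uu.
  move=> e /happ[v [Kv le]]; exists v; split; last exact: le.
  by move: Kv; rewrite /Kh; case: star => [[]|[]|[[]]].
have h0 (P : trialT R n N -> Prop) : (forall v, Kh Om V star v -> P v) -> forall e, 0 < e ->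
    exists v, [/\ inU v, P v & nU (u - v) < e].
  by move=> KP e /happ[v [Kv le]]; exists v; split; [exact: Kh_inU Kv|exact: KP|exact: le].
move: h0; rewrite /Kh; case: star => h0.
- by split; [exact: hU|apply: (half_nneg_closed Uu); apply: h0 => v []].
- by split; [exact: hU|apply: (mhalf_nneg_closed Uu); apply: h0 => v []].
- split; split; [exact: hU| |exact: hU|].
    by apply: (half_nneg_closed Uu); apply: h0 => v [[]].
  by apply: (mhalf_nneg_closed Uu); apply: h0 => v [_ []].
Qed.

Lemma Kh_0 : Kh Om V star 0.
Proof.
have U0 := Uh_0 oOm oT; have I0 := inU_0 oOm oT.
have g0 : half_nneg Om (gamma0 Om V 0).
  apply/(half_nneg_potential I0).
  have a0 : adh 0.
    split; first exact: (H1_0 oOm).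
    move=> e e0; exists 0; split; first exact: (nneg_trace_0 oOm).
    by rewrite subr0 (snorm0 HH).
  have h := potential_lin (-1) I0 I0; rewrite scaler0 addr0 scaleN1r addNr subr0 in h.
  by have := adherent_nneg_H10 oOm a0 h; rewrite add0r.
have m0 : mhalf_nneg Om (gamman Om V 0).
  by move=> f [Hf _]; rewrite gamman_shat// big1.
by rewrite /Kh; case: star.
Qed.

Lemma solves_VI_ex_unique beta f : 2 <= beta -> L2 Om f ->
  exists u, solves_VI Om V star beta f u /\ forall u', solves_VI Om V star beta f u' -> eqU Om V u' u.
Proof.
move=> beta2 Lf.
have [FL [B FB]] := Fform_bounded_linear oOm oT sT dT nT beta Lf.
have al v Uv := (aform_linl oOm oT sT dT nT star beta (v := v) Uv).1.
have ar u Uu := (aform_linr oOm oT sT dT nT star beta (u := u) Uu).1.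
have ab := aform_bounded oOm oT sT dT nT star beta2.
have ac := aform_coercive oOm oT sT dT nT star beta2.
have half0 : 0 < 2^-1 :> R by rewrite invr_gt0.
have [u Ku uP] := lions_stampacchia HU (ex_intro _ _ Kh_0) Kh_inU Kh_convex Kh_closed
  al ar ab half0 ac FL FB.
exists u; split=> [|u' [Ku' u'P]]; first exact: (conj Ku uP).
have Uu := Kh_inU Ku; have Uu' := Kh_inU Ku'; have Uw := shB HU Uu' Uu.
apply: (eqU_of_null oOm oT sT dT nT Uu' Uu).
(* Each solution is tested with the other one. Adding the two inequalities gives a(u' - u, u' - u)
   <= 0, and coercivity makes the distance zero. *)
have h1 := uP _ Ku'; have h2 := u'P _ Ku.
have e1 : u - u' = (-1) *: (u' - u) + 0 by rewrite addr0 scaleN1r opprB.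
have U0 := sh0 HU.
rewrite e1 (FL _ _ _ Uw U0) (ar _ Uu' _ _ _ Uw U0) (lin0 U0 FL) (lin0 U0 (ar _ Uu')) in h2.
have ww := linB (al _ Uw) Uu' Uu.
have := ac _ Uw; rewrite ww => cw.
have le0 : nU (u' - u) ^+ 2 <= 0.
  by move: h1 h2 cw; move: (Fform _ _ _ _ _) (aform _ _ _ _ _ _) (aform _ _ _ _ _ _) (_ ^+ 2) => *; lra.
apply/eqP; rewrite -(@sqrf_eq0 R); rewrite eq_le le0 sqr_ge0 //.
Qed.

End cones.

(** A point of [Om] outside all the open simplices lies in the closure of one of them, hence on its
    boundary, which is a null set. *)
Lemma conforming_mesh_null {R : realType} {n N : nat} (Om : set 'rV[R]_n.+1)
    (V : 'I_N -> 'M[R]_(n.+2, n.+1)) : open Om -> conforming_mesh Om V ->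
  lebesgue_rV n.+1 (Om `\` \bigcup_k simplex (V k)) = 0%E.
Proof.
move=> oOm [aV sV cV _ _].
have oV k : open (simplex (V k)) := simplex_open (aV k).
have UE : \bigcup_k simplex (V k) = \big[setU/set0]_k simplex (V k).
  by rewrite -bigcup_seq; apply: eq_bigcupl; split=> k _ //=; exact: mem_index_enum.
have mD : measurable (Om `\` \bigcup_k simplex (V k)).
  apply: measurableD; first exact: rV_open_measurable.
  by rewrite UE; apply: bigsetU_measurable => k _; apply: rV_open_measurable (@oV k).
have : (@lebesgue_rV R n.+1).-negligible (\big[setU/set0]_k boundary (simplex (V k))).
  elim/big_ind: _ => [|A B|k _]; [exact: negligible_set0|exact: negligibleU|].
  have := simplex_boundary_null (aV k) => b0.
  exists (boundary (simplex (V k))); split=> //; apply: measurableD.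
    by apply: rV_closed_measurable; exact: closed_closure.
  by apply: rV_open_measurable; exact: open_interior.
move/negligibleS => /(_ (Om `\` \bigcup_k simplex (V k))) h.
apply/(@negligibleP _ _ _ _ _ mD)/h => x [Ox nx].
have : closure Om x by exact: subset_closure.
rewrite -cV => -[k _ cx]; rewrite -bigcup_seq; exists k; first by rewrite /= mem_index_enum.
by split=> // /interior_subset kx; apply: nx; exists k.
Qed.

Theorem theorem2 (R : realType) (n : nat) (hn : n.+1 = 2%N \/ n.+1 = 3%N)
    (Om : set 'rV[R]_n.+1)
    (hOm : lipschitz_domain Om) (hsc : simply_connected Om)
    (N : nat) (T : 'I_N -> 'M[R]_(n.+2, n.+1)) (hT : conforming_mesh Om T)
    (f : 'rV[R]_n.+1 -> R) (hf : L2 Om f)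
    (star : variant) (beta : R) (hbeta : 2 <= beta) :
  exists u : trialT R n N,
    solves_VI Om T star beta f u /\
    forall u' : trialT R n N, solves_VI Om T star beta f u' -> eqU Om T u' u.
Proof.
have [_ oOm _ [M [Mr hM]] _] := hOm; have aT := mesh_nondegenerate hT.
have bT k : bounded_set (simplex (T k)).
  by exists M; split=> // m Mm x /(mesh_sub hT); exact: hM.
exact: (solves_VI_ex_unique oOm (fun k => simplex_open (aT k)) (mesh_sub hT) (mesh_disjoint hT) aT bT
  (conforming_mesh_null oOm hT) star hbeta hf).
Qed.
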